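(* Let $P_{2k}$ be a real-valued polynomial in $z_1,\bar z_1$ such that for some integer $k>1$, $P_{2k}(rz)=r^{2k}P_{2k}(z)$ for all $r\in\mathbb R,z\in\mathbb C$, and $\frac{\partial^2P_{2k}}{\partial z_1\partial\bar z_1}(z_1)>0$ for all $z_1\neq0$. Let $\Omega=\{(z_1,z_2)\in\mathbb C^2:\mathrm{Re}\, z_2+P_{2k}(z_1)<0\}$. Then for every boundary point $p\in\partial\Omega$ there is a holomorphic function $f_p:\Omega\to\Delta$ (with $\Delta$ the open unit disc) such that (1) $\lim_{z\to p}f_p(z)=1$, and (2) for every $r>0$ there exists $s>0$ with $|f_p(w)|<1-s$ for all $w\in\Omega\setminus B(p,r)$, where $B(p,r)$ is the Euclidean ball of radius $r$ centered at $p$. *)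

(* Defs.v *)
From Stdlib Require Export Reals.
From Coquelicot Require Export Coquelicot.

Local Open Scope R_scope.

Definition C2 := (C * C)%type.

Definition norm2 (w : C2) : R := sqrt (Cmod (fst w) ^ 2 + Cmod (snd w) ^ 2).

Definition dist2 (w p : C2) : R :=
  norm2 (Cminus (fst w) (fst p), Cminus (snd w) (snd p)).

Definition is_poly_z_zbar (P : C -> R) : Prop :=
  exists (N : nat) (a : nat -> nat -> C), forall z : C,
    RtoC (P z) =
    sum_n (fun j => sum_n (fun l => Cmult (a j l) (Cmult (Cpow z j) (Cpow (Cconj z) l))) N) N.

(* d^2 P / (dz d\bar z) = (1/4) (d^2P/dx^2 + d^2P/dy^2), z = x + i y. *)
Definition dz_dzbar (P : C -> R) (z : C) : R :=
  / 4 * ( Derive (fun t => Derive (fun s => P (s, snd z)) t) (fst z)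
        + Derive (fun t => Derive (fun s => P (fst z, s)) t) (snd z)).

Definition holomorphic_on (U : C2 -> Prop) (f : C2 -> C) : Prop :=
  forall a : C2, U a ->
    exists c1 c2 : C, forall eps : R, 0 < eps -> exists delta : R, 0 < delta /\
      forall h : C2, norm2 h < delta ->
        U (Cplus (fst a) (fst h), Cplus (snd a) (snd h)) ->
        Cmod (Cminus (Cminus (f (Cplus (fst a) (fst h), Cplus (snd a) (snd h))) (f a))
                     (Cplus (Cmult c1 (fst h)) (Cmult c2 (snd h))))
        <= eps * norm2 h.

Definition boundary (U : C2 -> Prop) (p : C2) : Prop :=
  forall eps : R, 0 < eps ->
    (exists w, U w /\ dist2 w p < eps) /\ (exists w, ~ U w /\ dist2 w p < eps).

Definition Omega (P : C -> R) (w : C2) : Prop := Re (snd w) + P (fst w) < 0.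

(* Main.v *)
(** For each ray there is an entire function [W] with [|W z| <= exp (P z - eps |z|^(2k) - eps dev z)]
    up to a small error, which is comparable to [exp (C0 z^(2k))] near the ray: the indicator
    [P - eps |z|^(2k) - eps dev] is trigonometrically strictly convex because [P] is strictly
    subharmonic, so it is approximated from below by the indicator of a canonical product whose
    zeros lie on finitely many other rays.  Then [exp z2 * W z1] is bounded on the domain with decay
    at infinity.  At a boundary point off the axis [z1 = 0], a dilation makes [|z1|] large, and a
    quadratically corrected [exp z2 * W z1] times [(exp L - 1) / L] peaks there.  At a boundary point
    on the axis, summing the dilates of such a function over all dyadic scales yields a function with
    real part bounded below tending to infinity exactly at the point; a Cayley transform of it peaks. *)
Require Import Defs.
From Stdlib Require Import Lra Lia List ZArith IndefiniteDescription.
Local Open Scope R_scope.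

(** * Complex arithmetic *)

(** A polynomial exponent supports [P] only locally: the sinusoid of frequency [2k] tangent to the
    indicator at one direction lies below it within an angle [PI / (2k)], and may exceed it farther
    away. The zeros of [W] let the exponent switch from one tangent to the next where the two cross:
    passing a ray of zeros shifts a branch of the logarithm by [2 * PI * i], and the density of the
    zeros is tuned to the required jump. The price is an error of lower order in [|z|], which shapes
    the rest. Off the axis, once the value and the linear term of this error are divided out, it
    costs [r^(2k-3) |w|^2] at distance [|w|] from a point of modulus [r], against a gain
    [r^(2k-2) |w|^2]; hence the dilation. On the axis a dilation keeps [z1 = 0], and a constant
    factor in the bound for [|W|] remains; in the dyadic sum it only adds a bounded error to a
    quantity that is unbounded near the point. The factor [(exp L - 1) / L] is there because
    [exp z2] keeps modulus 1 along the imaginary direction of [z2], where the decay in [z1] does not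
    act. *)

Lemma C_eq (z w : C) : Re z = Re w -> Im z = Im w -> z = w.
Proof. destruct z, w; unfold Re, Im; simpl; congruence. Qed.

Lemma RtoC_inj_eq (a b : R) : a = b -> RtoC a = RtoC b.
Proof. congruence. Qed.

Lemma im_le_Cmod (c : C) : Rabs (Im c) <= Cmod c.
Proof.
  eapply Rle_trans; [ | apply Rmax_Cmod]. apply Rmax_r.
Qed.

Lemma Re_le_Cmod (c : C) : Re c <= Cmod c.
Proof. pose proof (re_le_Cmod c). pose proof (Rle_abs (Re c)). lra. Qed.

Lemma Re_ge_Cmod (c : C) : - Cmod c <= Re c.
Proof.
  pose proof (re_le_Cmod c). pose proof (Rle_abs (- Re c)). rewrite Rabs_Ropp in *. lra.
Qed.

Lemma Re_plus (z w : C) : Re (z + w)%C = Re z + Re w.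
Proof. reflexivity. Qed.
Lemma Re_minus (z w : C) : Re (z - w)%C = Re z - Re w.
Proof. reflexivity. Qed.
Lemma Re_mult (z w : C) : Re (z * w)%C = Re z * Re w - Im z * Im w.
Proof. reflexivity. Qed.
Lemma Im_mult (z w : C) : Im (z * w)%C = Re z * Im w + Im z * Re w.
Proof. reflexivity. Qed.
Lemma Re_RtoC_mult (a : R) (z : C) : Re (RtoC a * z)%C = a * Re z.
Proof. unfold Re; simpl; ring. Qed.
Lemma Im_RtoC_mult (a : R) (z : C) : Im (RtoC a * z)%C = a * Im z.
Proof. unfold Im; simpl; ring. Qed.

Lemma Cmod_sqr (z : C) : Cmod z * Cmod z = Re z * Re z + Im z * Im z.
Proof. pose proof (Cmod2_alt z). simpl in *. lra. Qed.

Lemma Cmod_sum_parts (c : C) : Cmod c <= Rabs (Re c) + Rabs (Im c).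
Proof.
  pose proof (Rabs_pos (Re c)). pose proof (Rabs_pos (Im c)). pose proof (Cmod_ge_0 c).
  apply Rsqr_incr_0_var; [ | lra]. unfold Rsqr. rewrite Cmod_sqr.
  rewrite <- (Rabs_right (Re c * Re c)), <- (Rabs_right (Im c * Im c)); try nra.
  rewrite !Rabs_mult. nra.
Qed.

Lemma Cmod_minus_sym (z w : C) : Cmod (z - w) = Cmod (w - z).
Proof. rewrite <- Cmod_opp. f_equal. ring. Qed.

Lemma Cmod_triangle_minus (z w : C) : Cmod (z - w) <= Cmod z + Cmod w.
Proof.
  eapply Rle_trans; [apply Cmod_triangle | ]. rewrite Cmod_opp. lra.
Qed.

Lemma Cmod_triangle3 (x y z : C) : Cmod (x - z) <= Cmod (x - y) + Cmod (y - z).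
Proof.
  replace (x - z)%C with ((x - y) + (y - z))%C by ring. apply Cmod_triangle.
Qed.

Lemma Cmod_reverse (z w : C) : Cmod z - Cmod w <= Cmod (z - w).
Proof.
  pose proof (Cmod_triangle (z - w) w). replace (z - w + w)%C with z in H by ring. lra.
Qed.

Lemma Cmod_plus_reverse (z w : C) : Cmod z - Cmod w <= Cmod (z + w).
Proof.
  pose proof (Cmod_triangle (z + w) (- w)). rewrite Cmod_opp in H.
  replace (z + w + - w)%C with z in H by ring. lra.
Qed.

Lemma Cmod_nz (z : C) : z <> 0 -> 0 < Cmod z.
Proof. apply Cmod_gt_0. Qed.

Lemma Cmod_pos_nz (z : C) : 0 < Cmod z -> z <> 0.
Proof. intros H ->. rewrite Cmod_0 in H. lra. Qed.

Lemma Cmod_RtoC_pos (x : R) : 0 <= x -> Cmod (RtoC x) = x.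
Proof. intros. rewrite Cmod_R. apply Rabs_right. lra. Qed.

Lemma RtoC_nz (x : R) : x <> 0 -> RtoC x <> 0.
Proof. intros H E. apply H. injection E. auto. Qed.

Definition cis (t : R) : C := (cos t, sin t).

Lemma cis_plus (a b : R) : cis (a + b) = (cis a * cis b)%C.
Proof. apply C_eq; unfold cis, Re, Im; simpl; [rewrite cos_plus | rewrite sin_plus]; ring. Qed.

Lemma cis_0 : cis 0 = RtoC 1.
Proof. apply C_eq; unfold cis, Re, Im; simpl; [apply cos_0 | apply sin_0]. Qed.

Lemma cis_PI : cis PI = RtoC (-1).
Proof. apply C_eq; unfold cis, Re, Im; simpl; [apply cos_PI | apply sin_PI]. Qed.

Lemma Cmod_cis (t : R) : Cmod (cis t) = 1.
Proof.
  unfold Cmod, cis; simpl. replace (_ + _) with 1; [apply sqrt_1 | ].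
  pose proof (sin2_cos2 t). unfold Rsqr in *. lra.
Qed.

Lemma cis_nz (t : R) : cis t <> 0.
Proof. apply Cmod_pos_nz. rewrite Cmod_cis. lra. Qed.

Lemma cis_pow (t : R) (n : nat) : (cis t ^ n)%C = cis (INR n * t).
Proof.
  induction n as [ | n IH].
  - simpl. rewrite Rmult_0_l, cis_0. reflexivity.
  - rewrite Cpow_S, IH, <- cis_plus, S_INR. f_equal. ring.
Qed.

Lemma cis_opp_mult (t : R) : (cis (- t) * cis t)%C = 1.
Proof. rewrite <- cis_plus. replace (- t + t) with 0 by ring. apply cis_0. Qed.

Lemma cis_period (t : R) : cis (t + 2 * PI) = cis t.
Proof. unfold cis.
  pose proof (cos_period t 1). pose proof (sin_period t 1). simpl in *.
  replace (t + 2 * PI) with (t + 2 * 1 * PI) by ring. congruence.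
Qed.

Lemma cis_conj (t : R) : Cconj (cis t) = cis (- t).
Proof. apply C_eq; unfold cis, Cconj, Re, Im; simpl; [now rewrite cos_neg | now rewrite sin_neg]. Qed.

(** The window of angles is left free because later case distinctions place the angle relative to
    the last ray of zeros, or symmetrically about a given ray. *)
Lemma polar (z : C) (t0 : R) :
  exists t, t0 <= t < t0 + 2 * PI /\ z = (RtoC (Cmod z) * cis t)%C.
Proof.
  assert (HPI := PI_RGT_0).
  assert (H0 : exists t, z = (RtoC (Cmod z) * cis t)%C).
  { destruct (Req_dec (Cmod z) 0) as [E | E].
    - exists 0. rewrite E. rewrite (Cmod_eq_0 _ E). ring.
    - assert (Hp : 0 < Cmod z) by (pose proof (Cmod_ge_0 z); lra).
      set (x := Re z / Cmod z). set (y := Im z / Cmod z).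
      assert (Hxy : x * x + y * y = 1).
      { unfold x, y. pose proof (Cmod_sqr z). field_simplify; [ | lra].
        replace (Re z ^ 2 + Im z ^ 2) with (Cmod z ^ 2) by (simpl; lra). field. lra. }
      assert (Hx : -1 <= x <= 1) by nra.
      assert (Hs : sin (acos x) = Rabs y).
      { rewrite sin_acos by lra. replace (1 - x²) with (y²) by (unfold Rsqr; lra).
        apply sqrt_Rsqr_abs. }
      assert (Ex : Re z = Cmod z * x) by (unfold x; field; lra).
      assert (Ey : Im z = Cmod z * y) by (unfold y; field; lra).
      destruct (Rle_dec 0 y) as [Hy | Hy].
      + exists (acos x). apply C_eq; [rewrite Re_RtoC_mult | rewrite Im_RtoC_mult];
          unfold cis, Re, Im; simpl; fold (Re z) (Im z).
        * rewrite cos_acos by lra. auto.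
        * rewrite Hs, Rabs_right by lra. auto.
      + exists (- acos x). apply C_eq; [rewrite Re_RtoC_mult | rewrite Im_RtoC_mult];
          unfold cis, Re, Im; simpl; fold (Re z) (Im z).
        * rewrite cos_neg, cos_acos by lra. auto.
        * rewrite sin_neg, Hs, Rabs_left by lra. rewrite Ropp_involutive. auto. }
  destruct H0 as [t Ht].
  assert (Hper : forall n : nat, forall u, cis (u + INR n * (2 * PI)) = cis u).
  { induction n; intro u; [simpl; f_equal; ring | ].
    rewrite S_INR. replace (u + (INR n + 1) * (2 * PI)) with ((u + INR n * (2 * PI)) + 2 * PI) by ring.
    rewrite cis_period. apply IHn. }
  assert (HperZ : forall n : Z, forall u, cis (u + IZR n * (2 * PI)) = cis u).
  { intros n u. destruct n as [ | p | p].
    - f_equal. simpl. ring.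
    - rewrite <- (Hper (Pos.to_nat p) u). now rewrite INR_IZR_INZ, positive_nat_Z.
    - rewrite <- (Hper (Pos.to_nat p) (u + IZR (Z.neg p) * (2 * PI))).
      f_equal. rewrite INR_IZR_INZ, positive_nat_Z.
      replace (IZR (Z.neg p)) with (- IZR (Z.pos p)) by (rewrite <- opp_IZR; reflexivity). ring. }
  (* [up] is the least integer strictly above, so the shifted angle falls in the window closed on
     the right; the right end itself is moved back by one turn. *)
  set (n := (up ((t0 - t) / (2 * PI)))).
  destruct (archimed ((t0 - t) / (2 * PI))) as [A1 A2]. fold n in A1, A2.
  assert (B1 : t0 - t < IZR n * (2 * PI)).
  { apply (Rmult_lt_compat_r (2 * PI)) in A1; [ | lra].
    replace ((t0 - t) / (2 * PI) * (2 * PI)) with (t0 - t) in A1 by (field; lra). lra. }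
  assert (B2 : IZR n * (2 * PI) - 2 * PI <= t0 - t).
  { apply (Rmult_le_compat_r (2 * PI)) in A2; [ | lra].
    replace ((IZR n - (t0 - t) / (2 * PI)) * (2 * PI)) with (IZR n * (2 * PI) - (t0 - t)) in A2 by (field; lra). lra. }
  destruct (Rle_lt_dec (t0 + 2 * PI) (t + IZR n * (2 * PI))) as [D | D].
  - exists (t + IZR (n - 1) * (2 * PI)). rewrite HperZ. split; [ | auto].
    rewrite minus_IZR. lra.
  - exists (t + IZR n * (2 * PI)). rewrite HperZ. split; [lra | auto].
Qed.

(** * Finite sums and powers *)

Fixpoint csum (f : nat -> C) (n : nat) : C :=
  match n with O => RtoC 0 | S m => (csum f m + f m)%C end.

Fixpoint rsum (f : nat -> R) (n : nat) : R :=
  match n with O => 0 | S m => rsum f m + f m end.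

Lemma csum_ext (f g : nat -> C) (n : nat) :
  (forall i, (i < n)%nat -> f i = g i) -> csum f n = csum g n.
Proof. induction n; intros H; simpl; auto. rewrite IHn, H; auto. Qed.

Lemma rsum_ext (f g : nat -> R) (n : nat) :
  (forall i, (i < n)%nat -> f i = g i) -> rsum f n = rsum g n.
Proof. induction n; intros H; simpl; auto. rewrite IHn, H; auto. Qed.

Lemma csum_plus (f g : nat -> C) (n : nat) :
  csum (fun i => (f i + g i)%C) n = (csum f n + csum g n)%C.
Proof. induction n; simpl; [ring | rewrite IHn; ring]. Qed.

Lemma csum_scal (c : C) (f : nat -> C) (n : nat) :
  csum (fun i => (c * f i)%C) n = (c * csum f n)%C.
Proof. induction n; simpl; [ring | rewrite IHn; ring]. Qed.

Lemma rsum_plus (f g : nat -> R) (n : nat) :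
  rsum (fun i => f i + g i) n = rsum f n + rsum g n.
Proof. induction n; simpl; [ring | rewrite IHn; ring]. Qed.

Lemma rsum_scal (c : R) (f : nat -> R) (n : nat) :
  rsum (fun i => c * f i) n = c * rsum f n.
Proof. induction n; simpl; [ring | rewrite IHn; ring]. Qed.

Lemma rsum_const (c : R) (n : nat) : rsum (fun _ => c) n = INR n * c.
Proof. induction n; [simpl; ring | simpl rsum; rewrite IHn, S_INR; ring]. Qed.

Lemma Re_csum (f : nat -> C) (n : nat) : Re (csum f n) = rsum (fun i => Re (f i)) n.
Proof. induction n; cbn [csum rsum]; [reflexivity | rewrite Re_plus, IHn; auto]. Qed.

Lemma rsum_le (f g : nat -> R) (n : nat) :
  (forall i, (i < n)%nat -> f i <= g i) -> rsum f n <= rsum g n.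
Proof.
  induction n; intros H; simpl; [lra | ]. specialize (H n) as Hn.
  specialize (IHn (fun i Hi => H i (Nat.lt_lt_succ_r _ _ Hi))). specialize (Hn (Nat.lt_succ_diag_r n)). lra.
Qed.

Lemma rsum_nonneg (f : nat -> R) (n : nat) :
  (forall i, (i < n)%nat -> 0 <= f i) -> 0 <= rsum f n.
Proof.
  intros H. replace 0 with (rsum (fun _ => 0) n); [now apply rsum_le | ].
  rewrite rsum_const; ring.
Qed.

Lemma rsum_pos_bound (f : nat -> R) (n i : nat) :
  (forall i, (i < n)%nat -> 0 <= f i) -> (i < n)%nat -> f i <= rsum f n.
Proof.
  induction n; intros H Hi; [lia | ]. simpl.
  assert (H1 : 0 <= rsum f n) by (apply rsum_nonneg; intros; apply H; lia).
  assert (H2 : 0 <= f n) by (apply H; lia).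
  destruct (Nat.eq_dec i n) as [-> | Hne]; [lra | ].
  assert (f i <= rsum f n) by (apply IHn; [intros; apply H; lia | lia]). lra.
Qed.

Lemma Cmod_csum (f : nat -> C) (n : nat) : Cmod (csum f n) <= rsum (fun i => Cmod (f i)) n.
Proof.
  induction n; simpl; [rewrite Cmod_0; lra | ].
  pose proof (Cmod_triangle (csum f n) (f n)). lra.
Qed.

Lemma Cmod_csum_le (f : nat -> C) (g : nat -> R) (n : nat) :
  (forall i, (i < n)%nat -> Cmod (f i) <= g i) -> Cmod (csum f n) <= rsum g n.
Proof. intros H. eapply Rle_trans; [apply Cmod_csum | now apply rsum_le]. Qed.

Lemma csum_telescope (f : nat -> C) (n : nat) :
  csum (fun i => (f (S i) - f i)%C) n = (f n - f O)%C.
Proof. induction n; simpl; [ring | rewrite IHn; ring]. Qed.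

Lemma csum_split (f : nat -> C) (n m : nat) :
  csum f (n + m) = (csum f n + csum (fun i => f (n + i)%nat) m)%C.
Proof.
  induction m; simpl; [rewrite Nat.add_0_r; ring | ].
  rewrite Nat.add_succ_r. simpl. rewrite IHm. ring.
Qed.

Lemma rsum_split (f : nat -> R) (n m : nat) :
  rsum f (n + m) = rsum f n + rsum (fun i => f (n + i)%nat) m.
Proof.
  induction m; simpl; [rewrite Nat.add_0_r; ring | ].
  rewrite Nat.add_succ_r. simpl. rewrite IHm. ring.
Qed.

Lemma csum_first (f : nat -> C) (n : nat) :
  csum f (S n) = (f O + csum (fun i => f (S i)) n)%C.
Proof. change (S n) with (1 + n)%nat. rewrite csum_split. simpl. ring. Qed.

(** Comparison with the telescoping terms [/ x - / (x + 1) = / (x * (x + 1))]. *)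
Lemma rsum_tail_inv_sq (n m : nat) : (0 < n)%nat ->
  rsum (fun i => / (INR (S (n + i)) * INR (S (n + i)))) m <= / INR n.
Proof.
  intros Hn.
  assert (Hp : 0 < INR n) by (apply lt_0_INR; lia).
  assert (H : rsum (fun i => / (INR (S (n + i)) * INR (S (n + i)))) m <= / INR n - / INR (n + m)).
  { induction m.
    - simpl rsum. rewrite Nat.add_0_r. lra.
    - cbn [rsum]. rewrite Nat.add_succ_r, !S_INR. revert IHm. set (x := INR (n + m)). intros IHm.
      assert (0 < x) by (unfold x; apply lt_0_INR; lia).
      assert (/ ((x + 1) * (x + 1)) <= / x - / (x + 1)); [ | lra].
      replace (/ x - / (x + 1)) with (/ (x * (x + 1))) by (field; lra).
      apply Rinv_le_contravar; nra. }
  assert (0 < / INR (n + m)) by (apply Rinv_0_lt_compat, lt_0_INR; lia). lra.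
Qed.

Lemma Cpow_0_l (n : nat) : (0 < n)%nat -> (RtoC 0 ^ n)%C = 0.
Proof. destruct n; [lia | intros _; rewrite Cpow_S; ring]. Qed.

Lemma pow_le_1 (x : R) (n : nat) : 0 <= x <= 1 -> x ^ n <= 1.
Proof. intros. rewrite <- (pow1 n). apply pow_incr. lra. Qed.

(** Serves three purposes: Lipschitz bounds for powers, sums over roots of unity, and the
    cancellation of the poles [n - u] near a ray of zeros. *)
Lemma geom_factor (x y : C) (n : nat) :
  (x ^ n - y ^ n)%C = ((x - y) * csum (fun i => x ^ i * y ^ (n - 1 - i)) n)%C.
Proof.
  induction n as [ | n IH]; [simpl; ring | ].
  rewrite csum_ext with (g := fun i => (if Nat.eq_dec i n then x ^ n else y * (x ^ i * y ^ (n - 1 - i)))%C).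
  2: { intros i Hi. destruct (Nat.eq_dec i n) as [-> | Hne].
       - replace (S n - 1 - n)%nat with O by lia. simpl. ring.
       - replace (S n - 1 - i)%nat with (S (n - 1 - i)) by lia. rewrite Cpow_S. ring. }
  simpl csum. destruct (Nat.eq_dec n n); [ | lia].
  rewrite csum_ext with (g := fun i => (y * (x ^ i * y ^ (n - 1 - i)))%C).
  2: { intros i Hi. destruct (Nat.eq_dec i n); [lia | auto]. }
  rewrite csum_scal, !Cpow_S.
  replace ((x - y) * (y * csum (fun i => x ^ i * y ^ (n - 1 - i)) n + x ^ n))%C
    with (y * ((x - y) * csum (fun i => x ^ i * y ^ (n - 1 - i)) n) + (x - y) * x ^ n)%C by ring.
  rewrite <- IH. ring.
Qed.

Lemma Cpow_lipschitz (x y : C) (n : nat) (B : R) : Cmod x <= B -> Cmod y <= B ->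
  Cmod (x ^ n - y ^ n) <= INR n * B ^ (n - 1) * Cmod (x - y).
Proof.
  intros Hx Hy. rewrite geom_factor, Cmod_mult.
  rewrite Rmult_comm. apply Rmult_le_compat_r; [apply Cmod_ge_0 | ].
  rewrite <- rsum_const. apply Cmod_csum_le. intros i Hi.
  rewrite Cmod_mult, !Cmod_pow.
  replace (B ^ (n - 1)) with (B ^ i * B ^ (n - 1 - i)) by (rewrite <- pow_add; f_equal; lia).
  apply Rmult_le_compat; try (apply pow_le, Cmod_ge_0); apply pow_incr; split; auto using Cmod_ge_0.
Qed.

(** * Differentiable curves in the plane *)

(** Holomorphic expressions are estimated by integration along segments, rays and arcs, so
    derivatives are those of curves with a real parameter, taken componentwise. *)
Definition cderiv (x : R -> C) (t : R) (v : C) : Prop :=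
  is_derive (fun s => Re (x s)) t (Re v) /\ is_derive (fun s => Im (x s)) t (Im v).

Lemma cderiv_ext (x y : R -> C) (t : R) (v : C) :
  (forall s, x s = y s) -> cderiv x t v -> cderiv y t v.
Proof.
  intros H [H1 H2]. split;
    [eapply is_derive_ext; [ | exact H1] | eapply is_derive_ext; [ | exact H2]];
    intros s; simpl; now rewrite H.
Qed.

Lemma cderiv_val (x : R -> C) (t : R) (v w : C) : v = w -> cderiv x t v -> cderiv x t w.
Proof. now intros ->. Qed.

Lemma cderiv_const (c : C) (t : R) : cderiv (fun _ => c) t 0.
Proof. split; [exact (is_derive_const (Re c) t) | exact (is_derive_const (Im c) t)]. Qed.

Lemma cderiv_plus (x y : R -> C) (t : R) (v w : C) :
  cderiv x t v -> cderiv y t w -> cderiv (fun s => (x s + y s)%C) t (v + w).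
Proof.
  intros [H1 H2] [H3 H4]. split;
    [exact (is_derive_plus _ _ _ _ _ H1 H3) | exact (is_derive_plus _ _ _ _ _ H2 H4)].
Qed.

Lemma is_derive_Rmult (f g : R -> R) (t a b : R) : is_derive f t a -> is_derive g t b ->
  is_derive (fun s => f s * g s) t (a * g t + f t * b).
Proof. intros Hf Hg. apply (is_derive_mult f g t a b Hf Hg). intros; apply Rmult_comm. Qed.

Lemma is_derive_Rplus (f g : R -> R) (t a b : R) : is_derive f t a -> is_derive g t b ->
  is_derive (fun s => f s + g s) t (a + b).
Proof. intros Hf Hg. exact (is_derive_plus f g t a b Hf Hg). Qed.

Lemma is_derive_Rminus (f g : R -> R) (t a b : R) : is_derive f t a -> is_derive g t b ->
  is_derive (fun s => f s - g s) t (a - b).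
Proof. intros Hf Hg. exact (is_derive_minus f g t a b Hf Hg). Qed.

Lemma is_derive_Rcomp (f g : R -> R) (t a b : R) : is_derive f (g t) a -> is_derive g t b ->
  is_derive (fun s => f (g s)) t (b * a).
Proof. intros Hf Hg. exact (is_derive_comp f g t a b Hf Hg). Qed.

Lemma is_derive_val (f : R -> R) (t a b : R) : a = b -> is_derive f t a -> is_derive f t b.
Proof. now intros ->. Qed.

Lemma cderiv_mult (x y : R -> C) (t : R) (v w : C) :
  cderiv x t v -> cderiv y t w -> cderiv (fun s => (x s * y s)%C) t (v * y t + x t * w).
Proof.
  intros [H1 H2] [H3 H4]. split.
  - eapply is_derive_val; [ | apply is_derive_Rminus; apply is_derive_Rmult; eassumption].
    unfold Im, Re; simpl. ring.
  - eapply is_derive_val; [ | apply is_derive_Rplus; apply is_derive_Rmult; eassumption].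
    unfold Im, Re; simpl. ring.
Qed.

Lemma cderiv_scal (c : C) (x : R -> C) (t : R) (v : C) :
  cderiv x t v -> cderiv (fun s => (c * x s)%C) t (c * v).
Proof.
  intros H. eapply cderiv_val; [ | apply cderiv_mult; [apply cderiv_const | exact H]]. cbv beta. ring.
Qed.

Lemma cderiv_pow (x : R -> C) (t : R) (v : C) (n : nat) :
  cderiv x t v -> cderiv (fun s => (x s ^ n)%C) t (INR n * x t ^ (n - 1) * v).
Proof.
  intros H. induction n as [ | n IH].
  - simpl Cpow. eapply cderiv_val; [ | apply cderiv_const]. simpl INR. ring.
  - apply cderiv_ext with (fun s => (x s * x s ^ n)%C); [reflexivity | ].
    eapply cderiv_val; [ | apply cderiv_mult; [exact H | exact IH]].
    cbv beta. replace (S n - 1)%nat with n by lia. rewrite S_INR, RtoC_plus.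
    destruct n as [ | n]; [simpl; ring | ].
    replace (S n - 1)%nat with n by lia. rewrite Cpow_S. ring.
Qed.

Lemma cderiv_inv (x : R -> C) (t : R) (v : C) : x t <> 0 ->
  cderiv x t v -> cderiv (fun s => (/ x s)%C) t (- v / (x t * x t)).
Proof.
  intros Hx [H1 H2].
  assert (Hn : Re (x t) * Re (x t) + Im (x t) * Im (x t) <> 0).
  { rewrite <- Cmod_sqr. apply Cmod_nz in Hx. nra. }
  set (a := fun s => Re (x s)) in *. set (b := fun s => Im (x s)) in *.
  assert (Hd : is_derive (fun s => / (a s * a s + b s * b s)) t
     (- (2 * a t * Re v + 2 * b t * Im v) / (a t * a t + b t * b t) ^ 2)).
  { eapply is_derive_val; [ | apply is_derive_inv; [apply is_derive_Rplus; apply is_derive_Rmult; eassumption | exact Hn]].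
    simpl. f_equal. ring. }
  assert (Hinv : forall s, (/ x s)%C = (a s * / (a s * a s + b s * b s), - b s * / (a s * a s + b s * b s))).
  { intros s. unfold Cinv, a, b, Re, Im. f_equal; unfold Rdiv; f_equal; f_equal; ring. }
  split.
  - apply is_derive_ext with (fun s => a s * / (a s * a s + b s * b s)).
    { intros s. now rewrite Hinv. }
    eapply is_derive_val; [ | apply is_derive_Rmult; [exact H1 | exact Hd]].
    unfold a, b, Cdiv. unfold Re, Im in *. simpl. field; repeat split; intro E; apply Hn; nra.
  - apply is_derive_ext with (fun s => - b s * / (a s * a s + b s * b s)).
    { intros s. now rewrite Hinv. }
    eapply is_derive_val; [ | apply is_derive_Rmult; [apply (is_derive_opp _ _ _ H2) | exact Hd]].
    unfold a, b, Cdiv, opp. unfold Re, Im in *. simpl. field; repeat split; intro E; apply Hn; nra.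
Qed.

Lemma cderiv_csum (x : nat -> R -> C) (t : R) (v : nat -> C) (n : nat) :
  (forall i, (i < n)%nat -> cderiv (x i) t (v i)) ->
  cderiv (fun s => csum (fun i => x i s) n) t (csum v n).
Proof.
  induction n; intros H; simpl; [apply cderiv_const | ].
  apply cderiv_plus; [apply IHn; intros; apply H; lia | apply H; lia].
Qed.

Lemma is_derive_rsum (x : nat -> R -> R) (t : R) (v : nat -> R) (n : nat) :
  (forall i, (i < n)%nat -> is_derive (x i) t (v i)) ->
  is_derive (fun s => rsum (fun i => x i s) n) t (rsum v n).
Proof.
  induction n; intros H; simpl; [exact (is_derive_const 0 t) | ].
  apply is_derive_Rplus; [apply IHn; intros; apply H; lia | apply H; lia].
Qed.

Lemma cderiv_affine (a w : C) (t : R) : cderiv (fun s => (a + RtoC s * w)%C) t w.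
Proof.
  split; unfold Re, Im; simpl; auto_derive; auto; ring.
Qed.

Lemma cderiv_cis (t : R) : cderiv cis t (Ci * cis t).
Proof. split; unfold cis, Re, Im; simpl; auto_derive; auto; ring. Qed.

(** The logarithm of the modulus has the real part of the logarithmic derivative as its derivative,
    and it requires no choice of a branch; the growth of the canonical products is computed in this
    form. *)
Lemma is_derive_ln_Cmod (x : R -> C) (t : R) (v : C) : x t <> 0 -> cderiv x t v ->
  is_derive (fun s => ln (Cmod (x s))) t (Re (v / x t)%C).
Proof.
  intros Hx [H1 H2]. assert (Hm := Cmod_nz _ Hx).
  assert (Hq : 0 < Re (x t) * Re (x t) + Im (x t) * Im (x t)) by (rewrite <- Cmod_sqr; nra).
  apply is_derive_ext with (fun s => ln (sqrt (Re (x s) * Re (x s) + Im (x s) * Im (x s)))).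
  { intros s. f_equal. unfold Cmod, Re, Im. f_equal. simpl; ring. }
  eapply is_derive_val.
  2: { apply (is_derive_Rcomp ln (fun s => sqrt (Re (x s) * Re (x s) + Im (x s) * Im (x s)))).
       - apply is_derive_ln. apply sqrt_lt_R0. exact Hq.
       - apply is_derive_sqrt; [ | exact Hq]. apply is_derive_Rplus; apply is_derive_Rmult; eassumption. }
  set (q := Re (x t) * Re (x t) + Im (x t) * Im (x t)) in *.
  assert (Hs : sqrt q * sqrt q = q) by (apply sqrt_sqrt; lra).
  assert (Hsp : 0 < sqrt q) by (apply sqrt_lt_R0; auto).
  replace (Re (v / x t)%C) with ((Re v * Re (x t) + Im v * Im (x t)) / q).
  2: { unfold q, Cdiv. unfold Re, Im. simpl. field. unfold q, Re, Im in Hq.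
       intro E. nra. }
  cbv beta. fold q. generalize dependent (sqrt q). intros sq Hs Hsp. rewrite <- Hs. field. lra.
Qed.

Lemma MVT_upper (f f' : R -> R) (a b B : R) : a <= b ->
  (forall t, a <= t <= b -> is_derive f t (f' t)) ->
  (forall t, a <= t <= b -> f' t <= B) -> f b - f a <= B * (b - a).
Proof.
  intros Hab Hd HB.
  destruct (MVT_gen f a b f') as [c [Hc E]].
  - intros x Hx. rewrite Rmin_left, Rmax_right in Hx by lra. apply Hd. lra.
  - intros x Hx. rewrite Rmin_left, Rmax_right in Hx by lra.
    apply derivable_continuous_pt. exists (f' x). apply is_derive_Reals, Hd. lra.
  - rewrite Rmin_left, Rmax_right in Hc by lra. rewrite E.
    apply Rmult_le_compat_r; [lra | ]. now apply HB.
Qed.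

Lemma MVT_abs (f f' : R -> R) (a b B : R) : a <= b ->
  (forall t, a <= t <= b -> is_derive f t (f' t)) ->
  (forall t, a <= t <= b -> Rabs (f' t) <= B) -> Rabs (f b - f a) <= B * (b - a).
Proof.
  intros Hab Hd HB. apply Rabs_le. split.
  - enough (- f b - - f a <= B * (b - a)) by lra.
    apply (MVT_upper (fun t => - f t) (fun t => - f' t)); auto.
    + intros. apply (is_derive_opp f). auto.
    + intros t Ht. specialize (HB t Ht). pose proof (Rle_abs (- f' t)). rewrite Rabs_Ropp in *. lra.
  - apply (MVT_upper f f'); auto.
    intros t Ht. specialize (HB t Ht). pose proof (Rle_abs (f' t)). lra.
Qed.

(** Pairing the curve with the conjugate of its increment gives a real function whose increment is
    the squared length, to which the real bound applies. *)
Lemma MVT_C (x v : R -> C) (a b B : R) : a <= b ->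
  (forall t, a <= t <= b -> cderiv x t (v t)) ->
  (forall t, a <= t <= b -> Cmod (v t) <= B) -> Cmod (x b - x a) <= B * (b - a).
Proof.
  intros Hab Hd HB.
  destruct (Req_dec (Cmod (x b - x a)) 0) as [E | E].
  { rewrite E. apply Rmult_le_pos; [ | lra]. eapply Rle_trans; [apply Cmod_ge_0 | apply (HB a); lra]. }
  assert (Hp : 0 < Cmod (x b - x a)) by (pose proof (Cmod_ge_0 (x b - x a)); lra).
  set (w := (Cconj (x b - x a))%C).
  assert (H : Re (w * x b)%C - Re (w * x a)%C <= (Cmod w * B) * (b - a)).
  { apply (MVT_upper (fun t => Re (w * x t)%C) (fun t => Re (w * v t)%C)); auto.
    - intros t Ht. destruct (cderiv_scal w x t (v t) (Hd t Ht)). auto.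
    - intros t Ht. eapply Rle_trans; [apply Re_le_Cmod | ]. rewrite Cmod_mult.
      apply Rmult_le_compat_l; [apply Cmod_ge_0 | auto]. }
  assert (E1 : Re (w * x b)%C - Re (w * x a)%C = Cmod (x b - x a) * Cmod (x b - x a)).
  { rewrite <- Re_minus. replace (w * x b - w * x a)%C with (w * (x b - x a))%C by ring.
    rewrite Cmod_sqr. unfold w. generalize (x b - x a)%C. intros [p q]. unfold Re; simpl; ring. }
  rewrite E1 in H. unfold w in H. rewrite Cmod_conj in H.
  apply Rmult_le_reg_l with (Cmod (x b - x a)); auto. lra.
Qed.

(** * The complex exponential *)

Definition Cexp (z : C) : C := (exp (Re z) * cos (Im z), exp (Re z) * sin (Im z)).

Lemma Cexp_polar (z : C) : Cexp z = (RtoC (exp (Re z)) * cis (Im z))%C.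
Proof. apply C_eq; [rewrite Re_RtoC_mult | rewrite Im_RtoC_mult]; reflexivity. Qed.

Lemma Cexp_plus (z w : C) : Cexp (z + w) = (Cexp z * Cexp w)%C.
Proof.
  rewrite !Cexp_polar.
  replace (Im (z + w)%C) with (Im z + Im w) by reflexivity.
  rewrite Re_plus, exp_plus, cis_plus, RtoC_mult. ring.
Qed.

Lemma Cexp_0 : Cexp 0 = 1.
Proof. rewrite Cexp_polar. unfold Re, Im; simpl. rewrite exp_0, cis_0. ring. Qed.

Lemma Cmod_Cexp (z : C) : Cmod (Cexp z) = exp (Re z).
Proof. rewrite Cexp_polar, Cmod_mult, Cmod_cis, Cmod_RtoC_pos; [ring | apply Rlt_le, exp_pos]. Qed.

Lemma Cexp_pow (z : C) (n : nat) : (Cexp z ^ n)%C = Cexp (INR n * z).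
Proof.
  induction n as [ | n IH].
  - simpl Cpow. replace (RtoC (INR 0) * z)%C with (RtoC 0) by (simpl; ring). now rewrite Cexp_0.
  - rewrite Cpow_S, IH, <- Cexp_plus. f_equal. rewrite S_INR, RtoC_plus. ring.
Qed.

Lemma exp_le (a b : R) : a <= b -> exp a <= exp b.
Proof. intros [H | ->]; [left; now apply exp_increasing | lra]. Qed.

Lemma cderiv_Cexp (x : R -> C) (t : R) (v : C) :
  cderiv x t v -> cderiv (fun s => Cexp (x s)) t (Cexp (x t) * v).
Proof.
  intros [H1 H2].
  assert (He : is_derive (fun s => exp (Re (x s))) t (Re v * exp (Re (x t)))).
  { apply (is_derive_Rcomp exp (fun s => Re (x s))); auto. apply is_derive_exp. }
  assert (Hc : is_derive (fun s => cos (Im (x s))) t (Im v * - sin (Im (x t)))).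
  { apply (is_derive_Rcomp cos (fun s => Im (x s))); auto. apply is_derive_cos. }
  assert (Hs : is_derive (fun s => sin (Im (x s))) t (Im v * cos (Im (x t)))).
  { apply (is_derive_Rcomp sin (fun s => Im (x s))); auto. apply is_derive_sin. }
  split.
  - eapply is_derive_val; [ | apply (is_derive_Rmult _ _ _ _ _ He Hc)].
    unfold Cexp. rewrite Re_mult. unfold Re, Im; simpl; ring.
  - eapply is_derive_val; [ | apply (is_derive_Rmult _ _ _ _ _ He Hs)].
    unfold Cexp. rewrite Im_mult. unfold Re, Im; simpl; ring.
Qed.

Lemma cderiv_line (w : C) (t : R) : cderiv (fun s => (RtoC s * w)%C) t w.
Proof.
  apply cderiv_ext with (fun s => (0 + RtoC s * w)%C); [intros; ring | apply cderiv_affine].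
Qed.

Lemma Re_line_le (t : R) (w : C) : 0 <= t <= 1 -> Re (RtoC t * w)%C <= Cmod w.
Proof.
  intros H. rewrite Re_RtoC_mult. pose proof (Re_le_Cmod w). pose proof (Cmod_ge_0 w). nra.
Qed.

Lemma Cexp_minus_1 (w : C) : Cmod (Cexp w - 1) <= Cmod w * exp (Cmod w).
Proof.
  replace (Cexp w - 1)%C with (Cexp (RtoC 1 * w) - Cexp (RtoC 0 * w))%C.
  2: { replace (RtoC 0 * w)%C with (RtoC 0) by ring. rewrite Cexp_0. f_equal; f_equal; ring. }
  replace (Cmod w * exp (Cmod w)) with (Cmod w * exp (Cmod w) * (1 - 0)) by ring.
  apply (MVT_C (fun t => Cexp (RtoC t * w)) (fun t => (Cexp (RtoC t * w) * w)%C)); [lra | | ].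
  - intros t _. apply cderiv_Cexp, cderiv_line.
  - intros t Ht. rewrite Cmod_mult, Cmod_Cexp, Rmult_comm.
    apply Rmult_le_compat_l; [apply Cmod_ge_0 | apply exp_le, Re_line_le; auto].
Qed.

Lemma Cexp_taylor2 (w : C) : Cmod (Cexp w - 1 - w) <= Cmod w ^ 2 * exp (Cmod w).
Proof.
  set (y := fun t => (Cexp (RtoC t * w) + - (RtoC 1) * (RtoC t * w))%C).
  replace (Cexp w - 1 - w)%C with (y 1 - y 0)%C.
  2: { unfold y. replace (RtoC 0 * w)%C with (RtoC 0) by ring. rewrite Cexp_0.
       replace (RtoC 1 * w)%C with w by ring. ring. }
  replace (Cmod w ^ 2 * exp (Cmod w)) with (Cmod w ^ 2 * exp (Cmod w) * (1 - 0)) by ring.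
  apply (MVT_C y (fun t => (Cexp (RtoC t * w) * w + - (RtoC 1) * w)%C)); [lra | | ].
  - intros t _. apply cderiv_plus; [apply cderiv_Cexp, cderiv_line | apply cderiv_scal, cderiv_line].
  - intros t Ht. replace (Cexp (RtoC t * w) * w + - (RtoC 1) * w)%C with (w * (Cexp (RtoC t * w) - 1))%C by ring.
    rewrite Cmod_mult. replace (Cmod w ^ 2 * exp (Cmod w)) with (Cmod w * (Cmod w * exp (Cmod w))) by ring.
    apply Rmult_le_compat_l; [apply Cmod_ge_0 | ].
    eapply Rle_trans; [apply Cexp_minus_1 | ].
    assert (Cmod (RtoC t * w) <= Cmod w).
    { rewrite Cmod_mult, Cmod_RtoC_pos by lra. pose proof (Cmod_ge_0 w). nra. }
    apply Rmult_le_compat; auto using Cmod_ge_0. apply Rlt_le, exp_pos. now apply exp_le.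
Qed.

(* This exhibits [Cexp] as a locally uniform limit of polynomials. *)
Lemma Cexp_approx (w : C) (n : nat) : (0 < n)%nat ->
  Cmod (Cexp w - (1 + w / INR n) ^ n) <= Cmod w ^ 2 * exp (2 * Cmod w) / INR n.
Proof.
  intros Hn. assert (Hp : 0 < INR n) by (apply lt_0_INR; lia).
  assert (Hpz : RtoC (INR n) <> 0) by (apply RtoC_nz; lra).
  assert (Hw := Cmod_ge_0 w).
  replace (Cexp w) with (Cexp (w / INR n) ^ n)%C.
  2: { rewrite Cexp_pow. f_equal. field; auto. }
  assert (Hm : Cmod (w / INR n) = Cmod w / INR n).
  { rewrite Cmod_div by auto. rewrite Cmod_RtoC_pos; lra. }
  eapply Rle_trans.
  { apply Cpow_lipschitz with (B := exp (Cmod w / INR n)).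
    - rewrite Cmod_Cexp. apply exp_le. rewrite <- Hm. apply Re_le_Cmod.
    - eapply Rle_trans; [apply Cmod_triangle | ]. rewrite Cmod_1, Hm.
      pose proof (exp_ineq1_le (Cmod w / INR n)). lra. }
  assert (HT := Cexp_taylor2 (w / INR n)).
  replace (Cexp (w / INR n) - (1 + w / INR n))%C with (Cexp (w / INR n) - 1 - w / INR n)%C by ring.
  set (e := exp (Cmod w / INR n)) in *.
  assert (Hee : e ^ n = exp (Cmod w)).
  { unfold e. assert (forall m, exp (Cmod w / INR n) ^ m = exp (INR m * (Cmod w / INR n))) as ->.
    { induction m; [simpl; now rewrite Rmult_0_l, exp_0 | ].
      simpl pow. rewrite IHm, <- exp_plus, S_INR. f_equal. ring. }
    f_equal. field. lra. }
  assert (He1 : 1 <= e).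
  { unfold e. pose proof (exp_ineq1_le (Cmod w / INR n)).
    assert (0 <= Cmod w / INR n) by (apply Rdiv_le_0_compat; lra). lra. }
  assert (He2 : e ^ (n - 1) * e = exp (Cmod w)).
  { rewrite <- Hee. rewrite <- (tech_pow_Rmult e (n-1)) || idtac.
    replace n with (S (n - 1)) at 2 by lia. simpl. ring. }
  rewrite Hm in HT. fold e in HT.
  apply Rle_trans with (INR n * e ^ (n - 1) * ((Cmod w / INR n) ^ 2 * e)).
  { apply Rmult_le_compat_l; auto. apply Rmult_le_pos; [lra | apply pow_le; lra]. }
  replace (INR n * e ^ (n - 1) * ((Cmod w / INR n) ^ 2 * e)) with (Cmod w ^ 2 * (e ^ (n - 1) * e) / INR n) by (field; lra).
  rewrite He2. apply Rmult_le_compat_r; [apply Rlt_le, Rinv_0_lt_compat; auto | ].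
  apply Rmult_le_compat_l; [apply pow_le; auto | apply exp_le; lra].
Qed.

(** * Limits of complex sequences *)

Definition cvg (u : nat -> C) (l : C) : Prop :=
  forall eps, 0 < eps -> exists n0, forall n, (n0 <= n)%nat -> Cmod (u n - l) < eps.

Lemma cvg_complete (u : nat -> C) :
  (forall eps, 0 < eps -> exists n0, forall n m, (n0 <= n)%nat -> (n0 <= m)%nat -> Cmod (u n - u m) < eps) ->
  exists l, cvg u l.
Proof.
  intros H.
  assert (HR : Cauchy_crit (fun n => Re (u n))).
  { intros eps He. destruct (H eps He) as [n0 Hn]. exists n0. intros n m Hm Hn'.
    unfold R_dist, Rdist. rewrite <- Re_minus. eapply Rle_lt_trans; [apply re_le_Cmod | apply Hn; lia]. }
  assert (HI : Cauchy_crit (fun n => Im (u n))).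
  { intros eps He. destruct (H eps He) as [n0 Hn]. exists n0. intros n m Hm Hn'.
    unfold R_dist, Rdist. change (Im (u n) - Im (u m)) with (Im (u n - u m)%C).
    eapply Rle_lt_trans; [apply im_le_Cmod | apply Hn; lia]. }
  destruct (Rcomplete.R_complete _ HR) as [a Ha]. destruct (Rcomplete.R_complete _ HI) as [b Hb].
  exists (a, b). intros eps He.
  destruct (Ha (eps / 2) ltac:(lra)) as [n1 H1]. destruct (Hb (eps / 2) ltac:(lra)) as [n2 H2].
  exists (max n1 n2). intros n Hn. specialize (H1 n ltac:(lia)). specialize (H2 n ltac:(lia)).
  unfold R_dist, Rdist in *. eapply Rle_lt_trans; [apply Cmod_sum_parts | ].
  change (Re (u n - (a, b))%C) with (Re (u n) - a). change (Im (u n - (a, b))%C) with (Im (u n) - b). lra.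
Qed.

Lemma cvg_Cmod_le (u : nat -> C) (l c : C) (B : R) :
  cvg u l -> (exists n0, forall n, (n0 <= n)%nat -> Cmod (u n - c) <= B) -> Cmod (l - c) <= B.
Proof.
  intros H [n0 Hn]. apply le_epsilon. intros eps He.
  destruct (H eps He) as [n1 H1]. specialize (H1 (max n0 n1) ltac:(lia)).
  specialize (Hn (max n0 n1) ltac:(lia)).
  pose proof (Cmod_triangle3 l (u (max n0 n1)) c). rewrite (Cmod_minus_sym l (u (max n0 n1))) in H0. lra.
Qed.

Lemma cvg_Cmod_le0 (u : nat -> C) (l : C) (B : R) :
  cvg u l -> (exists n0, forall n, (n0 <= n)%nat -> Cmod (u n) <= B) -> Cmod l <= B.
Proof.
  intros H [n0 Hn]. replace l with (l - 0)%C by ring. apply (cvg_Cmod_le u); auto.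
  exists n0. intros n Hl. replace (u n - 0)%C with (u n) by ring. auto.
Qed.

Lemma cvg_const (c : C) : cvg (fun _ => c) c.
Proof. intros eps He. exists O. intros. replace (c - c)%C with (RtoC 0) by ring. rewrite Cmod_0; auto. Qed.

Lemma cvg_plus (u v : nat -> C) (a b : C) : cvg u a -> cvg v b -> cvg (fun n => (u n + v n)%C) (a + b).
Proof.
  intros Hu Hv eps He. destruct (Hu (eps / 2) ltac:(lra)) as [n1 H1]. destruct (Hv (eps / 2) ltac:(lra)) as [n2 H2].
  exists (max n1 n2). intros n Hn. specialize (H1 n ltac:(lia)). specialize (H2 n ltac:(lia)).
  replace (u n + v n - (a + b))%C with ((u n - a) + (v n - b))%C by ring.
  eapply Rle_lt_trans; [apply Cmod_triangle | lra].
Qed.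

Lemma cvg_scal (c : C) (u : nat -> C) (a : C) : cvg u a -> cvg (fun n => (c * u n)%C) (c * a).
Proof.
  intros Hu eps He. assert (Hc := Cmod_ge_0 c).
  destruct (Hu (eps / (Cmod c + 1))) as [n1 H1]; [apply Rdiv_lt_0_compat; lra | ].
  exists n1. intros n Hn. specialize (H1 n Hn).
  replace (c * u n - c * a)%C with (c * (u n - a))%C by ring. rewrite Cmod_mult.
  apply Rle_lt_trans with (Cmod c * (eps / (Cmod c + 1))).
  { apply Rmult_le_compat_l; lra. }
  replace eps with ((Cmod c + 1) * (eps / (Cmod c + 1))) at 2 by (field; lra).
  apply Rmult_lt_compat_r; [apply Rdiv_lt_0_compat; lra | lra].
Qed.

Lemma cvg_ext (u v : nat -> C) (l : C) : (forall n, u n = v n) -> cvg u l -> cvg v l.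
Proof. intros E H eps He. destruct (H eps He) as [n0 Hn]. exists n0. intros. rewrite <- E. auto. Qed.

Lemma cvg_bounded (u : nat -> C) (l : C) : cvg u l -> exists n0, forall n, (n0 <= n)%nat -> Cmod (u n) <= Cmod l + 1.
Proof.
  intros H. destruct (H 1 Rlt_0_1) as [n0 Hn]. exists n0. intros n Hl. specialize (Hn n Hl).
  pose proof (Cmod_reverse (u n) l). lra.
Qed.

Lemma cvg_mult (u v : nat -> C) (a b : C) : cvg u a -> cvg v b -> cvg (fun n => (u n * v n)%C) (a * b).
Proof.
  intros Hu Hv eps He. destruct (cvg_bounded v b Hv) as [n0 H0].
  assert (Hb := Cmod_ge_0 b). assert (Ha := Cmod_ge_0 a).
  destruct (Hu (eps / 2 / (Cmod b + 1))) as [n1 H1]; [apply Rdiv_lt_0_compat; lra | ].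
  destruct (Hv (eps / 2 / (Cmod a + 1))) as [n2 H2]; [apply Rdiv_lt_0_compat; lra | ].
  exists (max n0 (max n1 n2)). intros n Hn.
  specialize (H0 n ltac:(lia)). specialize (H1 n ltac:(lia)). specialize (H2 n ltac:(lia)).
  replace (u n * v n - a * b)%C with ((u n - a) * v n + a * (v n - b))%C by ring.
  eapply Rle_lt_trans; [apply Cmod_triangle | ]. rewrite !Cmod_mult.
  assert (Cmod (u n - a) * Cmod (v n) <= Cmod (u n - a) * (Cmod b + 1)).
  { apply Rmult_le_compat_l; auto using Cmod_ge_0. }
  assert (Cmod (u n - a) * (Cmod b + 1) < eps / 2).
  { replace (eps / 2) with (eps / 2 / (Cmod b + 1) * (Cmod b + 1)) by (field; lra).
    apply Rmult_lt_compat_r; lra. }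
  assert (Cmod a * Cmod (v n - b) <= (Cmod a + 1) * (eps / 2 / (Cmod a + 1))).
  { apply Rmult_le_compat; auto using Cmod_ge_0; lra. }
  replace ((Cmod a + 1) * (eps / 2 / (Cmod a + 1))) with (eps / 2) in * by (field; lra). lra.
Qed.

Lemma cvg_Cexp (u : nat -> C) (a : C) : cvg u a -> cvg (fun n => Cexp (u n)) (Cexp a).
Proof.
  intros Hu eps He.
  assert (Hea : 0 < Cmod (Cexp a)) by (rewrite Cmod_Cexp; apply exp_pos).
  assert (H3 := exp_pos 1).
  destruct (Hu (Rmin 1 (eps / (Cmod (Cexp a) * exp 1)))) as [n1 H1].
  { apply Rmin_glb_lt; [lra | apply Rdiv_lt_0_compat; nra]. }
  exists n1. intros n Hn. specialize (H1 n Hn).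
  assert (Hm1 := Rmin_l 1 (eps / (Cmod (Cexp a) * exp 1))). assert (Hm2 := Rmin_r 1 (eps / (Cmod (Cexp a) * exp 1))).
  replace (Cexp (u n) - Cexp a)%C with (Cexp a * (Cexp (u n - a) - 1))%C.
  2: { replace (u n) with (a + (u n - a))%C at 2 by ring. rewrite Cexp_plus. ring. }
  rewrite Cmod_mult.
  assert (HE := Cexp_minus_1 (u n - a)).
  assert (exp (Cmod (u n - a)) <= exp 1) by (apply exp_le; lra).
  assert (Hge := Cmod_ge_0 (u n - a)).
  apply Rle_lt_trans with (Cmod (Cexp a) * (Cmod (u n - a) * exp 1)).
  { apply Rmult_le_compat_l; [lra | ]. eapply Rle_trans; [exact HE | ]. apply Rmult_le_compat_l; auto. }
  apply Rlt_le_trans with (Cmod (Cexp a) * (eps / (Cmod (Cexp a) * exp 1) * exp 1)).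
  { apply Rmult_lt_compat_l; auto. apply Rmult_lt_compat_r; lra. }
  right. field. lra.
Qed.

(** * Locally uniform limits of polynomials *)

Fixpoint peval (l : list C) (z : C) : C :=
  match l with nil => RtoC 0 | c :: l' => (c + z * peval l' z)%C end.

Fixpoint padd (l m : list C) : list C :=
  match l, m with
  | nil, _ => m
  | _, nil => l
  | a :: l', b :: m' => (a + b)%C :: padd l' m'
  end.

Fixpoint pmul (l m : list C) : list C :=
  match l with
  | nil => nil
  | a :: l' => padd (map (Cmult a) m) (RtoC 0 :: pmul l' m)
  end.

Lemma peval_add (l m : list C) (z : C) : peval (padd l m) z = (peval l z + peval m z)%C.
Proof.
  revert m; induction l as [ | a l IH]; intros [ | b m]; simpl; try ring. rewrite IH; ring.
Qed.

Lemma peval_scal (a : C) (l : list C) (z : C) : peval (map (Cmult a) l) z = (a * peval l z)%C.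
Proof. induction l as [ | b l IH]; simpl; [ring | rewrite IH; ring]. Qed.

Lemma peval_mul (l m : list C) (z : C) : peval (pmul l m) z = (peval l z * peval m z)%C.
Proof.
  induction l as [ | a l IH]; simpl; [ring | ].
  rewrite peval_add, peval_scal. simpl. rewrite IH. ring.
Qed.

Lemma nth_padd (l m : list C) (i : nat) : nth i (padd l m) (RtoC 0) = (nth i l (RtoC 0) + nth i m (RtoC 0))%C.
Proof.
  revert m i; induction l as [ | a l IH]; intros [ | b m] [ | i]; simpl; try ring. apply IH.
Qed.

Lemma nth_pscal (a : C) (l : list C) (i : nat) : nth i (map (Cmult a) l) (RtoC 0) = (a * nth i l (RtoC 0))%C.
Proof. revert i; induction l as [ | b l IH]; intros [ | i]; simpl; try ring. apply IH. Qed.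

Lemma peval_csum (l : list C) (z : C) : peval l z = csum (fun i => (nth i l (RtoC 0) * z ^ i)%C) (length l).
Proof.
  induction l as [ | a l IH]; [reflexivity | ].
  simpl length. rewrite csum_first. simpl peval. rewrite IH, <- csum_scal. f_equal; [simpl; ring | ].
  apply csum_ext. intros i _. simpl nth. rewrite Cpow_S. ring.
Qed.

(** * Cauchy's estimates for polynomials *)

Lemma csum_swap (f : nat -> nat -> C) (n m : nat) :
  csum (fun i => csum (fun j => f i j) m) n = csum (fun j => csum (fun i => f i j) n) m.
Proof.
  induction n as [ | n IH]; simpl.
  - induction m; simpl; [auto | rewrite <- IHm; ring].
  - rewrite IH. now rewrite <- csum_plus.
Qed.

Lemma csum_zero (f : nat -> C) (n : nat) : (forall i, (i < n)%nat -> f i = 0) -> csum f n = 0.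
Proof. induction n; intros H; simpl; auto. rewrite IHn, H by auto. ring. Qed.

Lemma csum_single (f : nat -> C) (n m : nat) : (m < n)%nat ->
  (forall i, (i < n)%nat -> i <> m -> f i = 0) -> csum f n = f m.
Proof.
  induction n; intros Hm H; [lia | ]. simpl. destruct (Nat.eq_dec m n) as [-> | Hne].
  - rewrite csum_zero; [ring | ]. intros i Hi. apply H; lia.
  - rewrite IHn; [ | lia | intros; apply H; lia]. rewrite (H n) by lia. ring.
Qed.

Lemma cis_eq_1 (t : R) : cis t = 1 -> Rabs t < 2 * PI -> t = 0.
Proof.
  intros E Ht. apply Rabs_def2 in Ht.
  assert (Hc : cos t = 1) by (injection E; auto).
  replace t with (2 * (t / 2)) in Hc by field. rewrite cos_2a_sin in Hc.
  assert (Hs : sin (t / 2) = 0) by nra.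
  destruct (Rtotal_order (t / 2) 0) as [H | [H | H]]; [ | lra | ].
  - assert (0 < sin (- (t / 2))) by (apply sin_gt_0; lra). rewrite sin_neg in *. lra.
  - assert (0 < sin (t / 2)) by (apply sin_gt_0; lra). lra.
Qed.

Lemma cis_2PI_nat (n : nat) : cis (2 * PI * INR n) = 1.
Proof.
  induction n; [simpl INR; rewrite Rmult_0_r; apply cis_0 | ].
  rewrite S_INR. replace (2 * PI * (INR n + 1)) with (2 * PI * INR n + 2 * PI) by ring.
  now rewrite cis_period.
Qed.

Lemma csum_geom_root (x : C) (n : nat) : (x ^ n)%C = 1 -> x <> 1 -> csum (fun i => (x ^ i)%C) n = 0.
Proof.
  intros E Hx.
  assert (H := geom_factor x 1 n). rewrite Cpow_1_l, E in H.
  rewrite csum_ext with (g := fun i => (x ^ i)%C) in H by (intros; rewrite Cpow_1_l; ring).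
  replace (1 - 1)%C with (RtoC 0) in H by ring. symmetry in H.
  assert (Hn : (x - 1)%C <> 0) by (intro E'; apply Hx; replace x with (x - 1 + 1)%C by ring; rewrite E'; ring).
  replace (csum (fun i => (x ^ i)%C) n) with ((x - 1) * csum (fun i => (x ^ i)%C) n / (x - 1))%C by (field; auto).
  rewrite H. unfold Cdiv. ring.
Qed.

(* Cauchy's estimate for polynomials: average over roots of unity of order exceeding the degree. *)
Lemma coef_bound (l : list C) (Rad M : R) (m : nat) : 0 < Rad ->
  (forall z, Cmod z <= Rad -> Cmod (peval l z) <= M) -> Cmod (nth m l (RtoC 0)) * Rad ^ m <= M.
Proof.
  intros HR HM.
  destruct (le_lt_dec (length l) m) as [Hm | Hm].
  { rewrite nth_overflow by auto. rewrite Cmod_0, Rmult_0_l.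
    eapply Rle_trans; [apply Cmod_ge_0 | apply (HM 0%C)]. rewrite Cmod_0; lra. }
  set (n := length l) in *. assert (Hn : 0 < INR n) by (apply lt_0_INR; lia).
  set (h := 2 * PI / INR n).
  assert (HPI := PI_RGT_0).
  set (pt := fun i : nat => (RtoC Rad * cis (INR i * h))%C).
  assert (E : csum (fun i => (cis (- (INR i * INR m * h)) * peval l (pt i))%C) n
              = (INR n * (nth m l (RtoC 0) * RtoC Rad ^ m))%C).
  { rewrite csum_ext with (g := fun i => csum (fun j => (nth j l (RtoC 0) * RtoC Rad ^ j * (cis ((INR j - INR m) * h)) ^ i)%C) n).
    2: { intros i _. rewrite peval_csum, <- csum_scal. apply csum_ext. intros j _.
         unfold pt. rewrite Cpow_mult_l, !cis_pow.
         replace (INR i * ((INR j - INR m) * h)) with (- (INR i * INR m * h) + INR j * (INR i * h)) by ring.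
         rewrite cis_plus. ring. }
    rewrite csum_swap.
    rewrite csum_ext with (g := fun j => (nth j l (RtoC 0) * RtoC Rad ^ j * csum (fun i => (cis ((INR j - INR m) * h) ^ i)%C) n)%C).
    2: { intros j _. rewrite <- csum_scal. reflexivity. }
    rewrite csum_single with (m := m); auto.
    - replace ((INR m - INR m) * h) with 0 by ring. rewrite cis_0.
      rewrite csum_ext with (g := fun _ => RtoC 1) by (intros; apply Cpow_1_l).
      replace (csum (fun _ => RtoC 1) n) with (RtoC (INR n)).
      2: { clear. induction n; [reflexivity | ]. cbn [csum]. rewrite S_INR, RtoC_plus, IHn. reflexivity. }
      ring.
    - intros j Hj Hjm. rewrite csum_geom_root; [ring | | ].
      + rewrite cis_pow. unfold h. replace (INR n * ((INR j - INR m) * (2 * PI / INR n))) with (2 * PI * INR j + - (2 * PI * INR m)) by (field; lra).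
        rewrite cis_plus, cis_2PI_nat.
        assert (H := cis_opp_mult (2 * PI * INR m)). rewrite cis_2PI_nat in H. 
        replace (cis (- (2 * PI * INR m))) with (RtoC 1) by (rewrite <- H; ring). ring.
      + intro E1. apply cis_eq_1 in E1.
        * assert (INR j - INR m = 0).
          { apply Rmult_eq_reg_r with h; [lra | ]. unfold h. apply Rgt_not_eq, Rdiv_lt_0_compat; lra. }
          apply Hjm. apply INR_eq. lra.
        * unfold h. rewrite Rabs_mult, (Rabs_right (2 * PI / INR n)).
          2: { apply Rle_ge, Rdiv_le_0_compat; lra. }
          apply lt_INR in Hj. apply lt_INR in Hm. pose proof (pos_INR j). pose proof (pos_INR m).
          replace (2 * PI) with (INR n * (2 * PI / INR n)) at 2 by (field; lra).
          apply Rmult_lt_compat_r; [apply Rdiv_lt_0_compat; lra | ].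
          apply Rabs_def1; lra. }
  assert (HB : Cmod (csum (fun i => (cis (- (INR i * INR m * h)) * peval l (pt i))%C) n) <= INR n * M).
  { rewrite <- rsum_const. apply Cmod_csum_le. intros i _. rewrite Cmod_mult, Cmod_cis, Rmult_1_l.
    apply HM. unfold pt. rewrite Cmod_mult, Cmod_cis, Cmod_RtoC_pos by lra. lra. }
  rewrite E, !Cmod_mult, Cmod_pow, !Cmod_RtoC_pos in HB by lra.
  apply Rmult_le_reg_l with (INR n); auto.
Qed.

Lemma rsum_geom_half (n : nat) (x : R) : 0 <= x <= / 2 -> rsum (fun i => x ^ i) n <= 2.
Proof.
  intros Hx. assert (H : rsum (fun i => x ^ i) n * (1 - x) = 1 - x ^ n).
  { induction n; simpl; [ring | ]. rewrite Rmult_plus_distr_r, IHn. ring. }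
  assert (0 <= x ^ n) by (apply pow_le; lra).
  assert (0 <= rsum (fun i => x ^ i) n) by (apply rsum_nonneg; intros; apply pow_le; lra). nra.
Qed.

(** What follows the linear term is [z^2] times a polynomial whose coefficients are bounded by
    Cauchy's estimate; for [Cmod z <= Rad / 2] its terms are dominated by a geometric series of
    ratio at most one half. *)
Lemma poly_taylor (l : list C) (Rad M : R) (z : C) : 0 < Rad ->
  (forall w, Cmod w <= Rad -> Cmod (peval l w) <= M) -> Cmod z <= Rad / 2 ->
  Cmod (peval l z - nth 0 l (RtoC 0) - nth 1 l (RtoC 0) * z) <= 2 * M * Cmod z ^ 2 / Rad ^ 2.
Proof.
  intros HR HM Hz.
  assert (HM0 : 0 <= M) by (eapply Rle_trans; [apply Cmod_ge_0 | apply (HM 0%C); rewrite Cmod_0; lra]).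
  assert (Hz0 := Cmod_ge_0 z).
  assert (Hpos : 0 <= 2 * M * Cmod z ^ 2 / Rad ^ 2).
  { apply Rdiv_le_0_compat; [ | apply pow_lt; auto]. apply Rmult_le_pos; [lra | apply pow_le; auto]. }
  destruct l as [ | a [ | b l]]; simpl nth; simpl peval.
  - replace (0 - 0 - 0 * z)%C with (RtoC 0) by ring. now rewrite Cmod_0.
  - replace (a + z * 0 - a - 0 * z)%C with (RtoC 0) by ring. now rewrite Cmod_0.
  - replace (a + z * (b + z * peval l z) - a - b * z)%C with (z ^ 2 * peval l z)%C by ring.
    rewrite Cmod_mult, Cmod_pow.
    assert (H : Cmod (peval l z) <= M / Rad ^ 2 * 2).
    { rewrite peval_csum. eapply Rle_trans.
      - apply Cmod_csum_le with (g := fun i => M / Rad ^ 2 * (Cmod z / Rad) ^ i). intros i _.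
        rewrite Cmod_mult, Cmod_pow. assert (Hc := coef_bound (a :: b :: l) Rad M (S (S i)) HR HM).
        simpl nth in Hc.
        assert (Hcc : Cmod (nth i l (RtoC 0)) <= M / Rad ^ S (S i)).
        { apply Rmult_le_reg_r with (Rad ^ S (S i)); [apply pow_lt; auto | ].
          replace (M / Rad ^ S (S i) * Rad ^ S (S i)) with M; auto. field.
          apply pow_nonzero; lra. }
        replace (M / Rad ^ 2 * (Cmod z / Rad) ^ i) with (M / Rad ^ S (S i) * Cmod z ^ i).
        2: { unfold Rdiv. rewrite Rpow_mult_distr, pow_inv. simpl. field.
             split; [apply pow_nonzero; lra | lra]. }
        apply Rmult_le_compat_r; [apply pow_le; auto | auto].
      - rewrite rsum_scal. apply Rmult_le_compat_l; [apply Rdiv_le_0_compat; [auto | apply pow_lt; auto] | ].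
        apply rsum_geom_half. split; [apply Rdiv_le_0_compat; lra | ].
        apply Rmult_le_reg_r with Rad; auto. replace (Cmod z / Rad * Rad) with (Cmod z) by (field; lra). lra. }
    replace (2 * M * Cmod z ^ 2 / Rad ^ 2) with (Cmod z ^ 2 * (M / Rad ^ 2 * 2)) by (field; lra).
    apply Rmult_le_compat_l; auto. apply pow_le; auto.
Qed.

(** Entire functions, encoded as locally uniform limits of polynomials. Closure under products,
    exponentials and locally uniform limits is then direct, and Cauchy's estimates pass over from
    polynomials. *)
Definition ent (f : C -> C) : Prop :=
  forall Rad eps, 0 < Rad -> 0 < eps -> exists l, forall z, Cmod z <= Rad -> Cmod (f z - peval l z) <= eps.

Lemma peval_bounded (l : list C) (Rad : R) : exists M, 0 < M /\ forall z, Cmod z <= Rad -> Cmod (peval l z) <= M.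
Proof.
  induction l as [ | a l [M [HM IH]]].
  - exists 1. split; [lra | ]. intros. simpl. rewrite Cmod_0. lra.
  - exists (Cmod a + (Rabs Rad + 1) * M + 1). pose proof (Cmod_ge_0 a). pose proof (Rabs_pos Rad).
    split; [nra | ]. intros z Hz. simpl. eapply Rle_trans; [apply Cmod_triangle | ].
    rewrite Cmod_mult. specialize (IH z Hz). pose proof (Cmod_ge_0 z). pose proof (Rle_abs Rad).
    assert (Cmod z * Cmod (peval l z) <= (Rabs Rad + 1) * M).
    { apply Rmult_le_compat; auto using Cmod_ge_0. lra. }
    lra.
Qed.

Lemma ent_bounded (f : C -> C) (Rad : R) : ent f -> exists M, 0 < M /\ forall z, Cmod z <= Rad -> Cmod (f z) <= M.
Proof.
  intros Hf. destruct (Hf (Rabs Rad + 1) 1) as [l Hl]; [pose proof (Rabs_pos Rad); lra | lra | ].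
  destruct (peval_bounded l (Rabs Rad + 1)) as [M [HM H]].
  exists (M + 1). split; [lra | ]. intros z Hz. pose proof (Rle_abs Rad).
  specialize (Hl z ltac:(lra)). specialize (H z ltac:(lra)).
  pose proof (Cmod_reverse (f z) (peval l z)). lra.
Qed.

Lemma ent_ext (f g : C -> C) : (forall z, f z = g z) -> ent f -> ent g.
Proof.
  intros E H Rad eps HR He. destruct (H Rad eps HR He) as [l Hl]. exists l. intros z Hz. rewrite <- E. auto.
Qed.

Lemma ent_poly (l : list C) : ent (peval l).
Proof. intros Rad eps HR He. exists l. intros. replace (peval l z - peval l z)%C with (RtoC 0) by ring. rewrite Cmod_0; lra. Qed.

Lemma ent_const (c : C) : ent (fun _ => c).
Proof. apply ent_ext with (peval (c :: nil)); [intros; simpl; ring | apply ent_poly]. Qed.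

Lemma ent_id : ent (fun z => z).
Proof. apply ent_ext with (peval (RtoC 0 :: RtoC 1 :: nil)); [intros; simpl; ring | apply ent_poly]. Qed.

Lemma ent_plus (f g : C -> C) : ent f -> ent g -> ent (fun z => (f z + g z)%C).
Proof.
  intros Hf Hg Rad eps HR He.
  destruct (Hf Rad (eps / 2) HR ltac:(lra)) as [l Hl]. destruct (Hg Rad (eps / 2) HR ltac:(lra)) as [m Hm].
  exists (padd l m). intros z Hz. rewrite peval_add.
  replace (f z + g z - (peval l z + peval m z))%C with ((f z - peval l z) + (g z - peval m z))%C by ring.
  eapply Rle_trans; [apply Cmod_triangle | ]. specialize (Hl z Hz). specialize (Hm z Hz). lra.
Qed.

Lemma ent_mult (f g : C -> C) : ent f -> ent g -> ent (fun z => (f z * g z)%C).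
Proof.
  intros Hf Hg Rad eps HR He.
  destruct (ent_bounded f Rad Hf) as [A [HA HfA]]. destruct (ent_bounded g Rad Hg) as [B [HB HgB]].
  destruct (Hg Rad (Rmin 1 (eps / 2 / A)) HR) as [m Hm].
  { apply Rmin_glb_lt; [lra | apply Rdiv_lt_0_compat; lra]. }
  destruct (Hf Rad (eps / 2 / (B + 1)) HR) as [l Hl]; [apply Rdiv_lt_0_compat; lra | ].
  exists (pmul l m). intros z Hz. rewrite peval_mul.
  specialize (Hl z Hz). specialize (Hm z Hz). specialize (HfA z Hz). specialize (HgB z Hz).
  assert (Hm1 := Rmin_l 1 (eps / 2 / A)). assert (Hm2 := Rmin_r 1 (eps / 2 / A)).
  assert (Hmb : Cmod (peval m z) <= B + 1).
  { pose proof (Cmod_reverse (peval m z) (g z)). rewrite Cmod_minus_sym in H. lra. }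
  replace (f z * g z - peval l z * peval m z)%C with (f z * (g z - peval m z) + (f z - peval l z) * peval m z)%C by ring.
  eapply Rle_trans; [apply Cmod_triangle | ]. rewrite !Cmod_mult.
  assert (Cmod (f z) * Cmod (g z - peval m z) <= A * (eps / 2 / A)).
  { apply Rmult_le_compat; auto using Cmod_ge_0. lra. }
  assert (Cmod (f z - peval l z) * Cmod (peval m z) <= eps / 2 / (B + 1) * (B + 1)).
  { apply Rmult_le_compat; auto using Cmod_ge_0. }
  replace (A * (eps / 2 / A)) with (eps / 2) in * by (field; lra).
  replace (eps / 2 / (B + 1) * (B + 1)) with (eps / 2) in * by (field; lra). lra.
Qed.

Lemma ent_scal (c : C) (f : C -> C) : ent f -> ent (fun z => (c * f z)%C).
Proof. intros Hf. apply (ent_mult (fun _ => c)); auto using ent_const. Qed.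

Lemma ent_minus (f g : C -> C) : ent f -> ent g -> ent (fun z => (f z - g z)%C).
Proof.
  intros Hf Hg. apply ent_ext with (fun z => (f z + (- (1)) * g z)%C); [intros; ring | ].
  apply ent_plus; auto. now apply ent_scal.
Qed.

Lemma ent_pow (f : C -> C) (n : nat) : ent f -> ent (fun z => (f z ^ n)%C).
Proof.
  intros Hf. induction n; [exact (ent_const (RtoC 1)) | ].
  apply ent_ext with (fun z => (f z * f z ^ n)%C); [reflexivity | now apply ent_mult].
Qed.

Lemma ent_csum (f : nat -> C -> C) (n : nat) : (forall i, (i < n)%nat -> ent (f i)) -> ent (fun z => csum (fun i => f i z) n).
Proof.
  induction n; intros H; simpl; [exact (ent_const (RtoC 0)) | ].
  apply ent_plus; [apply IHn; auto | apply H; lia].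
Qed.

Lemma ent_limit (f : C -> C) :
  (forall Rad eps, 0 < Rad -> 0 < eps -> exists g, ent g /\ forall z, Cmod z <= Rad -> Cmod (f z - g z) <= eps) -> ent f.
Proof.
  intros H Rad eps HR He. destruct (H Rad (eps / 2) HR ltac:(lra)) as [g [Hg Hd]].
  destruct (Hg Rad (eps / 2) HR ltac:(lra)) as [l Hl]. exists l. intros z Hz.
  eapply Rle_trans; [apply (Cmod_triangle3 _ (g z)) | ]. specialize (Hd z Hz). specialize (Hl z Hz). lra.
Qed.

Lemma ent_affine (f : C -> C) (a b : C) : ent f -> ent (fun z => f (a + b * z)%C).
Proof.
  intros Hf. apply ent_limit. intros Rad eps HR He.
  destruct (Hf (Cmod a + Cmod b * Rad + 1) eps) as [l Hl]; auto.
  { pose proof (Cmod_ge_0 a). pose proof (Cmod_ge_0 b). nra. }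
  exists (fun z => peval l (a + b * z)%C). split.
  - clear Hl. induction l as [ | c l IH]; simpl; [exact (ent_const (RtoC 0)) | ].
    apply ent_plus; [apply ent_const | ]. apply ent_mult; [ | exact IH].
    apply ent_plus; [apply ent_const | apply ent_scal, ent_id].
  - intros z Hz. apply Hl. eapply Rle_trans; [apply Cmod_triangle | ]. rewrite Cmod_mult.
    pose proof (Cmod_ge_0 b). pose proof (Cmod_ge_0 z). nra.
Qed.

Lemma exists_nat_large (x : R) : exists n, (0 < n)%nat /\ x < INR n.
Proof.
  destruct (archimed (Rabs x)) as [H _]. exists (S (Z.to_nat (up (Rabs x)))). split; [lia | ].
  rewrite S_INR, INR_IZR_INZ. pose proof (Rle_abs x). pose proof (Rabs_pos x).
  rewrite Z2Nat.id; [lra | ]. apply le_IZR. lra.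
Qed.

Lemma ent_Cexp (f : C -> C) : ent f -> ent (fun z => Cexp (f z)).
Proof.
  intros Hf. apply ent_limit. intros Rad eps HR He.
  destruct (ent_bounded f Rad Hf) as [A [HA HfA]].
  destruct (exists_nat_large (A ^ 2 * exp (2 * A) / eps)) as [n [Hn Hne]].
  assert (Hp : 0 < INR n) by (apply lt_0_INR; lia).
  exists (fun z => ((1 + / INR n * f z) ^ n)%C). split.
  - apply ent_pow. apply ent_plus; [apply ent_const | now apply ent_scal].
  - intros z Hz. specialize (HfA z Hz).
    replace (/ INR n * f z)%C with (f z / INR n)%C by (unfold Cdiv; ring).
    eapply Rle_trans; [apply Cexp_approx; auto | ].
    apply Rle_trans with (A ^ 2 * exp (2 * A) / INR n).
    + apply Rmult_le_compat_r; [apply Rlt_le, Rinv_0_lt_compat; auto | ].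
      apply Rmult_le_compat; [apply pow_le, Cmod_ge_0 | apply Rlt_le, exp_pos | | apply exp_le; lra].
      apply pow_incr. split; auto using Cmod_ge_0.
    + apply Rmult_le_reg_r with (INR n); auto.
      replace (A ^ 2 * exp (2 * A) / INR n * INR n) with (A ^ 2 * exp (2 * A) / eps * eps) by (field; lra). nra.
Qed.

(** The derivative [c] at the origin is the limit of the linear coefficients of approximating
    polynomials, a Cauchy sequence by [coef_bound]. One [c] serves all radii and bounds, which later
    allows a bound that depends on a second variable. *)
Lemma ent_taylor (f : C -> C) : ent f -> exists c, forall Rad M, 0 < Rad ->
  (forall z, Cmod z <= Rad -> Cmod (f z) <= M) ->
  Cmod c * Rad <= M /\
  forall z, Cmod z <= Rad / 2 -> Cmod (f z - f 0 - c * z) <= 2 * M * Cmod z ^ 2 / Rad ^ 2.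
Proof.
  intros Hf.
  assert (Hl : exists l : nat -> list C, forall n z, Cmod z <= INR n + 1 -> Cmod (f z - peval (l n) z) <= / (INR n + 1)).
  { apply (functional_choice (fun n l => forall z, Cmod z <= INR n + 1 -> Cmod (f z - peval l z) <= / (INR n + 1))).
    intros n. pose proof (pos_INR n). apply Hf; [lra | apply Rinv_0_lt_compat; lra]. }
  destruct Hl as [l Hl].
  assert (Hsmall : forall eps, 0 < eps -> exists n0, forall n, (n0 <= n)%nat -> / (INR n + 1) < eps).
  { intros eps He. destruct (exists_nat_large (/ eps)) as [n0 [_ Hn0]]. exists n0. intros n Hn.
    apply le_INR in Hn. rewrite <- (Rinv_inv eps). apply Rinv_lt_contravar; [ | lra].
    assert (0 < / eps) by (apply Rinv_0_lt_compat; auto). nra. }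
  assert (Hc : exists c, cvg (fun n => nth 1 (l n) (RtoC 0)) c).
  { apply cvg_complete. intros eps He. destruct (Hsmall (eps / 2) ltac:(lra)) as [n0 Hn0].
    exists n0. intros n m Hn Hm.
    assert (H := coef_bound (padd (l n) (map (Cmult (- (1))%C) (l m))) 1 (/ (INR n + 1) + / (INR m + 1)) 1 Rlt_0_1).
    rewrite nth_padd, nth_pscal, pow1, Rmult_1_r in H.
    replace (nth 1 (l n) (RtoC 0) - nth 1 (l m) (RtoC 0))%C with (nth 1 (l n) (RtoC 0) + - (1) * nth 1 (l m) (RtoC 0))%C by ring.
    eapply Rle_lt_trans; [apply H | ].
    - intros z Hz. rewrite peval_add, peval_scal.
      replace (peval (l n) z + - (1) * peval (l m) z)%C with ((f z - peval (l m) z) - (f z - peval (l n) z))%C by ring.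
      pose proof (pos_INR n). pose proof (pos_INR m).
      eapply Rle_trans; [apply Cmod_triangle_minus | ].
      pose proof (Hl n z ltac:(lra)). pose proof (Hl m z ltac:(lra)). lra.
    - pose proof (Hn0 n Hn). pose proof (Hn0 m Hm). lra. }
  destruct Hc as [c Hc]. exists c. intros Rad M HR HM.
  assert (HM0 : 0 <= M) by (eapply Rle_trans; [apply Cmod_ge_0 | apply (HM 0%C); rewrite Cmod_0; lra]).
  destruct (exists_nat_large Rad) as [n1 [_ Hn1]].
  assert (Hb : forall n, (n1 <= n)%nat -> forall z, Cmod z <= Rad -> Cmod (peval (l n) z) <= M + / (INR n + 1)).
  { intros n Hn z Hz. apply le_INR in Hn. specialize (Hl n z ltac:(lra)). specialize (HM z Hz).
    pose proof (Cmod_reverse (peval (l n) z) (f z)). rewrite Cmod_minus_sym in H. lra. }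
  split.
  - apply le_epsilon. intros eps He.
    destruct (Hc (eps / 2 / Rad)) as [n2 Hn2]; [apply Rdiv_lt_0_compat; lra | ].
    destruct (Hsmall (eps / 2) ltac:(lra)) as [n3 Hn3].
    set (n := max n1 (max n2 n3)).
    assert (H := coef_bound (l n) Rad _ 1 HR (Hb n ltac:(lia))). rewrite pow_1 in H.
    specialize (Hn2 n ltac:(lia)). specialize (Hn3 n ltac:(lia)).
    assert (Cmod c <= Cmod (nth 1 (l n) (RtoC 0)) + eps / 2 / Rad).
    { pose proof (Cmod_reverse c (nth 1 (l n) (RtoC 0))). rewrite Cmod_minus_sym in H0. lra. }
    apply Rle_trans with ((Cmod (nth 1 (l n) (RtoC 0)) + eps / 2 / Rad) * Rad); [apply Rmult_le_compat_r; lra | ].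
    replace ((Cmod (nth 1 (l n) (RtoC 0)) + eps / 2 / Rad) * Rad) with (Cmod (nth 1 (l n) (RtoC 0)) * Rad + eps / 2) by (field; lra). lra.
  - intros z Hz. apply le_epsilon. intros eps He. assert (Hz0 := Cmod_ge_0 z).
    destruct (Hc (eps / 4 / (Cmod z + 1))) as [n2 Hn2]; [apply Rdiv_lt_0_compat; lra | ].
    destruct (Hsmall (eps / 4)) as [n3 Hn3]; [lra | ].
    set (n := max n1 (max n2 n3)).
    assert (H := poly_taylor (l n) Rad _ z HR (Hb n ltac:(lia)) Hz).
    specialize (Hn2 n ltac:(lia)). specialize (Hn3 n ltac:(lia)).
    assert (Hn1' : INR n1 <= INR n) by (apply le_INR; lia).
    assert (H1 := Hl n z ltac:(lra)).
    assert (H0 := Hl n 0%C ltac:(rewrite Cmod_0; lra)).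
    assert (E0 : peval (l n) 0%C = nth 0 (l n) (RtoC 0)) by (destruct (l n); simpl; ring).
    rewrite E0 in H0.
    set (p := peval (l n) z) in *. set (a := nth 0 (l n) (RtoC 0)) in *. set (b := nth 1 (l n) (RtoC 0)) in *.
    assert (Cmod (f z - f 0 - c * z) <= Cmod (p - a - b * z) + Cmod (f z - p) + Cmod (f 0 - a) + Cmod (b - c) * Cmod z).
    { replace (f z - f 0 - c * z)%C with ((p - a - b * z) + (f z - p) - (f 0 - a) + (b - c) * z)%C by ring.
      rewrite <- Cmod_mult. eapply Rle_trans; [apply Cmod_triangle | ].
      apply Rplus_le_compat_r. eapply Rle_trans; [apply Cmod_triangle_minus | ].
      apply Rplus_le_compat_r. apply Cmod_triangle. }
    assert (Cmod (b - c) * Cmod z <= eps / 4).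
    { apply Rle_trans with (eps / 4 / (Cmod z + 1) * (Cmod z + 1)); [ | right; field; lra].
      apply Rmult_le_compat; auto using Cmod_ge_0; lra. }
    assert (2 * (M + / (INR n + 1)) * Cmod z ^ 2 / Rad ^ 2 <= 2 * M * Cmod z ^ 2 / Rad ^ 2 + eps / 4).
    { replace (2 * (M + / (INR n + 1)) * Cmod z ^ 2 / Rad ^ 2) with
        (2 * M * Cmod z ^ 2 / Rad ^ 2 + / (INR n + 1) * (2 * (Cmod z / Rad) ^ 2)).
      2: { pose proof (pos_INR n). field. lra. }
      apply Rplus_le_compat_l. apply Rle_trans with (eps / 4 * 1); [ | lra].
      apply Rmult_le_compat; [apply Rlt_le, Rinv_0_lt_compat; pose proof (pos_INR n); lra | | lra | ].
      - apply Rmult_le_pos; [lra | apply pow_le, Rdiv_le_0_compat; lra].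
      - assert (0 <= Cmod z / Rad <= / 2).
        { split; [apply Rdiv_le_0_compat; lra | ]. apply Rmult_le_reg_r with Rad; auto.
          replace (Cmod z / Rad * Rad) with (Cmod z) by (field; lra). lra. }
        simpl. nra. }
    lra.
Qed.

(** * A digamma-type sum *)

(* [Dg M u] is a partial sum of [psi (1 - u) + gamma]: the logarithmic derivative of
   [prod_n E (u / n) ^ (n ^ (rho - 1))] is [u ^ (rho - 1)] times it. *)
Definition Dg (M : nat) (u : C) : C := csum (fun i => (/ INR (S i) - / (INR (S i) - u))%C) M.

(** A definite angle to the positive half-axis, in the form that bounds all the denominators [n - u]
    at once. *)
Definition away (c : R) (u : C) : Prop := forall x, 0 <= x -> c * (x + Cmod u) <= Cmod (x - u).

(** The law of cosines gives [|x - u|^2 >= (x - |u|)^2 + 4 c^2 x |u|], which is at least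
    [c^2 (x + |u|)^2] for [c <= 1]. When [c] is the sine of half an angle, [1 - 2 c^2] is the cosine
    of that angle. *)
Lemma away_cone (c : R) (u : C) : 0 < c <= 1 -> Re u <= (1 - 2 * c ^ 2) * Cmod u -> away c u.
Proof.
  intros Hc H x Hx. assert (Hu := Cmod_ge_0 u). assert (Hm := Cmod_ge_0 (x - u)).
  apply Rsqr_incr_0_var; auto. unfold Rsqr. rewrite Cmod_sqr.
  assert (E := Cmod_sqr u).
  replace (Re (x - u)%C) with (x - Re u) by reflexivity.
  replace (Im (x - u)%C) with (- Im u) by (unfold Im; simpl; ring).
  assert (Hxx : x * Re u <= x * ((1 - 2 * c ^ 2) * Cmod u)) by (apply Rmult_le_compat_l; auto).
  assert (Hc2 : c * c <= 1) by (clear - Hc; nra).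
  assert (0 <= (1 - c * c) * ((x - Cmod u) * (x - Cmod u))) by (apply Rmult_le_pos; [lra | apply Rle_0_sqr]).
  nra.
Qed.

Lemma away_nz (c : R) (u : C) (x : R) : 0 < c -> away c u -> 0 <= x -> u <> 0 -> (RtoC x - u)%C <> 0.
Proof.
  intros Hc Ha Hx Hu. apply Cmod_pos_nz. specialize (Ha x Hx). apply Cmod_nz in Hu. nra.
Qed.

Lemma Cmod_inv_le (z : C) (b : R) : 0 < b -> b <= Cmod z -> Cmod (/ z) <= / b.
Proof.
  intros Hb H. rewrite Cmod_inv by (apply Cmod_pos_nz; lra). apply Rinv_le_contravar; lra.
Qed.

(** The sum is minus the derivative of [Dg M], which should behave like [ln (- u)], with derivative
    [/ u]. With [d = n - u] one has [1 / d^2 = 1 / (d (d - 1)) - 1 / (d^2 (d - 1))]: the first part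
    telescopes to [- / u] and an end term of size [/ (c * INR M)], the second is a remainder of
    higher order. *)
Lemma Dg_prime_bound (c : R) (u : C) (M : nat) : 0 < c -> away c u -> u <> 0 -> (0 < M)%nat ->
  Cmod (csum (fun i => (/ ((INR (S i) - u) * (INR (S i) - u)))%C) M + / u) <=
  / (c ^ 3 * Cmod u ^ 2) + / (c * INR M).
Proof.
  intros Hc Ha Hu HM. assert (Hr := Cmod_nz _ Hu). set (r := Cmod u) in *.
  assert (HMp : 0 < INR M) by (apply lt_0_INR; lia).
  set (g := fun i : nat => (/ (INR i - u))%C).
  assert (Hnz : forall i : nat, (RtoC (INR i) - u)%C <> 0) by (intros i; apply (away_nz c); auto; apply pos_INR).
  rewrite csum_ext with (g := fun i => (- (1) * (g (S i) - g i) + - (1) * (/ ((INR (S i) - u) * (INR (S i) - u) * (INR i - u))))%C).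
  2: { intros i _. unfold g. assert (H1 := Hnz i). assert (H2 := Hnz (S i)).
       assert (E : (RtoC (INR (S i)) = INR i + 1)%C) by (now rewrite S_INR, RtoC_plus).
       rewrite E in *. field. auto. }
  rewrite csum_plus, !csum_scal, csum_telescope.
  replace (- (1) * (g M - g 0%nat) + - (1) * csum (fun i => (/ ((INR (S i) - u) * (INR (S i) - u) * (INR i - u)))%C) M + / u)%C
    with (- (csum (fun i => (/ ((INR (S i) - u) * (INR (S i) - u) * (INR i - u)))%C) M) - g M)%C.
  2: { unfold g. simpl INR. replace (0 - u)%C with (- u)%C by ring. field. split; auto. }
  eapply Rle_trans; [apply Cmod_triangle_minus | ]. rewrite Cmod_opp. apply Rplus_le_compat.
  (* Of the three denominators one is bounded below by [c * r] only, so that the other two still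
     telescope. *)
  - apply Rle_trans with (/ (c ^ 3 * r) * (/ r - / (INR M + r))).
    2: { apply Rle_trans with (/ (c ^ 3 * r) * / r).
         - apply Rmult_le_compat_l; [apply Rlt_le, Rinv_0_lt_compat, Rmult_lt_0_compat; [apply pow_lt | ]; auto | ].
           assert (0 < / (INR M + r)) by (apply Rinv_0_lt_compat; lra). lra.
         - right. field. lra. }
    eapply Rle_trans with (rsum (fun i => / (c ^ 3 * r) * (/ (INR i + r) - / (INR (S i) + r))) M).
    + apply Cmod_csum_le. intros i _. pose proof (pos_INR i) as Hi.
      assert (H0 := Ha (INR i) Hi). assert (H1 := Ha (INR (S i)) (pos_INR _)). fold r in H0, H1.
      rewrite S_INR in *.
      apply Rle_trans with (/ (c * (INR i + 1 + r) * (c * r) * (c * (INR i + r)))).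
      * apply Cmod_inv_le.
        -- repeat apply Rmult_lt_0_compat; lra.
        -- rewrite !Cmod_mult. assert (0 < c * r) by nra. assert (0 < c * (INR i + r)) by nra.
           assert (0 < c * (INR i + 1 + r)) by nra.
           assert (c * r <= c * (INR i + 1 + r)) by nra.
           apply Rmult_le_compat; [nra | lra | | lra]. apply Rmult_le_compat; lra.
      * right. field. repeat split; lra.
    + rewrite rsum_scal. apply Rmult_le_compat_l; [apply Rlt_le, Rinv_0_lt_compat, Rmult_lt_0_compat; [apply pow_lt | ]; auto | ].
      right. clear. induction M; cbn [rsum].
      * simpl. rewrite Rplus_0_l. ring.
      * rewrite IHM. ring.
  - unfold g. assert (H0 := Ha (INR M) (pos_INR _)). fold r in H0.
    apply Cmod_inv_le; [apply Rmult_lt_0_compat; auto | nra].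
Qed.

Lemma cderiv_Dg (M : nat) (x : R -> C) (t : R) (v : C) :
  (forall i, (i < M)%nat -> (INR (S i) - x t)%C <> 0) -> cderiv x t v ->
  cderiv (fun s => Dg M (x s)) t (- v * csum (fun i => (/ ((INR (S i) - x t) * (INR (S i) - x t)))%C) M).
Proof.
  intros Hnz Hx. unfold Dg. rewrite <- csum_scal.
  apply (cderiv_csum (fun i s => (/ INR (S i) - / (INR (S i) - x s))%C)). intros i Hi.
  apply cderiv_ext with (fun s => (/ INR (S i) + - (1) * / (INR (S i) + - (1) * x s))%C).
  { intros s. replace (INR (S i) + - (1) * x s)%C with (INR (S i) - x s)%C by ring. ring. }
  assert (E : (INR (S i) + - (1) * x t)%C = (INR (S i) - x t)%C) by ring.
  eapply cderiv_val; [ | apply cderiv_plus; [apply cderiv_const | apply cderiv_scal; apply cderiv_inv; [ | apply cderiv_plus; [apply cderiv_const | apply cderiv_scal; exact Hx]]]].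
  - cbv beta. rewrite E. field. now apply Hnz.
  - cbv beta. rewrite E. now apply Hnz.
Qed.

Lemma cos_le_between (a b : R) : 0 < a < 2 * PI -> Rmin a PI <= b <= Rmax a PI -> cos b <= cos a.
Proof.
  intros Ha Hb. destruct (Rle_lt_dec a PI) as [H | H].
  - rewrite Rmin_left, Rmax_right in Hb by lra. apply cos_decr_1; lra.
  - rewrite Rmin_right, Rmax_left in Hb by lra. apply cos_incr_1; lra.
Qed.

Lemma away_polar (c x b : R) : 0 < c <= 1 -> 0 < x -> cos b <= 1 - 2 * c ^ 2 -> away c (RtoC x * cis b).
Proof.
  intros Hc Hx Hb. apply away_cone; auto. rewrite Re_RtoC_mult, Cmod_mult, Cmod_cis, Cmod_RtoC_pos by lra.
  unfold cis, Re. simpl fst. nra.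
Qed.

(** Turn at constant modulus from direction [a] to the negative axis, where [ln (- u)] is real.
    Along the arc, [Dg M u] minus [Ci] times the angle has a derivative of modulus [x] times the
    error in [Dg_prime_bound], and the distance to the positive axis does not deteriorate on the
    way. The range of [a] fixes the branch. *)
Lemma Dg_arc (c x a : R) (M : nat) : 0 < c <= 1 -> 0 < x -> 0 < a < 2 * PI -> (0 < M)%nat ->
  cos a <= 1 - 2 * c ^ 2 ->
  Cmod (Dg M (RtoC x * cis a) - Dg M (RtoC (- x)) - Ci * RtoC (a - PI))
  <= PI * x * (/ (c ^ 3 * x ^ 2) + / (c * INR M)).
Proof.
  intros Hc Hx Ha HM Hcos. assert (HPI := PI_RGT_0).
  assert (HMp : 0 < INR M) by (apply lt_0_INR; lia).
  set (B := x * (/ (c ^ 3 * x ^ 2) + / (c * INR M))).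
  assert (HB : 0 <= B).
  { unfold B. apply Rmult_le_pos; [lra | ]. apply Rplus_le_le_0_compat; apply Rlt_le, Rinv_0_lt_compat.
    - apply Rmult_lt_0_compat; apply pow_lt; lra.
    - apply Rmult_lt_0_compat; lra. }
  set (y := fun b => (Dg M (RtoC x * cis b) + - Ci * RtoC b)%C).
  assert (Hxz : forall b, (RtoC x * cis b)%C <> 0).
  { intros b. apply Cmod_pos_nz. rewrite Cmod_mult, Cmod_cis, Cmod_RtoC_pos; lra. }
  assert (Hd : forall b, Rmin a PI <= b <= Rmax a PI -> exists v, cderiv y b v /\ Cmod v <= B).
  { intros b Hb. assert (Hcb := cos_le_between a b Ha Hb).
    assert (Haw : away c (RtoC x * cis b)) by (apply away_polar; auto; lra).
    eexists. split.
    - apply cderiv_plus.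
      + apply (cderiv_Dg M (fun s => (RtoC x * cis s)%C)).
        * intros i _. apply (away_nz c); auto; [lra | apply pos_INR].
        * apply cderiv_scal, cderiv_cis.
      + apply cderiv_scal. apply cderiv_ext with (fun s => (RtoC s * 1)%C); [intros; ring | apply cderiv_line].
    - cbv beta. set (S0 := csum _ M).
      replace (- (RtoC x * (Ci * cis b)) * S0 + - Ci * 1)%C with (- (Ci * (RtoC x * cis b)) * (S0 + / (RtoC x * cis b)))%C.
      2: { field. split; [apply cis_nz | apply RtoC_nz; lra]. }
      rewrite Cmod_mult, Cmod_opp, !Cmod_mult, Cmod_Ci, Cmod_cis, Cmod_RtoC_pos by lra.
      unfold B. rewrite Rmult_1_l, Rmult_1_r. apply Rmult_le_compat_l; [lra | ].
      assert (H := Dg_prime_bound c (RtoC x * cis b) M ltac:(lra) Haw (Hxz b) HM).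
      rewrite Cmod_mult, Cmod_cis, Cmod_RtoC_pos, Rmult_1_r in H by lra. exact H. }
  assert (Hd' : exists v, forall b, Rmin a PI <= b <= Rmax a PI -> cderiv y b (v b) /\ Cmod (v b) <= B).
  { destruct (functional_choice (fun b v => Rmin a PI <= b <= Rmax a PI -> cderiv y b v /\ Cmod v <= B)) as [v Hv].
    - intros b. destruct (Rle_dec (Rmin a PI) b); [destruct (Rle_dec b (Rmax a PI)) | ].
      + destruct (Hd b ltac:(lra)) as [v Hv]. exists v; auto.
      + exists 0%C. intros; lra.
      + exists 0%C. intros; lra.
    - exists v. exact Hv. }
  destruct Hd' as [v Hv].
  replace (Dg M (RtoC x * cis a) - Dg M (RtoC (- x)) - Ci * RtoC (a - PI))%C with (y a - y PI)%C.
  2: { unfold y. rewrite cis_PI. replace (RtoC x * RtoC (-1))%C with (RtoC (- x)).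
       2: { rewrite <- RtoC_mult. apply RtoC_inj_eq. ring. }
       rewrite RtoC_minus. ring. }
  replace (PI * x * (/ (c ^ 3 * x ^ 2) + / (c * INR M))) with (B * PI) by (unfold B; ring).
  destruct (Rle_lt_dec a PI) as [H | H].
  - rewrite Rmin_left, Rmax_right in Hv by lra. rewrite Cmod_minus_sym.
    eapply Rle_trans; [apply (MVT_C y v a PI B); [lra | apply Hv | apply Hv] | ].
    apply Rmult_le_compat_l; lra.
  - rewrite Rmin_right, Rmax_left in Hv by lra.
    eapply Rle_trans; [apply (MVT_C y v PI a B); [lra | apply Hv | apply Hv] | ].
    apply Rmult_le_compat_l; lra.
Qed.

Lemma away_neg (x : R) : 0 <= x -> away 1 (RtoC (- x)).
Proof.
  intros Hx y Hy. rewrite <- RtoC_minus, !Cmod_R, Rabs_Ropp, !Rabs_right by lra. lra.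
Qed.

Lemma Dg_neg (x y : R) (M : nat) : 0 < x -> x <= y -> (0 < M)%nat ->
  Cmod (Dg M (RtoC (- y)) - Dg M (RtoC (- x)) - RtoC (ln (y / x))) <= (/ x ^ 2 + / INR M) * (y - x).
Proof.
  intros Hx Hxy HM. assert (HMp : 0 < INR M) by (apply lt_0_INR; lia).
  set (g := fun t => (Dg M (RtoC (- t)) + - (1) * RtoC (ln t))%C).
  replace (Dg M (RtoC (- y)) - Dg M (RtoC (- x)) - RtoC (ln (y / x)))%C with (g y - g x)%C.
  2: { unfold g. rewrite ln_div, RtoC_minus by lra. ring. }
  apply (MVT_C g (fun t => (csum (fun i => (/ ((INR (S i) - RtoC (- t)) * (INR (S i) - RtoC (- t))))%C) M + / RtoC (- t))%C)); auto.
  - intros t Ht. eapply cderiv_val; [ | apply cderiv_plus].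
    2: { apply (cderiv_Dg M (fun s => RtoC (- s))) with (v := (- (1))%C).
         - intros i _. apply (away_nz 1); [lra | apply away_neg; lra | apply pos_INR | apply RtoC_nz; lra].
         - apply cderiv_ext with (fun s => (RtoC s * - (1))%C); [intros; rewrite RtoC_opp; ring | apply cderiv_line]. }
    2: { apply cderiv_scal. instantiate (1 := (/ RtoC t)%C). split.
         - eapply is_derive_val; [ | apply is_derive_ln; lra]. rewrite <- RtoC_inv by lra. reflexivity.
         - eapply is_derive_val; [ | exact (is_derive_const 0 t)]. rewrite <- RtoC_inv by lra. reflexivity. }
    cbv beta. rewrite (RtoC_opp t). assert (Ht' : RtoC t <> 0) by (apply RtoC_nz; lra).
    replace (/ - RtoC t)%C with (- (1) * / RtoC t)%C by (field; auto). ring.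
  - intros t Ht. assert (Htz : RtoC (- t) <> 0) by (apply RtoC_nz; lra).
    eapply Rle_trans; [apply (Dg_prime_bound 1); auto; [lra | apply away_neg; lra] | ].
    rewrite Cmod_R, Rabs_Ropp, Rabs_right by lra. rewrite pow1, !Rmult_1_l.
    apply Rplus_le_compat_r. apply Rinv_le_contravar; [apply pow_lt; lra | apply pow_incr; lra].
Qed.

(** The polar form of [ln (- u)] for [u] of modulus [tau * x] and argument [a]. Measuring against
    the value at [- x] removes the growing [ln x], common to all rays. In the error, [x / INR M]
    comes from the truncation. The constant [m] is there because the segment between [x] and
    [tau * x] begins at [m * x]. *)
Lemma Dg_asym (tau c : R) : 0 < tau -> 0 < c <= 1 -> exists K, 0 < K /\ forall x a M,
  0 < x -> 0 < a < 2 * PI -> (0 < M)%nat -> cos a <= 1 - 2 * c ^ 2 ->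
  Cmod (Dg M (RtoC (tau * x) * cis a) - Dg M (RtoC (- x)) - (RtoC (ln tau) + Ci * RtoC (a - PI)))
  <= K * (/ x + x / INR M).
Proof.
  intros Ht Hc. assert (HPI := PI_RGT_0).
  set (m := Rmin 1 tau). assert (Hm : 0 < m) by (apply Rmin_glb_lt; lra).
  assert (Hm1 : m <= 1) by apply Rmin_l. assert (Hm2 : m <= tau) by apply Rmin_r.
  set (K1 := PI * tau * (/ (c ^ 3 * tau ^ 2) + / c)). set (K2 := (1 + tau) * (/ m ^ 2 + 1)).
  assert (HK1 : 0 < K1).
  { unfold K1. apply Rmult_lt_0_compat; [nra | ]. apply Rplus_lt_0_compat; apply Rinv_0_lt_compat; [ | lra].
    apply Rmult_lt_0_compat; apply pow_lt; lra. }
  assert (HK2 : 0 < K2).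
  { unfold K2. apply Rmult_lt_0_compat; [lra | ]. assert (0 < / m ^ 2) by (apply Rinv_0_lt_compat, pow_lt; auto). lra. }
  exists (K1 + K2). split; [lra | ]. intros x a M Hx Ha HM Hcos.
  assert (HMp : 0 < INR M) by (apply lt_0_INR; lia).
  assert (Htx : 0 < tau * x) by nra.
  assert (H1 := Dg_arc c (tau * x) a M Hc Htx Ha HM Hcos).
  assert (Hix : 0 < / x) by (apply Rinv_0_lt_compat; auto).
  assert (HxM : 0 < x / INR M) by (apply Rdiv_lt_0_compat; auto).
  assert (H1' : PI * (tau * x) * (/ (c ^ 3 * (tau * x) ^ 2) + / (c * INR M)) <= K1 * (/ x + x / INR M)).
  { unfold K1. set (A := / (c ^ 3 * tau ^ 2)). set (B := / c).
    assert (0 < A) by (apply Rinv_0_lt_compat, Rmult_lt_0_compat; apply pow_lt; lra).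
    assert (0 < B) by (apply Rinv_0_lt_compat; lra).
    replace (PI * (tau * x) * (/ (c ^ 3 * (tau * x) ^ 2) + / (c * INR M))) with (PI * tau * (A * / x + B * (x / INR M))).
    2: { unfold A, B. field. repeat split; lra. }
    rewrite (Rmult_assoc (PI * tau) (A + B)). apply Rmult_le_compat_l; [nra | ]. nra. }
  assert (H2 : Cmod (Dg M (RtoC (- (tau * x))) - Dg M (RtoC (- x)) - RtoC (ln tau)) <= K2 * (/ x + x / INR M)).
  { assert (HH : forall p q, 0 < p -> p <= q -> p = m * x -> q - p <= (1 + tau) * x ->
       (/ p ^ 2 + / INR M) * (q - p) <= K2 * (/ x + x / INR M)).
    { intros p q Hp Hpq Ep Hq. apply Rle_trans with ((/ p ^ 2 + / INR M) * ((1 + tau) * x)).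
      - apply Rmult_le_compat_l; auto. assert (0 < / p ^ 2) by (apply Rinv_0_lt_compat, pow_lt; auto).
        assert (0 < / INR M) by (apply Rinv_0_lt_compat; auto). lra.
      - rewrite Ep. unfold K2. set (A := / m ^ 2). assert (0 < A) by (apply Rinv_0_lt_compat, pow_lt; auto).
        replace ((/ (m * x) ^ 2 + / INR M) * ((1 + tau) * x)) with ((1 + tau) * (A * / x + x / INR M)).
        2: { unfold A. field. repeat split; lra. }
        rewrite (Rmult_assoc (1 + tau) (A + 1)). apply Rmult_le_compat_l; [lra | ]. nra. }
    destruct (Rle_lt_dec tau 1) as [Hle | Hle].
    - assert (Em : m = tau) by (unfold m; apply Rmin_right; lra).
      assert (H := Dg_neg (tau * x) x M Htx ltac:(nra) HM).
      replace (x / (tau * x)) with (/ tau) in H by (field; lra). rewrite ln_Rinv in H by auto.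
      rewrite <- Cmod_opp.
      replace (- (Dg M (RtoC (- (tau * x))) - Dg M (RtoC (- x)) - RtoC (ln tau)))%C with
        (Dg M (RtoC (- x)) - Dg M (RtoC (- (tau * x))) - RtoC (- ln tau))%C by (rewrite (RtoC_opp (ln tau)); ring).
      eapply Rle_trans; [exact H | ]. apply HH; auto; [nra | rewrite Em; auto | nra].
    - assert (Em : m = 1) by (unfold m; apply Rmin_left; lra).
      assert (H := Dg_neg x (tau * x) M Hx ltac:(nra) HM).
      replace (tau * x / x) with tau in H by (field; lra).
      eapply Rle_trans; [exact H | ]. apply HH; auto; [nra | rewrite Em; ring | nra]. }
  replace (Dg M (RtoC (tau * x) * cis a) - Dg M (RtoC (- x)) - (RtoC (ln tau) + Ci * RtoC (a - PI)))%C with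
    ((Dg M (RtoC (tau * x) * cis a) - Dg M (RtoC (- (tau * x))) - Ci * RtoC (a - PI)) +
     (Dg M (RtoC (- (tau * x))) - Dg M (RtoC (- x)) - RtoC (ln tau)))%C by ring.
  eapply Rle_trans; [apply Cmod_triangle | ]. lra.
Qed.

(** * Canonical products with zeros on rays *)

Definition Eexp (rho : nat) (u : C) : C := csum (fun l => (u ^ S l / INR (S l))%C) rho.

(** The Weierstrass primary factor of genus [rho]: the exponent is the truncated Taylor series of
    [- ln (1 - u)]. *)
Definition Efac (rho : nat) (u : C) : C := ((1 - u) * Cexp (Eexp rho u))%C.

Definition eterm (rho n : nat) (u : C) : R :=
  INR n ^ (rho - 1) * (ln (Cmod (1 - u / INR n)) + Re (Eexp rho (u / INR n))).

Fixpoint cprod (f : nat -> C) (n : nat) : C :=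
  match n with O => RtoC 1 | S m => (cprod f m * f m)%C end.

(* The zeros of [Wprod] are the points [n / s j], with multiplicity [n ^ (rho - 1)]. *)
Fixpoint Wprod (rho N : nat) (s : nat -> C) (c : C) (M : nat) (z : C) : C :=
  match M with
  | O => Cexp (c * z ^ rho)
  | S i => (Wprod rho N s c i z * cprod (fun j => (Efac rho (s j * z / INR (S i)) ^ (S i ^ (rho - 1)))%C) N)%C
  end.

Definition LG (rho M : nat) (u : C) : R := rsum (fun i => eterm rho (S i) u) M.

Definition LW (rho N : nat) (s : nat -> C) (c : C) (M : nat) (z : C) : R :=
  Re (c * z ^ rho)%C + rsum (fun j => LG rho M (s j * z)%C) N.

Definition SW (rho N : nat) (s : nat -> C) (M : nat) (z : C) : C :=
  csum (fun j => (s j ^ rho * Dg M (s j * z))%C) N.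

Lemma INR_S_nz (i : nat) : RtoC (INR (S i)) <> 0.
Proof. apply RtoC_nz. apply not_0_INR. lia. Qed.

Lemma csum_geom (y : C) (n : nat) : ((1 - y) * csum (fun l => (y ^ l)%C) n)%C = (1 - y ^ n)%C.
Proof.
  induction n; simpl csum; [simpl; ring | ].
  replace ((1 - y) * (csum (fun l => (y ^ l)%C) n + y ^ n))%C with ((1 - y) * csum (fun l => (y ^ l)%C) n + (1 - y) * y ^ n)%C by ring.
  rewrite IHn, Cpow_S. ring.
Qed.

Lemma cderiv_Eexp (rho : nat) (y : R -> C) (t : R) (w : C) : cderiv y t w ->
  cderiv (fun s => Eexp rho (y s)) t (w * csum (fun l => (y t ^ l)%C) rho).
Proof.
  intros Hy. unfold Eexp. rewrite <- csum_scal.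
  apply (cderiv_csum (fun l s => (y s ^ S l / INR (S l))%C)). intros l _.
  apply cderiv_ext with (fun s => (/ INR (S l) * y s ^ S l)%C); [intros; unfold Cdiv; ring | ].
  eapply cderiv_val; [ | apply cderiv_scal, cderiv_pow, Hy].
  cbv beta. replace (S l - 1)%nat with l by lia. field. apply INR_S_nz.
Qed.

Lemma Cdiv_one_minus (u : C) (n : nat) : (1 - u / INR (S n))%C = ((INR (S n) - u) / INR (S n))%C.
Proof. field. apply INR_S_nz. Qed.

Lemma one_minus_nz (u : C) (n : nat) : (INR (S n) - u)%C <> 0 -> (1 - u / INR (S n))%C <> 0.
Proof.
  intros H. rewrite Cdiv_one_minus. intro E. apply H.
  replace (INR (S n) - u)%C with ((INR (S n) - u) / INR (S n) * INR (S n))%C by (field; apply INR_S_nz).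
  rewrite E. ring.
Qed.

Lemma eterm_log_derive (n : nat) (x : R -> C) (t : R) (v : C) :
  (INR (S n) - x t)%C <> 0 -> cderiv x t v ->
  is_derive (fun s => ln (Cmod (1 - x s / INR (S n)))) t (Re (- v / (INR (S n) - x t))%C).
Proof.
  intros Hnz Hx. assert (Hn := INR_S_nz n).
  eapply is_derive_val; [ | apply (is_derive_ln_Cmod (fun s => (1 - x s / INR (S n))%C) t (- / INR (S n) * v)%C)].
  - f_equal. field. repeat split; auto.
  - now apply one_minus_nz.
  - apply cderiv_ext with (fun s => (1 + - / INR (S n) * x s)%C); [intros; unfold Cdiv; ring | ].
    eapply cderiv_val; [ | apply cderiv_plus; [apply cderiv_const | apply cderiv_scal; exact Hx]]. ring.
Qed.

Lemma eterm_poly_derive (rho n : nat) (x : R -> C) (t : R) (v : C) : cderiv x t v ->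
  is_derive (fun s => Re (Eexp rho (x s / INR (S n))%C)) t (Re (v / INR (S n) * csum (fun l => ((x t / INR (S n)) ^ l)%C) rho)%C).
Proof.
  intros Hx.
  assert (H : cderiv (fun s => (x s / INR (S n))%C) t (v / INR (S n))).
  { apply cderiv_ext with (fun s => (/ INR (S n) * x s)%C); [intros; unfold Cdiv; ring | ].
    eapply cderiv_val; [ | apply cderiv_scal; exact Hx]. unfold Cdiv; ring. }
  apply (cderiv_Eexp rho) in H. destruct H as [H _]. exact H.
Qed.

Lemma pow_shift (rho n : nat) (y : C) : (0 < rho)%nat ->
  (RtoC (INR (S n) ^ (rho - 1)) * (y / INR (S n)) ^ rho)%C = (y ^ rho / INR (S n))%C.
Proof.
  intros Hr. assert (Hn := INR_S_nz n). destruct rho as [ | r]; [lia | ]. replace (S r - 1)%nat with r by lia.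
  unfold Cdiv. rewrite Cpow_mult_l, Cpow_inv, RtoC_pow by auto. rewrite !Cpow_S.
  field. split; [auto | now apply Cpow_nz].
Qed.

(** The geometric sum leaves [- v / (n - x) * (x / n)^rho], and the multiplicity [n^(rho - 1)] turns
    [(x / n)^rho] into [x^rho / n]. What remains is [x^(rho - 1)] times one term of [Dg]; the
    multiplicities of the zeros are chosen for this. *)
Lemma eterm_derive (rho n : nat) (x : R -> C) (t : R) (v : C) : (0 < rho)%nat ->
  (INR (S n) - x t)%C <> 0 -> cderiv x t v ->
  is_derive (fun s => eterm rho (S n) (x s)) t
    (Re (v * x t ^ (rho - 1) * (/ INR (S n) - / (INR (S n) - x t)))%C).
Proof.
  intros Hr Hnz Hx. assert (Hn := INR_S_nz n). unfold eterm.
  eapply is_derive_val.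
  2: { apply (is_derive_scal (fun s => ln (Cmod (1 - x s / INR (S n))) + Re (Eexp rho (x s / INR (S n))%C)) t (INR (S n) ^ (rho - 1))).
       apply is_derive_Rplus; [eapply eterm_log_derive; eassumption | eapply eterm_poly_derive; eassumption]. }
  rewrite <- Re_plus. change mult with Rmult. rewrite <- Re_RtoC_mult. f_equal.
  set (y := (x t / INR (S n))%C).
  assert (Hy : (1 - y)%C <> 0) by (now apply one_minus_nz).
  replace (csum (fun l => (y ^ l)%C) rho) with ((1 - y ^ rho) / (1 - y))%C.
  2: { rewrite <- csum_geom. field. auto. }
  replace (1 - y)%C with ((INR (S n) - x t) / INR (S n))%C by (unfold y; now rewrite Cdiv_one_minus).
  replace (RtoC (INR (S n) ^ (rho - 1)) * (- v / (INR (S n) - x t) + v / INR (S n) * ((1 - y ^ rho) / ((INR (S n) - x t) / INR (S n)))))%C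
    with (- v / (INR (S n) - x t) * (RtoC (INR (S n) ^ (rho - 1)) * y ^ rho))%C.
  2: { field. auto. }
  unfold y. rewrite pow_shift by auto.
  destruct rho as [ | r]; [lia | ]. replace (S r - 1)%nat with r by lia. rewrite Cpow_S. field. auto.
Qed.

Lemma LG_derive (rho M : nat) (x : R -> C) (t : R) (v : C) : (0 < rho)%nat ->
  (forall i, (i < M)%nat -> (INR (S i) - x t)%C <> 0) -> cderiv x t v ->
  is_derive (fun s => LG rho M (x s)) t (Re (v * x t ^ (rho - 1) * Dg M (x t))%C).
Proof.
  intros Hr Hnz Hx. unfold LG, Dg. rewrite <- csum_scal, Re_csum.
  apply (is_derive_rsum (fun i s => eterm rho (S i) (x s))). intros i Hi.
  apply eterm_derive; auto.
Qed.

Lemma LW_derive (rho N : nat) (s : nat -> C) (c : C) (M : nat) (x : R -> C) (t : R) (v : C) : (0 < rho)%nat ->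
  (forall j i, (j < N)%nat -> (i < M)%nat -> (INR (S i) - s j * x t)%C <> 0) -> cderiv x t v ->
  is_derive (fun y => LW rho N s c M (x y)) t (Re (v * x t ^ (rho - 1) * (INR rho * c + SW rho N s M (x t)))%C).
Proof.
  intros Hr Hnz Hx. unfold LW.
  eapply is_derive_val.
  2: { apply is_derive_Rplus.
       - destruct (cderiv_scal c _ t _ (cderiv_pow x t v rho Hx)) as [H _]. exact H.
       - apply (is_derive_rsum (fun j y => LG rho M (s j * x y)%C)). intros j Hj.
         apply (LG_derive rho M (fun y => (s j * x y)%C)); auto. apply cderiv_scal. exact Hx. }
  rewrite <- Re_csum, <- Re_plus. f_equal.
  rewrite (csum_ext _ (fun j => (v * x t ^ (rho - 1) * (s j ^ rho * Dg M (s j * x t)))%C)).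
  2: { intros j _. destruct rho as [ | r]; [lia | ]. replace (S r - 1)%nat with r by lia.
       rewrite Cpow_mult_l, Cpow_S. ring. }
  rewrite csum_scal. unfold SW. ring.
Qed.

Lemma LW_0 (rho N : nat) (s : nat -> C) (c : C) (M : nat) : (0 < rho)%nat -> LW rho N s c M 0 = 0.
Proof.
  intros Hr. unfold LW. rewrite Cpow_0_l by auto. replace (c * 0)%C with (RtoC 0) by ring.
  replace (Re 0) with 0 by reflexivity. rewrite Rplus_0_l.
  rewrite (rsum_ext _ (fun _ => 0)); [rewrite rsum_const; ring | ]. intros j _.
  unfold LG. rewrite (rsum_ext _ (fun _ => 0)); [rewrite rsum_const; ring | ]. intros i _.
  unfold eterm. replace (s j * 0 / INR (S i))%C with (RtoC 0) by (unfold Cdiv; ring).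
  replace (1 - 0)%C with (RtoC 1) by ring. rewrite Cmod_1, ln_1.
  unfold Eexp. rewrite csum_zero; [unfold Re; simpl; ring | ]. intros l _.
  rewrite Cpow_0_l by lia. unfold Cdiv; ring.
Qed.

Lemma Cmod_Efac_pow (rho n : nat) (u : C) : (INR (S n) - u)%C <> 0 ->
  Cmod (Efac rho (u / INR (S n)) ^ (S n ^ (rho - 1)))%C = exp (eterm rho (S n) u).
Proof.
  intros Hnz. apply one_minus_nz in Hnz. apply Cmod_nz in Hnz.
  rewrite Cmod_pow. unfold Efac. rewrite Cmod_mult, Cmod_Cexp.
  unfold eterm. rewrite <- (exp_ln (Cmod (1 - u / INR (S n)))) at 1 by auto. rewrite <- exp_plus.
  rewrite <- pow_INR. generalize (S n ^ (rho - 1))%nat as m.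
  generalize (ln (Cmod (1 - u / INR (S n))) + Re (Eexp rho (u / INR (S n))%C)) as b.
  intros b m. induction m; [simpl; now rewrite Rmult_0_l, exp_0 | ].
  simpl pow. rewrite IHm, <- exp_plus, S_INR. f_equal. ring.
Qed.

Lemma LW_S (rho N : nat) (s : nat -> C) (c : C) (M : nat) (z : C) :
  LW rho N s c (S M) z = LW rho N s c M z + rsum (fun j => eterm rho (S M) (s j * z)%C) N.
Proof. unfold LW, LG. cbn [rsum]. rewrite rsum_plus. ring. Qed.

Lemma Cmod_cprod_exp (f : nat -> C) (g : nat -> R) (n : nat) :
  (forall i, (i < n)%nat -> Cmod (f i) = exp (g i)) -> Cmod (cprod f n) = exp (rsum g n).
Proof.
  induction n; intros H; simpl; [now rewrite Cmod_1, exp_0 | ].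
  rewrite Cmod_mult, exp_plus, IHn, H; auto.
Qed.

Lemma Cmod_Wprod (rho N : nat) (s : nat -> C) (c : C) (M : nat) (z : C) :
  (forall j i, (j < N)%nat -> (i < M)%nat -> (INR (S i) - s j * z)%C <> 0) ->
  Cmod (Wprod rho N s c M z) = exp (LW rho N s c M z).
Proof.
  induction M; intros H.
  - unfold Wprod, LW, LG. rewrite Cmod_Cexp. f_equal. cbn [rsum]. rewrite rsum_const. ring.
  - rewrite LW_S, exp_plus. cbn [Wprod]. rewrite Cmod_mult, IHM by auto. f_equal.
    apply Cmod_cprod_exp. intros j Hj. apply Cmod_Efac_pow. auto.
Qed.

Lemma cprod_zero (f : nat -> C) (n i : nat) : (i < n)%nat -> f i = 0 -> cprod f n = 0.
Proof.
  induction n; intros Hi E; [lia | ]. simpl. destruct (Nat.eq_dec i n) as [-> | Hne].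
  - rewrite E. ring.
  - rewrite IHn by (auto; lia). ring.
Qed.

Lemma Wprod_zero (rho N : nat) (s : nat -> C) (c : C) (M : nat) (z : C) (i j : nat) :
  (i < M)%nat -> (j < N)%nat -> (INR (S i) - s j * z)%C = 0 -> Wprod rho N s c M z = 0.
Proof.
  induction M; intros Hi Hj E; [lia | ]. cbn [Wprod]. destruct (Nat.eq_dec i M) as [-> | Hne].
  - rewrite (cprod_zero _ N j); auto; [ring | ].
    unfold Efac. rewrite Cdiv_one_minus, E.
    replace (0 / INR (S M) * Cexp (Eexp rho (s j * z / INR (S M))))%C with (RtoC 0) by (unfold Cdiv; ring).
    apply Cpow_0_l. apply Nat.neq_0_lt_0, Nat.pow_nonzero. lia.
  - rewrite IHM by (auto; lia). ring.
Qed.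

(** * Convergence of the canonical products *)

Lemma Efac_0 (rho : nat) : Efac rho 0 = 1.
Proof.
  unfold Efac, Eexp. rewrite csum_zero; [rewrite Cexp_0; ring | ].
  intros l _. rewrite Cpow_0_l by lia. unfold Cdiv; ring.
Qed.

Lemma cprod_one (f : nat -> C) (n : nat) : (forall i, (i < n)%nat -> f i = 1) -> cprod f n = 1.
Proof. induction n; intros H; simpl; auto. rewrite IHn, H by auto. ring. Qed.

Lemma Wprod_0 (rho N : nat) (s : nat -> C) (c : C) (M : nat) : (0 < rho)%nat -> Wprod rho N s c M 0 = 1.
Proof.
  intros Hr. induction M; cbn [Wprod].
  - rewrite Cpow_0_l by auto. replace (c * 0)%C with (RtoC 0) by ring. apply Cexp_0.
  - rewrite IHM, cprod_one; [ring | ]. intros j _.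
    replace (s j * 0 / INR (S M))%C with (RtoC 0) by (unfold Cdiv; ring).
    now rewrite Efac_0, Cpow_1_l.
Qed.

(** Along the segment from the origin the derivative of the primary factor collapses to
    [- exp(...) * u * w^rho], since the geometric sum cancels all lower powers of [w]. *)
Lemma Efac_bound (rho : nat) (u : C) : Cmod u <= 1 -> Cmod (Efac rho u - 1) <= exp (INR rho) * Cmod u ^ S rho.
Proof.
  intros Hu. assert (Hu0 := Cmod_ge_0 u).
  set (y := fun t => Efac rho (RtoC t * u)).
  replace (Efac rho u - 1)%C with (y 1 - y 0)%C.
  2: { unfold y. replace (RtoC 0 * u)%C with (RtoC 0) by ring. rewrite Efac_0.
       replace (RtoC 1 * u)%C with u by ring. reflexivity. }
  replace (exp (INR rho) * Cmod u ^ S rho) with (exp (INR rho) * Cmod u ^ S rho * (1 - 0)) by ring.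
  apply (MVT_C y (fun t => (- (Cexp (Eexp rho (RtoC t * u)) * u * (RtoC t * u) ^ rho))%C)); [lra | | ].
  - intros t _. unfold y, Efac. eapply cderiv_val; [ | apply cderiv_mult].
    2: { apply cderiv_ext with (fun s => (1 + RtoC s * - u)%C); [intros; ring | apply cderiv_affine]. }
    2: { apply cderiv_Cexp, cderiv_Eexp, cderiv_line. }
    cbv beta. set (w := (RtoC t * u)%C).
    replace (- u * Cexp (Eexp rho w) + (1 - w) * (Cexp (Eexp rho w) * (u * csum (fun l => (w ^ l)%C) rho)))%C
      with (Cexp (Eexp rho w) * u * (- (1) + (1 - w) * csum (fun l => (w ^ l)%C) rho))%C by ring.
    rewrite csum_geom. ring.
  - intros t Ht. rewrite Cmod_opp, !Cmod_mult, Cmod_pow, Cmod_Cexp.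
    assert (Hw : Cmod (RtoC t * u) <= Cmod u).
    { rewrite Cmod_mult, Cmod_RtoC_pos by lra. nra. }
    simpl pow. rewrite Rmult_assoc. apply Rmult_le_compat.
    + apply Rlt_le, exp_pos.
    + apply Rmult_le_pos; [auto | apply pow_le, Cmod_ge_0].
    + apply exp_le. eapply Rle_trans; [apply Re_le_Cmod | ]. unfold Eexp.
      replace (INR rho) with (INR rho * 1) by ring. rewrite <- rsum_const.
      apply Cmod_csum_le. intros l _. rewrite Cmod_div by apply INR_S_nz.
      rewrite Cmod_pow, Cmod_RtoC_pos by apply pos_INR.
      assert (Hl : 1 <= INR (S l)) by (rewrite S_INR; pose proof (pos_INR l); lra).
      apply Rmult_le_reg_r with (INR (S l)); [lra | ].
      replace (Cmod (RtoC t * u) ^ S l / INR (S l) * INR (S l)) with (Cmod (RtoC t * u) ^ S l) by (field; lra).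
      apply Rle_trans with 1; [ | lra]. apply pow_le_1. split; [apply Cmod_ge_0 | lra].
    + apply Rmult_le_compat_l; auto. apply pow_incr. split; [apply Cmod_ge_0 | auto].
Qed.

Lemma Cpow_near_1 (x : C) (d : R) (m : nat) : Cmod (x - 1) <= d -> Cmod (x ^ m - 1) <= (1 + d) ^ m - 1.
Proof.
  intros H. assert (Hd : 0 <= d) by (eapply Rle_trans; [apply Cmod_ge_0 | exact H]).
  induction m; [simpl; replace (1 - 1)%C with (RtoC 0) by ring; rewrite Cmod_0; lra | ].
  rewrite Cpow_S. replace (x * x ^ m - 1)%C with ((x - 1) * x ^ m + (x ^ m - 1))%C by ring.
  eapply Rle_trans; [apply Cmod_triangle | ]. rewrite Cmod_mult.
  assert (Cmod (x ^ m) <= (1 + d) ^ m).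
  { pose proof (Cmod_reverse (x ^ m) 1). rewrite Cmod_1 in H0. lra. }
  assert (Cmod (x - 1) * Cmod (x ^ m) <= d * (1 + d) ^ m) by (apply Rmult_le_compat; auto using Cmod_ge_0).
  simpl. lra.
Qed.

Lemma cprod_near_1 (f : nat -> C) (d : R) (n : nat) : (forall i, (i < n)%nat -> Cmod (f i - 1) <= d) -> 0 <= d ->
  Cmod (cprod f n - 1) <= (1 + d) ^ n - 1.
Proof.
  intros H Hd. induction n; cbn [cprod]; [simpl; replace (1 - 1)%C with (RtoC 0) by ring; rewrite Cmod_0; lra | ].
  replace (cprod f n * f n - 1)%C with ((f n - 1) * cprod f n + (cprod f n - 1))%C by ring.
  eapply Rle_trans; [apply Cmod_triangle | ]. rewrite Cmod_mult.
  specialize (IHn (fun i Hi => H i (Nat.lt_lt_succ_r _ _ Hi))).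
  assert (Cmod (cprod f n) <= (1 + d) ^ n).
  { pose proof (Cmod_reverse (cprod f n) 1). rewrite Cmod_1 in H0. lra. }
  assert (Cmod (f n - 1) * Cmod (cprod f n) <= d * (1 + d) ^ n) by (apply Rmult_le_compat; auto using Cmod_ge_0).
  simpl. lra.
Qed.

Lemma exp_minus_1_small (y : R) : 0 <= y <= 1 -> exp y - 1 <= 3 * y.
Proof.
  intros Hy. assert (H := MVT_upper exp exp 0 y 3 ltac:(lra)). rewrite exp_0 in H.
  replace (3 * y) with (3 * (y - 0)) by ring. apply H.
  - intros. apply is_derive_exp.
  - intros t Ht. apply Rle_trans with (exp 1); [apply exp_le; lra | apply exp_le_3].
Qed.

Lemma pow_1_plus_le_exp (d : R) (m : nat) : 0 <= d -> (1 + d) ^ m <= exp (INR m * d).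
Proof.
  intros Hd. induction m; [simpl; rewrite Rmult_0_l, exp_0; lra | ].
  simpl pow. rewrite S_INR. replace ((INR m + 1) * d) with (d + INR m * d) by ring. rewrite exp_plus.
  apply Rmult_le_compat; [lra | apply pow_le; lra | apply exp_ineq1_le | auto].
Qed.

(** There are [N * n^(rho - 1)] primary factors of index [n], each within a multiple of
    [n^(- rho - 1)] of 1, hence together within a multiple of [n^(-2)]. This is why the genus is
    [rho]. *)
Lemma Wfactor_near_1 (rho N : nat) (s : nat -> C) (Rad : R) : (0 < rho)%nat -> 0 < Rad ->
  exists K n0, 0 < K /\ (0 < n0)%nat /\ forall M z, (n0 <= M)%nat -> Cmod z <= Rad ->
  Cmod (cprod (fun j => (Efac rho (s j * z / INR (S M)) ^ (S M ^ (rho - 1)))%C) N - 1) <= K / (INR (S M) * INR (S M)).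
Proof.
  intros Hr HR.
  set (A := rsum (fun j => Cmod (s j)) N * Rad + 1).
  assert (Hs : 0 <= rsum (fun j => Cmod (s j)) N) by (apply rsum_nonneg; intros; apply Cmod_ge_0).
  assert (HA : 1 <= A) by (unfold A; nra).
  set (K0 := INR N * exp (INR rho) * A ^ S rho).
  assert (HK0 : 0 <= K0).
  { unfold K0. apply Rmult_le_pos; [apply Rmult_le_pos; [apply pos_INR | apply Rlt_le, exp_pos] | apply pow_le; lra]. }
  (* Beyond [A] the arguments of the primary factors lie in the unit disc, and beyond [K0] the total
     exponent [K0 / (n * n)] is at most 1. *)
  destruct (exists_nat_large (A + K0)) as [n0 [Hn0 Hn0']].
  exists (3 * K0 + 1), n0. split; [lra | split; [auto | ]]. intros M z HM Hz.
  apply le_INR in HM. set (n := INR (S M)).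
  assert (Hn : A + K0 < n) by (unfold n; rewrite S_INR; lra).
  assert (Hn1 : 1 < n) by lra.
  assert (Hnz := INR_S_nz M).
  set (d := exp (INR rho) * (A / n) ^ S rho).
  assert (Hd : 0 <= d).
  { unfold d. apply Rmult_le_pos; [apply Rlt_le, exp_pos | apply pow_le, Rdiv_le_0_compat; lra]. }
  assert (Hj : forall j, (j < N)%nat -> Cmod (Efac rho (s j * z / INR (S M)) - 1) <= d).
  { intros j Hj.
    assert (Hm : Cmod (s j * z / INR (S M)) <= A / n).
    { rewrite Cmod_div, Cmod_mult, (Cmod_RtoC_pos (INR (S M))) by (auto; apply pos_INR). fold n.
      apply Rmult_le_compat_r; [apply Rlt_le, Rinv_0_lt_compat; lra | ]. unfold A.
      assert (Cmod (s j) <= rsum (fun j => Cmod (s j)) N) by (apply (rsum_pos_bound (fun j => Cmod (s j))); auto; intros; apply Cmod_ge_0).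
      assert (Cmod (s j) * Cmod z <= rsum (fun j => Cmod (s j)) N * Rad) by (apply Rmult_le_compat; auto using Cmod_ge_0).
      lra. }
    eapply Rle_trans; [apply Efac_bound | ].
    - eapply Rle_trans; [exact Hm | ]. apply Rmult_le_reg_r with n; [lra | ].
      replace (A / n * n) with A by (field; lra). lra.
    - unfold d. apply Rmult_le_compat_l; [apply Rlt_le, exp_pos | ]. apply pow_incr. split; [apply Cmod_ge_0 | auto]. }
  set (m := (S M ^ (rho - 1))%nat).
  eapply Rle_trans.
  { apply cprod_near_1 with (d := (1 + d) ^ m - 1).
    - intros j Hjj. apply Cpow_near_1. auto.
    - assert (1 <= (1 + d) ^ m) by (apply pow_R1_Rle; lra). lra. }
  replace (1 + ((1 + d) ^ m - 1)) with ((1 + d) ^ m) by ring. rewrite <- pow_mult.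
  apply Rle_trans with (exp (INR (m * N) * d) - 1).
  { pose proof (pow_1_plus_le_exp d (m * N) Hd). lra. }
  assert (E : INR (m * N) * d = K0 / (n * n)).
  { rewrite mult_INR. unfold m. rewrite pow_INR. fold n. unfold d, K0.
    destruct rho as [ | r]; [lia | ]. replace (S r - 1)%nat with r by lia.
    unfold Rdiv at 1. rewrite Rpow_mult_distr, pow_inv. simpl. field.
    repeat split; first [lra | apply pow_nonzero; lra]. }
  rewrite E.
  assert (Hy : 0 <= K0 / (n * n) <= 1).
  { split; [apply Rdiv_le_0_compat; nra | ]. apply Rmult_le_reg_r with (n * n); [nra | ].
    replace (K0 / (n * n) * (n * n)) with K0 by (field; lra). nra. }
  eapply Rle_trans; [apply exp_minus_1_small; auto | ].
  replace (3 * (K0 / (n * n))) with (3 * K0 / (n * n)) by (unfold Rdiv; ring).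
  apply Rmult_le_compat_r; [apply Rlt_le, Rinv_0_lt_compat; nra | lra].
Qed.

(** Since [1 / (M + 1)^2 <= 1 / M - 1 / (M + 1)], the logarithmic growth of the partial products
    telescopes and they stay below [A * exp K]; their increments then telescope as well. The rate
    depends on [A] and [K] alone, hence is uniform on discs. *)
Lemma prod_cauchy (w b : nat -> C) (n0 : nat) (A K : R) : (0 < n0)%nat -> 0 < K ->
  (forall M, (n0 <= M)%nat -> w (S M) = (w M * b M)%C) ->
  (forall M, (n0 <= M)%nat -> Cmod (b M - 1) <= K / (INR (S M) * INR (S M))) ->
  Cmod (w n0) <= A ->
  forall M m, (n0 <= M)%nat -> Cmod (w (M + m)%nat - w M) <= A * exp K * K / INR M.
Proof.
  intros Hn0 HK Hw Hb HA.
  assert (HA0 : 0 <= A) by (eapply Rle_trans; [apply Cmod_ge_0 | exact HA]).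
  assert (Hstep : forall M, (n0 <= M)%nat -> / (INR (S M) * INR (S M)) <= / INR M - / INR (S M)).
  { intros M HM. assert (0 < INR M) by (apply lt_0_INR; lia). rewrite S_INR.
    replace (/ INR M - / (INR M + 1)) with (/ (INR M * (INR M + 1))) by (field; lra).
    apply Rinv_le_contravar; nra. }
  assert (Hn0p : 0 < INR n0) by (apply lt_0_INR; lia).
  assert (Hn01 : / INR n0 <= 1).
  { rewrite <- Rinv_1. apply Rinv_le_contravar; [lra | ]. apply (le_INR 1). lia. }
  assert (Hbd : forall M, (n0 <= M)%nat -> Cmod (w M) <= A * exp (K * (/ INR n0 - / INR M))).
  { intros M HM. induction HM as [ | M HM IH].
    - replace (K * (/ INR n0 - / INR n0)) with 0 by ring. rewrite exp_0. lra.
    - rewrite Hw by auto. rewrite Cmod_mult.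
      assert (Hb1 : Cmod (b M) <= exp (K * (/ INR M - / INR (S M)))).
      { pose proof (Cmod_reverse (b M) 1). rewrite Cmod_1 in H. specialize (Hb M HM). specialize (Hstep M HM).
        pose proof (exp_ineq1_le (K * (/ INR M - / INR (S M)))). unfold Rdiv in Hb. nra. }
      eapply Rle_trans; [apply Rmult_le_compat; [apply Cmod_ge_0 | apply Cmod_ge_0 | exact IH | exact Hb1] | ].
      rewrite Rmult_assoc, <- exp_plus. right. f_equal. f_equal. ring. }
  assert (Hbd' : forall M, (n0 <= M)%nat -> Cmod (w M) <= A * exp K).
  { intros M HM. eapply Rle_trans; [apply Hbd; auto | ]. apply Rmult_le_compat_l; auto. apply exp_le.
    assert (0 < / INR M) by (apply Rinv_0_lt_compat, lt_0_INR; lia). nra. }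
  intros M m HM.
  assert (HB0 : 0 <= A * exp K) by (apply Rmult_le_pos; [auto | apply Rlt_le, exp_pos]).
  assert (H : Cmod (w (M + m)%nat - w M) <= A * exp K * K * (/ INR M - / INR (M + m))).
  { induction m.
    - rewrite Nat.add_0_r. replace (w M - w M)%C with (RtoC 0) by ring. rewrite Cmod_0. right; ring.
    - rewrite Nat.add_succ_r. eapply Rle_trans; [apply (Cmod_triangle3 _ (w (M + m)%nat)) | ].
      assert (Hlt : (n0 <= M + m)%nat) by lia.
      rewrite Hw by auto. replace (w (M + m)%nat * b (M + m)%nat - w (M + m)%nat)%C with (w (M + m)%nat * (b (M + m)%nat - 1))%C by ring.
      rewrite Cmod_mult. specialize (Hb _ Hlt). specialize (Hstep _ Hlt). specialize (Hbd' _ Hlt).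
      assert (Cmod (w (M + m)%nat) * Cmod (b (M + m)%nat - 1) <= A * exp K * (K * (/ INR (M + m) - / INR (S (M + m))))).
      { apply Rmult_le_compat; auto using Cmod_ge_0. eapply Rle_trans; [exact Hb | ]. unfold Rdiv. nra. }
      lra. }
  eapply Rle_trans; [exact H | ]. unfold Rdiv. apply Rmult_le_compat_l; [nra | ].
  assert (0 < / INR (M + m)) by (apply Rinv_0_lt_compat, lt_0_INR; lia). lra.
Qed.

Lemma ent_cprod (f : nat -> C -> C) (n : nat) : (forall i, (i < n)%nat -> ent (f i)) -> ent (fun z => cprod (fun i => f i z) n).
Proof.
  induction n; intros H; simpl; [exact (ent_const (RtoC 1)) | ].
  apply ent_mult; [apply IHn; auto | apply H; lia].
Qed.

Lemma ent_Efac (rho : nat) (a : C) : ent (fun z => Efac rho (a * z)).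
Proof.
  assert (Ha : ent (fun z => (a * z)%C)) by (apply ent_scal, ent_id).
  unfold Efac. apply ent_mult; [apply ent_minus; [apply ent_const | auto] | ].
  apply ent_Cexp. unfold Eexp. apply (ent_csum (fun l z => ((a * z) ^ S l / INR (S l))%C)). intros l _.
  apply ent_ext with (fun z => (/ INR (S l) * (a * z) ^ S l)%C); [intros; unfold Cdiv; ring | ].
  now apply ent_scal, ent_pow.
Qed.

Lemma ent_Wprod (rho N : nat) (s : nat -> C) (c : C) (M : nat) : ent (Wprod rho N s c M).
Proof.
  induction M; cbn [Wprod].
  - apply ent_Cexp, ent_scal, ent_pow, ent_id.
  - apply ent_mult; [exact IHM | ].
    apply (ent_cprod (fun j z => (Efac rho (s j * z / INR (S M)) ^ (S M ^ (rho - 1)))%C)). intros j _.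
    apply ent_pow. apply ent_ext with (fun z => Efac rho (s j / INR (S M) * z)); [intros; f_equal; unfold Cdiv; ring | apply ent_Efac].
Qed.

(** The value 1 at the origin will make the terms of the dyadic series close to 1 near a boundary
    point on the axis. *)
Lemma Wlimit_exists (rho N : nat) (s : nat -> C) (c : C) : (0 < rho)%nat ->
  exists W, ent W /\ W 0%C = 1 /\ forall z, cvg (fun M => Wprod rho N s c M z) (W z).
Proof.
  intros Hr.
  assert (HC : forall Rad eps, 0 < Rad -> 0 < eps -> exists n1, forall M m z, (n1 <= M)%nat -> Cmod z <= Rad ->
     Cmod (Wprod rho N s c (M + m) z - Wprod rho N s c M z) <= eps).
  { intros Rad eps HR He. destruct (Wfactor_near_1 rho N s Rad Hr HR) as [K [n0 [HK [Hn0 HF]]]].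
    destruct (ent_bounded _ Rad (ent_Wprod rho N s c n0)) as [A [HA HWA]].
    destruct (exists_nat_large (A * exp K * K / eps)) as [n2 [Hn2 Hn2']].
    exists (max n0 n2). intros M m z HM Hz.
    eapply Rle_trans; [apply (prod_cauchy (fun M => Wprod rho N s c M z) (fun M => cprod (fun j => (Efac rho (s j * z / INR (S M)) ^ (S M ^ (rho - 1)))%C) N) n0 A K); auto; lia | ].
    assert (HMp : 0 < INR M) by (apply lt_0_INR; lia).
    assert (INR n2 <= INR M) by (apply le_INR; lia).
    apply Rmult_le_reg_r with (INR M); auto.
    replace (A * exp K * K / INR M * INR M) with (A * exp K * K / eps * eps) by (field; lra). nra. }
  assert (HL : forall z, exists l, cvg (fun M => Wprod rho N s c M z) l).
  { intros z. apply cvg_complete. intros eps He.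
    destruct (HC (Cmod z + 1) (eps / 2)) as [n1 H1]; [pose proof (Cmod_ge_0 z); lra | lra | ].
    exists n1.
    assert (Hle : forall n m, (n1 <= n)%nat -> (n <= m)%nat -> Cmod (Wprod rho N s c n z - Wprod rho N s c m z) < eps).
    { intros n m Hn Hnm. rewrite Cmod_minus_sym. replace m with (n + (m - n))%nat by lia.
      eapply Rle_lt_trans; [apply H1; [auto | lra] | lra]. }
    intros n m Hn Hm. destruct (le_lt_dec n m); [apply Hle; auto | rewrite Cmod_minus_sym; apply Hle; auto; lia]. }
  destruct (functional_choice (fun z l => cvg (fun M => Wprod rho N s c M z) l) HL) as [W HW].
  exists W. split; [ | split; auto].
  - apply ent_limit. intros Rad eps HR He. destruct (HC Rad eps HR He) as [n1 H1].
    exists (Wprod rho N s c n1). split; [apply ent_Wprod | ]. intros z Hz.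
    apply (cvg_Cmod_le (fun M => Wprod rho N s c M z)); auto.
    exists n1. intros n Hn. replace n with (n1 + (n - n1))%nat by lia. apply H1; auto.
  - assert (H : Cmod (W 0%C - 1) <= 0).
    { apply (cvg_Cmod_le (fun M => Wprod rho N s c M 0)); auto.
      exists O. intros n _. rewrite Wprod_0 by auto. replace (1 - 1)%C with (RtoC 0) by ring. rewrite Cmod_0; lra. }
    assert (E : (W 0%C - 1)%C = 0) by (apply Cmod_eq_0; pose proof (Cmod_ge_0 (W 0%C - 1)); lra).
    replace (W 0%C) with (W 0%C - 1 + 1)%C by ring. rewrite E. ring.
Qed.

Lemma Dg_term_bound (u : C) (n : R) : 0 < n -> 2 * Cmod u <= n ->
  Cmod (/ RtoC n - / (RtoC n - u)) <= 2 * Cmod u * / (n * n).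
Proof.
  intros Hn Hu. assert (Hu0 := Cmod_ge_0 u).
  assert (Hd : n / 2 <= Cmod (RtoC n - u)).
  { pose proof (Cmod_reverse (RtoC n) u). rewrite Cmod_RtoC_pos in H by lra. lra. }
  assert (Hnz : RtoC n <> 0) by (apply RtoC_nz; lra).
  assert (Hdz : (RtoC n - u)%C <> 0) by (apply Cmod_pos_nz; lra).
  replace (/ RtoC n - / (RtoC n - u))%C with (- u * (/ RtoC n * / (RtoC n - u)))%C by (field; auto).
  rewrite !Cmod_mult, Cmod_opp, (Cmod_inv (RtoC n)), (Cmod_RtoC_pos n) by (auto; lra).
  assert (H : Cmod (/ (RtoC n - u)) <= / (n / 2)) by (apply Cmod_inv_le; lra).
  replace (2 * Cmod u * / (n * n)) with (Cmod u * (/ n * / (n / 2))) by (field; lra).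
  apply Rmult_le_compat_l; auto. apply Rmult_le_compat_l; auto. apply Rlt_le, Rinv_0_lt_compat; auto.
Qed.

Lemma Dg_tail (u : C) (n0 M : nat) : (0 < n0)%nat -> (n0 <= M)%nat -> 2 * Cmod u <= INR n0 ->
  Cmod (Dg M u - Dg n0 u) <= 2 * Cmod u / INR n0.
Proof.
  intros Hn HM Hu. unfold Dg. replace M with (n0 + (M - n0))%nat by lia. rewrite csum_split.
  match goal with |- Cmod (?a + ?b - ?a) <= _ => replace (a + b - a)%C with b by ring end.
  eapply Rle_trans.
  { apply Cmod_csum_le with (g := fun i => 2 * Cmod u * / (INR (S (n0 + i)) * INR (S (n0 + i)))).
    intros i _. apply Dg_term_bound; [apply lt_0_INR; lia | ].
    eapply Rle_trans; [exact Hu | apply le_INR; lia]. }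
  rewrite rsum_scal. unfold Rdiv. apply Rmult_le_compat_l; [pose proof (Cmod_ge_0 u); lra | ].
  now apply rsum_tail_inv_sq.
Qed.

(** Provides the limit of the linear coefficients of the truncated products at a base point. *)
Lemma Dg_cvg (u : C) : exists l, cvg (fun M => Dg M u) l.
Proof.
  apply cvg_complete. intros eps He. assert (Hu := Cmod_ge_0 u).
  destruct (exists_nat_large (2 * Cmod u + 4 * Cmod u / eps)) as [n0 [Hn0 H]].
  assert (Hp : 0 < INR n0) by (apply lt_0_INR; lia).
  assert (0 <= 4 * Cmod u / eps) by (apply Rdiv_le_0_compat; lra).
  exists n0. intros n m Hn Hm.
  assert (H1 := Dg_tail u n0 n Hn0 Hn ltac:(lra)). assert (H2 := Dg_tail u n0 m Hn0 Hm ltac:(lra)).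
  assert (2 * Cmod u / INR n0 < eps / 2).
  { apply Rmult_lt_reg_r with (INR n0); auto. replace (2 * Cmod u / INR n0 * INR n0) with (2 * Cmod u) by (field; lra).
    assert (4 * Cmod u / eps * eps = 4 * Cmod u) by (field; lra). nra. }
  pose proof (Cmod_triangle3 (Dg n u) (Dg n0 u) (Dg m u)). rewrite (Cmod_minus_sym (Dg n0 u)) in H4. lra.
Qed.

(** * Growth of the product between and near its rays of zeros *)

Section Rays.

(* [s j = tau j * cis (- th j)] puts zeros on the ray of direction [th j]. The [Cv i] are the
   exponents with [W ~ exp (Cv i * z ^ rho)] between the rays [th (i - 1)] and [th i]. *)
Variables (rho N : nat) (s : nat -> C) (tau th : nat -> R) (Cv : nat -> C) (c : C).
Hypothesis Hrho : (4 <= rho)%nat.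
Hypothesis Hs : forall j, (j < N)%nat -> s j = (RtoC (tau j) * cis (- th j))%C.
Hypothesis Htau : forall j, (j < N)%nat -> 0 < tau j.
(** Passing ray [j] counterclockwise lowers the argument of [- s j * z] by [2 * PI], hence [Dg] by
    about [2 * PI * i], and this enters the logarithmic derivative with the weight [s j ^ rho]. *)
Hypothesis HCv : forall j, (j < N)%nat ->
  (RtoC (INR rho) * (Cv (S j) - Cv j))%C = (- (RtoC (2 * PI) * Ci * s j ^ rho))%C.
Hypothesis HCN : Cv N = Cv O.
(** The value of [c] for which [rho * c + SW] tends to [rho * Cv 0] in the sector before all the
    rays. *)
Hypothesis Hc : (RtoC (INR rho) * c)%C =
  (RtoC (INR rho) * Cv O - csum (fun j => s j ^ rho * (RtoC (ln (tau j)) - Ci * RtoC (th j))) N)%C.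

(** The jumps of [Cv] add up to zero around the circle. This is Lindelof's balance condition: it
    cancels the terms [Dg M (- x)], of size [ln x], which would otherwise produce growth of order
    [r^rho * ln r]. *)
Lemma rays_balance : csum (fun j => (s j ^ rho)%C) N = 0.
Proof.
  assert (H2 : (RtoC (2 * PI) * Ci)%C <> 0).
  { apply Cmod_pos_nz. pose proof PI_RGT_0. rewrite Cmod_mult, Cmod_Ci, Cmod_RtoC_pos; lra. }
  assert (H : ((RtoC (2 * PI) * Ci) * csum (fun j => (s j ^ rho)%C) N)%C = 0).
  { rewrite <- csum_scal.
    rewrite (csum_ext _ (fun j => (- RtoC (INR rho) * (Cv (S j) - Cv j))%C)).
    - rewrite csum_scal, csum_telescope, HCN. ring.
    - intros j Hj. replace (- RtoC (INR rho) * (Cv (S j) - Cv j))%C with (- (RtoC (INR rho) * (Cv (S j) - Cv j)))%C by ring.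
      rewrite HCv by auto. ring. }
  replace (csum (fun j => (s j ^ rho)%C) N) with ((RtoC (2 * PI) * Ci) * csum (fun j => (s j ^ rho)%C) N / (RtoC (2 * PI) * Ci))%C.
  - rewrite H. unfold Cdiv; ring.
  - field. split; [apply Cmod_pos_nz; rewrite Cmod_Ci; lra | intro E; apply H2; rewrite E; ring].
Qed.

Lemma ray_point (j : nat) (x phi : R) : (j < N)%nat ->
  (s j * (RtoC x * cis phi))%C = (RtoC (tau j * x) * cis (phi - th j))%C.
Proof.
  intros Hj. rewrite Hs by auto. replace (phi - th j) with (- th j + phi) by ring.
  rewrite cis_plus, RtoC_mult. ring.
Qed.

Lemma Cmod_s (j : nat) : (j < N)%nat -> Cmod (s j) = tau j.
Proof.
  intros Hj. rewrite Hs, Cmod_mult, Cmod_cis, Cmod_RtoC_pos by (auto; apply Rlt_le; auto). ring.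
Qed.

(** The direction comes after the rays of index below [i] and before the others; the shift by
    [2 * PI] puts the argument of [s j * z] in the branch used by [Dg_asym]. *)
Definition in_sector (i : nat) (phi : R) : Prop :=
  (i <= N)%nat /\ forall j, (j < N)%nat ->
    ((j < i)%nat -> 0 < phi - th j < 2 * PI) /\ ((i <= j)%nat -> 0 < phi - th j + 2 * PI < 2 * PI).

Definition off_rays (c0 phi : R) : Prop := forall j, (j < N)%nat -> cos (phi - th j) <= 1 - 2 * c0 ^ 2.

Lemma sector_sum (i : nat) : (i <= N)%nat ->
  csum (fun j => (s j ^ rho * (if lt_dec j i then 0 else RtoC (2 * PI) * Ci))%C) N = (RtoC (INR rho) * (Cv i - Cv O))%C.
Proof.
  intros Hi. replace N with (i + (N - i))%nat at 1 by lia. rewrite csum_split.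
  rewrite csum_zero.
  2: { intros j Hj. destruct (lt_dec j i); [ring | lia]. }
  rewrite (csum_ext _ (fun j => (- RtoC (INR rho) * (Cv (i + S j)%nat - Cv (i + j)%nat))%C)).
  2: { intros j Hj. destruct (lt_dec (i + j) i); [lia | ].
       rewrite Nat.add_succ_r.
       replace (- RtoC (INR rho) * (Cv (S (i + j)) - Cv (i + j)%nat))%C with (- (RtoC (INR rho) * (Cv (S (i + j)) - Cv (i + j)%nat)))%C by ring.
       rewrite HCv by lia. ring. }
  rewrite csum_scal, (csum_telescope (fun j => Cv (i + j)%nat)).
  replace (i + (N - i))%nat with N by lia. rewrite Nat.add_0_r, HCN. ring.
Qed.

Lemma Ksum_exists (P : nat -> R -> Prop) (n : nat) :
  (forall j, (j < n)%nat -> exists K, 0 < K /\ P j K) -> exists K : nat -> R, forall j, (j < n)%nat -> 0 < K j /\ P j (K j).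
Proof.
  intros H. apply (functional_choice (fun j K => (j < n)%nat -> 0 < K /\ P j K)).
  intros j. destruct (lt_dec j n) as [Hj | Hj]; [ | exists 0; intros; lia].
  destruct (H j Hj) as [K HK]. exists K. auto.
Qed.

(** Each [Dg] is replaced by its asymptotic value. What is common to all rays disappears by
    [rays_balance], the branch shifts add up by [sector_sum] to the difference of exponents, and [c]
    accounts for the rest. *)
Lemma SW_sector (c0 : R) : 0 < c0 <= 1 -> exists K, 0 < K /\ forall i phi x M,
  in_sector i phi -> off_rays c0 phi -> 0 < x -> (0 < M)%nat ->
  Cmod (INR rho * c + SW rho N s M (RtoC x * cis phi) - INR rho * Cv i) <= K * (/ x + x / INR M).
Proof.
  intros Hc0.
  destruct (Ksum_exists (fun j K => forall x a M, 0 < x -> 0 < a < 2 * PI -> (0 < M)%nat -> cos a <= 1 - 2 * c0 ^ 2 ->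
     Cmod (Dg M (RtoC (tau j * x) * cis a) - Dg M (RtoC (- x)) - (RtoC (ln (tau j)) + Ci * RtoC (a - PI))) <= K * (/ x + x / INR M)) N) as [K HK].
  { intros j Hj. apply Dg_asym; auto. }
  exists (rsum (fun j => tau j ^ rho * K j) N + 1). split.
  { assert (0 <= rsum (fun j => tau j ^ rho * K j) N); [ | lra]. apply rsum_nonneg. intros j Hj.
    apply Rmult_le_pos; [apply pow_le, Rlt_le; auto | apply Rlt_le, HK; auto]. }
  intros i phi x M [Hi Hsec] Hoff Hx HM.
  assert (HMp : 0 < INR M) by (apply lt_0_INR; lia).
  set (al := fun j => if lt_dec j i then phi - th j else phi - th j + 2 * PI).
  set (A := fun j => (s j ^ rho * (Dg M (s j * (RtoC x * cis phi)) - Dg M (RtoC (- x)) - (RtoC (ln (tau j)) + Ci * RtoC (al j - PI))))%C).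
  assert (E : (INR rho * c + SW rho N s M (RtoC x * cis phi) - INR rho * Cv i)%C = csum A N).
  { rewrite (csum_ext A (fun j => (s j ^ rho * Dg M (s j * (RtoC x * cis phi)) +
       ((- Dg M (RtoC (- x)) - Ci * RtoC phi + Ci * RtoC PI) * s j ^ rho +
        (- (1) * (s j ^ rho * (RtoC (ln (tau j)) - Ci * RtoC (th j))) +
         - (1) * (s j ^ rho * (if lt_dec j i then 0 else RtoC (2 * PI) * Ci)))))%C)).
    2: { intros j Hj. unfold A, al. destruct (lt_dec j i); rewrite ?RtoC_minus, ?RtoC_plus, ?RtoC_minus; ring. }
    rewrite !csum_plus, !csum_scal, rays_balance, sector_sum by auto. unfold SW.
    rewrite Hc. ring. }
  rewrite E.
  apply Rle_trans with (rsum (fun j => (/ x + x / INR M) * (tau j ^ rho * K j)) N).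
  - apply Cmod_csum_le. intros j Hj. unfold A. rewrite Cmod_mult, Cmod_pow, Cmod_s by auto.
    rewrite <- Rmult_assoc, (Rmult_comm _ (tau j ^ rho)), Rmult_assoc.
    apply Rmult_le_compat_l; [apply pow_le, Rlt_le; auto | ]. rewrite (Rmult_comm _ (K j)).
    destruct (HK j Hj) as [_ HKj]. destruct (Hsec j Hj) as [S1 S2].
    rewrite ray_point by auto.
    replace (cis (phi - th j)) with (cis (al j)).
    2: { unfold al. destruct (lt_dec j i); [reflexivity | apply cis_period]. }
    apply HKj; auto.
    + unfold al. destruct (lt_dec j i); [apply S1; auto | apply S2; lia].
    + specialize (Hoff j Hj). unfold al. destruct (lt_dec j i); auto.
      replace (cos (phi - th j + 2 * PI)) with (cos (phi - th j)); auto.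
      assert (HH := cis_period (phi - th j)). injection HH. auto.
  - rewrite rsum_scal, Rmult_comm. apply Rmult_le_compat_r; [ | lra].
    assert (0 < / x) by (apply Rinv_0_lt_compat; auto). assert (0 < x / INR M) by (apply Rdiv_lt_0_compat; auto). lra.
Qed.

Lemma off_rays_nz (c0 phi x : R) (j n : nat) : 0 < c0 <= 1 -> off_rays c0 phi -> 0 <= x -> (j < N)%nat ->
  (INR (S n) - s j * (RtoC x * cis phi))%C <> 0.
Proof.
  intros Hc0 Hoff Hx Hj. destruct Hx as [Hx | <-].
  - assert (Ht := Htau j Hj). rewrite ray_point by auto. apply (away_nz c0); [lra | | apply pos_INR | ].
    + apply away_polar; auto. apply Rmult_lt_0_compat; auto.
    + apply Cmod_pos_nz. rewrite Cmod_mult, Cmod_cis, Cmod_RtoC_pos; nra.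
  - replace (INR (S n) - s j * (0 * cis phi))%C with (RtoC (INR (S n))) by ring. apply INR_S_nz.
Qed.

Lemma Re_scal_pow_derive (C0 : C) (x : R -> C) (t : R) (v : C) : cderiv x t v ->
  is_derive (fun y => Re (C0 * x y ^ rho)%C) t (Re (v * x t ^ (rho - 1) * (INR rho * C0))%C).
Proof.
  intros Hx. destruct (cderiv_scal C0 _ t _ (cderiv_pow x t v rho Hx)) as [H _].
  eapply is_derive_val; [ | exact H]. f_equal. ring.
Qed.

(** Both functions vanish at the origin, and along the ray the derivative of their difference is at
    most [t^(rho - 1)] times the error in [SW_sector]. The condition [r^2 <= INR M] keeps the
    truncation error [t / M] below [/ t]. *)
Lemma LW_radial (c0 : R) : 0 < c0 <= 1 -> exists K, 0 < K /\ forall i phi r M,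
  in_sector i phi -> off_rays c0 phi -> 0 < r -> (0 < M)%nat -> r ^ 2 <= INR M ->
  Rabs (LW rho N s c M (RtoC r * cis phi) - Re (Cv i * (RtoC r * cis phi) ^ rho)%C) <= K * r ^ (rho - 1).
Proof.
  intros Hc0. destruct (SW_sector c0 Hc0) as [K [HK HS]].
  exists (2 * K). split; [lra | ]. intros i phi r M Hsec Hoff Hr HM HrM.
  assert (HMp : 0 < INR M) by (apply lt_0_INR; lia).
  set (x := fun t => (0 + RtoC t * cis phi)%C).
  set (f := fun t => LW rho N s c M (x t) - Re (Cv i * x t ^ rho)%C).
  assert (Hx : forall t, x t = (RtoC t * cis phi)%C) by (intros; unfold x; ring).
  assert (E0 : f 0 = 0).
  { unfold f. rewrite Hx. replace (0 * cis phi)%C with (RtoC 0) by ring.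
    rewrite LW_0 by lia. rewrite Cpow_0_l by lia. replace (Cv i * 0)%C with (RtoC 0) by ring. unfold Re; simpl; ring. }
  assert (Hb : Rabs (f r - f 0) <= (2 * K * r ^ (rho - 2)) * (r - 0)).
  { apply (MVT_abs f (fun t => Re (cis phi * x t ^ (rho - 1) * (INR rho * c + SW rho N s M (x t)))%C -
                              Re (cis phi * x t ^ (rho - 1) * (INR rho * Cv i))%C)); [lra | | ].
    - intros t Ht. apply is_derive_Rminus.
      + apply LW_derive; [lia | | apply cderiv_affine].
        intros j n Hj Hn. rewrite Hx. apply (off_rays_nz c0); auto; lra.
      + apply Re_scal_pow_derive, cderiv_affine.
    - intros t Ht. rewrite <- Re_minus.
      match goal with |- Rabs (Re ?e) <= _ => replace e with (cis phi * x t ^ (rho - 1) * (INR rho * c + SW rho N s M (x t) - INR rho * Cv i))%C by ring end.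
      eapply Rle_trans; [apply re_le_Cmod | ]. rewrite !Cmod_mult, Cmod_cis, Rmult_1_l, Cmod_pow, Hx.
      rewrite Cmod_mult, Cmod_cis, Cmod_RtoC_pos, Rmult_1_r by lra.
      (* [SW_sector] speaks of positive radii only; at the origin the factor [t^(rho - 1)]
         vanishes. *)
      destruct (Req_dec t 0) as [-> | Ht0].
      + rewrite pow_ne_zero by lia. rewrite Rmult_0_l.
        apply Rmult_le_pos; [lra | apply pow_le; lra].
      + assert (Htp : 0 < t) by lra.
        eapply Rle_trans; [apply Rmult_le_compat_l; [apply pow_le; lra | apply (HS i phi t M); auto] | ].
        assert (Hp : 0 <= t ^ (rho - 2) <= r ^ (rho - 2)) by (split; [apply pow_le; lra | apply pow_incr; lra]).
        replace (t ^ (rho - 1) * (K * (/ t + t / INR M))) with (t ^ (rho - 2) * (K * (1 + t ^ 2 / INR M))).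
        2: { replace (rho - 1)%nat with (S (rho - 2)) by lia. simpl. field. lra. }
        assert (t ^ 2 / INR M <= 1).
        { apply Rmult_le_reg_r with (INR M); auto. replace (t ^ 2 / INR M * INR M) with (t ^ 2) by (field; lra).
          assert (t ^ 2 <= r ^ 2) by (apply pow_incr; lra). lra. }
        assert (0 <= t ^ 2 / INR M) by (apply Rdiv_le_0_compat; [apply pow_le; lra | auto]).
        apply Rle_trans with (r ^ (rho - 2) * (K * 2)); [ | lra].
        apply Rmult_le_compat; nra. }
  rewrite E0 in Hb. unfold f in Hb. rewrite Hx in Hb.
  replace (2 * K * r ^ (rho - 1)) with (2 * K * r ^ (rho - 2) * (r - 0)).
  2: { replace (rho - 1)%nat with (S (rho - 2)) by lia. simpl. ring. }
  rewrite Rminus_0_r in Hb at 1. exact Hb.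
Qed.

(** The derivative of [SW] is of order [/ b^2], one order better than for a single ray: the main
    parts [/ x] of the derivatives carry the weights [s j ^ rho] and cancel by [rays_balance]. *)
Lemma SW_lipschitz (c0 : R) : 0 < c0 -> exists K, 0 < K /\ forall (a w : C) (b : R) M, 0 < b -> (0 < M)%nat ->
  (forall t, 0 <= t <= 1 -> b <= Cmod (a + RtoC t * w) /\ forall j, (j < N)%nat -> away c0 (s j * (a + RtoC t * w))) ->
  Cmod (SW rho N s M (a + w) - SW rho N s M a) <= K * (/ b ^ 2 + / INR M) * Cmod w.
Proof.
  intros Hc0.
  set (K0 := rsum (fun j => tau j ^ S rho * (/ (c0 ^ 3 * tau j ^ 2) + / c0)) N).
  assert (HK0 : 0 <= K0).
  { apply rsum_nonneg. intros j Hj. specialize (Htau j Hj). apply Rmult_le_pos; [apply pow_le; lra | ].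
    apply Rplus_le_le_0_compat; apply Rlt_le, Rinv_0_lt_compat; auto. apply Rmult_lt_0_compat; apply pow_lt; auto. }
  exists (K0 + 1). split; [lra | ]. intros a w b M Hb HM Hseg.
  assert (HMp : 0 < INR M) by (apply lt_0_INR; lia).
  set (x := fun t => (a + RtoC t * w)%C).
  set (v := fun t => csum (fun j => (s j ^ rho * (- (s j * w) * csum (fun i => (/ ((INR (S i) - s j * x t) * (INR (S i) - s j * x t)))%C) M))%C) N).
  assert (Ex1 : (a + w)%C = x 1) by (unfold x; ring). assert (Ex0 : a = x 0) by (unfold x; ring).
  assert (Hib : 0 < / b ^ 2) by (apply Rinv_0_lt_compat, pow_lt; auto).
  assert (HiM : 0 < / INR M) by (apply Rinv_0_lt_compat; auto).
  replace ((K0 + 1) * (/ b ^ 2 + / INR M) * Cmod w) with ((K0 + 1) * (/ b ^ 2 + / INR M) * Cmod w * (1 - 0)) by ring.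
  assert (Hnz : forall t j, 0 <= t <= 1 -> (j < N)%nat -> (s j * x t)%C <> 0).
  { intros t j Ht Hj. destruct (Hseg t Ht) as [H1 H2]. apply Cmod_pos_nz. rewrite Cmod_mult, Cmod_s by auto.
    apply Rmult_lt_0_compat; auto. unfold x. lra. }
  enough (HG : Cmod (SW rho N s M (x 1) - SW rho N s M (x 0)) <= (K0 + 1) * (/ b ^ 2 + / INR M) * Cmod w * (1 - 0)).
  { rewrite Ex1. rewrite <- Ex0 in HG. exact HG. }
  apply (MVT_C (fun t => SW rho N s M (x t)) v 0 1); [lra | | ].
  - intros t Ht. unfold SW, v. apply (cderiv_csum (fun j t => (s j ^ rho * Dg M (s j * x t))%C)). intros j Hj.
    apply cderiv_scal. apply (cderiv_Dg M (fun t => (s j * x t)%C)).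
    + intros i _. apply (away_nz c0); auto; [apply (proj2 (Hseg t Ht)); auto | apply pos_INR].
    + apply cderiv_scal, cderiv_affine.
  - intros t Ht. destruct (Hseg t Ht) as [H1 H2].
    assert (Hxz : x t <> 0) by (apply Cmod_pos_nz; unfold x; lra).
    replace (v t) with (csum (fun j => (- (s j ^ rho * s j * w) * (csum (fun i => (/ ((INR (S i) - s j * x t) * (INR (S i) - s j * x t)))%C) M + / (s j * x t)))%C) N).
    2: { unfold v. symmetry. 
         rewrite (csum_ext (fun j => (- (s j ^ rho * s j * w) * (csum (fun i => (/ ((INR (S i) - s j * x t) * (INR (S i) - s j * x t)))%C) M + / (s j * x t)))%C)
           (fun j => (s j ^ rho * (- (s j * w) * csum (fun i => (/ ((INR (S i) - s j * x t) * (INR (S i) - s j * x t)))%C) M) + (- w / x t) * s j ^ rho)%C)).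
         - rewrite csum_plus, csum_scal, rays_balance. ring.
         - intros j Hj. assert (Hj' := Hnz t j Ht Hj). assert (s j <> 0).
           { intro E. apply Hj'. rewrite E. ring. }
           field. auto. }
    rewrite (Rmult_comm _ (Cmod w)).
    apply Rle_trans with (rsum (fun j => (Cmod w * (/ b ^ 2 + / INR M)) * (tau j ^ S rho * (/ (c0 ^ 3 * tau j ^ 2) + / c0))) N).
    + apply Cmod_csum_le. intros j Hj. assert (Htj := Htau j Hj).
      rewrite Cmod_mult, Cmod_opp, !Cmod_mult, Cmod_pow, Cmod_s by auto.
      assert (HD := Dg_prime_bound c0 (s j * x t) M Hc0 (H2 j Hj) (Hnz t j Ht Hj) HM).
      replace (tau j ^ rho * tau j * Cmod w) with (Cmod w * tau j ^ S rho) by (simpl; ring).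
      replace (Cmod w * (/ b ^ 2 + / INR M) * (tau j ^ S rho * (/ (c0 ^ 3 * tau j ^ 2) + / c0)))
        with (Cmod w * tau j ^ S rho * ((/ b ^ 2 + / INR M) * (/ (c0 ^ 3 * tau j ^ 2) + / c0))) by ring.
      apply Rmult_le_compat_l; [apply Rmult_le_pos; [apply Cmod_ge_0 | apply pow_le; lra] | ].
      eapply Rle_trans; [exact HD | ]. rewrite Cmod_mult, Cmod_s by auto.
      set (A := / (c0 ^ 3 * tau j ^ 2)). set (B := / c0).
      assert (0 < A) by (apply Rinv_0_lt_compat, Rmult_lt_0_compat; apply pow_lt; auto).
      assert (0 < B) by (apply Rinv_0_lt_compat; auto).
      assert (Hxp : 0 < Cmod (x t)) by (apply Cmod_nz; auto).
      replace (/ (c0 ^ 3 * (tau j * Cmod (x t)) ^ 2)) with (A * / Cmod (x t) ^ 2) by (unfold A; field; repeat split; lra).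
      replace (/ (c0 * INR M)) with (B * / INR M) by (unfold B; field; lra).
      assert (/ Cmod (x t) ^ 2 <= / b ^ 2).
      { apply Rinv_le_contravar; [apply pow_lt; auto | apply pow_incr; split; [lra | exact H1]]. }
      nra.
    + rewrite rsum_scal. fold K0. rewrite (Rmult_comm (K0 + 1)), <- Rmult_assoc.
      apply Rmult_le_compat_l; [apply Rmult_le_pos; [apply Cmod_ge_0 | lra] | lra].
Qed.

(** Along the segment the difference has derivative [Re (w * x^(rho - 1) * T x)] with
    [T = rho c + SW - rho Cv i]. Here [T] is of order [/ r] and varies by a multiple of [|w| / r^2],
    so replacing [x] by [a] costs [r^(rho - 3) * |w|^2], one power of [r] below the gain expected
    from the weight. *)
Lemma LW_local (c0 : R) : 0 < c0 <= 1 -> exists K, 0 < K /\ forall i phi r M w,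
  in_sector i phi -> off_rays c0 phi -> 1 <= r -> (0 < M)%nat -> r ^ 2 <= INR M -> Cmod w <= r / 2 ->
  (forall t j, 0 <= t <= 1 -> (j < N)%nat -> away c0 (s j * (RtoC r * cis phi + RtoC t * w))) ->
  let a := (RtoC r * cis phi)%C in
  let Q := (a ^ (rho - 1) * (INR rho * c + SW rho N s M a - INR rho * Cv i))%C in
  Cmod Q <= K * r ^ (rho - 2) /\
  LW rho N s c M (a + w)%C - Re (Cv i * (a + w) ^ rho)%C <=
  LW rho N s c M a - Re (Cv i * a ^ rho)%C + Re (Q * w)%C + K * r ^ (rho - 3) * Cmod w ^ 2.
Proof.
  intros Hc0. destruct (SW_sector c0 Hc0) as [K1 [HK1 HS]]. destruct (SW_lipschitz c0 ltac:(lra)) as [K2 [HK2 HL]].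
  (* The Lipschitz constant of the power [rho - 1] on the disc of radius [2 * r], up to the factor
     [r^(rho - 2)]; the segment stays in that disc. *)
  set (K3 := INR (rho - 1) * 2 ^ (rho - 2)).
  assert (HK3 : 0 <= K3) by (apply Rmult_le_pos; [apply pos_INR | apply pow_le; lra]).
  exists (2 * K1 + K3 * (2 * K1 + 5 * K2) + 5 * K2). split; [nra | ].
  intros i phi r M w Hsec Hoff Hr HM HrM Hw Haway a Q.
  assert (HMp : 0 < INR M) by (apply lt_0_INR; lia).
  assert (Hap : Cmod a = r) by (unfold a; rewrite Cmod_mult, Cmod_cis, Cmod_RtoC_pos by lra; ring).
  set (T := fun x => (INR rho * c + SW rho N s M x - INR rho * Cv i)%C).
  assert (Hir : 0 < / r) by (apply Rinv_0_lt_compat; lra).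
  assert (Hr2 : r ^ 2 = r * r) by (simpl; ring).
  assert (HTa : Cmod (T a) <= 2 * K1 * / r).
  { unfold T, a. eapply Rle_trans; [apply (HS i phi r M); auto; lra | ].
    rewrite (Rmult_comm 2), Rmult_assoc. apply Rmult_le_compat_l; [lra | ].
    assert (r / INR M <= / r); [ | lra].
    apply Rmult_le_reg_r with (r * INR M); [nra | ].
    replace (r / INR M * (r * INR M)) with (r * r) by (field; lra).
    replace (/ r * (r * INR M)) with (INR M) by (field; lra). lra. }
  assert (HQ : Cmod Q <= 2 * K1 * r ^ (rho - 2)).
  { unfold Q. rewrite Cmod_mult, Cmod_pow, Hap. fold (T a).
    replace (2 * K1 * r ^ (rho - 2)) with (r ^ (rho - 1) * (2 * K1 * / r)).
    2: { replace (rho - 1)%nat with (S (rho - 2)) by lia. simpl. field. lra. }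
    apply Rmult_le_compat_l; auto. apply pow_le; lra. }
  split.
  { eapply Rle_trans; [exact HQ | ]. apply Rmult_le_compat_r; [apply pow_le; lra | nra]. }
  assert (Hw0 := Cmod_ge_0 w).
  assert (Hseg : forall t, 0 <= t <= 1 -> r / 2 <= Cmod (a + RtoC t * w) <= 2 * r).
  { intros t Ht. assert (Cmod (RtoC t * w) <= r / 2).
    { rewrite Cmod_mult, Cmod_RtoC_pos by lra. nra. }
    pose proof (Cmod_plus_reverse a (RtoC t * w)). pose proof (Cmod_triangle a (RtoC t * w)). lra. }
  assert (HTx : forall t, 0 <= t <= 1 -> Cmod (T (a + RtoC t * w)%C - T a) <= 5 * K2 * / r ^ 2 * Cmod w).
  { intros t Ht. unfold T.
    match goal with |- Cmod ?e <= _ => replace e with (SW rho N s M (a + RtoC t * w) - SW rho N s M a)%C by ring end.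
    eapply Rle_trans; [apply (HL a (RtoC t * w)%C (r / 2) M); [lra | auto | ] | ].
    - intros u Hu. replace (a + RtoC u * (RtoC t * w))%C with (a + RtoC (u * t) * w)%C by (rewrite RtoC_mult; ring).
      assert (0 <= u * t <= 1) by nra. split; [apply Hseg; auto | intros; apply Haway; auto].
    - rewrite Cmod_mult, Cmod_RtoC_pos by lra.
      assert (/ INR M <= / r ^ 2) by (apply Rinv_le_contravar; [apply pow_lt; lra | auto]).
      replace (/ (r / 2) ^ 2) with (4 * / r ^ 2) by (field; lra).
      assert (0 < / r ^ 2) by (apply Rinv_0_lt_compat, pow_lt; lra).
      assert (0 < / INR M) by (apply Rinv_0_lt_compat; auto).
      apply Rle_trans with (K2 * (5 * / r ^ 2) * Cmod w); [ | lra].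
      apply Rmult_le_compat; [nra | nra | | nra]. apply Rmult_le_compat_l; lra. }
  set (f := fun t => LW rho N s c M (a + RtoC t * w)%C - Re (Cv i * (a + RtoC t * w) ^ rho)%C).
  assert (Hf : f 1 - f 0 <= (Re (Q * w)%C + (K3 * (2 * K1 + 5 * K2) + 5 * K2) * r ^ (rho - 3) * Cmod w ^ 2) * (1 - 0)).
  { apply (MVT_upper f (fun t => Re (w * (a + RtoC t * w) ^ (rho - 1) * (INR rho * c + SW rho N s M (a + RtoC t * w)))%C -
                              Re (w * (a + RtoC t * w) ^ (rho - 1) * (INR rho * Cv i))%C)); [lra | | ].
    - intros t Ht. apply is_derive_Rminus.
      + apply (LW_derive rho N s c M (fun t => (a + RtoC t * w)%C)); [lia | | apply cderiv_affine].
        intros j n Hj Hn. apply (away_nz c0); [lra | apply Haway; auto | apply pos_INR | ].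
        apply Cmod_pos_nz. rewrite Cmod_mult, Cmod_s by auto. apply Rmult_lt_0_compat; auto.
        specialize (Hseg t Ht). lra.
      + apply (Re_scal_pow_derive (Cv i) (fun t => (a + RtoC t * w)%C)), cderiv_affine.
    - intros t Ht. rewrite <- Re_minus. set (x := (a + RtoC t * w)%C).
      match goal with |- Re ?e <= _ => replace e with (Q * w + w * (x ^ (rho - 1) * T x - a ^ (rho - 1) * T a))%C by (unfold Q, T; ring) end.
      rewrite Re_plus. apply Rplus_le_compat_l. eapply Rle_trans; [apply Re_le_Cmod | ]. rewrite Cmod_mult.
      replace (_ * r ^ (rho - 3) * Cmod w ^ 2) with (Cmod w * ((K3 * (2 * K1 + 5 * K2) + 5 * K2) * r ^ (rho - 3) * Cmod w)) by ring.
      apply Rmult_le_compat_l; auto.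
      replace (x ^ (rho - 1) * T x - a ^ (rho - 1) * T a)%C with ((x ^ (rho - 1) - a ^ (rho - 1)) * T x + a ^ (rho - 1) * (T x - T a))%C by ring.
      eapply Rle_trans; [apply Cmod_triangle | ]. rewrite !Cmod_mult, Cmod_pow, Hap.
      assert (Hxa : Cmod (x - a) <= Cmod w).
      { unfold x. replace (a + RtoC t * w - a)%C with (RtoC t * w)%C by ring. rewrite Cmod_mult, Cmod_RtoC_pos by lra. nra. }
      assert (Hl : Cmod (x ^ (rho - 1) - a ^ (rho - 1)) <= K3 * r ^ (rho - 2) * Cmod w).
      { eapply Rle_trans; [apply Cpow_lipschitz with (B := 2 * r) | ].
        - apply Hseg; auto.
        - lra.
        - replace (rho - 1 - 1)%nat with (rho - 2)%nat by lia. unfold K3. rewrite Rpow_mult_distr, <- Rmult_assoc.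
          apply Rmult_le_compat_l; auto. apply Rmult_le_pos; [exact HK3 | apply pow_le; lra]. }
      assert (HT2 := HTx t Ht). fold x in HT2.
      assert (HTxx : Cmod (T x) <= (2 * K1 + 5 * K2) * / r).
      { assert (Cmod (T x) <= Cmod (T a) + Cmod (T x - T a)).
        { pose proof (Cmod_reverse (T x) (T a)). lra. }
        assert (5 * K2 * / r ^ 2 * Cmod w <= 5 * K2 * / r); [ | lra].
        rewrite Rmult_assoc. apply Rmult_le_compat_l; [lra | ].
        replace (/ r) with (/ r ^ 2 * r) by (field; lra). apply Rmult_le_compat_l; [ | lra].
        apply Rlt_le, Rinv_0_lt_compat, pow_lt; lra. }
      assert (P1 : Cmod (x ^ (rho - 1) - a ^ (rho - 1)) * Cmod (T x) <= (K3 * r ^ (rho - 2) * Cmod w) * ((2 * K1 + 5 * K2) * / r)).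
      { apply Rmult_le_compat; auto using Cmod_ge_0. }
      assert (P2 : r ^ (rho - 1) * Cmod (T x - T a) <= r ^ (rho - 1) * (5 * K2 * / r ^ 2 * Cmod w)).
      { apply Rmult_le_compat_l; auto. apply pow_le; lra. }
      replace (rho - 1)%nat with (S (S (rho - 3))) in P2 at 2 by lia.
      replace (rho - 2)%nat with (S (rho - 3)) in P1 by lia.
      replace (K3 * r ^ S (rho - 3) * Cmod w * ((2 * K1 + 5 * K2) * / r)) with (K3 * (2 * K1 + 5 * K2) * r ^ (rho - 3) * Cmod w) in P1 by (simpl; field; lra).
      replace (r ^ S (S (rho - 3)) * (5 * K2 * / r ^ 2 * Cmod w)) with (5 * K2 * r ^ (rho - 3) * Cmod w) in P2 by (simpl; field; lra).
      lra. }
  unfold f in Hf.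
  replace (a + 1 * w)%C with (a + w)%C in Hf by ring. replace (a + 0 * w)%C with a in Hf by ring.
  assert (0 <= 2 * K1 * r ^ (rho - 3) * Cmod w ^ 2).
  { apply Rmult_le_pos; [apply Rmult_le_pos; [lra | apply pow_le; lra] | apply pow_le; auto]. }
  lra.
Qed.

(** The left side is [z] times the logarithmic derivative, after removal of the contributions
    [ln |n - u|] of the zeros with [n <= N0] on the ray [i0]. The poles cancel because
    [(n^(rho - 1) - u^(rho - 1)) / (n - u)] is a polynomial, and there remain [N0] terms, about [r]
    in number, of size [r^(rho - 1)]. *)
Lemma near_ray_derivative_bound (c1 : R) : 0 < c1 <= 1 -> exists K, 0 < K /\ forall i0 r be (N0 M : nat),
  (i0 < N)%nat -> 1 <= r -> (0 < N0)%nat -> (N0 <= M)%nat ->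
  2 * rsum tau N * r <= INR N0 -> INR N0 <= (2 * rsum tau N + 1) * r ->
  (forall j, (j < N)%nat -> j <> i0 -> cos (be - th j) <= 1 - 2 * c1 ^ 2) ->
  (forall n, (n < N0)%nat -> (INR (S n) - s i0 * (RtoC r * cis be))%C <> 0) ->
  let z := (RtoC r * cis be)%C in let u := (s i0 * z)%C in
  Cmod (z ^ rho * (INR rho * c + SW rho N s M z) +
        csum (fun n => RtoC (INR (S n) ^ (rho - 1)) * (u / (INR (S n) - u))) N0)%C <= K * r ^ rho.
Proof.
  intros Hc1. set (ts := rsum tau N).
  assert (Hts : 0 <= ts) by (apply rsum_nonneg; intros; apply Rlt_le; auto).
  set (B1 := fun j => tau j ^ rho * ((2 * ts + 1) / (c1 * tau j) + 1)).
  assert (HB1 : forall j, (j < N)%nat -> 0 <= B1 j).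
  { intros j Hj. specialize (Htau j Hj). unfold B1. apply Rmult_le_pos; [apply pow_le; lra | ].
    assert (0 <= (2 * ts + 1) / (c1 * tau j)); [ | lra]. apply Rdiv_le_0_compat; [lra | nra]. }
  set (K2 := ts ^ rho + INR rho * (2 * ts + 1) ^ rho).
  set (K := Cmod (INR rho * c) + rsum B1 N + K2 + 1).
  assert (HK2 : 0 <= K2).
  { unfold K2. apply Rplus_le_le_0_compat; [apply pow_le; auto | apply Rmult_le_pos; [apply pos_INR | apply pow_le; lra]]. }
  assert (HrB : 0 <= rsum B1 N) by (apply rsum_nonneg; auto).
  exists K. split; [unfold K; pose proof (Cmod_ge_0 (INR rho * c)); lra | ].
  intros i0 r be N0 M Hi0 Hr HN0 HM HNl HNu Hcos Hnz z u.
  fold ts in HNl, HNu.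
  assert (HNp : 0 < INR N0) by (apply lt_0_INR; lia).
  assert (Hz : Cmod z = r) by (unfold z; rewrite Cmod_mult, Cmod_cis, Cmod_RtoC_pos by lra; ring).
  assert (Htj : forall j, (j < N)%nat -> tau j <= ts).
  { intros j Hj. apply (rsum_pos_bound tau); auto. intros; apply Rlt_le; auto. }
  assert (Huj : forall j, (j < N)%nat -> Cmod (s j * z) = tau j * r).
  { intros j Hj. rewrite Cmod_mult, Cmod_s, Hz by auto. reflexivity. }
  assert (Huj2 : forall j, (j < N)%nat -> 2 * Cmod (s j * z) <= INR N0).
  { intros j Hj. rewrite Huj by auto. specialize (Htj j Hj). nra. }
  (* By [rays_balance] the harmonic sum [H] may be subtracted from every [Dg]; only the terms
     [- / (n - u)] are left up to index [N0]. *)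
  set (H := csum (fun i => (/ INR (S i))%C) N0).
  set (X := fun j => (s j ^ rho * (Dg M (s j * z) - H))%C).
  set (G := csum (fun n => RtoC (INR (S n) ^ (rho - 1)) * (u / (INR (S n) - u)))%C N0).
  set (Y := fun j => if Nat.eq_dec j i0 then (z ^ rho * X j + G)%C else (z ^ rho * X j)%C).
  assert (E : (z ^ rho * (INR rho * c + SW rho N s M z) + G)%C = (z ^ rho * (INR rho * c) + csum Y N)%C).
  { assert (E1 : csum Y N = (z ^ rho * csum X N + G)%C).
    { rewrite (csum_ext Y (fun j => (z ^ rho * X j + (if Nat.eq_dec j i0 then G else 0))%C)).
      2: { intros j _. unfold Y. destruct (Nat.eq_dec j i0); ring. }
      rewrite csum_plus, csum_scal. f_equal.
      rewrite (csum_single _ N i0); auto.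
      - destruct (Nat.eq_dec i0 i0); [auto | lia].
      - intros j _ Hne. destruct (Nat.eq_dec j i0); [lia | auto]. }
    assert (E2 : csum X N = SW rho N s M z).
    { rewrite (csum_ext X (fun j => (s j ^ rho * Dg M (s j * z) + - H * s j ^ rho)%C)) by (intros; unfold X; ring).
      rewrite csum_plus, csum_scal, rays_balance. unfold SW. ring. }
    rewrite E1, E2. ring. }
  rewrite E. clear E.
  assert (Hrr : 0 < r ^ rho) by (apply pow_lt; lra).
  assert (Htail : forall j, (j < N)%nat -> Cmod (Dg M (s j * z) - Dg N0 (s j * z)) <= 1).
  { intros j Hj. eapply Rle_trans; [apply Dg_tail; auto | ]. apply Rmult_le_reg_r with (INR N0); auto.
    replace (2 * Cmod (s j * z) / INR N0 * INR N0) with (2 * Cmod (s j * z)) by (field; lra). rewrite Rmult_1_l. auto. }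
  assert (EH : forall v, (Dg N0 v - H)%C = csum (fun n => (- / (INR (S n) - v))%C) N0).
  { intros v. unfold Dg, H.
    rewrite (csum_ext (fun i => (/ INR (S i) - / (INR (S i) - v))%C) (fun i => (/ INR (S i) + - / (INR (S i) - v))%C)) by (intros; ring).
    rewrite csum_plus. ring. }
  eapply Rle_trans; [apply Cmod_triangle | ].
  rewrite Cmod_mult, Cmod_pow, Hz.
  apply Rle_trans with (r ^ rho * Cmod (INR rho * c) + rsum (fun j => r ^ rho * B1 j + (if Nat.eq_dec j i0 then r ^ rho * K2 else 0)) N).
  2: { rewrite rsum_plus, rsum_scal.
       assert (rsum (fun j => if Nat.eq_dec j i0 then r ^ rho * K2 else 0) N <= r ^ rho * K2).
       { clear - HK2 Hrr. assert (forall n, rsum (fun j => if Nat.eq_dec j i0 then r ^ rho * K2 else 0) n <= (if lt_dec i0 n then r ^ rho * K2 else 0)).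
         { induction n; simpl; [lra | ]. destruct (lt_dec i0 n), (lt_dec i0 (S n)), (Nat.eq_dec n i0); try lia; try lra. }
         specialize (H N). destruct (lt_dec i0 N); [lra | nra]. }
       unfold K. nra. }
  apply Rplus_le_compat_l. apply Cmod_csum_le. intros j Hj. unfold Y.
  assert (Htjp := Htau j Hj).
  destruct (Nat.eq_dec j i0) as [-> | Hne].
  - (* the poles of the ray [i0] cancel against [G] *)
    assert (EX : (z ^ rho * X i0 + G)%C = (u ^ rho * (Dg M u - Dg N0 u) +
        csum (fun n => (u * csum (fun i => RtoC (INR (S n)) ^ i * u ^ (rho - 1 - 1 - i)) (rho - 1)))%C N0)%C).
    { unfold X. replace (z ^ rho * (s i0 ^ rho * (Dg M (s i0 * z) - H)))%C with (u ^ rho * (Dg M u - Dg N0 u) + u ^ rho * (Dg N0 u - H))%C.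
      2: { unfold u. rewrite Cpow_mult_l. ring. }
      rewrite EH, <- csum_scal. unfold G. rewrite <- Cplus_assoc, <- csum_plus. f_equal. apply csum_ext.
      intros n Hn. assert (Hq := Hnz n Hn). fold z in Hq. fold u in Hq.
      assert (GF := geom_factor (RtoC (INR (S n))) u (rho - 1)).
      replace (csum (fun i => RtoC (INR (S n)) ^ i * u ^ (rho - 1 - 1 - i))%C (rho - 1)) with ((RtoC (INR (S n)) ^ (rho - 1) - u ^ (rho - 1)) / (INR (S n) - u))%C.
      2: { rewrite GF. field. auto. }
      rewrite RtoC_pow. destruct rho as [ | r0]; [lia | ]. replace (S r0 - 1)%nat with r0 by lia. rewrite Cpow_S.
      field. auto. }
    rewrite EX. eapply Rle_trans; [apply Cmod_triangle | ].
    assert (Hur : Cmod u <= ts * r) by (unfold u; rewrite Huj by auto; specialize (Htj i0 Hj); nra).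
    assert (Hu0 := Cmod_ge_0 u).
    assert (HuN : Cmod u <= INR N0) by (pose proof (Huj2 i0 Hj) as Hq; fold u in Hq; lra).
    assert (T1 : Cmod (u ^ rho * (Dg M u - Dg N0 u)) <= r ^ rho * ts ^ rho).
    { rewrite Cmod_mult, Cmod_pow. apply Rle_trans with (Cmod u ^ rho * 1).
      - apply Rmult_le_compat_l; [apply pow_le; auto | ]. apply (Htail i0 Hj).
      - rewrite Rmult_1_r, <- Rpow_mult_distr. apply pow_incr. split; auto. lra. }
    assert (T2 : Cmod (csum (fun n => (u * csum (fun i => RtoC (INR (S n)) ^ i * u ^ (rho - 1 - 1 - i)) (rho - 1)))%C N0) <= r ^ rho * (INR rho * (2 * ts + 1) ^ rho)).
    { eapply Rle_trans.
      - apply Cmod_csum_le with (g := fun _ => INR N0 * (INR (rho - 1) * INR N0 ^ (rho - 2))). intros n Hn.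
        rewrite Cmod_mult. apply Rmult_le_compat; auto using Cmod_ge_0. rewrite <- rsum_const.
        apply Cmod_csum_le. intros i Hi. rewrite Cmod_mult, !Cmod_pow, Cmod_RtoC_pos by apply pos_INR.
        replace (INR N0 ^ (rho - 2)) with (INR N0 ^ i * INR N0 ^ (rho - 1 - 1 - i)) by (rewrite <- pow_add; f_equal; lia).
        apply Rmult_le_compat; try (apply pow_le; auto; apply pos_INR).
        + apply pow_incr. split; [apply pos_INR | apply le_INR; lia].
        + apply pow_incr. split; auto.
      - rewrite rsum_const.
        replace (INR N0 * (INR N0 * (INR (rho - 1) * INR N0 ^ (rho - 2)))) with (INR (rho - 1) * INR N0 ^ rho).
        2: { replace rho with (S (S (rho - 2))) at 2 by lia. simpl. ring. }
        replace (r ^ rho * (INR rho * (2 * ts + 1) ^ rho)) with (INR rho * ((2 * ts + 1) * r) ^ rho) by (rewrite Rpow_mult_distr; ring).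
        apply Rmult_le_compat; [apply pos_INR | apply pow_le; lra | apply le_INR; lia | ].
        apply pow_incr. split; [lra | auto]. }
    assert (0 <= r ^ rho * B1 i0) by (apply Rmult_le_pos; [lra | auto]).
    unfold K2. lra.
  - rewrite Rplus_0_r. unfold X. rewrite !Cmod_mult, !Cmod_pow, Cmod_s, Hz by auto.
    apply Rmult_le_compat_l; [lra | ]. unfold B1. apply Rmult_le_compat_l; [apply pow_le; lra | ].
    replace (Dg M (s j * z) - H)%C with ((Dg N0 (s j * z) - H) + (Dg M (s j * z) - Dg N0 (s j * z)))%C by ring.
    eapply Rle_trans; [apply Cmod_triangle | ]. apply Rplus_le_compat; [ | auto].
    rewrite EH.
    apply Rle_trans with (rsum (fun _ => / (c1 * (tau j * r))) N0).
    + apply Cmod_csum_le. intros n _. rewrite Cmod_opp. apply Cmod_inv_le; [repeat apply Rmult_lt_0_compat; lra | ].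
      assert (Haw : away c1 (s j * z)).
      { unfold z. rewrite ray_point by auto. apply away_polar; auto. nra. }
      specialize (Haw (INR (S n)) (pos_INR _)). rewrite Huj in Haw by auto. pose proof (pos_INR (S n)). nra.
    + rewrite rsum_const. apply Rmult_le_reg_r with (c1 * tau j * r); [repeat apply Rmult_lt_0_compat; lra | ].
      replace (INR N0 * / (c1 * (tau j * r)) * (c1 * tau j * r)) with (INR N0) by (field; repeat split; lra).
      replace ((2 * ts + 1) / (c1 * tau j) * (c1 * tau j * r)) with ((2 * ts + 1) * r) by (field; repeat split; lra). auto.
Qed.

Lemma Cmod_n_minus_polar (n x b b' : R) : 0 <= n -> 0 <= x -> cos b' <= cos b ->
  Cmod (RtoC n - RtoC x * cis b) <= Cmod (RtoC n - RtoC x * cis b').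
Proof.
  intros Hn Hx H. apply Rsqr_incr_0_var; [ | apply Cmod_ge_0]. unfold Rsqr. rewrite !Cmod_sqr.
  unfold cis, Re, Im; simpl.
  pose proof (sin2_cos2 b). pose proof (sin2_cos2 b'). unfold Rsqr in *.
  assert (n * x * cos b' <= n * x * cos b) by (apply Rmult_le_compat_l; [nra | auto]).
  assert (x * x * (sin b * sin b + cos b * cos b) = x * x * 1) by (f_equal; lra).
  assert (x * x * (sin b' * sin b' + cos b' * cos b') = x * x * 1) by (f_equal; lra).
  lra.
Qed.

(* Turning away from the ray [i0] increases every [|n - u|] for small [n]; all other factors
   have logarithmic angular derivative [O(r ^ rho)]. *)
Lemma LW_near_ray (c1 : R) : 0 < c1 <= 1 -> exists K, 0 < K /\ forall i0 r phi phi' (M : nat),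
  (i0 < N)%nat -> 1 <= r -> (2 * rsum tau N + 1) * r <= INR M ->
  (forall be j, Rmin phi phi' <= be <= Rmax phi phi' -> (j < N)%nat -> j <> i0 -> cos (be - th j) <= 1 - 2 * c1 ^ 2) ->
  (forall be, Rmin phi phi' <= be <= Rmax phi phi' -> cos (be - th i0) <= cos (phi - th i0)) ->
  (forall n, (n < M)%nat -> (INR (S n) - s i0 * (RtoC r * cis phi))%C <> 0) ->
  LW rho N s c M (RtoC r * cis phi) <= LW rho N s c M (RtoC r * cis phi') + K * r ^ rho * Rabs (phi' - phi).
Proof.
  intros Hc1. destruct (near_ray_derivative_bound c1 Hc1) as [K [HK HB]].
  exists K. split; auto. intros i0 r phi phi' M Hi0 Hr HM Hcos Hmono Hnz.
  assert (Hts : 0 <= rsum tau N) by (apply rsum_nonneg; intros; apply Rlt_le; auto).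
  assert (Hx : 0 < 2 * rsum tau N * r + 1) by nra.
  (* Zeros of index above [N0] satisfy [2 * |u| <= n] on every ray, so [Dg_tail] makes their
     contribution bounded. *)
  assert (HN0 : exists N0 : nat, (0 < N0)%nat /\ 2 * rsum tau N * r <= INR N0 /\ INR N0 <= 2 * rsum tau N * r + 1).
  { destruct (archimed (2 * rsum tau N * r)) as [A1 A2]. exists (Z.to_nat (up (2 * rsum tau N * r))).
    assert (0 < up (2 * rsum tau N * r))%Z by (apply lt_IZR; nra).
    rewrite INR_IZR_INZ, Z2Nat.id by lia. split; [lia | lra]. }
  destruct HN0 as [N0 [HN0 [HN1 HN2]]].
  assert (HN0M : (N0 <= M)%nat) by (apply INR_le; nra).
  assert (Htp := Htau i0 Hi0).
  set (x := fun be => (RtoC r * cis be)%C).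
  assert (Hz' : forall be n, Rmin phi phi' <= be <= Rmax phi phi' -> (n < M)%nat -> (INR (S n) - s i0 * x be)%C <> 0).
  { intros be n Hbe Hn. specialize (Hnz n Hn). apply Cmod_nz in Hnz. apply Cmod_pos_nz.
    eapply Rlt_le_trans; [exact Hnz | ]. unfold x. rewrite !ray_point by auto.
    apply Cmod_n_minus_polar; [apply pos_INR | nra | apply Hmono; auto]. }
  assert (Hnzall : forall be j n, Rmin phi phi' <= be <= Rmax phi phi' -> (j < N)%nat -> (n < M)%nat -> (INR (S n) - s j * x be)%C <> 0).
  { intros be j n Hbe Hj Hn. destruct (Nat.eq_dec j i0) as [-> | Hne]; [now apply Hz' | ].
    assert (Htj := Htau j Hj).
    unfold x. rewrite ray_point by auto. apply (away_nz c1); [lra | | apply pos_INR | ].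
    - apply away_polar; [auto | nra | apply Hcos; auto].
    - apply Cmod_pos_nz. rewrite Cmod_mult, Cmod_cis, Cmod_RtoC_pos; nra. }
  set (sg := fun be => rsum (fun n => INR (S n) ^ (rho - 1) * ln (Cmod (1 - s i0 * x be / INR (S n)))) N0).
  set (F := fun be => LW rho N s c M (x be) - sg be).
  set (F' := fun be => Re (Ci * (x be ^ rho * (INR rho * c + SW rho N s M (x be)) +
        csum (fun n => RtoC (INR (S n) ^ (rho - 1)) * ((s i0 * x be) / (INR (S n) - s i0 * x be))) N0))%C).
  assert (Hd : forall be, Rmin phi phi' <= be <= Rmax phi phi' -> is_derive F be (F' be)).
  { intros be Hbe. unfold F, F', sg.
    assert (Hcx : cderiv x be (Ci * x be)).
    { unfold x. eapply cderiv_val; [ | apply cderiv_scal, cderiv_cis]. ring. }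
    eapply is_derive_val.
    2: { apply is_derive_Rminus.
         - apply (LW_derive rho N s c M x be (Ci * x be)); [lia | auto | exact Hcx].
         - apply (is_derive_rsum (fun n be => INR (S n) ^ (rho - 1) * ln (Cmod (1 - s i0 * x be / INR (S n)))) be
             (fun n => INR (S n) ^ (rho - 1) * Re (- (s i0 * (Ci * x be)) / (INR (S n) - s i0 * x be))%C)).
           intros n Hn. apply (is_derive_scal (fun be => ln (Cmod (1 - s i0 * x be / INR (S n))))).
           apply (eterm_log_derive n (fun be => (s i0 * x be)%C)); [apply Hz'; auto; lia | apply cderiv_scal; exact Hcx]. }
    rewrite (rsum_ext _ (fun n => Re (RtoC (INR (S n) ^ (rho - 1)) * (- (s i0 * (Ci * x be)) / (INR (S n) - s i0 * x be)))%C)) by (intros; now rewrite Re_RtoC_mult).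
    rewrite <- Re_csum, <- Re_minus. f_equal.
    rewrite (csum_ext _ (fun n => (- Ci * (RtoC (INR (S n) ^ (rho - 1)) * ((s i0 * x be) / (INR (S n) - s i0 * x be))))%C)).
    2: { intros n Hn. field. apply Hz'; auto; lia. }
    rewrite csum_scal. destruct rho as [ | r0]; [lia | ]. replace (S r0 - 1)%nat with r0 by lia. rewrite Cpow_S. ring. }
  assert (Hbd : forall be, Rmin phi phi' <= be <= Rmax phi phi' -> Rabs (F' be) <= K * r ^ rho).
  { intros be Hbe. unfold F'. eapply Rle_trans; [apply re_le_Cmod | ]. rewrite Cmod_mult, Cmod_Ci, Rmult_1_l.
    apply HB; auto; try nra.
    intros n Hn. apply Hz'; auto; lia. }
  assert (HF : Rabs (F phi' - F phi) <= K * r ^ rho * Rabs (phi' - phi)).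
  { destruct (Rle_lt_dec phi phi') as [Hle | Hlt].
    - rewrite Rmin_left, Rmax_right in * by lra. rewrite (Rabs_right (phi' - phi)) by lra.
      apply (MVT_abs F F'); auto.
    - rewrite Rmin_right, Rmax_left in * by lra. rewrite (Rabs_left (phi' - phi)) by lra.
      rewrite Rabs_minus_sym. replace (- (phi' - phi)) with (phi - phi') by ring.
      apply (MVT_abs F F'); auto; lra. }
  assert (Hpp : Rmin phi phi' <= phi <= Rmax phi phi') by (split; [apply Rmin_l | apply Rmax_l]).
  assert (Hpp' : Rmin phi phi' <= phi' <= Rmax phi phi') by (split; [apply Rmin_r | apply Rmax_r]).
  assert (Hsg : sg phi <= sg phi').
  { unfold sg. apply rsum_le. intros n Hn. apply Rmult_le_compat_l; [apply pow_le, pos_INR | ].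
    assert (Hn' : (n < M)%nat) by lia. assert (Hp1 := Hz' phi n Hpp Hn'). assert (Hp2 := Hz' phi' n Hpp' Hn').
    rewrite !Cdiv_one_minus, !Cmod_div by apply INR_S_nz.
    assert (HI : 0 < Cmod (INR (S n))) by (apply Cmod_nz, INR_S_nz).
    assert (Hle : Cmod (INR (S n) - s i0 * x phi) <= Cmod (INR (S n) - s i0 * x phi')).
    { unfold x. rewrite !ray_point by auto. apply Cmod_n_minus_polar; [apply pos_INR | nra | apply Hmono; auto]. }
    apply Cmod_nz in Hp1. apply ln_le; [apply Rdiv_lt_0_compat; auto | ].
    apply Rmult_le_compat_r; [apply Rlt_le, Rinv_0_lt_compat; auto | auto]. }
  pose proof (Rle_abs (- (F phi' - F phi))). rewrite Rabs_Ropp in H. unfold F in *. fold (x phi). fold (x phi'). lra.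
Qed.
End Rays.

(** * Entire functions with a prescribed trigonometrically convex majorant *)

Section Indicator.

Variables (rho : nat) (q q1 q2 : R -> R) (nu B th0 : R).
Hypothesis Hrho : (4 <= rho)%nat.
Hypothesis Hq1 : forall t, is_derive q t (q1 t).
Hypothesis Hq2 : forall t, is_derive q1 t (q2 t).
Hypothesis Hper : forall t, q (t + 2 * PI) = q t.
Hypothesis Hper1 : forall t, q1 (t + 2 * PI) = q1 t.
Hypothesis Hnu : 0 < nu.
Hypothesis Hconv : forall t, nu <= q2 t + INR rho ^ 2 * q t.
Hypothesis HB : forall t, Rabs (q t) <= B /\ Rabs (q1 t) <= B.

Let rr := INR rho.

(* [Re (Cq t * z ^ rho)] agrees with [r ^ rho * q] to first order along the ray of direction [t]. *)
Definition Cq (t : R) : C := (cis (- (rr * t)) * (RtoC (q t) - Ci * RtoC (q1 t / rr)))%C.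

(** The sinusoid of frequency [rho] that touches [q] at [t] to first order. *)
Definition Tan (t x : R) : R := q t * cos (rr * (x - t)) + q1 t / rr * sin (rr * (x - t)).

Lemma rr_pos : 4 <= rr.
Proof. unfold rr. apply (le_INR 4) in Hrho. simpl in Hrho. lra. Qed.

Lemma Cq_Tan (t x : R) : Re (Cq t * cis (rr * x))%C = Tan t x.
Proof.
  unfold Cq. replace (cis (- (rr * t)) * (RtoC (q t) - Ci * RtoC (q1 t / rr)) * cis (rr * x))%C
    with ((RtoC (q t) - Ci * RtoC (q1 t / rr)) * cis (- (rr * t) + rr * x))%C by (rewrite cis_plus; ring).
  replace (- (rr * t) + rr * x) with (rr * (x - t)) by ring.
  unfold Tan, cis, Re; simpl. ring.
Qed.

(** When the contact point moves, the cosine terms cancel and only the density [q'' + rho^2 q] of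
    trigonometric convexity remains. *)
Lemma Tan_derive (x t : R) : is_derive (fun y => Tan y x) t ((q2 t + rr ^ 2 * q t) / rr * sin (rr * (x - t))).
Proof.
  assert (Hr := rr_pos). unfold Tan.
  assert (Hc : is_derive (fun y => cos (rr * (x - y))) t (rr * sin (rr * (x - t)))) by (auto_derive; auto; unfold Rminus; ring).
  assert (Hs : is_derive (fun y => sin (rr * (x - y))) t (- rr * cos (rr * (x - t)))) by (auto_derive; auto; unfold Rminus; ring).
  assert (Hq' : is_derive (fun y => q1 y / rr) t (q2 t / rr)).
  { apply is_derive_ext with (fun y => / rr * q1 y); [intros y; apply Rmult_comm | ].
    eapply is_derive_val; [ | apply (is_derive_scal q1 t (/ rr)); apply Hq2]. unfold Rdiv. change mult with Rmult. ring. }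
  eapply is_derive_val; [ | apply is_derive_Rplus; [apply (is_derive_Rmult q _ t _ _ (Hq1 t) Hc) | apply (is_derive_Rmult _ _ t _ _ Hq' Hs)]].
  field. lra.
Qed.

(** Let the contact point run from [t] to [x]. By [Tan_derive] the value at [x] rises to [q x], at
    least as fast as [nu / rr^2 * cos (rr * (x - y))] does, as long as the sine keeps its sign, that
    is within [PI / rr]. *)
Lemma tan_gap (t x : R) : Rabs (x - t) <= PI / rr -> nu / rr ^ 2 * (1 - cos (rr * (x - t))) <= q x - Tan t x.
Proof.
  intros Hx. assert (Hr := rr_pos). assert (HPI := PI_RGT_0).
  apply Rabs_le_between in Hx.
  assert (Hbnd : - PI <= rr * (x - t) <= PI).
  { split.
    - replace (- PI) with (rr * (- (PI / rr))) by (field; lra). apply Rmult_le_compat_l; lra.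
    - replace PI with (rr * (PI / rr)) by (field; lra). apply Rmult_le_compat_l; lra. }
  set (f := fun y => Tan y x - nu / rr ^ 2 * cos (rr * (x - y))).
  assert (Hf : forall y, is_derive f y ((q2 y + rr ^ 2 * q y - nu) / rr * sin (rr * (x - y)))).
  { intros y. unfold f. eapply is_derive_val; [ | apply is_derive_Rminus; [apply Tan_derive | ]].
    2: { apply (is_derive_scal (fun y => cos (rr * (x - y))) y (nu / rr ^ 2)). instantiate (1 := rr * sin (rr * (x - y))).
         auto_derive; auto; unfold Rminus; ring. }
    change mult with Rmult. field. lra. }
  assert (Hpos : forall y, 0 <= (q2 y + rr ^ 2 * q y - nu) / rr).
  { intros y. apply Rdiv_le_0_compat; [ | lra]. specialize (Hconv y). fold rr in Hconv. lra. }
  assert (Hfx : f x = q x - nu / rr ^ 2).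
  { unfold f, Tan. replace (x - x) with 0 by ring. rewrite Rmult_0_r, cos_0, sin_0. ring. }
  assert (Hge : f t <= f x).
  { destruct (Rle_lt_dec t x) as [Hle | Hlt].
    - assert (H := MVT_upper (fun y => - f y) (fun y => - ((q2 y + rr ^ 2 * q y - nu) / rr * sin (rr * (x - y)))) t x 0 Hle).
      assert (- f x - - f t <= 0 * (x - t)); [ | lra]. apply H.
      + intros y _. apply (is_derive_opp f). apply Hf.
      + intros y Hy. assert (0 <= sin (rr * (x - y))).
        { apply sin_ge_0; [nra | ]. apply Rle_trans with (rr * (x - t)); [ | lra]. nra. }
        specialize (Hpos y). nra.
    - assert (H := MVT_upper f (fun y => (q2 y + rr ^ 2 * q y - nu) / rr * sin (rr * (x - y))) x t 0 ltac:(lra)).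
      assert (f t - f x <= 0 * (t - x)); [ | lra]. apply H.
      + intros y _. apply Hf.
      + intros y Hy. assert (0 <= sin (rr * (y - x))).
        { apply sin_ge_0; [nra | ]. apply Rle_trans with (rr * (t - x)); nra. }
        replace (rr * (x - y)) with (- (rr * (y - x))) by ring. rewrite sin_neg.
        specialize (Hpos y). nra. }
  rewrite Hfx in Hge. unfold f in Hge. lra.
Qed.

Lemma tan_le (t x : R) : Rabs (x - t) <= PI / rr -> Tan t x <= q x.
Proof.
  intros Hx. assert (H := tan_gap t x Hx). assert (Hr := rr_pos).
  assert (0 <= nu / rr ^ 2 * (1 - cos (rr * (x - t)))); [ | lra].
  apply Rmult_le_pos; [apply Rdiv_le_0_compat; [lra | apply pow_lt; lra] | ].
  pose proof (COS_bound (rr * (x - t))). lra.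
Qed.

(** A quarter of the period of the sinusoids: the cosine in [tan_gap] vanishes at this distance, and
    [4 * rho] steps make a full turn. *)
Let hh := PI / (2 * rr).
Let tt (i : nat) := th0 + INR i * hh.

Lemma hh_pos : 0 < hh.
Proof. assert (Hr := rr_pos). assert (HPI := PI_RGT_0). unfold hh. apply Rdiv_lt_0_compat; lra. Qed.

Lemma hh_le : hh <= PI / rr.
Proof.
  assert (Hr := rr_pos). assert (HPI := PI_RGT_0). unfold hh.
  replace (PI / rr) with (2 * (PI / (2 * rr))) by (field; lra).
  assert (0 < PI / (2 * rr)) by (apply Rdiv_lt_0_compat; lra). lra.
Qed.

Lemma tan_lt_step (t x : R) : Rabs (x - t) = hh -> Tan t x < q x.
Proof.
  intros Hx. assert (Hr := rr_pos). assert (HPI := PI_RGT_0). assert (Hl := hh_le).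
  assert (H := tan_gap t x ltac:(lra)).
  assert (Hc : cos (rr * (x - t)) = 0).
  { assert (E : rr * hh = PI / 2) by (unfold hh; field; lra).
    unfold Rabs in Hx. destruct (Rcase_abs (x - t)).
    - replace (rr * (x - t)) with (- (PI / 2)) by (rewrite <- E, <- Hx; ring). rewrite cos_neg. apply cos_PI2.
    - rewrite Hx, E. apply cos_PI2. }
  rewrite Hc in H. assert (0 < nu / rr ^ 2) by (apply Rdiv_lt_0_compat; [lra | apply pow_lt; lra]). lra.
Qed.

(** Each of two neighbouring tangents is the larger one at its own contact point, by the strict gap,
    so they cross in between. At the crossing direction [th] the difference of the exponents is
    [- Ci * d * cis (- rr * th)] with [d > 0], exactly the form of the jump produced by zeros on
    that ray. *)
Lemma ray_exists (i : nat) : exists p : R * R, tt i < fst p < tt (S i) /\ 0 < snd p /\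
  (RtoC rr * (Cq (tt (S i)) - Cq (tt i)))%C = (- (RtoC (2 * PI) * Ci * (RtoC (snd p) * cis (- fst p)) ^ rho))%C.
Proof.
  assert (Hr := rr_pos). assert (HPI := PI_RGT_0). assert (Hh := hh_pos).
  set (a := tt i). set (b := tt (S i)). assert (Eb : b = a + hh) by (unfold a, b, tt; rewrite S_INR; ring).
  set (D := (Cq b - Cq a)%C).
  set (m := fun x => Re (D * cis (rr * x))%C).
  assert (Hm : forall x, m x = Tan b x - Tan a x).
  { intros x. unfold m, D. rewrite <- !Cq_Tan, <- Re_minus. f_equal. ring. }
  assert (Hma : m a < 0).
  { rewrite Hm. assert (Tan b a < q a) by (apply tan_lt_step; rewrite Eb, Rabs_left; lra).
    assert (Tan a a = q a); [ | lra]. unfold Tan. replace (a - a) with 0 by ring. rewrite Rmult_0_r, cos_0, sin_0. ring. }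
  assert (Hmb : 0 < m b).
  { rewrite Hm. assert (Tan a b < q b) by (apply tan_lt_step; rewrite Eb, Rabs_right; lra).
    assert (Tan b b = q b); [ | lra]. unfold Tan. replace (b - b) with 0 by ring. rewrite Rmult_0_r, cos_0, sin_0. ring. }
  assert (Hcont : continuity m).
  { intros x. apply derivable_continuous_pt.
    assert (Hd : is_derive m x (Re (D * (Ci * RtoC rr * cis (rr * x)))%C)).
    { assert (H : cderiv (fun y => cis (rr * y)) x (Ci * RtoC rr * cis (rr * x))).
      { split; unfold cis, Re, Im; simpl; auto_derive; auto; ring. }
      destruct (cderiv_scal D _ _ _ H) as [H1 _]. exact H1. }
    exists (Re (D * (Ci * RtoC rr * cis (rr * x)))%C). now apply is_derive_Reals. }
  destruct (IVT_gen m a b 0 Hcont) as [th [Hth Eth]].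
  { rewrite Rmin_left, Rmax_right by lra. lra. }
  rewrite Rmin_left, Rmax_right in Hth by lra.
  assert (Hth' : a < th < b).
  { split; destruct Hth as [[H1 | H1] [H2 | H2]]; try lra; subst; lra. }
  set (d := - Im (D * cis (rr * th))%C).
  assert (ED : (D * cis (rr * th))%C = (- Ci * RtoC d)%C).
  { apply C_eq; [unfold m in Eth; rewrite Eth | unfold d]; unfold Re, Im; simpl; ring. }
  assert (Ed : m b = d * sin (rr * (b - th))).
  { unfold m. replace (rr * b) with (rr * th + rr * (b - th)) by ring. rewrite cis_plus.
    replace (D * (cis (rr * th) * cis (rr * (b - th))))%C with (D * cis (rr * th) * cis (rr * (b - th)))%C by ring.
    rewrite ED. unfold cis, Re; simpl. ring. }
  assert (Hsin : 0 < sin (rr * (b - th))).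
  { apply sin_gt_0; [apply Rmult_lt_0_compat; lra | ].
    apply Rlt_trans with (rr * hh); [apply Rmult_lt_compat_l; lra | ]. unfold hh.
    replace (rr * (PI / (2 * rr))) with (PI / 2) by (field; lra). lra. }
  assert (Hd : 0 < d).
  { rewrite Ed in Hmb. apply Rmult_lt_reg_r with (sin (rr * (b - th))); lra. }
  (* Solves [rr * d = 2 * PI * tau^rho], whence the root of order [rho] in the witness. *)
  set (sg := rr * d / (2 * PI)). assert (Hsg : 0 < sg) by (unfold sg; apply Rdiv_lt_0_compat; nra).
  exists (th, Rpower sg (/ rr)). simpl fst. simpl snd. split; [auto | split; [apply exp_pos | ]].
  assert (Ep : Rpower sg (/ rr) ^ rho = sg).
  { rewrite <- Rpower_pow by apply exp_pos. rewrite Rpower_mult. fold rr. replace (/ rr * rr) with 1 by (field; lra).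
    now apply Rpower_1. }
  rewrite Cpow_mult_l, <- RtoC_pow, Ep, cis_pow. fold rr. fold D.
  replace (rr * - th) with (- (rr * th)) by ring.
  assert (EDD : D = (- Ci * RtoC d * cis (- (rr * th)))%C).
  { replace D with (D * cis (rr * th) * cis (- (rr * th)))%C; [now rewrite ED | ].
    replace (D * cis (rr * th) * cis (- (rr * th)))%C with (D * (cis (- (rr * th)) * cis (rr * th)))%C by ring.
    rewrite cis_opp_mult. ring. }
  rewrite EDD. replace (RtoC d) with (RtoC (2 * PI) * RtoC sg / RtoC rr)%C.
  2: { unfold sg. rewrite <- RtoC_mult, <- RtoC_div by lra. apply RtoC_inj_eq. field. lra. }
  field. apply RtoC_nz; lra.
Qed.

Lemma finite_min (P : nat -> R -> Prop) (n : nat) :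
  (forall j, (j < n)%nat -> exists k, 0 < k /\ P j k) -> (forall j k k', P j k -> 0 < k' <= k -> P j k') ->
  exists k, 0 < k <= 1 /\ forall j, (j < n)%nat -> P j k.
Proof.
  intros H Hm. induction n.
  - exists 1. split; [lra | intros; lia].
  - destruct IHn as [k [Hk HP]]; [intros; apply H; lia | ].
    destruct (H n ltac:(lia)) as [k' [Hk' HP']].
    exists (Rmin k k'). assert (0 < Rmin k k') by (apply Rmin_glb_lt; lra).
    assert (Rmin k k' <= k) by apply Rmin_l. assert (Rmin k k' <= k') by apply Rmin_r.
    split; [lra | ]. intros j Hj. destruct (Nat.eq_dec j n) as [-> | Hne].
    + apply Hm with k'; auto.
    + apply Hm with k; [apply HP; lia | lra].
Qed.

Lemma cos_le_arc (x g : R) : 0 < g -> g <= x <= 2 * PI - g -> cos x <= cos g.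
Proof.
  intros Hg Hx. assert (HPI := PI_RGT_0). destruct (Rle_lt_dec x PI).
  - apply cos_decr_1; lra.
  - replace (cos x) with (cos (2 * PI - x)).
    + apply cos_decr_1; lra.
    + rewrite cos_minus, cos_2PI, sin_2PI. ring.
Qed.

Lemma cos_gt_cases (x b : R) : 0 < b < PI -> - (2 * PI) <= x < 2 * PI -> cos b < cos x ->
  exists k : Z, - b < x - IZR k * (2 * PI) < b.
Proof.
  intros Hb Hx H. assert (HPI := PI_RGT_0).
  destruct (Rlt_le_dec x 0) as [Hn | Hn].
  - rewrite <- (cos_neg x) in H.
    destruct (Rlt_le_dec (- x) b); [exists 0%Z; lra | ].
    destruct (Rlt_le_dec (2 * PI - b) (- x)); [exists (-1)%Z; lra | ].
    assert (cos (- x) <= cos b) by (apply cos_le_arc; lra). lra.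
  - destruct (Rlt_le_dec x b); [exists 0%Z; lra | ].
    destruct (Rlt_le_dec (2 * PI - b) x); [exists 1%Z; lra | ].
    assert (cos x <= cos b) by (apply cos_le_arc; lra). lra.
Qed.

Lemma cis_period_Z (k : Z) (x : R) : cis (x - IZR k * (2 * PI)) = cis x.
Proof.
  replace (x - IZR k * (2 * PI)) with (x + - (IZR k * (2 * PI))) by ring. rewrite cis_plus.
  assert (H : forall n : nat, cis (INR n * (2 * PI)) = 1) by (intros n; rewrite Rmult_comm; apply cis_2PI_nat).
  replace (cis (- (IZR k * (2 * PI)))) with (RtoC 1); [ring | ].
  destruct (Z_le_gt_dec 0 k) as [Hk | Hk].
  - specialize (H (Z.to_nat k)). rewrite INR_IZR_INZ, Z2Nat.id in H by lia.
    assert (E := cis_opp_mult (IZR k * (2 * PI))). rewrite H in E. rewrite <- E. ring.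
  - specialize (H (Z.to_nat (- k))). rewrite INR_IZR_INZ, Z2Nat.id, opp_IZR in H by lia.
    rewrite <- H. f_equal. ring.
Qed.

(** Split at [r = A / e]: above it the higher power dominates, below it the left side is bounded. *)
Lemma absorb_power (A e : R) (n : nat) : 0 <= A -> 0 < e -> exists K, 0 <= K /\ forall r, 0 <= r -> A * r ^ n <= e * r ^ S n + K.
Proof.
  intros HA He. exists (A * (A / e) ^ n).
  assert (0 <= A / e) by (apply Rdiv_le_0_compat; auto).
  split; [apply Rmult_le_pos; [auto | apply pow_le; auto] | ]. intros r Hr.
  assert (Hrn : 0 <= r ^ n) by (apply pow_le; auto).
  assert (H1 : 0 <= A * (A / e) ^ n) by (apply Rmult_le_pos; [auto | apply pow_le; auto]).
  destruct (Rle_lt_dec r (A / e)).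
  - assert (A * r ^ n <= A * (A / e) ^ n) by (apply Rmult_le_compat_l; auto; apply pow_incr; lra).
    assert (0 <= e * r ^ S n) by (apply Rmult_le_pos; [lra | apply pow_le; auto]). lra.
  - assert (A <= e * r). { apply Rlt_le. apply Rmult_lt_reg_r with (/ e); [apply Rinv_0_lt_compat; auto | ].
      replace (e * r * / e) with r by (field; lra). exact r0. }
    simpl. nra.
Qed.

Lemma q_lipschitz (x y : R) : q x <= q y + B * Rabs (x - y).
Proof.
  assert (HH : forall a b, a <= b -> Rabs (q b - q a) <= B * (b - a)).
  { intros a b Hab. apply (MVT_abs q q1); auto. intros. apply HB. }
  destruct (Rle_lt_dec y x) as [H | H].
  - assert (H1 := HH y x H). rewrite (Rabs_right (x - y)) by lra. pose proof (Rle_abs (q x - q y)). lra.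
  - assert (H1 := HH x y ltac:(lra)). rewrite (Rabs_left (x - y)) by lra. rewrite Rabs_minus_sym in H1.
    pose proof (Rle_abs (q x - q y)). lra.
Qed.

(** The product has its zeros on the [4 * rho] crossing directions of consecutive tangents. Away
    from these rays it grows like the tangent of the sector, hence stays below [q]. Near a ray one
    turns away by a small angle, which costs a small multiple of [r^rho]. The last part concerns the
    contact direction [th0], which lies in sector 0 and at a positive angle from all rays. *)
Lemma indicator_entire : exists W : C -> C, ent W /\ W 0%C = 1 /\
  (forall e, 0 < e -> exists K, forall z, exists phi, z = (RtoC (Cmod z) * cis phi)%C /\
     Cmod (W z) <= exp (Cmod z ^ rho * (q phi + e) + K)) /\
  (exists delta K, 0 < delta <= / 2 /\ 0 < K /\ forall r, 1 <= r ->
     let a := (RtoC r * cis th0)%C in let V := fun z => (W z * Cexp (- (Cq th0 * z ^ rho)))%C in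
     exp (- (K * r ^ (rho - 1))) <= Cmod (V a) /\
     exists v, Cmod v <= K * r ^ (rho - 2) /\ forall w, Cmod w <= delta * r ->
       Cmod (V (a + w)%C) <= Cmod (V a) * exp (Re (v * w)%C + K * r ^ (rho - 3) * Cmod w ^ 2)).
Proof.
  assert (Hr := rr_pos). assert (HPI := PI_RGT_0). assert (HPI3 := PI2_3_2). assert (Hh := hh_pos).
  destruct (functional_choice _ ray_exists) as [pr Hpr].
  set (th := fun i => fst (pr i)). set (tau := fun i => snd (pr i)).
  set (N := (4 * rho)%nat). set (Cv := fun i => Cq (tt i)).
  set (s := fun j => (RtoC (tau j) * cis (- th j))%C).
  set (c := (Cv O - csum (fun j => s j ^ rho * (RtoC (ln (tau j)) - Ci * RtoC (th j))) N / RtoC rr)%C).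
  assert (HN : INR N * hh = 2 * PI).
  { unfold N. rewrite mult_INR. fold rr. simpl INR. unfold hh. field. lra. }
  assert (Hth : forall j, tt j < th j < tt (S j)) by (intros j; apply (Hpr j)).
  assert (Htau : forall j, (j < N)%nat -> 0 < tau j) by (intros j _; apply (Hpr j)).
  assert (HCv : forall j, (j < N)%nat -> (RtoC (INR rho) * (Cv (S j) - Cv j))%C = (- (RtoC (2 * PI) * Ci * s j ^ rho))%C).
  { intros j _. apply (Hpr j). }
  assert (HttN : tt N = th0 + 2 * PI) by (unfold tt; lra).
  assert (HCN : Cv N = Cv O).
  { unfold Cv. rewrite HttN. unfold tt. simpl INR. rewrite Rmult_0_l, Rplus_0_r. unfold Cq. rewrite Hper, Hper1.
    f_equal. replace (- (rr * (th0 + 2 * PI))) with (- (rr * th0) - IZR (Z.of_nat rho) * (2 * PI)).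
    - apply cis_period_Z.
    - rewrite <- INR_IZR_INZ. fold rr. ring. }
  assert (Hs : forall j, (j < N)%nat -> s j = (RtoC (tau j) * cis (- th j))%C) by reflexivity.
  assert (Hc : (RtoC (INR rho) * c)%C = (RtoC (INR rho) * Cv O - csum (fun j => s j ^ rho * (RtoC (ln (tau j)) - Ci * RtoC (th j))) N)%C).
  { unfold c. fold rr. field. apply RtoC_nz; lra. }
  assert (HNp : (0 < N)%nat) by (unfold N; lia).
  assert (Htt : forall i j, (i <= j)%nat -> tt i <= tt j).
  { intros i j Hij. apply le_INR in Hij. unfold tt. nra. }
  assert (Hlt : forall i j, (i < j)%nat -> th i < th j).
  { intros i j Hij. assert (H1 := Hth i). assert (H2 := Hth j). assert (tt (S i) <= tt j) by (apply Htt; lia). lra. }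
  assert (Hthr : forall j, (j < N)%nat -> th0 < th j < th0 + 2 * PI).
  { intros j Hj. assert (H1 := Hth j). assert (tt (S j) <= tt N) by (apply Htt; lia). assert (tt O <= tt j) by (apply Htt; lia).
    unfold tt in H0 at 1. simpl INR in H0. lra. }
  (* The second condition measures the gap across the end of the turn, from ray [j] to the next copy
     of the first ray. *)
  assert (Hgap : exists g, 0 < g <= 1 /\ forall j l, (j < l)%nat -> (l < N)%nat -> g <= th l - th j <= 2 * PI - g).
  { destruct (finite_min (fun j k => (forall l, (j < l)%nat -> (l < N)%nat -> k <= th l - th j) /\ k <= th 0%nat + 2 * PI - th j) N) as [g [Hg HP]].
    - intros j Hj. exists (Rmin (th (S j) - th j) (th 0%nat + 2 * PI - th j)). split.
      + apply Rmin_glb_lt; [pose proof (Hlt j (S j) ltac:(lia)); lra | ].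
        pose proof (Hthr j Hj). pose proof (Hthr O HNp). lra.
      + split; [ | apply Rmin_r]. intros l Hjl Hl. eapply Rle_trans; [apply Rmin_l | ].
        destruct (Nat.eq_dec l (S j)) as [-> | Hne]; [lra | ]. pose proof (Hlt (S j) l ltac:(lia)). lra.
    - intros j k k' [H1 H2] Hk. split; [intros l Hl Hl'; specialize (H1 l Hl Hl'); lra | lra].
    - exists g. split; auto. intros j l Hjl Hl. split; [apply (HP j ltac:(lia)); auto | ].
      destruct (HP l Hl) as [_ H2]. assert (th 0%nat <= th j).
      { destruct j; [lra | apply Rlt_le, Hlt; lia]. }
      lra. }
  destruct Hgap as [g [Hg Hgap]].
  assert (Hg2 : forall j l, (j < N)%nat -> (l < N)%nat -> j <> l ->
     forall y, - (g / 2) <= y <= g / 2 -> g / 2 <= Rabs (th j + y - th l) <= 2 * PI - g / 2).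
  { intros j l Hj Hl Hne y Hy. destruct (lt_dec j l) as [Hjl | Hjl].
    - pose proof (Hgap j l Hjl Hl). rewrite Rabs_left by lra. lra.
    - pose proof (Hgap l j ltac:(lia) Hj). rewrite Rabs_right by lra. lra. }
  assert (Hcosabs : forall x, cos (Rabs x) = cos x).
  { intros x. unfold Rabs. destruct (Rcase_abs x); [apply cos_neg | reflexivity]. }
  destruct (Wlimit_exists rho N s c ltac:(lia)) as [W [HW [HW0 HWl]]].
  exists W. split; [auto | split; [auto | split]].
  - intros e He.
    (* Then [1 - 2 * c1^2 = cos (g / 2)]: within [g / 2] of one ray, all the others are at angle at
       least [g / 2]. *)
    set (c1 := sin (g / 4)).
    assert (Hc1 : 0 < c1 <= 1) by (unfold c1; split; [apply sin_gt_0; lra | apply SIN_bound]).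
    assert (Ec1 : 1 - 2 * c1 ^ 2 = cos (g / 2)).
    { replace (g / 2) with (2 * (g / 4)) by field. rewrite cos_2a_sin. unfold c1. simpl. ring. }
    destruct (LW_near_ray rho N s tau th Cv c Hrho Hs Htau HCv HCN Hc c1 Hc1) as [K2 [HK2 HNR]].
    assert (HB0 : 0 <= B) by (eapply Rle_trans; [apply Rabs_pos | apply (HB 0)]).
    (* Turning by [be] costs at most [(B + K2) * be * r^rho], with [B] for the variation of [q] and
       [K2] for that of the product. One half of [e] pays for this, the other half absorbs the
       lower-order error [K3 * r^(rho - 1)]. *)
    set (be := Rmin (g / 2) (e / 2 / (B + K2))).
    assert (Hbe : 0 < be) by (apply Rmin_glb_lt; [lra | apply Rdiv_lt_0_compat; lra]).
    assert (Hbe1 : be <= g / 2) by apply Rmin_l.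
    assert (Hbe2 : (B + K2) * be <= e / 2).
    { apply Rle_trans with ((B + K2) * (e / 2 / (B + K2))); [apply Rmult_le_compat_l; [lra | apply Rmin_r] | right; field; lra]. }
    set (cb := sin (be / 2)).
    assert (Hcb : 0 < cb <= 1) by (unfold cb; split; [apply sin_gt_0; lra | apply SIN_bound]).
    assert (Ecb : 1 - 2 * cb ^ 2 = cos be).
    { unfold cb. assert (E := cos_2a_sin (be / 2)). replace (2 * (be / 2)) with be in E by field. rewrite E. simpl. ring. }
    destruct (LW_radial rho N s tau th Cv c Hrho Hs Htau HCv HCN Hc cb Hcb) as [K3 [HK3 HRad]].
    destruct (absorb_power K3 (e / 2) (rho - 1)) as [K4 [HK4 Habs]]; [lra | lra | ].
    replace (S (rho - 1)) with rho in Habs by lia.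
    destruct (ent_bounded W 1 HW) as [M0 [HM0 HWM]].
    exists (K4 + Rabs (ln M0) + B + e).
    (* With the window starting one turn before the last ray, every direction off the rays lies in a
       sector of index below [N]. *)
    intros z. destruct (polar z (th (N - 1)%nat - 2 * PI)) as [phi [Hphi Hz]].
    set (r := Cmod z) in *. assert (Hr0 : 0 <= r) by apply Cmod_ge_0.
    assert (HBq : forall t, - B <= q t <= B).
    { intros t. apply Rabs_le_between. apply HB. }
    destruct (Rle_lt_dec 1 r) as [Hr1 | Hr1].
    2: { exists phi. split; auto. eapply Rle_trans; [apply HWM; fold r; lra | ].
         rewrite <- (exp_ln M0) at 1 by auto. apply exp_le.
         assert (0 <= r ^ rho <= 1) by (split; [apply pow_le; auto | apply pow_le_1; lra]).
         pose proof (HBq phi). pose proof (Rle_abs (ln M0)). nra. }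
    assert (Hrr : 0 < r ^ rho) by (apply pow_lt; lra).
    (* The limit is bounded through the truncated products: where one of them vanishes the bound is
       trivial, elsewhere its modulus is [exp] of [LW]. *)
    assert (Hred : forall phi', z = (RtoC r * cis phi')%C ->
       (exists n0, forall M, (n0 <= M)%nat -> Wprod rho N s c M z <> 0 -> LW rho N s c M z <= r ^ rho * (q phi' + e) + K4) ->
       exists phi0, z = (RtoC r * cis phi0)%C /\ Cmod (W z) <= exp (r ^ rho * (q phi0 + e) + (K4 + Rabs (ln M0) + B + e))).
    { intros phi' Hz' [n0 Hn0]. exists phi'. split; auto.
      apply (cvg_Cmod_le0 (fun M => Wprod rho N s c M z)); auto. exists n0. intros M HM.
      destruct (Req_dec (Cmod (Wprod rho N s c M z)) 0) as [E | E].
      - rewrite E. apply Rlt_le, exp_pos.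
      - assert (Hnz : Wprod rho N s c M z <> 0) by (intro E'; apply E; rewrite E'; apply Cmod_0).
        rewrite Cmod_Wprod.
        + apply exp_le. specialize (Hn0 M HM Hnz). pose proof (Rabs_pos (ln M0)). lra.
        + intros j i Hj Hi E'. apply Hnz. apply (Wprod_zero rho N s c M z i j); auto. }
    assert (Hsecval : forall i x, (i <= N)%nat -> Rabs (x - tt i) <= hh -> Re (Cv i * (RtoC r * cis x) ^ rho)%C <= r ^ rho * q x).
    { intros i x Hi Hx. rewrite Cpow_mult_l, <- RtoC_pow, cis_pow. fold rr.
      replace (Cv i * (RtoC (r ^ rho) * cis (rr * x)))%C with (RtoC (r ^ rho) * (Cv i * cis (rr * x)))%C by ring.
      rewrite Re_RtoC_mult. unfold Cv. rewrite Cq_Tan. apply Rmult_le_compat_l; [lra | ]. apply tan_le.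
      pose proof hh_le. lra. }
    destruct (exists_nat_large (r ^ 2 + (2 * rsum tau N + 1) * r)) as [n0 [Hn0 Hn0']].
    assert (Hts : 0 <= rsum tau N) by (apply rsum_nonneg; intros; apply Rlt_le; auto).
    assert (HMr : forall M, (n0 <= M)%nat -> (0 < M)%nat /\ r ^ 2 <= INR M /\ (2 * rsum tau N + 1) * r <= INR M).
    { intros M HM. split; [lia | ]. apply le_INR in HM. assert (0 <= r ^ 2) by (apply pow_le; lra).
      assert (0 <= (2 * rsum tau N + 1) * r) by nra. lra. }
    destruct (Classical_Prop.classic (exists j, (j < N)%nat /\ cos be < cos (phi - th j))) as [[j [Hj Hnear]] | Hfar].
    + assert (Hthj := Hthr j Hj). assert (HthN := Hthr (N - 1)%nat ltac:(lia)).
      assert (Hjle : th j <= th (N - 1)%nat).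
      { destruct (Nat.eq_dec j (N - 1)) as [-> | Hne]; [lra | apply Rlt_le, Hlt; lia]. }
      destruct (cos_gt_cases (phi - th j) be) as [k Hk]; [lra | lra | auto | ].
      set (y := phi - th j - IZR k * (2 * PI)) in *.
      assert (Hzy : z = (RtoC r * cis (th j + y))%C).
      { rewrite Hz. f_equal. rewrite <- (cis_period_Z k phi). f_equal. unfold y. ring. }
      apply (Hred (th j + y) Hzy). exists n0. intros M HM Hnz.
      destruct (HMr M HM) as [HM1 [HM2 HM3]].
      (* The turn goes to the side of the ray on which the direction already lies, so that the
         distances to its zeros increase; [i] is the sector entered. *)
      set (y' := if Rle_dec 0 y then be else - be).
      set (i := if Rle_dec 0 y then S j else j).
      assert (Hsec : in_sector N th i (th j + y')).
      { unfold i, y'. destruct (Rle_dec 0 y).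
        - split; [lia | ]. intros l Hl. split; intros Hli.
          + destruct (Nat.eq_dec l j) as [-> | Hne]; [lra | ]. pose proof (Hgap l j ltac:(lia) Hj). lra.
          + pose proof (Hgap j l ltac:(lia) Hl). lra.
        - split; [lia | ]. intros l Hl. split; intros Hli.
          + pose proof (Hgap l j ltac:(lia) Hj). lra.
          + destruct (Nat.eq_dec l j) as [-> | Hne]; [lra | ]. pose proof (Hgap j l ltac:(lia) Hl). lra. }
      assert (Hy' : Rabs y' = be) by (unfold y'; destruct (Rle_dec 0 y); [rewrite Rabs_right | rewrite Rabs_left]; lra).
      assert (Hy'2 : - be <= y' <= be) by (apply Rabs_le_between; lra).
      assert (Hoff : off_rays N th cb (th j + y')).
      { intros l Hl. rewrite Ecb. destruct (Nat.eq_dec l j) as [-> | Hne].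
        - replace (th j + y' - th j) with y' by ring. rewrite <- (Hcosabs y'), Hy'. lra.
        - rewrite <- Hcosabs. apply cos_le_arc; auto. pose proof (Hg2 j l Hj Hl ltac:(auto) y' ltac:(lra)). lra. }
      assert (Hrd := HRad i (th j + y') r M Hsec Hoff ltac:(lra) HM1 HM2).
      assert (Hval : Re (Cv i * (RtoC r * cis (th j + y')) ^ rho)%C <= r ^ rho * q (th j + y')).
      { apply Hsecval; [apply Hsec | ]. assert (Hj1 := Hth j).
        (* Neighbouring rays are less than [2 * hh] apart and [be] is at most half of the smallest
           gap; hence the new direction stays within [hh] of the contact point of its sector. *)
        assert (Hbh : be <= hh).
        { destruct (Nat.eq_dec j (N - 1)) as [-> | Hne].
          - assert (HH : th (N - 1)%nat - th (N - 2)%nat < 2 * hh).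
            { pose proof (Hth (N - 2)%nat). pose proof (Hth (N - 1)%nat). unfold tt in *. replace (S (N - 1)) with (S (S (N - 2))) in * by (unfold N; lia).
              rewrite !S_INR in *. lra. }
            pose proof (Hgap (N - 2)%nat (N - 1)%nat ltac:(unfold N; lia) ltac:(lia)). lra.
          - assert (HH : th (S j) - th j < 2 * hh).
            { pose proof (Hth (S j)). unfold tt in *. rewrite !S_INR in *. lra. }
            pose proof (Hgap j (S j) ltac:(lia) ltac:(lia)). lra. }
        unfold i, y'. destruct (Rle_dec 0 y); apply Rabs_le_between; unfold tt in *; rewrite ?S_INR in *; lra. }
      assert (Hpath : forall b, Rmin (th j + y) (th j + y') <= b <= Rmax (th j + y) (th j + y') -> exists u, b = th j + u /\ Rabs y <= Rabs u <= be /\ - be <= u <= be).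
      { intros b Hb. exists (b - th j). split; [ring | ]. unfold y' in *. destruct (Rle_dec 0 y).
        - rewrite Rmin_left, Rmax_right in Hb by lra. rewrite !Rabs_right by lra. lra.
        - rewrite Rmin_right, Rmax_left in Hb by lra. rewrite !Rabs_left by lra. lra. }
      assert (Hnr := HNR j r (th j + y) (th j + y') M Hj Hr1 HM3).
      rewrite Hzy.
      eapply Rle_trans; [apply Hnr | ].
      * intros b l Hb Hl Hne. destruct (Hpath b Hb) as [u [-> [Hu1 Hu2]]]. rewrite Ec1.
        rewrite <- Hcosabs. apply cos_le_arc; [lra | ]. apply Hg2; auto. lra.
      * intros b Hb. destruct (Hpath b Hb) as [u [-> [Hu1 Hu2]]].
        replace (th j + u - th j) with u by ring. replace (th j + y - th j) with y by ring.
        rewrite <- (Hcosabs u), <- (Hcosabs y). pose proof (Rabs_pos y). apply cos_decr_1; lra.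
      * intros n Hn. intro E. apply Hnz. apply (Wprod_zero rho N s c M z n j); auto. rewrite Hzy. exact E.
      * assert (Hql := q_lipschitz (th j + y') (th j + y)).
        replace (th j + y' - (th j + y)) with (y' - y) in * by ring.
        assert (Hyy : Rabs (y' - y) <= be).
        { unfold y'. destruct (Rle_dec 0 y); [rewrite Rabs_right | rewrite Rabs_left1]; lra. }
        apply Rabs_le_between in Hrd. specialize (Habs r Hr0).
        assert (r ^ rho * q (th j + y') <= r ^ rho * (q (th j + y) + B * be)).
        { apply Rmult_le_compat_l; [lra | ]. assert (B * Rabs (y' - y) <= B * be) by (apply Rmult_le_compat_l; auto). lra. }
        assert (K2 * r ^ rho * Rabs (y' - y) <= K2 * r ^ rho * be) by (apply Rmult_le_compat_l; [apply Rmult_le_pos; lra | auto]).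
        assert (r ^ rho * ((B + K2) * be) <= r ^ rho * (e / 2)) by (apply Rmult_le_compat_l; lra).
        lra.
    + assert (Hfar' : forall j, (j < N)%nat -> cos (phi - th j) <= cos be).
      { intros j Hj. apply Rnot_lt_le. intro. apply Hfar. exists j. auto. }
      apply (Hred phi Hz). exists n0. intros M HM Hnz. destruct (HMr M HM) as [HM1 [HM2 HM3]].
      assert (Hi : exists i, (i < N)%nat /\ phi < th i /\ forall j, (j < i)%nat -> th j <= phi).
      { assert (HH : forall n, (n < N)%nat -> phi < th n -> exists i, (i < N)%nat /\ phi < th i /\ forall j, (j < i)%nat -> th j <= phi).
        { induction n as [n IH] using lt_wf_ind. intros Hn Hp.
          destruct n as [ | n]; [exists O; repeat split; auto; intros; lia | ].
          destruct (Rlt_le_dec phi (th n)) as [H1 | H1].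
          - apply (IH n); auto; lia.
          - exists (S n). repeat split; auto. intros j Hj. destruct (Nat.eq_dec j n) as [-> | Hne]; [auto | ].
            pose proof (Hlt j n ltac:(lia)). lra. }
        apply (HH (N - 1)%nat); [lia | lra]. }
      destruct Hi as [i [HiN [Hi1 Hi2]]].
      assert (Hcb1 : cos be < 1).
      { rewrite <- cos_0. apply cos_decreasing_1; lra. }
      assert (Hne : forall j, (j < N)%nat -> phi <> th j /\ phi <> th j - 2 * PI).
      { intros j Hj. pose proof (Hfar' j Hj). split; intro E; rewrite E in H.
        - replace (th j - th j) with 0 in H by ring. rewrite cos_0 in H. lra.
        - replace (th j - 2 * PI - th j) with (- (2 * PI)) in H by ring. rewrite cos_neg, cos_2PI in H. lra. }
      assert (HthN : forall j, (j < N)%nat -> th j <= th (N - 1)%nat).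
      { intros j Hj. destruct (Nat.eq_dec j (N - 1)) as [-> | Hn]; [lra | apply Rlt_le, Hlt; lia]. }
      assert (Hsec : in_sector N th i phi).
      { split; [lia | ]. intros j Hj. destruct (Hne j Hj) as [Hn1 Hn2]. pose proof (HthN j Hj).
        pose proof (Hthr j Hj). pose proof (Hthr (N - 1)%nat ltac:(lia)). split; intros Hji.
        - specialize (Hi2 j Hji). lra.
        - assert (th i <= th j). { destruct (Nat.eq_dec i j) as [-> | Hn]; [lra | apply Rlt_le, Hlt; lia]. }
          lra. }
      assert (Hoff : off_rays N th cb phi) by (intros j Hj; rewrite Ecb; auto).
      rewrite Hz.
      assert (Hrd := HRad i phi r M Hsec Hoff ltac:(lra) HM1 HM2).
      assert (Hval : Re (Cv i * (RtoC r * cis phi) ^ rho)%C <= r ^ rho * q phi).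
      { apply Hsecval; [lia | ]. assert (Hti := Hth i). apply Rabs_le_between.
        destruct i as [ | i].
        - pose proof (Hth (N - 1)%nat). replace (S (N - 1)) with N in H by lia. rewrite HttN in H.
          assert (tt (N - 1)%nat = th0 + 2 * PI - hh).
          { unfold tt. rewrite minus_INR by lia. simpl (INR 1). lra. }
          unfold tt in *. rewrite ?S_INR in *. simpl INR in *. lra.
        - specialize (Hi2 i ltac:(lia)). pose proof (Hth i). unfold tt in *. rewrite ?S_INR in *. lra. }
      apply Rabs_le_between in Hrd. specialize (Habs r Hr0). nra.
  - assert (Hsec0 : in_sector N th 0 th0).
    { split; [lia | ]. intros j Hj. pose proof (Hthr j Hj). split; intros; [lia | lra]. }
    assert (Hc0 : exists c0, 0 < c0 <= 1 /\ off_rays N th c0 th0).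
    { destruct (finite_min (fun j k => cos (th0 - th j) <= 1 - 2 * k ^ 2) N) as [k [Hk HP]].
      - intros j Hj. pose proof (Hthr j Hj).
        set (y := (th j - th0) / 2). exists (sin y).
        split; [apply sin_gt_0; unfold y; lra | ].
        replace (th0 - th j) with (- (2 * y)) by (unfold y; field). rewrite cos_neg, cos_2a_sin. simpl. lra.
      - intros j k k' H Hk. assert (k' ^ 2 <= k ^ 2) by (apply pow_incr; lra). lra.
      - exists k. split; auto. }
    destruct Hc0 as [c0 [Hc0 Hoff0]].
    (* Half of the opening is kept in reserve: displacements of size [c0^2 / 2 * r] leave the point
       off the rays with constant [c1]. *)
    set (c1 := c0 / 2). assert (Hc1 : 0 < c1 <= 1) by (unfold c1; lra).
    assert (Hoff1 : off_rays N th c1 th0).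
    { intros j Hj. specialize (Hoff0 j Hj). unfold c1. simpl in *. nra. }
    destruct (LW_radial rho N s tau th Cv c Hrho Hs Htau HCv HCN Hc c1 Hc1) as [K3 [HK3 HRad]].
    destruct (LW_local rho N s tau th Cv c Hrho Hs Htau HCv HCN Hc c1 Hc1) as [K4 [HK4 HLoc]].
    exists (c0 ^ 2 / 2), (K3 + K4). split; [split; [ | ]; simpl; nra | split; [lra | ]].
    intros r Hr1 a V.
    assert (Hap : Cmod a = r) by (unfold a; rewrite Cmod_mult, Cmod_cis, Cmod_RtoC_pos by lra; ring).
    assert (ECv0 : Cv O = Cq th0) by (unfold Cv, tt; simpl INR; f_equal; ring).
    set (VM := fun M z => (Wprod rho N s c M z * Cexp (- (Cq th0 * z ^ rho)))%C).
    assert (HVl : forall z, cvg (fun M => VM M z) (V z)).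
    { intros z. unfold VM, V. apply cvg_mult; [apply HWl | apply cvg_const]. }
    assert (HVm : forall M z, (forall j i, (j < N)%nat -> (i < M)%nat -> (INR (S i) - s j * z)%C <> 0) ->
       Cmod (VM M z) = exp (LW rho N s c M z - Re (Cv O * z ^ rho)%C)).
    { intros M z Hz. unfold VM. rewrite Cmod_mult, Cmod_Wprod, Cmod_Cexp by auto. rewrite <- exp_plus, ECv0. reflexivity. }
    destruct (exists_nat_large (r ^ 2)) as [n0 [Hn0 Hn0']].
    assert (HMr : forall M, (n0 <= M)%nat -> (0 < M)%nat /\ r ^ 2 <= INR M).
    { intros M HM. split; [lia | ]. apply le_INR in HM. lra. }
    assert (Hnza : forall M j i, (j < N)%nat -> (i < M)%nat -> (INR (S i) - s j * a)%C <> 0).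
    { intros M j i Hj Hi. apply (off_rays_nz N s tau th Hs Htau c1); auto. lra. }
    assert (HVa : forall M, (n0 <= M)%nat -> exp (- (K3 * r ^ (rho - 1))) <= Cmod (VM M a)).
    { intros M HM. destruct (HMr M HM) as [HM1 HM2]. rewrite HVm by (intros; eapply Hnza; eauto).
      apply exp_le. pose proof (HRad O th0 r M Hsec0 Hoff1 ltac:(lra) HM1 HM2) as H. apply Rabs_le_between in H. fold a in H. lra. }
    assert (Hrp1 : 0 <= r ^ (rho - 1)) by (apply pow_le; lra).
    assert (HVap : exp (- ((K3 + K4) * r ^ (rho - 1))) <= Cmod (V a)).
    { apply Rle_trans with (exp (- (K3 * r ^ (rho - 1)))); [apply exp_le; nra | ].
      apply le_epsilon. intros ep Hep. destruct (HVl a ep Hep) as [n1 Hn1].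
      specialize (Hn1 (max n0 n1) ltac:(lia)). specialize (HVa (max n0 n1) ltac:(lia)).
      pose proof (Cmod_reverse (VM (max n0 n1) a) (V a)). lra. }
    split; auto.
    assert (HS : exists S0, cvg (fun M => SW rho N s M a) S0).
    { unfold SW. clear - s. generalize N as n. induction n as [ | n [S0 IH]].
      - exists 0%C. exact (cvg_const 0%C).
      - destruct (Dg_cvg (s n * a)) as [l Hl]. exists (S0 + s n ^ rho * l)%C. cbn [csum].
        exact (cvg_plus _ _ _ _ IH (cvg_scal (s n ^ rho) _ _ Hl)). }
    destruct HS as [S0 HS].
    (* The linear coefficients of the truncated products; their limit is the witness [v]. *)
    set (Q := fun M => (a ^ (rho - 1) * (INR rho * c + SW rho N s M a - INR rho * Cv O))%C).
    assert (HQl : cvg Q (a ^ (rho - 1) * (INR rho * c + S0 - INR rho * Cv O))).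
    { unfold Q. apply cvg_scal. apply cvg_ext with (fun M => ((INR rho * c - INR rho * Cv O) + SW rho N s M a)%C); [intros; ring | ].
      replace (INR rho * c + S0 - INR rho * Cv O)%C with ((INR rho * c - INR rho * Cv O) + S0)%C by ring.
      apply cvg_plus; [apply cvg_const | auto]. }
    set (v := (a ^ (rho - 1) * (INR rho * c + S0 - INR rho * Cv O))%C) in *.
    assert (Haway : forall w, Cmod w <= c0 ^ 2 / 2 * r -> forall t j, 0 <= t <= 1 -> (j < N)%nat -> away c1 (s j * (RtoC r * cis th0 + RtoC t * w))).
    { intros w Hw t j Ht Hj. assert (Htj := Htau j Hj). apply away_cone; auto.
      set (x := (RtoC r * cis th0 + RtoC t * w)%C).
      assert (Htw : Cmod (RtoC t * w) <= c0 ^ 2 / 2 * r).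
      { rewrite Cmod_mult, Cmod_RtoC_pos by lra. pose proof (Cmod_ge_0 w). nra. }
      assert (Hsj : Cmod (s j) = tau j) by (apply (Cmod_s N s tau th); auto).
      assert (HRe : Re (s j * x)%C <= tau j * r * (1 - 2 * c0 ^ 2) + tau j * (c0 ^ 2 / 2 * r)).
      { unfold x. replace (s j * (RtoC r * cis th0 + RtoC t * w))%C with (s j * (RtoC r * cis th0) + s j * (RtoC t * w))%C by ring.
        rewrite Re_plus. apply Rplus_le_compat.
        - rewrite (ray_point N s tau th) by auto. rewrite Re_RtoC_mult. apply Rmult_le_compat_l; [nra | ]. apply (Hoff0 j Hj).
        - eapply Rle_trans; [apply Re_le_Cmod | ]. rewrite Cmod_mult, Hsj. apply Rmult_le_compat_l; lra. }
      assert (Hx : r - c0 ^ 2 / 2 * r <= Cmod x).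
      { unfold x. pose proof (Cmod_plus_reverse (RtoC r * cis th0) (RtoC t * w)) as H. fold a in H. rewrite Hap in H. fold a. lra. }
      rewrite Cmod_mult, Hsj. unfold c1. replace ((c0 / 2) ^ 2) with (c0 ^ 2 / 4) by field.
      set (k := c0 ^ 2) in *. assert (Hk : 0 < k <= 1) by (unfold k; simpl; nra).
      apply Rle_trans with (tau j * ((1 - k / 2) * (r - k / 2 * r))).
      - eapply Rle_trans; [exact HRe | ].
        replace (tau j * r * (1 - 2 * k) + tau j * (k / 2 * r)) with (tau j * (r * (1 - 3 / 2 * k))) by field.
        apply Rmult_le_compat_l; [lra | ]. nra.
      - replace ((1 - 2 * (k / 4)) * (tau j * Cmod x)) with (tau j * ((1 - k / 2) * Cmod x)) by field.
        apply Rmult_le_compat_l; [lra | ]. apply Rmult_le_compat_l; lra. }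
    exists v. split.
    { apply (cvg_Cmod_le0 Q); auto. exists n0. intros M HM. destruct (HMr M HM) as [HM1 HM2].
      destruct (HLoc O th0 r M 0%C Hsec0 Hoff1 Hr1 HM1 HM2) as [H _].
      - rewrite Cmod_0. lra.
      - intros t j Ht Hj. apply Haway; auto. rewrite Cmod_0. simpl. nra.
      - fold a in H. fold (Q M) in H. eapply Rle_trans; [exact H | ]. apply Rmult_le_compat_r; [apply pow_le; lra | lra]. }
    intros w Hw.
    assert (Hwr : Cmod w <= r / 2) .
    { assert (Hc2 : c0 ^ 2 <= 1) by (apply pow_le_1; lra).
      assert (c0 ^ 2 / 2 * r <= 1 / 2 * r) by (apply Rmult_le_compat_r; lra). lra. }
    assert (Hfin : forall M, (n0 <= M)%nat -> Cmod (VM M (a + w)%C) <= Cmod (VM M a) * exp (Re (Q M * w)%C + K4 * r ^ (rho - 3) * Cmod w ^ 2)).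
    { intros M HM. destruct (HMr M HM) as [HM1 HM2].
      destruct (HLoc O th0 r M w Hsec0 Hoff1 Hr1 HM1 HM2 Hwr (Haway w Hw)) as [_ H]. fold a in H. fold (Q M) in H.
      rewrite (HVm M a) by (intros; eapply Hnza; eauto). rewrite HVm.
      - rewrite <- exp_plus. apply exp_le. lra.
      - intros j i Hj Hi. apply (away_nz c1); [lra | | apply pos_INR | ].
        + replace (a + w)%C with (RtoC r * cis th0 + RtoC 1 * w)%C by (unfold a; ring). apply Haway; auto. lra.
        + apply Cmod_pos_nz. rewrite Cmod_mult, (Cmod_s N s tau th) by auto. apply Rmult_lt_0_compat; auto.
          pose proof (Cmod_plus_reverse a w). lra. }
    (* With the quadratic error put into the exponent, the right side is the modulus of a convergent
       sequence and the inequality passes to the limit. *)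
    set (E1 := RtoC (K4 * r ^ (rho - 3) * Cmod w ^ 2)).
    assert (HR : cvg (fun M => (VM M a * Cexp (Q M * w + E1))%C) (V a * Cexp (v * w + E1))).
    { apply cvg_mult; auto. apply cvg_Cexp. apply cvg_plus; [ | apply cvg_const].
      apply cvg_ext with (fun M => (w * Q M)%C); [intros; ring | ]. replace (v * w)%C with (w * v)%C by ring. now apply cvg_scal. }
    assert (HmR : forall x : C, Re (x * w + E1)%C = Re (x * w)%C + K4 * r ^ (rho - 3) * Cmod w ^ 2) by (intros; reflexivity).
    apply Rle_trans with (Cmod (V a * Cexp (v * w + E1))).
    + apply le_epsilon. intros ep Hep.
      destruct (HVl (a + w)%C (ep / 2) ltac:(lra)) as [n1 Hn1]. destruct (HR (ep / 2) ltac:(lra)) as [n2 Hn2].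
      set (M := max n0 (max n1 n2)). specialize (Hn1 M ltac:(lia)). specialize (Hn2 M ltac:(lia)). specialize (Hfin M ltac:(lia)).
      rewrite <- HmR, <- Cmod_Cexp, <- Cmod_mult in Hfin.
      pose proof (Cmod_reverse (V (a + w)%C) (VM M (a + w)%C)) as G1. rewrite Cmod_minus_sym in G1.
      pose proof (Cmod_reverse (VM M a * Cexp (Q M * w + E1)) (V a * Cexp (v * w + E1))) as G2. lra.
    + rewrite Cmod_mult, Cmod_Cexp, HmR. apply Rmult_le_compat_l; [apply Cmod_ge_0 | ]. apply exp_le.
      apply Rplus_le_compat_l. apply Rmult_le_compat_r; [apply pow_le, Cmod_ge_0 | ].
      apply Rmult_le_compat_r; [apply pow_le; lra | lra].
Qed.

End Indicator.

(** * Homogeneous polynomials in polar coordinates *)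

Lemma sum_n_csum (f : nat -> C) (N : nat) : sum_n f N = csum f (S N).
Proof.
  induction N; [rewrite sum_O; simpl; ring | ]. rewrite sum_Sn, IHN. reflexivity.
Qed.

Definition dsum (n : nat) (f : nat -> nat -> C) : C := csum (fun j => csum (fun l => f j l) n) n.
Definition rdsum (n : nat) (f : nat -> nat -> R) : R := rsum (fun j => rsum (fun l => f j l) n) n.

Lemma rdsum_ext (n : nat) (f g : nat -> nat -> R) : (forall j l, f j l = g j l) -> rdsum n f = rdsum n g.
Proof. intros H. apply rsum_ext. intros. apply rsum_ext. auto. Qed.

Lemma rdsum_plus (n : nat) (f g : nat -> nat -> R) : rdsum n (fun j l => f j l + g j l) = rdsum n f + rdsum n g.
Proof. unfold rdsum. rewrite <- rsum_plus. apply rsum_ext. intros. apply rsum_plus. Qed.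

Lemma rdsum_scal (n : nat) (c : R) (f : nat -> nat -> R) : rdsum n (fun j l => c * f j l) = c * rdsum n f.
Proof. unfold rdsum. rewrite <- rsum_scal. apply rsum_ext. intros. apply rsum_scal. Qed.

Lemma Re_dsum (n : nat) (f : nat -> nat -> C) : Re (dsum n f) = rdsum n (fun j l => Re (f j l)).
Proof. unfold dsum, rdsum. rewrite Re_csum. apply rsum_ext. intros. apply Re_csum. Qed.

Lemma is_derive_rdsum (n : nat) (x : nat -> nat -> R -> R) (t : R) (v : nat -> nat -> R) :
  (forall j l, is_derive (x j l) t (v j l)) -> is_derive (fun s => rdsum n (fun j l => x j l s)) t (rdsum n v).
Proof.
  intros H. unfold rdsum. apply (is_derive_rsum (fun j s => rsum (fun l => x j l s) n)). intros j _.
  apply (is_derive_rsum (fun l s => x j l s)). auto.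
Qed.

Lemma rdsum_abs (n : nat) (f g : nat -> nat -> R) : (forall j l, Rabs (f j l) <= g j l) -> Rabs (rdsum n f) <= rdsum n g.
Proof.
  intros H. assert (HH : forall m (u v : nat -> R), (forall i, Rabs (u i) <= v i) -> Rabs (rsum u m) <= rsum v m).
  { induction m; intros u v Huv; simpl; [rewrite Rabs_R0; lra | ].
    eapply Rle_trans; [apply Rabs_triang | ]. specialize (IHm u v Huv). specialize (Huv m). lra. }
  unfold rdsum. apply HH. intros. apply HH. auto.
Qed.

Lemma cderiv_conj (x : R -> C) (t : R) (v : C) : cderiv x t v -> cderiv (fun s => Cconj (x s)) t (Cconj v).
Proof. intros [H1 H2]. split; [exact H1 | exact (is_derive_opp _ _ _ H2)]. Qed.

Definition mon (j l : nat) (z : C) : C := (z ^ j * Cconj z ^ l)%C.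
Definition mon1 (v : C) (j l : nat) (z : C) : C := (INR j * mon (j - 1) l z * v + INR l * mon j (l - 1) z * Cconj v)%C.

Lemma cderiv_mon (j l : nat) (x : R -> C) (t : R) (v : C) : cderiv x t v ->
  cderiv (fun s => mon j l (x s)) t (mon1 v j l (x t)).
Proof.
  intros Hx. unfold mon. eapply cderiv_val; [ | apply cderiv_mult; [apply cderiv_pow, Hx | apply cderiv_pow, cderiv_conj, Hx]].
  unfold mon1, mon. cbv beta. ring.
Qed.

Lemma mon_cis (j l : nat) (t : R) : mon j l (cis t) = cis ((INR j - INR l) * t).
Proof.
  unfold mon. rewrite cis_conj, !cis_pow, <- cis_plus. f_equal. ring.
Qed.

Section Polar.

Variables (P : C -> R) (n : nat) (a : nat -> nat -> C) (rho : nat).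
Hypothesis HP : forall z, P z = Re (dsum n (fun j l => (a j l * mon j l z)%C)).
Hypothesis Hhom : forall (r : R) (z : C), P (RtoC r * z)%C = r ^ rho * P z.
Hypothesis Hsub : forall z : C, z <> RtoC 0 -> 0 < dz_dzbar P z.

Lemma P_dir_derive (x : R -> C) (v : C) (t : R) : cderiv x t v ->
  is_derive (fun s => P (x s)) t (rdsum n (fun j l => Re (a j l * mon1 v j l (x t))%C)).
Proof.
  intros Hx. apply is_derive_ext with (fun s => rdsum n (fun j l => Re (a j l * mon j l (x s))%C)).
  { intros s. rewrite HP. symmetry. apply Re_dsum. }
  apply (is_derive_rdsum n (fun j l s => Re (a j l * mon j l (x s))%C)). intros j l.
  destruct (cderiv_scal (a j l) _ t _ (cderiv_mon j l x t v Hx)) as [H _]. exact H.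
Qed.

Definition mon2 (v : C) (j l : nat) (z : C) : C :=
  (INR j * mon1 v (j - 1) l z * v + INR l * mon1 v j (l - 1) z * Cconj v)%C.

Lemma P_dir_derive2 (x : R -> C) (v : C) (t : R) : cderiv x t v ->
  is_derive (fun s => rdsum n (fun j l => Re (a j l * mon1 v j l (x s))%C)) t (rdsum n (fun j l => Re (a j l * mon2 v j l (x t))%C)).
Proof.
  intros Hx. apply (is_derive_rdsum n (fun j l s => Re (a j l * mon1 v j l (x s))%C)). intros j l.
  assert (H : cderiv (fun s => (a j l * mon1 v j l (x s))%C) t (a j l * mon2 v j l (x t))); [ | exact (proj1 H)].
  apply cderiv_scal. unfold mon1, mon2.
  eapply cderiv_val; [ | apply (cderiv_plus (fun s => (INR j * mon (j - 1) l (x s) * v)%C) (fun s => (INR l * mon j (l - 1) (x s) * Cconj v)%C))].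
  2: { apply cderiv_ext with (fun s => ((INR j * v) * mon (j - 1) l (x s))%C); [intros; ring | ]. apply cderiv_scal, cderiv_mon, Hx. }
  2: { apply cderiv_ext with (fun s => ((INR l * Cconj v) * mon j (l - 1) (x s))%C); [intros; ring | ]. apply cderiv_scal, cderiv_mon, Hx. }
  ring.
Qed.

Lemma laplacian (z : C) : dz_dzbar P z = rdsum n (fun j l => Re (a j l * (INR j * INR l * mon (j - 1) (l - 1) z))%C).
Proof.
  unfold dz_dzbar. destruct z as [x y]. simpl fst. simpl snd.
  assert (Hx : forall s, cderiv (fun s => (s, y) : C) s 1).
  { intros s. split; [apply (is_derive_id s) | exact (is_derive_const y s)]. }
  assert (Hy : forall s, cderiv (fun s => (x, s) : C) s Ci).
  { intros s. split; [exact (is_derive_const x s) | apply (is_derive_id s)]. }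
  assert (A1 : Derive (fun t => Derive (fun s => P (s, y)) t) x = rdsum n (fun j l => Re (a j l * mon2 1 j l (x, y))%C)).
  { rewrite (Derive_ext _ (fun t => rdsum n (fun j l => Re (a j l * mon1 1 j l (t, y))%C))).
    - apply is_derive_unique. exact (P_dir_derive2 (fun s => (s, y) : C) 1 x (Hx x)).
    - intros t. apply is_derive_unique. exact (P_dir_derive (fun s => (s, y) : C) 1 t (Hx t)). }
  assert (A2 : Derive (fun t => Derive (fun s => P (x, s)) t) y = rdsum n (fun j l => Re (a j l * mon2 Ci j l (x, y))%C)).
  { rewrite (Derive_ext _ (fun t => rdsum n (fun j l => Re (a j l * mon1 Ci j l (x, t))%C))).
    - apply is_derive_unique. exact (P_dir_derive2 (fun s => (x, s) : C) Ci y (Hy y)).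
    - intros t. apply is_derive_unique. exact (P_dir_derive (fun s => (x, s) : C) Ci t (Hy t)). }
  rewrite A1, A2.
  set (z := (x, y) : C). rewrite <- rdsum_plus, <- rdsum_scal. apply rdsum_ext. intros j l.
  rewrite <- Re_plus, <- Re_RtoC_mult. f_equal.
  assert (E1 : Cconj (RtoC 1) = 1) by (apply C_eq; unfold Cconj, Re, Im; simpl; ring).
  assert (E2 : Cconj Ci = (- Ci)%C) by (apply C_eq; unfold Cconj, Ci, Re, Im; simpl; ring).
  assert (E3 : (Ci * Ci)%C = (- (1))%C) by (apply C_eq; unfold Ci, Re, Im; simpl; ring).
  unfold mon2, mon1. rewrite E1, E2.
  match goal with |- (RtoC (/ 4) * (a j l * ?A + a j l * ?B))%C = _ =>
    assert (E : (A + B)%C = (4 * (INR j * INR l * mon (j - 1) (l - 1) z))%C);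
    [ | replace (a j l * A + a j l * B)%C with (a j l * (A + B))%C by ring; rewrite E ] end.
  - ring_simplify. replace (Ci ^ 2)%C with (- (1))%C by (rewrite <- E3; simpl; ring). ring.
  - rewrite RtoC_inv by lra. field.
Qed.

(** Apply [r d/dr] to both sides. The argument acts on the whole real sum, so it does not depend on
    identifying which coefficients of the polynomial vanish. *)
Lemma euler_identity (b : nat -> nat -> R) (c : R) : (forall r, rdsum n (fun j l => b j l * r ^ (j + l)) = r ^ rho * c) ->
  forall r, rdsum n (fun j l => (INR (j + l) * b j l) * r ^ (j + l)) = r ^ rho * (INR rho * c).
Proof.
  intros H r.
  assert (D1 : is_derive (fun r => rdsum n (fun j l => b j l * r ^ (j + l))) r (rdsum n (fun j l => b j l * (INR (j + l) * r ^ pred (j + l))))).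
  { apply (is_derive_rdsum n (fun j l r => b j l * r ^ (j + l))). intros j l. auto_derive; auto; ring. }
  assert (D2 : is_derive (fun r => rdsum n (fun j l => b j l * r ^ (j + l))) r (INR rho * r ^ pred rho * c)).
  { apply is_derive_ext with (fun r => r ^ rho * c); [intros; now rewrite H | ]. auto_derive; auto; ring. }
  assert (E : rdsum n (fun j l => b j l * (INR (j + l) * r ^ pred (j + l))) = INR rho * r ^ pred rho * c).
  { rewrite <- (is_derive_unique _ _ _ D1). apply is_derive_unique. exact D2. }
  assert (E2 : r * rdsum n (fun j l => b j l * (INR (j + l) * r ^ pred (j + l))) = r * (INR rho * r ^ pred rho * c)) by now rewrite E.
  rewrite <- rdsum_scal in E2.
  assert (Hp : forall m, INR m * (r * r ^ pred m) = INR m * r ^ m).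
  { intros [ | m]; [simpl; ring | reflexivity]. }
  rewrite (rdsum_ext n _ (fun j l => INR (j + l) * b j l * r ^ (j + l))) in E2.
  - rewrite E2. rewrite <- (Rmult_comm (INR rho * c)). replace (r * (INR rho * r ^ pred rho * c)) with (INR rho * (r * r ^ pred rho) * c) by ring.
    rewrite Hp. ring.
  - intros j l. replace (r * (b j l * (INR (j + l) * r ^ pred (j + l)))) with (b j l * (INR (j + l) * (r * r ^ pred (j + l)))) by ring.
    rewrite Hp. ring.
Qed.

Definition pol (t : R) : R := P (cis t).
Definition pol1 (t : R) : R := rdsum n (fun j l => Re (a j l * (Ci * RtoC (INR j - INR l) * cis ((INR j - INR l) * t)))%C).
Definition pol2 (t : R) : R := rdsum n (fun j l => Re (a j l * (- RtoC ((INR j - INR l) ^ 2) * cis ((INR j - INR l) * t)))%C).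

Lemma cderiv_cis_scal (m t : R) : cderiv (fun s => cis (m * s)) t (Ci * RtoC m * cis (m * t)).
Proof. split; unfold cis, Re, Im; simpl; auto_derive; auto; ring. Qed.

Lemma pol_sum (t : R) : pol t = rdsum n (fun j l => Re (a j l * cis ((INR j - INR l) * t))%C).
Proof. unfold pol. rewrite HP, Re_dsum. apply rdsum_ext. intros. now rewrite mon_cis. Qed.

Lemma pol_derive (t : R) : is_derive pol t (pol1 t).
Proof.
  apply is_derive_ext with (fun s => rdsum n (fun j l => Re (a j l * cis ((INR j - INR l) * s))%C)); [intros; now rewrite pol_sum | ].
  apply (is_derive_rdsum n (fun j l s => Re (a j l * cis ((INR j - INR l) * s))%C)). intros j l.
  exact (proj1 (cderiv_scal (a j l) _ t _ (cderiv_cis_scal (INR j - INR l) t))).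
Qed.

Lemma pol1_derive (t : R) : is_derive pol1 t (pol2 t).
Proof.
  apply (is_derive_rdsum n (fun j l s => Re (a j l * (Ci * RtoC (INR j - INR l) * cis ((INR j - INR l) * s)))%C)). intros j l.
  eapply is_derive_val; [ | exact (proj1 (cderiv_scal (a j l) _ t _ (cderiv_scal (Ci * RtoC (INR j - INR l)) _ t _ (cderiv_cis_scal (INR j - INR l) t))))].
  f_equal. replace (RtoC ((INR j - INR l) ^ 2)) with (RtoC (INR j - INR l) * RtoC (INR j - INR l))%C by (rewrite <- RtoC_mult; apply RtoC_inj_eq; ring).
  assert (E3 : (Ci * Ci)%C = (- (1))%C) by (apply C_eq; unfold Ci, Re, Im; simpl; ring).
  replace (Ci * RtoC (INR j - INR l) * (Ci * RtoC (INR j - INR l) * cis ((INR j - INR l) * t)))%C with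
    ((Ci * Ci) * (RtoC (INR j - INR l) * RtoC (INR j - INR l)) * cis ((INR j - INR l) * t))%C by ring.
  rewrite E3. ring.
Qed.

(** The Laplacian in polar coordinates on the unit circle. Term by term it is
    [(j + l)^2 - (j - l)^2 = 4 j l]: the first square comes from Euler's identity used twice, the
    second from the angular derivatives. *)
Lemma pol_convex (t : R) : pol2 t + INR rho ^ 2 * pol t = 4 * dz_dzbar P (cis t).
Proof.
  set (be := fun j l => Re (a j l * cis ((INR j - INR l) * t))%C).
  assert (H0 : forall r, rdsum n (fun j l => be j l * r ^ (j + l)) = r ^ rho * pol t).
  { intros r. unfold pol. rewrite <- Hhom, HP, Re_dsum. apply rdsum_ext. intros j l. unfold be, mon.
    replace (Cconj (RtoC r * cis t)) with (RtoC r * Cconj (cis t))%C by (apply C_eq; unfold Cconj, Re, Im; simpl; ring).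
    rewrite !Cpow_mult_l. 
    replace (a j l * (RtoC r ^ j * cis t ^ j * (RtoC r ^ l * Cconj (cis t) ^ l)))%C with ((RtoC r ^ j * RtoC r ^ l) * (a j l * (cis t ^ j * Cconj (cis t) ^ l)))%C by ring.
    fold (mon j l (cis t)). rewrite mon_cis, <- Cpow_add_r, <- RtoC_pow, Re_RtoC_mult. ring. }
  assert (H1 := euler_identity _ _ H0). assert (H2 := euler_identity _ _ H1 1).
  assert (E2 : INR rho ^ 2 * pol t = rdsum n (fun j l => INR (j + l) * (INR (j + l) * be j l))).
  { rewrite pow1 in H2. rewrite (rdsum_ext n _ (fun j l => INR (j + l) * (INR (j + l) * be j l))) in H2 by (intros; rewrite pow1; ring).
    rewrite H2. ring. }
  rewrite E2, laplacian. unfold pol2. rewrite <- rdsum_plus, <- rdsum_scal. apply rdsum_ext. intros j l.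
  unfold be. rewrite <- !Re_RtoC_mult, <- Re_plus. f_equal.
  rewrite plus_INR.
  (* When [j] or [l] is 0 the truncated exponent [j - 1] or [l - 1] is meaningless, but the
     coefficient [j * l] vanishes. *)
  destruct j as [ | j]; [ | destruct l as [ | l]].
  - change (INR 0) with 0. rewrite Rplus_0_l, Rminus_0_l, RtoC_pow, RtoC_opp. ring.
  - change (INR 0) with 0. generalize (INR (S j)) as x. intros x. rewrite Rplus_0_r, Rminus_0_r, RtoC_pow. ring.
  - rewrite mon_cis. replace (S j - 1)%nat with j by lia. replace (S l - 1)%nat with l by lia.
    replace (INR j - INR l) with (INR (S j) - INR (S l)) by (rewrite !S_INR; ring).
    generalize (INR (S j)) (INR (S l)). intros x y. rewrite RtoC_pow, RtoC_minus, RtoC_plus. ring.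
Qed.

(** Compactness of the circle makes strict subharmonicity uniform; [nu] is the source of all the
    margins used later. *)
Lemma pol_data : exists nu B, 0 < nu /\ (forall t, nu <= pol2 t + INR rho ^ 2 * pol t) /\
  (forall t, Rabs (pol t) <= B /\ Rabs (pol1 t) <= B).
Proof.
  set (nuf := fun t => pol2 t + INR rho ^ 2 * pol t).
  assert (HPI := PI_RGT_0).
  assert (Hcont : forall t, continuity_pt nuf t).
  { intros t.
    assert (Hd : exists d, is_derive nuf t d).
    { eexists. unfold nuf. apply is_derive_Rplus.
      - apply (is_derive_rdsum n (fun j l s => Re (a j l * (- RtoC ((INR j - INR l) ^ 2) * cis ((INR j - INR l) * s)))%C)). intros j l.
        exact (proj1 (cderiv_scal (a j l) _ t _ (cderiv_scal (- RtoC ((INR j - INR l) ^ 2)) _ t _ (cderiv_cis_scal (INR j - INR l) t)))).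
      - apply (is_derive_scal pol t (INR rho ^ 2)). apply pol_derive. }
    destruct Hd as [d Hd]. apply derivable_continuous_pt. exists d. now apply is_derive_Reals. }
  destruct (continuity_ab_min nuf 0 (2 * PI)) as [m [Hm _]]; [lra | intros; apply Hcont | ].
  exists (nuf m), (rdsum n (fun j l => Cmod (a j l) * (Rabs (INR j - INR l) + 1))).
  split; [ | split].
  - unfold nuf. rewrite pol_convex. pose proof (Hsub (cis m) (cis_nz m)). lra.
  - intros t. change (nuf m <= nuf t).
    destruct (polar (cis t) 0) as [t' [Ht' E]]. rewrite Cmod_cis, Cmult_1_l in E.
    replace (nuf t) with (nuf t'); [apply Hm; lra | ]. unfold nuf. now rewrite !pol_convex, E.
  - intros t. split; [rewrite pol_sum | unfold pol1]; apply rdsum_abs; intros j l; (eapply Rle_trans; [apply re_le_Cmod | ]).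
    + rewrite Cmod_mult, Cmod_cis, Rmult_1_r. pose proof (Cmod_ge_0 (a j l)). pose proof (Rabs_pos (INR j - INR l)). nra.
    + rewrite !Cmod_mult, Cmod_cis, Cmod_Ci, Cmod_R. pose proof (Cmod_ge_0 (a j l)). pose proof (Rabs_pos (INR j - INR l)). nra.
Qed.

End Polar.

Lemma poly_dsum (P : C -> R) : is_poly_z_zbar P ->
  exists n a, forall z, P z = Re (dsum n (fun j l => (a j l * mon j l z)%C)).
Proof.
  intros [N [a H]]. exists (S N), a. intros z.
  replace (P z) with (Re (RtoC (P z))) by reflexivity. rewrite H. f_equal.
  rewrite sum_n_csum. apply csum_ext. intros j _. apply sum_n_csum.
Qed.

Lemma poly_locally_lipschitz (P : C -> R) : is_poly_z_zbar P -> forall z, exists K, 0 < K /\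
  forall w, Cmod (w - z) <= 1 -> Rabs (P w - P z) <= K * Cmod (w - z).
Proof.
  intros HP z. destruct (poly_dsum P HP) as [n [a Ha]].
  set (X := Cmod z + 1). assert (HX : 1 <= X) by (unfold X; pose proof (Cmod_ge_0 z); lra).
  set (K := rdsum n (fun j l => Cmod (a j l) * ((INR j + INR l) * X ^ (j + l)))).
  assert (HK : 0 <= K).
  { unfold K, rdsum. apply rsum_nonneg. intros. apply rsum_nonneg. intros.
    apply Rmult_le_pos; [apply Cmod_ge_0 | ]. apply Rmult_le_pos; [apply Rplus_le_le_0_compat; apply pos_INR | apply pow_le; lra]. }
  exists (K + 1). split; [lra | ]. intros w Hw. set (h := (w - z)%C) in *. assert (Hh := Cmod_ge_0 h).
  set (x := fun t => (z + RtoC t * h)%C).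
  assert (Hx1 : x 1 = w) by (unfold x, h; ring). assert (Hx0 : x 0 = z) by (unfold x; ring).
  assert (H : Rabs (P (x 1) - P (x 0)) <= ((K + 1) * Cmod h) * (1 - 0)).
  { apply (MVT_abs (fun t => P (x t)) (fun t => rdsum n (fun j l => Re (a j l * mon1 h j l (x t))%C))); [lra | | ].
    - intros t _. apply (P_dir_derive P n a Ha x h t). apply cderiv_affine.
    - intros t Ht.
      assert (Hxt : Cmod (x t) <= X).
      { unfold x, X. eapply Rle_trans; [apply Cmod_triangle | ]. rewrite Cmod_mult, Cmod_RtoC_pos by lra. nra. }
      apply Rle_trans with (Cmod h * K); [ | nra]. unfold K. rewrite <- rdsum_scal. apply rdsum_abs. intros j l.
      eapply Rle_trans; [apply re_le_Cmod | ]. rewrite Cmod_mult.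
      replace (Cmod h * (Cmod (a j l) * ((INR j + INR l) * X ^ (j + l)))) with (Cmod (a j l) * (Cmod h * ((INR j + INR l) * X ^ (j + l)))) by ring.
      apply Rmult_le_compat_l; [apply Cmod_ge_0 | ].
      assert (Hmon : forall p m, (p + m <= j + l)%nat -> Cmod (mon p m (x t)) <= X ^ (j + l)).
      { intros p m Hpm. unfold mon. rewrite Cmod_mult, !Cmod_pow, Cmod_conj, <- pow_add.
        apply Rle_trans with (X ^ (p + m)); [apply pow_incr; split; auto using Cmod_ge_0 | now apply Rle_pow]. }
      unfold mon1. eapply Rle_trans; [apply Cmod_triangle | ]. rewrite !Cmod_mult, Cmod_conj, !Cmod_RtoC_pos by apply pos_INR.
      pose proof (Hmon (j - 1)%nat l ltac:(lia)) as M1. pose proof (Hmon j (l - 1)%nat ltac:(lia)) as M2.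
      pose proof (pos_INR j). pose proof (pos_INR l).
      assert (INR j * Cmod (mon (j - 1) l (x t)) <= INR j * X ^ (j + l)) by (apply Rmult_le_compat_l; auto).
      assert (INR l * Cmod (mon j (l - 1) (x t)) <= INR l * X ^ (j + l)) by (apply Rmult_le_compat_l; auto).
      nra. }
  rewrite Hx1, Hx0 in H. lra.
Qed.

(* Vanishes exactly on the ray of direction [th0]. *)
Definition dev (rho : nat) (th0 : R) (z : C) : R := Cmod z ^ (rho - 1) * (Cmod z - Re (z * cis (- th0))%C).

Lemma dev_polar (rho : nat) (th0 r phi : R) : (0 < rho)%nat -> 0 <= r ->
  dev rho th0 (RtoC r * cis phi) = r ^ rho * (1 - cos (phi - th0)).
Proof.
  intros Hr Hr0. unfold dev. rewrite Cmod_mult, Cmod_cis, Cmod_RtoC_pos, Rmult_1_r by auto.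
  replace (RtoC r * cis phi * cis (- th0))%C with (RtoC r * cis (phi - th0))%C.
  2: { replace (phi - th0) with (phi + - th0) by ring. rewrite cis_plus. ring. }
  rewrite Re_RtoC_mult. unfold cis at 1, Re. simpl fst.
  replace rho with (S (rho - 1)) at 2 by lia. simpl. ring.
Qed.

(** * The entire weight attached to a ray *)

Section Weight.

Variables (k : nat) (P : C -> R).
Hypothesis hk : (1 < k)%nat.
Hypothesis hpoly : is_poly_z_zbar P.
Hypothesis hhom : forall (r : R) (z : C), P (Cmult (RtoC r) z) = r ^ (2 * k) * P z.
Hypothesis hsub : forall z : C, z <> RtoC 0 -> 0 < dz_dzbar P z.

(** [indicator_entire] is applied to the angular part of [P] lowered by
    [eps + eps * (1 - cos (t - th0))]. The constant part gives decay at infinity; the other part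
    vanishes on the chosen ray only and is homogenized as [dev]. *)
Lemma weight_exists : exists eps Bp, 0 < eps /\ 0 < Bp /\ (forall z, Rabs (P z) <= Bp * Cmod z ^ (2 * k)) /\
  forall th0, exists W C0 delta K, ent W /\ W 0%C = 1 /\ 0 < delta <= / 2 /\ 0 < K /\
  (forall r, 0 <= r -> Re (C0 * (RtoC r * cis th0) ^ (2 * k))%C = P (RtoC r * cis th0)%C - eps * r ^ (2 * k)) /\
  (forall e, 0 < e -> exists K1, forall z,
     Cmod (W z) <= exp (P z - eps * Cmod z ^ (2 * k) - eps * dev (2 * k) th0 z + e * Cmod z ^ (2 * k) + K1)) /\
  (forall r z, 0 < r -> Cmod (z - RtoC r * cis th0) <= delta * r ->
     Re (C0 * z ^ (2 * k))%C <= P z - eps * Cmod z ^ (2 * k) - eps * dev (2 * k) th0 z) /\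
  (forall r, 1 <= r -> let a := (RtoC r * cis th0)%C in let V := fun z => (W z * Cexp (- (C0 * z ^ (2 * k))))%C in
     exp (- (K * r ^ (2 * k - 1))) <= Cmod (V a) /\
     exists v, Cmod v <= K * r ^ (2 * k - 2) /\ forall w, Cmod w <= delta * r ->
       Cmod (V (a + w)%C) <= Cmod (V a) * exp (Re (v * w)%C + K * r ^ (2 * k - 3) * Cmod w ^ 2)).
Proof.
  destruct (poly_dsum P hpoly) as [n [a0 HP]].
  set (rho := (2 * k)%nat) in *. assert (Hrho : (4 <= rho)%nat) by (unfold rho; lia).
  destruct (pol_data P n a0 rho HP hhom hsub) as [nu [B [Hnu [Hconv HB]]]].
  set (p := pol P) in *. set (p1 := pol1 n a0) in *. set (p2 := pol2 n a0) in *.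
  set (rr := INR rho) in *. assert (Hr4 : 4 <= rr) by (unfold rr; apply (le_INR 4) in Hrho; simpl in Hrho; lra).
  assert (HPI := PI_RGT_0).
  (* Lowering the indicator reduces [q'' + rr^2 q] by at most [eps + 3 * rr^2 * eps], which is below
     [nu / 2]. *)
  set (eps := nu / (8 * rr ^ 2)).
  assert (Hrr2 : 16 <= rr ^ 2) by (simpl; nra).
  assert (Heps : 0 < eps) by (unfold eps; apply Rdiv_lt_0_compat; lra).
  assert (Eeps : 8 * rr ^ 2 * eps = nu) by (unfold eps; field; lra).
  assert (HB0 : 0 <= B) by (eapply Rle_trans; [apply Rabs_pos | apply (HB 0)]).
  assert (HPpol : forall r phi, P (RtoC r * cis phi)%C = r ^ rho * p phi) by (intros; apply hhom).
  exists eps, (B + 1). split; [auto | split; [lra | split]].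
  { intros z. destruct (polar z 0) as [phi [_ Hz]]. rewrite Hz at 1. rewrite HPpol, Rabs_mult, Rmult_comm.
    rewrite (Rabs_right (Cmod z ^ rho)) by (apply Rle_ge, pow_le, Cmod_ge_0).
    apply Rmult_le_compat_r; [apply pow_le, Cmod_ge_0 | ]. destruct (HB phi). lra. }
  intros th0.
  set (q := fun t => p t - eps - eps * (1 - cos (t - th0))).
  set (q1 := fun t => p1 t - eps * sin (t - th0)).
  set (q2 := fun t => p2 t - eps * cos (t - th0)).
  assert (Hq1 : forall t, is_derive q t (q1 t)).
  { intros t. unfold q, q1. eapply is_derive_val; [ | apply is_derive_Rminus; [apply is_derive_Rminus; [apply (pol_derive P n a0 HP) | exact (is_derive_const eps t)] | ]].
    2: { instantiate (1 := eps * sin (t - th0)). auto_derive; auto; unfold Rminus; ring. }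
    change zero with 0. fold p1. ring. }
  assert (Hq2 : forall t, is_derive q1 t (q2 t)).
  { intros t. unfold q1, q2. apply is_derive_Rminus; [apply (pol1_derive n a0) | ]. auto_derive; auto; unfold Rminus; ring. }
  assert (Hcis : forall t, cos (t + 2 * PI - th0) = cos (t - th0) /\ sin (t + 2 * PI - th0) = sin (t - th0)).
  { intros t. assert (E := cis_period (t - th0)). replace (t + 2 * PI - th0) with (t - th0 + 2 * PI) by ring.
    unfold cis in E. injection E. auto. }
  assert (Hper : forall t, q (t + 2 * PI) = q t).
  { intros t. unfold q. destruct (Hcis t) as [-> _]. unfold p, pol. now rewrite cis_period. }
  assert (Hper1 : forall t, q1 (t + 2 * PI) = q1 t).
  { intros t. rewrite <- (is_derive_unique _ _ _ (Hq1 (t + 2 * PI))), <- (is_derive_unique _ _ _ (Hq1 t)).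
    symmetry. apply is_derive_unique. apply is_derive_ext with (fun s => q (s + 2 * PI)); [intros; apply Hper | ].
    eapply is_derive_val; [ | apply (is_derive_Rcomp q (fun s => s + 2 * PI) t)].
    2: { apply Hq1. }
    2: { instantiate (1 := 1). auto_derive; auto. }
    rewrite Rmult_1_l. symmetry. apply is_derive_unique, Hq1. }
  assert (Hqconv : forall t, nu / 2 <= q2 t + INR rho ^ 2 * q t).
  { intros t. fold rr. specialize (Hconv t). fold rr in Hconv. unfold q, q2. pose proof (COS_bound (t - th0)) as Hc.
    assert (rr ^ 2 * eps * cos (t - th0) >= - (rr ^ 2 * eps)) by nra.
    assert (eps * cos (t - th0) <= eps) by nra. nra. }
  assert (HqB : forall t, Rabs (q t) <= B + 3 * eps /\ Rabs (q1 t) <= B + 3 * eps).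
  { intros t. destruct (HB t) as [B1 B2]. apply Rabs_le_between in B1. apply Rabs_le_between in B2.
    pose proof (COS_bound (t - th0)). pose proof (SIN_bound (t - th0)).
    unfold q, q1. split; apply Rabs_le; nra. }
  destruct (indicator_entire rho q q1 q2 (nu / 2) (B + 3 * eps) th0 Hrho Hq1 Hq2 Hper Hper1 ltac:(lra) Hqconv HqB)
    as [W [HW [HW0 [Hup [del [K [Hdel [HK Hloc]]]]]]]].
  (* Since [(1 - kap / 2) / (1 + kap / 2) >= 1 - kap], points within [kap / 2 * r] of the ray point
     of modulus [r] make an angle at most [PI / rr] with the ray, where [tan_le] applies. *)
  set (kap := 1 - cos (PI / rr)).
  assert (Hpr : 0 < PI / rr <= PI / 4).
  { split; [apply Rdiv_lt_0_compat; lra | ]. apply Rmult_le_compat_l; [lra | ]. apply Rinv_le_contravar; lra. }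
  assert (Hkap : 0 < kap).
  { unfold kap. assert (cos (PI / rr) < cos 0) by (apply cos_decreasing_1; lra). rewrite cos_0 in *. lra. }
  assert (Hkap1 : kap <= 1).
  { unfold kap. assert (0 <= cos (PI / rr)) by (apply cos_ge_0; lra). lra. }
  exists W, (Cq rho q q1 th0), (Rmin del (kap / 2)), K.
  assert (Hd1 : Rmin del (kap / 2) <= del) by apply Rmin_l. assert (Hd2 : Rmin del (kap / 2) <= kap / 2) by apply Rmin_r.
  assert (Hd0 : 0 < Rmin del (kap / 2)) by (apply Rmin_glb_lt; lra).
  assert (HTan : forall r phi, Re (Cq rho q q1 th0 * (RtoC r * cis phi) ^ rho)%C = r ^ rho * Tan rho q q1 th0 phi).
  { intros r phi. rewrite Cpow_mult_l, <- RtoC_pow, cis_pow.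
    replace (Cq rho q q1 th0 * (RtoC (r ^ rho) * cis (INR rho * phi)))%C with (RtoC (r ^ rho) * (Cq rho q q1 th0 * cis (INR rho * phi)))%C by ring.
    rewrite Re_RtoC_mult. f_equal. apply Cq_Tan; auto. }
  split; [auto | split; [auto | split; [lra | split; [auto | split; [ | split; [ | split]]]]]].
  - intros r Hr. rewrite HTan, HPpol. unfold Tan. replace (th0 - th0) with 0 by ring. rewrite Rmult_0_r, cos_0, sin_0.
    unfold q. replace (th0 - th0) with 0 by ring. rewrite cos_0. ring.
  - intros e He. destruct (Hup e He) as [K1 HK1]. exists K1. intros z. destruct (HK1 z) as [phi [Hz Hb]].
    eapply Rle_trans; [exact Hb | ]. apply exp_le. right.
    assert (Hz0 := Cmod_ge_0 z).
    assert (Ed : dev rho th0 z = Cmod z ^ rho * (1 - cos (phi - th0))) by (rewrite Hz at 1; apply dev_polar; [lia | auto]).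
    assert (EP : P z = Cmod z ^ rho * p phi) by (rewrite Hz at 1; apply HPpol).
    rewrite Ed, EP. unfold q. ring.
  - intros r z Hr Hz. destruct (polar z (th0 - PI)) as [phi [Hphi Ez]]. set (x := Cmod z) in *.
    assert (Hx0 : 0 <= x) by apply Cmod_ge_0.
    assert (Hcos : cos (PI / rr) <= cos (phi - th0)).
    { assert (H1 : r * (1 - kap / 2) <= x * cos (phi - th0)).
      { assert (HRe : Re ((z - RtoC r * cis th0) * cis (- th0))%C >= - (Rmin del (kap / 2) * r)).
        { pose proof (Re_ge_Cmod ((z - RtoC r * cis th0) * cis (- th0))). rewrite Cmod_mult, Cmod_cis in H. lra. }
        replace (Re ((z - RtoC r * cis th0) * cis (- th0))%C) with (x * cos (phi - th0) - r) in HRe.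
        2: { rewrite Ez. replace ((RtoC x * cis phi - RtoC r * cis th0) * cis (- th0))%C with (RtoC x * (cis phi * cis (- th0)) - RtoC r * (cis (- th0) * cis th0))%C by ring.
             rewrite cis_opp_mult, <- cis_plus. replace (phi + - th0) with (phi - th0) by ring.
             unfold cis, Re; simpl; ring. }
        assert (Rmin del (kap / 2) * r <= kap / 2 * r) by (apply Rmult_le_compat_r; lra). lra. }
      assert (H2 : x <= r * (1 + kap / 2)).
      { pose proof (Cmod_reverse z (RtoC r * cis th0)) as H. rewrite (Cmod_mult (RtoC r)), Cmod_cis, Cmod_RtoC_pos in H by lra. fold x in H.
        assert (Rmin del (kap / 2) * r <= kap / 2 * r) by (apply Rmult_le_compat_r; lra). lra. }
      assert (H3 : 0 < x) by (pose proof (COS_bound (phi - th0)); nra).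
      replace (cos (PI / rr)) with (1 - kap) by (unfold kap; ring).
      apply Rmult_le_reg_l with x; auto.
      apply Rle_trans with (r * (1 + kap / 2) * (1 - kap)); [apply Rmult_le_compat_r; lra | ]. nra. }
    assert (Habs : Rabs (phi - th0) <= PI / rr).
    { apply Rnot_lt_le. intro Hlt. assert (Hab : Rabs (phi - th0) <= PI) by (apply Rabs_le; lra).
      assert (HcA : cos (Rabs (phi - th0)) = cos (phi - th0)) by (unfold Rabs; destruct (Rcase_abs (phi - th0)); [apply cos_neg | reflexivity]).
      assert (cos (Rabs (phi - th0)) < cos (PI / rr)) by (apply cos_decreasing_1; lra). lra. }
    assert (HT := tan_le rho q q1 q2 (nu / 2) Hrho Hq1 Hq2 ltac:(lra) Hqconv th0 phi Habs).
    assert (Ed : dev rho th0 z = x ^ rho * (1 - cos (phi - th0))) by (rewrite Ez; apply dev_polar; [lia | auto]).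
    assert (EP : P z = x ^ rho * p phi) by (rewrite Ez; apply HPpol).
    rewrite Ed, EP. rewrite Ez at 1. rewrite HTan.
    apply Rle_trans with (x ^ rho * q phi); [apply Rmult_le_compat_l; [apply pow_le; auto | auto] | ].
    unfold q. right. ring.
  - intros r Hr a V. destruct (Hloc r Hr) as [H1 [v [H2 H3]]]. split; [exact H1 | ]. exists v. split; [exact H2 | ].
    intros w Hw. apply H3. assert (Rmin del (kap / 2) * r <= del * r) by (apply Rmult_le_compat_r; lra). lra.
Qed.

End Weight.

(** * The function (exp u - 1) / u *)

(** The mean of [exp (t * u)] over [0 <= t <= 1]. Unlike [exp], it attains modulus 1 on the closed
    left half-plane at the origin only, and it decays at infinity there. *)
Definition E1 (u : C) : C := if Req_EM_T (Cmod u) 0 then RtoC 1 else ((Cexp u - 1) / u)%C.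

Lemma E1_mult (u : C) : (E1 u * u)%C = (Cexp u - 1)%C.
Proof.
  unfold E1. destruct (Req_EM_T (Cmod u) 0) as [E | E].
  - rewrite (Cmod_eq_0 _ E), Cexp_0. ring.
  - field. intro Eu. apply E. rewrite Eu. apply Cmod_0.
Qed.

Lemma E1_0 : E1 0 = 1.
Proof. unfold E1. rewrite Cmod_0. destruct (Req_EM_T 0 0); [reflexivity | lra]. Qed.

Lemma Cmod_E1_mult (u : C) : Cmod (E1 u) * Cmod u <= 1 + exp (Re u).
Proof.
  rewrite <- Cmod_mult, E1_mult. eapply Rle_trans; [apply Cmod_triangle_minus | ]. rewrite Cmod_Cexp, Cmod_1. lra.
Qed.

Lemma Cexp_minus_1_le (u : C) (b : R) : 1 <= b -> exp (Re u) <= b -> Cmod (Cexp u - 1) <= b * Cmod u.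
Proof.
  intros Hb Hu.
  replace (Cexp u - 1)%C with (Cexp (RtoC 1 * u) - Cexp (RtoC 0 * u))%C.
  2: { replace (RtoC 0 * u)%C with (RtoC 0) by ring. rewrite Cexp_0. f_equal; f_equal; ring. }
  replace (b * Cmod u) with (b * Cmod u * (1 - 0)) by ring.
  apply (MVT_C (fun t => Cexp (RtoC t * u)) (fun t => (Cexp (RtoC t * u) * u)%C)); [lra | | ].
  - intros t _. apply cderiv_Cexp, cderiv_line.
  - intros t Ht. rewrite Cmod_mult, Cmod_Cexp. apply Rmult_le_compat_r; [apply Cmod_ge_0 | ].
    rewrite Re_RtoC_mult. destruct (Rle_lt_dec (Re u) 0).
    + apply Rle_trans with (exp 0); [apply exp_le; nra | rewrite exp_0; lra].
    + apply Rle_trans with (exp (Re u)); [apply exp_le; nra | auto].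
Qed.

Lemma Cmod_E1_le (u : C) (b : R) : 1 <= b -> exp (Re u) <= b -> Cmod (E1 u) <= b.
Proof.
  intros Hb Hu. destruct (Req_dec (Cmod u) 0) as [E | E].
  - rewrite (Cmod_eq_0 _ E), E1_0, Cmod_1. auto.
  - assert (Hp : 0 < Cmod u) by (pose proof (Cmod_ge_0 u); lra).
    apply Rmult_le_reg_r with (Cmod u); auto. rewrite <- Cmod_mult, E1_mult. now apply Cexp_minus_1_le.
Qed.

Lemma E1_half (u : C) : u <> 0 -> E1 u = (E1 (u / 2) * ((1 + Cexp (u / 2)) / 2))%C.
Proof.
  intros Hu. assert (H1 := E1_mult u). assert (H2 := E1_mult (u / 2)).
  assert (E : Cexp u = (Cexp (u / 2) * Cexp (u / 2))%C) by (rewrite <- Cexp_plus; f_equal; field).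
  replace (E1 u) with (E1 u * u / u)%C by (field; auto). rewrite H1, E.
  replace (E1 (u / 2)) with ((E1 (u / 2) * (u / 2)) / (u / 2))%C by (field; auto). rewrite H2. field. auto.
Qed.

(** For [|u| >= 4] the bound [2 / |u|] suffices. Otherwise use the duplication formula with
    [v = u / 2]: the factor [E1 v] has modulus at most 1, and since [|Im v| <= 2 < PI], the mean of
    1 and [exp v] stays away from modulus 1 unless [v] is near 0. *)
Lemma E1_strict (r : R) : 0 < r -> exists s, 0 < s /\ forall u, Re u <= 0 -> r <= Cmod u -> Cmod (E1 u) <= 1 - s.
Proof.
  intros Hr. assert (HPI3 := PI2_3_2).
  (* As [|v| >= r / 2], the real or the imaginary part of [v] is at least [r / 4] in absolute value;
     the cap 1 keeps [cos y0] nonnegative. *)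
  set (y0 := Rmin (r / 4) 1). assert (Hy0 : 0 < y0) by (apply Rmin_glb_lt; lra).
  assert (Hy1 : y0 <= 1) by apply Rmin_r. assert (Hy2 : y0 <= r / 4) by apply Rmin_l.
  set (c := cos y0). assert (Hc : 0 <= c < 1).
  { unfold c. split; [apply cos_ge_0; lra | ]. rewrite <- cos_0. apply cos_decreasing_1; lra. }
  set (s1 := 1 - sqrt ((1 + c) / 2)).
  assert (Hs1 : 0 < s1).
  { unfold s1. assert (sqrt ((1 + c) / 2) < 1); [ | lra]. apply Rlt_le_trans with (sqrt 1); [apply sqrt_lt_1; lra | rewrite sqrt_1; lra]. }
  set (s2 := (1 - exp (- (r / 4))) / 2).
  assert (Hs2 : 0 < s2).
  { unfold s2. assert (exp (- (r / 4)) < exp 0) by (apply exp_increasing; lra). rewrite exp_0 in *. lra. }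
  exists (Rmin (/ 2) (Rmin s1 s2)).
  assert (M1 : Rmin (/ 2) (Rmin s1 s2) <= / 2) by apply Rmin_l.
  assert (M2 : Rmin (/ 2) (Rmin s1 s2) <= s1) by (eapply Rle_trans; [apply Rmin_r | apply Rmin_l]).
  assert (M3 : Rmin (/ 2) (Rmin s1 s2) <= s2) by (eapply Rle_trans; [apply Rmin_r | apply Rmin_r]).
  split; [repeat apply Rmin_glb_lt; lra | ]. intros u Hu Hru.
  set (m := Rmin (/ 2) (Rmin s1 s2)) in *.
  assert (Hexp1 : exp (Re u) <= 1) by (rewrite <- exp_0; now apply exp_le).
  destruct (Rle_lt_dec 4 (Cmod u)) as [Hbig | Hsm].
  - assert (H := Cmod_E1_mult u). assert (Hp := Cmod_ge_0 (E1 u)). nra.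
  - assert (Hunz : u <> 0) by (apply Cmod_pos_nz; lra).
    set (v := (u / 2)%C).
    assert (Ev : v = (RtoC (/ 2) * u)%C) by (unfold v; rewrite RtoC_inv by lra; unfold Cdiv; ring).
    assert (HvR : Re v = Re u / 2) by (rewrite Ev, Re_RtoC_mult; field).
    assert (HvI : Im v = Im u / 2) by (rewrite Ev, Im_RtoC_mult; field).
    assert (Hexpv : exp (Re v) <= 1) by (rewrite <- exp_0; apply exp_le; lra).
    assert (Hev0 := exp_pos (Re v)).
    rewrite E1_half by auto. fold v. rewrite Cmod_mult.
    assert (HE : Cmod (E1 v) <= 1) by (apply Cmod_E1_le; lra).
    assert (HF : Cmod ((1 + Cexp v) / 2) <= 1 - m).
    { rewrite Cmod_div by (apply RtoC_nz; lra). rewrite Cmod_RtoC_pos by lra.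
      assert (Hcase : r / 4 <= Rabs (Re v) \/ r / 4 <= Rabs (Im v)).
      { destruct (Rle_lt_dec (r / 4) (Rabs (Re v))); [auto | ]. destruct (Rle_lt_dec (r / 4) (Rabs (Im v))); [auto | ].
        pose proof (Cmod_sum_parts v). rewrite Ev, Cmod_mult, Cmod_RtoC_pos in H by lra. rewrite <- Ev in H. lra. }
      destruct Hcase as [Hx | Hy].
      - rewrite Rabs_left1 in Hx by lra.
        assert (Cmod (1 + Cexp v) <= 1 + exp (- (r / 4))).
        { eapply Rle_trans; [apply Cmod_triangle | ]. rewrite Cmod_1, Cmod_Cexp. apply Rplus_le_compat_l. apply exp_le. lra. }
        unfold s2 in M3. lra.
      - assert (HIm : Rabs (Im v) <= 2).
        { rewrite HvI. unfold Rdiv. rewrite Rabs_mult, (Rabs_right (/ 2)) by lra. pose proof (im_le_Cmod u). lra. }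
        assert (Hcy : cos (Im v) <= c).
        { assert (HcA : cos (Rabs (Im v)) = cos (Im v)) by (unfold Rabs; destruct (Rcase_abs (Im v)); [apply cos_neg | reflexivity]).
          rewrite <- HcA. unfold c. apply cos_decr_1; lra. }
        assert (Hsq : Cmod (1 + Cexp v) * Cmod (1 + Cexp v) <= 2 * (1 + c)).
        { rewrite Cmod_sqr. unfold Cexp. set (x := exp (Re v)) in *. set (y := Im v) in *.
          unfold Re, Im; simpl. pose proof (sin2_cos2 y). unfold Rsqr in *.
          assert (x * x * (sin y * sin y + cos y * cos y) = x * x * 1) by (f_equal; lra).
          assert (x * cos y <= c) by nra. nra. }
        assert (Hle : Cmod (1 + Cexp v) <= 2 * sqrt ((1 + c) / 2)).
        { apply Rsqr_incr_0_var; [ | assert (0 <= sqrt ((1 + c) / 2)) by apply sqrt_pos; lra].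
          unfold Rsqr. replace (2 * sqrt ((1 + c) / 2) * (2 * sqrt ((1 + c) / 2))) with (4 * (sqrt ((1 + c) / 2) * sqrt ((1 + c) / 2))) by ring.
          rewrite sqrt_sqrt by lra. lra. }
        unfold s1 in M2. lra. }
    pose proof (Cmod_ge_0 (E1 v)). pose proof (Cmod_ge_0 ((1 + Cexp v) / 2)). nra.
Qed.

Lemma E1_lt_1 (u : C) : Re u < 0 -> Cmod (E1 u) < 1.
Proof.
  intros Hu. assert (Hnz : 0 < Cmod u) by (apply Cmod_nz; intro E; rewrite E in Hu; unfold Re in Hu; simpl in Hu; lra).
  destruct (E1_strict (Cmod u) Hnz) as [s [Hs H]]. specialize (H u ltac:(lra) ltac:(lra)). lra.
Qed.

(** The approximating polynomials are Riemann sums of [exp (t * u)]. Multiplied by [u] they become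
    [(1 + u / n)^n - 1], so [Cexp_approx] gives the error, which still contains a factor [|u|] to
    divide by. *)
Lemma ent_E1 : ent E1.
Proof.
  apply ent_limit. intros Rad eps HR He.
  destruct (exists_nat_large (Rad * exp (2 * Rad) / eps)) as [n [Hn Hne]].
  assert (Hp : 0 < INR n) by (apply lt_0_INR; lia).
  assert (Hpz : RtoC (INR n) <> 0) by (apply RtoC_nz; lra).
  exists (fun u => (/ INR n * csum (fun i => (1 + / INR n * u) ^ i) n)%C). split.
  - apply ent_scal. apply (ent_csum (fun i u => ((1 + / INR n * u) ^ i)%C)). intros i _. apply ent_pow.
    apply ent_plus; [apply ent_const | apply ent_scal, ent_id].
  - intros u Hu. set (A := (/ INR n * csum (fun i => (1 + / INR n * u) ^ i) n)%C).
    assert (EA : (A * u)%C = ((1 + u / INR n) ^ n - 1)%C).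
    { assert (H := csum_geom (1 + / INR n * u)%C n).
      replace (1 - (1 + / INR n * u))%C with (- (/ INR n * u))%C in H by ring.
      replace (1 + u / INR n)%C with (1 + / INR n * u)%C by (unfold Cdiv; ring).
      replace ((1 + / INR n * u) ^ n - 1)%C with (- (1 - (1 + / INR n * u) ^ n))%C by ring. rewrite <- H. unfold A. ring. }
    destruct (Req_dec (Cmod u) 0) as [E | E].
    + assert (Eu := Cmod_eq_0 _ E). rewrite Eu at 1. rewrite E1_0. replace A with (RtoC 1).
      * replace (1 - 1)%C with (RtoC 0) by ring. rewrite Cmod_0. lra.
      * unfold A. rewrite (csum_ext _ (fun _ => RtoC 1)).
        2: { intros i _. rewrite Eu. replace (1 + / INR n * 0)%C with (RtoC 1) by ring. apply Cpow_1_l. }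
        replace (csum (fun _ => RtoC 1) n) with (RtoC (INR n)).
        2: { clear. induction n; [reflexivity | ]. cbn [csum]. rewrite S_INR, RtoC_plus, IHn. reflexivity. }
        field. auto.
    + assert (Hup : 0 < Cmod u) by (pose proof (Cmod_ge_0 u); lra).
      apply Rmult_le_reg_r with (Cmod u); auto. rewrite <- Cmod_mult.
      replace ((E1 u - A) * u)%C with (Cexp u - (1 + u / INR n) ^ n)%C.
      2: { replace ((E1 u - A) * u)%C with (E1 u * u - A * u)%C by ring. rewrite E1_mult, EA. ring. }
      eapply Rle_trans; [apply Cexp_approx; auto | ].
      assert (exp (2 * Cmod u) <= exp (2 * Rad)) by (apply exp_le; lra).
      assert (He2 := exp_pos (2 * Cmod u)).
      assert (Hb : Rad * exp (2 * Rad) <= INR n * eps).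
      { replace (Rad * exp (2 * Rad)) with (Rad * exp (2 * Rad) / eps * eps) by (field; lra). apply Rmult_le_compat_r; lra. }
      apply Rmult_le_reg_r with (INR n); auto.
      replace (Cmod u ^ 2 * exp (2 * Cmod u) / INR n * INR n) with (Cmod u * (Cmod u * exp (2 * Cmod u))) by (field; lra).
      replace (eps * Cmod u * INR n) with (Cmod u * (INR n * eps)) by ring.
      apply Rmult_le_compat_l; [lra | ]. eapply Rle_trans; [ | exact Hb]. apply Rmult_le_compat; lra.
Qed.

(** * Holomorphy in two variables *)

(** A first-order expansion with quadratic remainder: stronger than differentiability at a point,
    and stable under products, inverses, composition with entire functions and summable series. *)
Definition loc2 (F : C -> C -> C) (a b : C) : Prop :=
  exists c1 c2 K d, 0 < K /\ 0 < d /\ forall h1 h2, Cmod h1 <= d -> Cmod h2 <= d ->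
    Cmod (F (a + h1) (b + h2) - F a b - (c1 * h1 + c2 * h2))%C <= K * (Cmod h1 + Cmod h2) ^ 2.

Lemma norm2_fst (h : C2) : Cmod (fst h) <= norm2 h.
Proof.
  unfold norm2. rewrite <- (sqrt_pow2 (Cmod (fst h))) at 1 by apply Cmod_ge_0. apply sqrt_le_1_alt.
  pose proof (pow2_ge_0 (Cmod (snd h))). lra.
Qed.

Lemma norm2_snd (h : C2) : Cmod (snd h) <= norm2 h.
Proof.
  unfold norm2. rewrite <- (sqrt_pow2 (Cmod (snd h))) at 1 by apply Cmod_ge_0. apply sqrt_le_1_alt.
  pose proof (pow2_ge_0 (Cmod (fst h))). lra.
Qed.

Lemma norm2_le_sum (h : C2) : norm2 h <= Cmod (fst h) + Cmod (snd h).
Proof.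
  unfold norm2. pose proof (Cmod_ge_0 (fst h)). pose proof (Cmod_ge_0 (snd h)).
  rewrite <- (sqrt_pow2 (Cmod (fst h) + Cmod (snd h))) by lra. apply sqrt_le_1_alt. simpl. nra.
Qed.

Lemma loc2_holomorphic (U : C2 -> Prop) (F : C -> C -> C) : (forall a, U a -> loc2 F (fst a) (snd a)) ->
  holomorphic_on U (fun w => F (fst w) (snd w)).
Proof.
  intros H a Ha. destruct (H a Ha) as [c1 [c2 [K [d [HK [Hd HF]]]]]]. exists c1, c2. intros eps He.
  exists (Rmin d (eps / (4 * K))). split; [apply Rmin_glb_lt; [auto | apply Rdiv_lt_0_compat; lra] | ].
  intros h Hh _. simpl fst. simpl snd.
  assert (H1 := norm2_fst h). assert (H2 := norm2_snd h).
  assert (M1 := Rmin_l d (eps / (4 * K))). assert (M2 := Rmin_r d (eps / (4 * K))).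
  eapply Rle_trans; [apply HF; lra | ].
  pose proof (Cmod_ge_0 (fst h)). pose proof (Cmod_ge_0 (snd h)).
  assert (Hn : norm2 h * (4 * K) <= eps).
  { apply Rle_trans with (eps / (4 * K) * (4 * K)); [apply Rmult_le_compat_r; lra | right; field; lra]. }
  assert ((Cmod (fst h) + Cmod (snd h)) ^ 2 <= (2 * norm2 h) ^ 2) by (apply pow_incr; lra).
  apply Rle_trans with (K * (2 * norm2 h) ^ 2); [apply Rmult_le_compat_l; lra | ].
  replace (K * (2 * norm2 h) ^ 2) with (norm2 h * (4 * K) * norm2 h) by ring.
  apply Rmult_le_compat_r; lra.
Qed.

Lemma loc2_continuous (F : C -> C -> C) (a b : C) : loc2 F a b -> forall eps, 0 < eps ->
  exists d, 0 < d /\ forall x y, Cmod (x - a) < d -> Cmod (y - b) < d -> Cmod (F x y - F a b) < eps.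
Proof.
  intros [c1 [c2 [K [d [HK [Hd HF]]]]]] eps He.
  set (A := Cmod c1 + Cmod c2 + 4 * K + 1).
  assert (HA : 0 < A) by (unfold A; pose proof (Cmod_ge_0 c1); pose proof (Cmod_ge_0 c2); lra).
  exists (Rmin (Rmin d 1) (eps / A)).
  assert (M1 : Rmin (Rmin d 1) (eps / A) <= d) by (eapply Rle_trans; [apply Rmin_l | apply Rmin_l]).
  assert (M2 : Rmin (Rmin d 1) (eps / A) <= 1) by (eapply Rle_trans; [apply Rmin_l | apply Rmin_r]).
  assert (M3 : Rmin (Rmin d 1) (eps / A) <= eps / A) by apply Rmin_r.
  split; [apply Rmin_glb_lt; [apply Rmin_glb_lt; lra | apply Rdiv_lt_0_compat; lra] | ].
  set (m := Rmin (Rmin d 1) (eps / A)) in *. intros x y Hx Hy.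
  assert (H := HF (x - a)%C (y - b)%C ltac:(lra) ltac:(lra)).
  replace (a + (x - a))%C with x in H by ring. replace (b + (y - b))%C with y in H by ring.
  set (h1 := (x - a)%C) in *. set (h2 := (y - b)%C) in *.
  assert (G := Cmod_reverse (F x y - F a b) (c1 * h1 + c2 * h2)).
  assert (G2 := Cmod_triangle (c1 * h1) (c2 * h2)). rewrite !Cmod_mult in G2.
  pose proof (Cmod_ge_0 h1). pose proof (Cmod_ge_0 h2). pose proof (Cmod_ge_0 c1). pose proof (Cmod_ge_0 c2).
  assert (Cmod c1 * Cmod h1 <= Cmod c1 * m) by (apply Rmult_le_compat_l; lra).
  assert (Cmod c2 * Cmod h2 <= Cmod c2 * m) by (apply Rmult_le_compat_l; lra).
  assert (K * (Cmod h1 + Cmod h2) ^ 2 <= K * (4 * m)).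
  { apply Rmult_le_compat_l; [lra | ]. simpl. nra. }
  assert (m * A <= eps).
  { apply Rle_trans with (eps / A * A); [apply Rmult_le_compat_r; lra | right; field; lra]. }
  unfold A in *. nra.
Qed.

Lemma loc2_ext (F G : C -> C -> C) (a b : C) : (forall x y, F x y = G x y) -> loc2 F a b -> loc2 G a b.
Proof.
  intros E [c1 [c2 [K [d [HK [Hd HF]]]]]]. exists c1, c2, K, d. split; [auto | split; [auto | ]].
  intros. rewrite <- !E. auto.
Qed.

Lemma ent_local (f : C -> C) (a : C) : ent f -> exists c K, 0 < K /\ forall h, Cmod h <= 1 -> Cmod (f (a + h)%C - f a - c * h) <= K * Cmod h ^ 2.
Proof.
  intros Hf. assert (Ha := ent_affine f a 1 Hf).
  destruct (ent_taylor _ Ha) as [c Hc]. destruct (ent_bounded _ 2 Ha) as [M [HM HMb]].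
  destruct (Hc 2 M ltac:(lra) HMb) as [_ H]. exists c, M. split; auto. intros h Hh.
  specialize (H h ltac:(lra)). replace (a + 1 * h)%C with (a + h)%C in H by ring. replace (a + 1 * 0)%C with a in H by ring.
  eapply Rle_trans; [exact H | ]. pose proof (pow2_ge_0 (Cmod h)). simpl (2 ^ 2). nra.
Qed.

Lemma loc2_fst (f : C -> C) (a b : C) : ent f -> loc2 (fun x _ => f x) a b.
Proof.
  intros Hf. destruct (ent_local f a Hf) as [c [K [HK H]]]. exists c, 0%C, K, 1. split; [auto | split; [lra | ]].
  intros h1 h2 H1 H2. replace (c * h1 + 0 * h2)%C with (c * h1)%C by ring. eapply Rle_trans; [apply H; auto | ].
  apply Rmult_le_compat_l; [lra | ]. apply pow_incr. pose proof (Cmod_ge_0 h1). pose proof (Cmod_ge_0 h2). lra.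
Qed.

Lemma loc2_snd (f : C -> C) (a b : C) : ent f -> loc2 (fun _ y => f y) a b.
Proof.
  intros Hf. destruct (ent_local f b Hf) as [c [K [HK H]]]. exists 0%C, c, K, 1. split; [auto | split; [lra | ]].
  intros h1 h2 H1 H2. replace (0 * h1 + c * h2)%C with (c * h2)%C by ring. eapply Rle_trans; [apply H; auto | ].
  apply Rmult_le_compat_l; [lra | ]. apply pow_incr. pose proof (Cmod_ge_0 h1). pose proof (Cmod_ge_0 h2). lra.
Qed.

Lemma loc2_plus (F G : C -> C -> C) (a b : C) : loc2 F a b -> loc2 G a b -> loc2 (fun x y => (F x y + G x y)%C) a b.
Proof.
  intros [c1 [c2 [K [d [HK [Hd HF]]]]]] [e1 [e2 [L [d' [HL [Hd' HG]]]]]].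
  exists (c1 + e1)%C, (c2 + e2)%C, (K + L), (Rmin d d'). split; [lra | split; [apply Rmin_glb_lt; auto | ]].
  intros h1 h2 H1 H2. assert (M1 := Rmin_l d d'). assert (M2 := Rmin_r d d').
  specialize (HF h1 h2 ltac:(lra) ltac:(lra)). specialize (HG h1 h2 ltac:(lra) ltac:(lra)).
  match goal with |- Cmod ?e <= _ => replace e with ((F (a + h1) (b + h2) - F a b - (c1 * h1 + c2 * h2)) + (G (a + h1) (b + h2) - G a b - (e1 * h1 + e2 * h2)))%C by ring end.
  eapply Rle_trans; [apply Cmod_triangle | ]. lra.
Qed.

Lemma loc2_lip (F : C -> C -> C) (a b : C) : loc2 F a b -> exists A d, 0 < A /\ 0 < d /\ forall h1 h2, Cmod h1 <= d -> Cmod h2 <= d ->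
  Cmod (F (a + h1)%C (b + h2)%C - F a b) <= A * (Cmod h1 + Cmod h2).
Proof.
  intros [c1 [c2 [K [d [HK [Hd HF]]]]]].
  exists (Cmod c1 + Cmod c2 + 2 * K + 1), (Rmin d 1).
  pose proof (Cmod_ge_0 c1). pose proof (Cmod_ge_0 c2).
  split; [lra | split; [apply Rmin_glb_lt; lra | ]]. intros h1 h2 H1 H2.
  assert (M1 := Rmin_l d 1). assert (M2 := Rmin_r d 1).
  specialize (HF h1 h2 ltac:(lra) ltac:(lra)).
  assert (G := Cmod_reverse (F (a + h1)%C (b + h2)%C - F a b) (c1 * h1 + c2 * h2)).
  assert (G2 := Cmod_triangle (c1 * h1) (c2 * h2)). rewrite !Cmod_mult in G2.
  pose proof (Cmod_ge_0 h1). pose proof (Cmod_ge_0 h2).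
  assert (K * (Cmod h1 + Cmod h2) ^ 2 <= K * (2 * (Cmod h1 + Cmod h2))) by (apply Rmult_le_compat_l; [lra | simpl; nra]).
  nra.
Qed.

Lemma loc2_mult (F G : C -> C -> C) (a b : C) : loc2 F a b -> loc2 G a b -> loc2 (fun x y => (F x y * G x y)%C) a b.
Proof.
  intros LF LG. destruct (loc2_lip F a b LF) as [A [dA [HA [HdA HFA]]]]. destruct (loc2_lip G a b LG) as [B [dB [HB [HdB HGB]]]].
  destruct LF as [c1 [c2 [K [d [HK [Hd HF]]]]]]. destruct LG as [e1 [e2 [L [d' [HL [Hd' HG]]]]]].
  exists (c1 * G a b + F a b * e1)%C, (c2 * G a b + F a b * e2)%C, (K * Cmod (G a b) + Cmod (F a b) * L + A * B + 1), (Rmin (Rmin d d') (Rmin dA dB)).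
  pose proof (Cmod_ge_0 (G a b)). pose proof (Cmod_ge_0 (F a b)).
  split; [nra | split; [repeat apply Rmin_glb_lt; auto | ]]. intros h1 h2 H1 H2.
  assert (M1 := Rmin_l (Rmin d d') (Rmin dA dB)). assert (M2 := Rmin_r (Rmin d d') (Rmin dA dB)).
  assert (M3 := Rmin_l d d'). assert (M4 := Rmin_r d d'). assert (M5 := Rmin_l dA dB). assert (M6 := Rmin_r dA dB).
  specialize (HF h1 h2 ltac:(lra) ltac:(lra)). specialize (HG h1 h2 ltac:(lra) ltac:(lra)).
  specialize (HFA h1 h2 ltac:(lra) ltac:(lra)). specialize (HGB h1 h2 ltac:(lra) ltac:(lra)).
  set (f := F (a + h1)%C (b + h2)%C) in *. set (g := G (a + h1)%C (b + h2)%C) in *. set (f0 := F a b) in *. set (g0 := G a b) in *.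
  replace (f * g - f0 * g0 - ((c1 * g0 + f0 * e1) * h1 + (c2 * g0 + f0 * e2) * h2))%C with
    ((f - f0 - (c1 * h1 + c2 * h2)) * g0 + f0 * (g - g0 - (e1 * h1 + e2 * h2)) + (f - f0) * (g - g0))%C by ring.
  eapply Rle_trans; [apply Cmod_triangle | ]. eapply Rle_trans; [apply Rplus_le_compat_r, Cmod_triangle | ]. rewrite !Cmod_mult.
  set (t := Cmod h1 + Cmod h2) in *. assert (Ht : 0 <= t) by (unfold t; pose proof (Cmod_ge_0 h1); pose proof (Cmod_ge_0 h2); lra).
  assert (Cmod (f - f0 - (c1 * h1 + c2 * h2)) * Cmod g0 <= K * t ^ 2 * Cmod g0) by (apply Rmult_le_compat_r; auto).
  assert (Cmod f0 * Cmod (g - g0 - (e1 * h1 + e2 * h2)) <= Cmod f0 * (L * t ^ 2)) by (apply Rmult_le_compat_l; auto).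
  assert (Cmod (f - f0) * Cmod (g - g0) <= (A * t) * (B * t)) by (apply Rmult_le_compat; auto using Cmod_ge_0).
  assert (0 <= t ^ 2) by apply pow2_ge_0. nra.
Qed.

Lemma loc2_const (c a b : C) : loc2 (fun _ _ => c) a b.
Proof. apply (loc2_fst (fun _ => c)). apply ent_const. Qed.

Lemma loc2_pow (F : C -> C -> C) (a b : C) (n : nat) : loc2 F a b -> loc2 (fun x y => (F x y ^ n)%C) a b.
Proof.
  intros HF. induction n; [exact (loc2_const 1 a b) | ].
  apply loc2_ext with (fun x y => (F x y * F x y ^ n)%C); [reflexivity | now apply loc2_mult].
Qed.

Lemma loc2_comp (f : C -> C) (F : C -> C -> C) (a b : C) : ent f -> loc2 F a b -> loc2 (fun x y => f (F x y)) a b.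
Proof.
  intros Hf LF. destruct (loc2_lip F a b LF) as [A [dA [HA [HdA HFA]]]].
  destruct LF as [c1 [c2 [K [d [HK [Hd HF]]]]]].
  destruct (ent_local f (F a b) Hf) as [c [L [HL H]]].
  exists (c * c1)%C, (c * c2)%C, (Cmod c * K + L * A ^ 2 + 1), (Rmin (Rmin d dA) (/ (2 * A))).
  pose proof (Cmod_ge_0 c).
  split; [assert (0 <= A ^ 2) by apply pow2_ge_0; nra | split; [repeat apply Rmin_glb_lt; auto; apply Rinv_0_lt_compat; lra | ]].
  intros h1 h2 H1 H2.
  assert (M1 := Rmin_l (Rmin d dA) (/ (2 * A))). assert (M2 := Rmin_r (Rmin d dA) (/ (2 * A))).
  assert (M3 := Rmin_l d dA). assert (M4 := Rmin_r d dA).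
  specialize (HF h1 h2 ltac:(lra) ltac:(lra)). specialize (HFA h1 h2 ltac:(lra) ltac:(lra)).
  set (x := (F (a + h1)%C (b + h2)%C - F a b)%C) in *.
  set (t := Cmod h1 + Cmod h2) in *. assert (Ht : 0 <= t) by (unfold t; pose proof (Cmod_ge_0 h1); pose proof (Cmod_ge_0 h2); lra).
  assert (Hx1 : Cmod x <= 1).
  { eapply Rle_trans; [exact HFA | ]. apply Rle_trans with (A * (2 * / (2 * A))); [apply Rmult_le_compat_l; unfold t; lra | right; field; lra]. }
  specialize (H x Hx1). replace (F a b + x)%C with (F (a + h1)%C (b + h2)%C) in H by (unfold x; ring).
  match goal with |- Cmod ?e <= _ => replace e with ((f (F (a + h1)%C (b + h2)%C) - f (F a b) - c * x) + c * (x - (c1 * h1 + c2 * h2)))%C by ring end.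
  eapply Rle_trans; [apply Cmod_triangle | ]. rewrite Cmod_mult.
  assert (Cmod c * Cmod (x - (c1 * h1 + c2 * h2)) <= Cmod c * (K * t ^ 2)) by (apply Rmult_le_compat_l; auto).
  assert (L * Cmod x ^ 2 <= L * (A * t) ^ 2) by (apply Rmult_le_compat_l; [lra | apply pow_incr; split; auto using Cmod_ge_0]).
  assert (0 <= t ^ 2) by apply pow2_ge_0. rewrite Rpow_mult_distr in *. nra.
Qed.

Lemma loc2_inv (F : C -> C -> C) (a b : C) : F a b <> 0 -> loc2 F a b -> loc2 (fun x y => (/ F x y)%C) a b.
Proof.
  intros Hnz LF. destruct (loc2_lip F a b LF) as [A [dA [HA [HdA HFA]]]].
  destruct LF as [c1 [c2 [K [d [HK [Hd HF]]]]]]. assert (H0 := Cmod_nz _ Hnz). set (f0 := F a b) in *. set (m := Cmod f0) in *.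
  exists (- (c1 / (f0 * f0)))%C, (- (c2 / (f0 * f0)))%C, (K / m ^ 2 + 2 * A ^ 2 / m ^ 3), (Rmin (Rmin d dA) (m / (4 * A))).
  assert (Hm2 : 0 < m ^ 2) by (apply pow_lt; auto). assert (Hm3 : 0 < m ^ 3) by (apply pow_lt; auto).
  assert (HA2 : 0 < A ^ 2) by (apply pow_lt; auto).
  split; [apply Rplus_lt_0_compat; apply Rdiv_lt_0_compat; lra | split; [repeat apply Rmin_glb_lt; auto; apply Rdiv_lt_0_compat; lra | ]].
  intros h1 h2 H1 H2.
  assert (M1 := Rmin_l (Rmin d dA) (m / (4 * A))). assert (M2 := Rmin_r (Rmin d dA) (m / (4 * A))).
  assert (M3 := Rmin_l d dA). assert (M4 := Rmin_r d dA).
  specialize (HF h1 h2 ltac:(lra) ltac:(lra)). specialize (HFA h1 h2 ltac:(lra) ltac:(lra)).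
  cbv beta. fold f0. set (f := F (a + h1)%C (b + h2)%C) in *. set (t := Cmod h1 + Cmod h2) in *.
  assert (Ht : 0 <= t) by (unfold t; pose proof (Cmod_ge_0 h1); pose proof (Cmod_ge_0 h2); lra).
  assert (Hfm : m / 2 <= Cmod f).
  { assert (A * t <= m / 2).
    { apply Rle_trans with (A * (2 * (m / (4 * A)))); [apply Rmult_le_compat_l; unfold t; lra | right; field; lra]. }
    pose proof (Cmod_reverse f0 (f0 - f)). replace (f0 - (f0 - f))%C with f in H3 by ring. rewrite (Cmod_minus_sym f0 f) in H3. fold m in H3. lra. }
  assert (Hf : f <> 0) by (apply Cmod_pos_nz; lra).
  match goal with |- Cmod ?e <= _ => replace e with ((f - f0) * (f - f0) / (f0 * f0 * f) - (f - f0 - (c1 * h1 + c2 * h2)) / (f0 * f0))%C by (field; auto) end.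
  eapply Rle_trans; [apply Cmod_triangle_minus | ].
  assert (Hff : (f0 * f0)%C <> 0) by (apply Cmod_pos_nz; rewrite Cmod_mult; fold m; nra).
  assert (Hfff : (f0 * f0 * f)%C <> 0) by (apply Cmod_pos_nz; rewrite !Cmod_mult; fold m; apply Rmult_lt_0_compat; nra).
  rewrite !Cmod_div by auto. rewrite !Cmod_mult. fold m.
  assert (P1 : Cmod (f - f0) * Cmod (f - f0) / (m * m * Cmod f) <= 2 * A ^ 2 / m ^ 3 * t ^ 2).
  { apply Rle_trans with ((A * t) * (A * t) / (m * m * (m / 2))); [ | right; field; lra].
    unfold Rdiv at 1. unfold Rdiv at 2. apply Rmult_le_compat.
    - apply Rmult_le_pos; apply Cmod_ge_0.
    - apply Rlt_le, Rinv_0_lt_compat. repeat apply Rmult_lt_0_compat; lra.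
    - apply Rmult_le_compat; auto using Cmod_ge_0.
    - apply Rinv_le_contravar; [repeat apply Rmult_lt_0_compat; lra | ]. apply Rmult_le_compat_l; nra. }
  assert (P2 : Cmod (f - f0 - (c1 * h1 + c2 * h2)) / (m * m) <= K / m ^ 2 * t ^ 2).
  { replace (K / m ^ 2 * t ^ 2) with (K * t ^ 2 / (m * m)) by (field; lra).
    apply Rmult_le_compat_r; [apply Rlt_le, Rinv_0_lt_compat; nra | auto]. }
  lra.
Qed.

(** Only the product of the two factors is bounded: in the dyadic series one factor may be huge
    where the other is tiny. Each Taylor estimate of one factor is therefore used with the bound
    divided by a value of the other, the case of the value zero being separate. *)
Lemma prod_taylor (al be : C -> C) : ent al -> ent be -> exists c1 c2, forall t M, 0 < t ->
  (forall v1 v2, Cmod v1 <= t -> Cmod v2 <= t -> Cmod (al v1 * be v2)%C <= M) ->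
  Cmod c1 <= M / t /\ Cmod c2 <= M / t /\ forall v1 v2, Cmod v1 <= t / 2 -> Cmod v2 <= t / 2 ->
    Cmod (al v1 * be v2 - al 0%C * be 0%C - (c1 * v1 + c2 * v2))%C <= 2 * M / t ^ 2 * (Cmod v1 + Cmod v2) ^ 2.
Proof.
  intros Ha Hb. destruct (ent_taylor al Ha) as [ca Hca]. destruct (ent_taylor be Hb) as [cb Hcb].
  exists (ca * be 0%C)%C, (al 0%C * cb)%C. intros t M Ht HM.
  assert (HM0 : 0 <= M) by (eapply Rle_trans; [apply Cmod_ge_0 | apply (HM 0%C 0%C); rewrite Cmod_0; lra]).
  assert (Z : Cmod 0 <= t) by (rewrite Cmod_0; lra).
  assert (Ht2 : 0 < t ^ 2) by (apply pow_lt; auto).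
  (* scaled estimates: multiply the Taylor bounds of one factor by a value of the other *)
  assert (SA : forall v, Cmod v <= t -> Cmod ca * Cmod (be v) <= M / t /\ forall z, Cmod z <= t / 2 ->
      Cmod (al z - al 0%C - ca * z) * Cmod (be v) <= 2 * M * Cmod z ^ 2 / t ^ 2).
  { intros v Hv. destruct (Req_dec (Cmod (be v)) 0) as [E | E].
    - rewrite E. split; [rewrite Rmult_0_r; apply Rdiv_le_0_compat; auto | ]. intros. rewrite Rmult_0_r.
      apply Rdiv_le_0_compat; auto. apply Rmult_le_pos; [lra | apply pow2_ge_0].
    - assert (Hp : 0 < Cmod (be v)) by (pose proof (Cmod_ge_0 (be v)); lra).
      destruct (Hca t (M / Cmod (be v)) Ht) as [T1 T2].
      { intros z Hz. specialize (HM z v Hz Hv). rewrite Cmod_mult in HM. apply Rmult_le_reg_r with (Cmod (be v)); auto.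
        replace (M / Cmod (be v) * Cmod (be v)) with M by (field; lra). auto. }
      split.
      + apply Rmult_le_reg_r with t; auto. replace (M / t * t) with (M / Cmod (be v) * Cmod (be v)) by (field; lra).
        replace (Cmod ca * Cmod (be v) * t) with (Cmod ca * t * Cmod (be v)) by ring. apply Rmult_le_compat_r; lra.
      + intros z Hz. specialize (T2 z Hz).
        replace (2 * M * Cmod z ^ 2 / t ^ 2) with (2 * (M / Cmod (be v)) * Cmod z ^ 2 / t ^ 2 * Cmod (be v)) by (field; lra).
        apply Rmult_le_compat_r; lra. }
  assert (SB : forall x B, 0 <= x -> (forall v, Cmod v <= t -> x * Cmod (be v) <= B) -> x * Cmod cb <= B / t /\ forall z, Cmod z <= t / 2 ->
      x * Cmod (be z - be 0%C - cb * z) <= 2 * B * Cmod z ^ 2 / t ^ 2).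
  { intros x B Hx HB. assert (HB0 : 0 <= B) by (eapply Rle_trans; [ | apply (HB 0%C Z)]; apply Rmult_le_pos; [auto | apply Cmod_ge_0]).
    destruct Hx as [Hx | <-].
    - destruct (Hcb t (B / x) Ht) as [T1 T2].
      { intros z Hz. specialize (HB z Hz). apply Rmult_le_reg_l with x; auto. replace (x * (B / x)) with B by (field; lra). auto. }
      split.
      + apply Rmult_le_reg_r with t; auto. replace (B / t * t) with (x * (B / x)) by (field; lra).
        rewrite Rmult_assoc. apply Rmult_le_compat_l; lra.
      + intros z Hz. specialize (T2 z Hz).
        replace (2 * B * Cmod z ^ 2 / t ^ 2) with (x * (2 * (B / x) * Cmod z ^ 2 / t ^ 2)) by (field; lra).
        apply Rmult_le_compat_l; lra.
    - split; [rewrite Rmult_0_l; apply Rdiv_le_0_compat; auto | ]. intros. rewrite Rmult_0_l.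
      apply Rdiv_le_0_compat; auto. apply Rmult_le_pos; [lra | apply pow2_ge_0]. }
  destruct (SB (Cmod (al 0%C)) M (Cmod_ge_0 _)) as [B1 B2].
  { intros v Hv. rewrite <- Cmod_mult. apply HM; auto. }
  destruct (SB (Cmod ca) (M / t) (Cmod_ge_0 _)) as [D1 D2].
  { intros v Hv. apply SA; auto. }
  split; [rewrite Cmod_mult; apply SA; auto | split; [rewrite Cmod_mult; exact B1 | ]].
  intros v1 v2 H1 H2. assert (H2' : Cmod v2 <= t) by lra.
  destruct (SA v2 H2') as [_ A2]. specialize (A2 v1 H1). specialize (B2 v2 H2). specialize (D2 v2 H2).
  set (x1 := Cmod v1) in *. set (x2 := Cmod v2) in *. assert (Hx1 : 0 <= x1) by apply Cmod_ge_0. assert (Hx2 : 0 <= x2) by apply Cmod_ge_0.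
  replace (al v1 * be v2 - al 0 * be 0 - (ca * be 0 * v1 + al 0 * cb * v2))%C with
    ((al v1 - al 0 - ca * v1) * be v2 + al 0 * (be v2 - be 0 - cb * v2) + (ca * (be v2 - be 0 - cb * v2) + (ca * cb) * v2) * v1)%C by ring.
  eapply Rle_trans; [apply Cmod_triangle | ]. eapply Rle_trans; [apply Rplus_le_compat_r, Cmod_triangle | ].
  rewrite (Cmod_mult (al v1 - al 0 - ca * v1)), (Cmod_mult (al 0%C)), (Cmod_mult _ v1). fold x1.
  assert (T3 : Cmod (ca * (be v2 - be 0 - cb * v2) + (ca * cb) * v2) <= 2 * M / t ^ 2 * x2).
  { eapply Rle_trans; [apply Cmod_triangle | ]. rewrite !Cmod_mult. fold x2.
    assert (Cmod ca * Cmod cb * x2 <= M / t / t * x2) by (apply Rmult_le_compat_r; auto).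
    assert (2 * (M / t) * x2 ^ 2 / t ^ 2 <= M / t / t * x2).
    { replace (2 * (M / t) * x2 ^ 2 / t ^ 2) with (M / t ^ 3 * x2 * (2 * x2)) by (field; lra).
      replace (M / t / t * x2) with (M / t ^ 3 * x2 * t) by (field; lra).
      apply Rmult_le_compat_l; [ | lra]. apply Rmult_le_pos; auto. apply Rdiv_le_0_compat; auto. apply pow_lt; auto. }
    replace (2 * M / t ^ 2 * x2) with (M / t / t * x2 + M / t / t * x2) by (field; lra). lra. }
  assert (T3' : Cmod (ca * (be v2 - be 0 - cb * v2) + (ca * cb) * v2) * x1 <= 2 * M / t ^ 2 * x2 * x1) by (apply Rmult_le_compat_r; auto).
  set (Y := 2 * M / t ^ 2) in *. assert (HY : 0 <= Y) by (unfold Y; apply Rdiv_le_0_compat; lra).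
  replace (2 * M * x1 ^ 2 / t ^ 2) with (Y * x1 ^ 2) in A2 by (unfold Y; field; lra).
  replace (2 * M * x2 ^ 2 / t ^ 2) with (Y * x2 ^ 2) in B2 by (unfold Y; field; lra).
  assert (0 <= Y * (x1 * x2)) by (apply Rmult_le_pos; nra).
  simpl in *. nra.
Qed.

Lemma rsum_half_pow (K : R) (n : nat) : 0 <= K -> rsum (fun j => K / 2 ^ j) n <= 2 * K.
Proof.
  intros HK. assert (H : rsum (fun j => K / 2 ^ j) n <= 2 * K - 2 * K / 2 ^ n).
  { induction n; cbn [rsum]; [simpl; lra | ].
    replace (2 * K / 2 ^ S n) with (K / 2 ^ n) by (simpl; field; apply pow_nonzero; lra).
    replace (2 * K / 2 ^ n) with (2 * (K / 2 ^ n)) in IHn by (field; apply pow_nonzero; lra). lra. }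
  assert (0 <= 2 * K / 2 ^ n) by (apply Rdiv_le_0_compat; [lra | apply pow_lt; lra]). lra.
Qed.

Lemma series_cvg (c : nat -> C) (K : R) : 0 <= K -> (forall j, Cmod (c j) <= K / 2 ^ j) -> exists l, cvg (csum c) l.
Proof.
  intros HK Hc. apply cvg_complete. intros eps He.
  assert (Htail : forall n m, Cmod (csum c (n + m) - csum c n) <= 2 * K / 2 ^ n).
  { intros n m. rewrite csum_split. replace (csum c n + csum (fun i => c (n + i)%nat) m - csum c n)%C with (csum (fun i => c (n + i)%nat) m) by ring.
    eapply Rle_trans; [apply Cmod_csum_le with (g := fun j => (K / 2 ^ n) / 2 ^ j) | ].
    - intros i _. eapply Rle_trans; [apply Hc | ]. rewrite pow_add. right. field. split; apply pow_nonzero; lra.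
    - eapply Rle_trans; [apply rsum_half_pow | right; field; apply pow_nonzero; lra].
      apply Rdiv_le_0_compat; [auto | apply pow_lt; lra]. }
  destruct (exists_nat_large (4 * K / eps)) as [n0 [Hn0 Hn1]].
  assert (Hp : INR n0 <= 2 ^ n0).
  { clear. induction n0; [simpl; lra | ]. rewrite S_INR. simpl. assert (1 <= 2 ^ n0) by (apply pow_R1_Rle; lra). lra. }
  assert (Hpp : 0 < 2 ^ n0) by (apply pow_lt; lra).
  assert (Hsm : 2 * K / 2 ^ n0 < eps / 2).
  { apply Rmult_lt_reg_r with (2 ^ n0); auto. replace (2 * K / 2 ^ n0 * 2 ^ n0) with (2 * K) by (field; lra).
    assert (4 * K / eps * eps = 4 * K) by (field; lra). nra. }
  exists n0. intros n m Hn Hm.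
  assert (H1 := Htail n0 (n - n0)%nat). assert (H2 := Htail n0 (m - n0)%nat).
  replace (n0 + (n - n0))%nat with n in H1 by lia. replace (n0 + (m - n0))%nat with m in H2 by lia.
  pose proof (Cmod_triangle3 (csum c n) (csum c n0) (csum c m)). rewrite (Cmod_minus_sym (csum c n0)) in H. lra.
Qed.

Lemma cvg_Cmod_le_lim (u : nat -> C) (l : C) (B : R) : cvg u l -> (forall n, Cmod (u n) <= B) -> Cmod l <= B.
Proof. intros H HB. apply (cvg_Cmod_le0 u); auto. exists O. auto. Qed.

(** The coefficients and remainders of the terms given by [prod_taylor] are dominated by [K / 2^j],
    so the expansions of the partial sums have a common remainder constant and pass to the limit. *)
Lemma series_loc2 (A B : C -> C) (lam mu : R) (g : C -> C -> C) (a b : C) (t K : R) : ent A -> ent B -> 0 < t -> 0 <= K ->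
  (forall j v1 v2, Cmod v1 <= t -> Cmod v2 <= t -> Cmod (A (RtoC (lam ^ j) * (a + v1))%C * B (RtoC (mu ^ j) * (b + v2))%C)%C <= K / 2 ^ j) ->
  (forall v1 v2, Cmod v1 <= t -> Cmod v2 <= t ->
     cvg (csum (fun j => (A (RtoC (lam ^ j) * (a + v1))%C * B (RtoC (mu ^ j) * (b + v2))%C)%C)) (g (a + v1)%C (b + v2)%C)) ->
  loc2 g a b.
Proof.
  intros HA HB Ht HK Hbd Hcv.
  assert (Hc : forall j, exists c : C * C, Cmod (fst c) <= K / 2 ^ j / t /\ Cmod (snd c) <= K / 2 ^ j / t /\
     forall v1 v2, Cmod v1 <= t / 2 -> Cmod v2 <= t / 2 ->
     Cmod (A (RtoC (lam ^ j) * (a + v1))%C * B (RtoC (mu ^ j) * (b + v2))%C - A (RtoC (lam ^ j) * a)%C * B (RtoC (mu ^ j) * b)%C - (fst c * v1 + snd c * v2))%C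
       <= 2 * (K / 2 ^ j) / t ^ 2 * (Cmod v1 + Cmod v2) ^ 2).
  { intros j.
    assert (EA : ent (fun v => A (RtoC (lam ^ j) * (a + v))%C)).
    { apply ent_ext with (fun v => A (RtoC (lam ^ j) * a + RtoC (lam ^ j) * v)%C); [intros; f_equal; ring | now apply ent_affine]. }
    assert (EB : ent (fun v => B (RtoC (mu ^ j) * (b + v))%C)).
    { apply ent_ext with (fun v => B (RtoC (mu ^ j) * b + RtoC (mu ^ j) * v)%C); [intros; f_equal; ring | now apply ent_affine]. }
    destruct (prod_taylor _ _ EA EB) as [c1 [c2 H]]. exists (c1, c2). simpl fst. simpl snd.
    destruct (H t (K / 2 ^ j) Ht (Hbd j)) as [H1 [H2 H3]]. split; [auto | split; [auto | ]].
    intros v1 v2 Hv1 Hv2. specialize (H3 v1 v2 Hv1 Hv2). cbv beta in H3.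
    replace (a + 0)%C with a in H3 by ring. replace (b + 0)%C with b in H3 by ring. exact H3. }
  destruct (functional_choice _ Hc) as [c Hc']. clear Hc.
  assert (HKt : 0 <= K / t) by (apply Rdiv_le_0_compat; auto).
  destruct (series_cvg (fun j => fst (c j)) (K / t) HKt) as [C1 HC1].
  { intros j. eapply Rle_trans; [apply Hc' | right; field; split; first [lra | apply pow_nonzero; lra]]. }
  destruct (series_cvg (fun j => snd (c j)) (K / t) HKt) as [C2' HC2].
  { intros j. eapply Rle_trans; [apply Hc' | right; field; split; first [lra | apply pow_nonzero; lra]]. }
  assert (Ht2 : 0 < t ^ 2) by (apply pow_lt; auto).
  exists C1, C2', (4 * K / t ^ 2 + 1), (t / 2).
  assert (0 <= 4 * K / t ^ 2) by (apply Rdiv_le_0_compat; lra).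
  split; [lra | split; [lra | ]]. intros v1 v2 Hv1 Hv2.
  assert (Z : Cmod 0 <= t) by (rewrite Cmod_0; lra).
  assert (G0 := Hcv 0%C 0%C Z Z). replace (a + 0)%C with a in G0 by ring. replace (b + 0)%C with b in G0 by ring.
  assert (G1 := Hcv v1 v2 ltac:(lra) ltac:(lra)).
  set (u := fun n => (csum (fun j => A (RtoC (lam ^ j) * (a + v1))%C * B (RtoC (mu ^ j) * (b + v2))%C) n + - (1) * csum (fun j => A (RtoC (lam ^ j) * a)%C * B (RtoC (mu ^ j) * b)%C) n
      + (- v1 * csum (fun j => fst (c j)) n + - v2 * csum (fun j => snd (c j)) n))%C).
  assert (Hu : cvg u (g (a + v1)%C (b + v2)%C + - (1) * g a b + (- v1 * C1 + - v2 * C2'))).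
  { unfold u. apply cvg_plus; [apply cvg_plus; [exact G1 | apply cvg_scal; exact G0] | apply cvg_plus; apply cvg_scal; auto]. }
  match goal with |- Cmod ?e <= _ => replace e with (g (a + v1)%C (b + v2)%C + - (1) * g a b + (- v1 * C1 + - v2 * C2'))%C by ring end.
  apply (cvg_Cmod_le_lim u); auto. intros n. unfold u.
  rewrite <- !csum_scal, <- !csum_plus.
  eapply Rle_trans; [apply Cmod_csum_le with (g := fun j => (2 / t ^ 2 * (Cmod v1 + Cmod v2) ^ 2 * K) / 2 ^ j) | ].
  - intros j _. destruct (Hc' j) as [_ [_ H3]]. specialize (H3 v1 v2 Hv1 Hv2).
    match goal with |- Cmod ?e <= _ => match type of H3 with Cmod ?e' <= _ => replace e with e' by ring end end.
    eapply Rle_trans; [exact H3 | right; field; split; first [lra | apply pow_nonzero; lra]].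
  - assert (0 <= (Cmod v1 + Cmod v2) ^ 2) by apply pow2_ge_0.
    eapply Rle_trans; [apply rsum_half_pow | ].
    + apply Rmult_le_pos; auto. apply Rmult_le_pos; auto. apply Rdiv_le_0_compat; lra.
    + replace (2 * (2 / t ^ 2 * (Cmod v1 + Cmod v2) ^ 2 * K)) with (4 * K / t ^ 2 * (Cmod v1 + Cmod v2) ^ 2) by (field; lra).
      apply Rmult_le_compat_r; lra.
Qed.

(** The sum of the retained terms below index [n] is at most 2 and also at most [x n]; the second
    bound carries the induction. *)
Lemma rsum_doubling (x : nat -> R) (Q : nat -> Prop) (dec : forall j, {Q j} + {~ Q j}) (n : nat) :
  (forall j, 0 <= x j) -> (forall j, 2 * x j <= x (S j)) -> (forall j, Q j -> x j <= 1) ->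
  rsum (fun j => if dec j then x j else 0) n <= 2.
Proof.
  intros H0 H2 H1.
  assert (H : rsum (fun j => if dec j then x j else 0) n <= 2 /\ rsum (fun j => if dec j then x j else 0) n <= x n); [ | tauto].
  induction n; cbn [rsum]; [split; [lra | apply H0] | ]. destruct IHn as [I1 I2].
  specialize (H0 n). specialize (H2 n). destruct (dec n) as [q | q]; [specialize (H1 n q) | ]; lra.
Qed.

(** The invariant is [2 - 2 / x n] once some [x j] exceeds 1, and 0 before. *)
Lemma rsum_halving (x : nat -> R) (dec : forall j, {x j <= 1} + {~ x j <= 1}) (n : nat) :
  (forall j, 0 < x j) -> (forall j, 2 * x j <= x (S j)) ->
  rsum (fun j => if dec j then 0 else / x j) n <= 2.
Proof.
  intros H0 H2.
  assert (H : rsum (fun j => if dec j then 0 else / x j) n <= Rmax 0 (2 - 2 / x n)).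
  { induction n; cbn [rsum]; [apply Rmax_l | ].
    assert (Hx := H0 n). assert (Hxs := H0 (S n)). specialize (H2 n).
    assert (Hi : / x (S n) <= / (2 * x n)) by (apply Rinv_le_contravar; lra).
    rewrite Rinv_mult in Hi.
    destruct (dec n) as [q | q].
    - rewrite Rmax_left in IHn. { eapply Rle_trans; [ | apply Rmax_l]. lra. }
      assert (1 <= / x n) by (rewrite <- Rinv_1; apply Rinv_le_contravar; lra). unfold Rdiv. lra.
    - assert (/ x n < 1) by (rewrite <- Rinv_1; apply Rinv_lt_contravar; lra).
      eapply Rle_trans; [ | apply Rmax_r]. rewrite Rmax_right in IHn by (unfold Rdiv; lra). unfold Rdiv in *. lra. }
  assert (0 < / x n) by (apply Rinv_0_lt_compat; auto).
  eapply Rle_trans; [exact H | ]. apply Rmax_lub; unfold Rdiv; lra.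
Qed.

(** * Peak functions *)

Lemma exp_pow (u : R) (n : nat) : exp u ^ n = exp (INR n * u).
Proof.
  induction n; [simpl; now rewrite Rmult_0_l, exp_0 | ].
  simpl pow. rewrite IHn, <- exp_plus, S_INR. f_equal. ring.
Qed.

Definition peak_at (U : C2 -> Prop) (p : C2) : Prop :=
  exists f : C2 -> C,
    holomorphic_on U f /\
    (forall w, U w -> Cmod (f w) < 1) /\
    (forall eps : R, 0 < eps -> exists delta : R, 0 < delta /\
       forall w, U w -> dist2 w p < delta -> Cmod (Cminus (f w) (RtoC 1)) < eps) /\
    (forall r : R, 0 < r -> exists s : R, 0 < s /\
       forall w, U w -> r <= dist2 w p -> Cmod (f w) < 1 - s).

Lemma dist2_fst (w p : C2) : Cmod (fst w - fst p) <= dist2 w p.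
Proof. apply (norm2_fst (fst w - fst p, snd w - snd p)%C). Qed.

Lemma dist2_snd (w p : C2) : Cmod (snd w - snd p) <= dist2 w p.
Proof. apply (norm2_snd (fst w - fst p, snd w - snd p)%C). Qed.

Lemma dist2_le_sum (w p : C2) : dist2 w p <= Cmod (fst w - fst p) + Cmod (snd w - snd p).
Proof. apply (norm2_le_sum (fst w - fst p, snd w - snd p)%C). Qed.

Lemma Omega_perturb (P : C -> R) (a b : C) : is_poly_z_zbar P -> exists K, 0 < K /\ forall x y, Cmod (x - a) <= 1 ->
  Rabs ((Re y + P x) - (Re b + P a)) <= K * (Cmod (x - a) + Cmod (y - b)).
Proof.
  intros HP. destruct (poly_locally_lipschitz P HP a) as [K [HK H]]. exists (K + 1). split; [lra | ]. intros x y Hx.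
  specialize (H x Hx). replace (Re y + P x - (Re b + P a)) with (Re (y - b)%C + (P x - P a)) by (rewrite Re_minus; ring).
  eapply Rle_trans; [apply Rabs_triang | ]. pose proof (re_le_Cmod (y - b)%C).
  pose proof (Cmod_ge_0 (x - a)). pose proof (Cmod_ge_0 (y - b)). nra.
Qed.

Lemma boundary_Omega (P : C -> R) (p : C2) : is_poly_z_zbar P -> boundary (Omega P) p -> Re (snd p) + P (fst p) = 0.
Proof.
  intros HP Hb. destruct (Omega_perturb P (fst p) (snd p) HP) as [K [HK H]].
  set (v := Re (snd p) + P (fst p)) in *.
  destruct (Req_dec v 0) as [E | E]; [auto | exfalso].
  assert (Hv : 0 < Rabs v) by now apply Rabs_pos_lt.
  destruct (Hb (Rmin 1 (Rabs v / (2 * K)))) as [[w [Hw Hd]] [w' [Hw' Hd']]].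
  { apply Rmin_glb_lt; [lra | apply Rdiv_lt_0_compat; lra]. }
  assert (M1 := Rmin_l 1 (Rabs v / (2 * K))). assert (M2 := Rmin_r 1 (Rabs v / (2 * K))).
  assert (HH : forall x : C2, dist2 x p < Rmin 1 (Rabs v / (2 * K)) -> Rabs (Re (snd x) + P (fst x) - v) < Rabs v).
  { intros x Hx. assert (D1 := dist2_fst x p). assert (D2 := dist2_snd x p).
    eapply Rle_lt_trans; [apply H; lra | ].
    apply Rlt_le_trans with (K * (2 * (Rabs v / (2 * K)))); [apply Rmult_lt_compat_l; lra | right; field; lra]. }
  assert (H1 := HH w Hd). assert (H2 := HH w' Hd'). unfold Omega in Hw, Hw'.
  apply Rabs_def2 in H1. apply Rabs_def2 in H2. unfold Rabs in *. destruct (Rcase_abs v); lra.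
Qed.

(** * Boundary points on the axis *)

Section Peaks.

Variables (k : nat) (P : C -> R).
Hypothesis hk : (1 < k)%nat.
Hypothesis hpoly : is_poly_z_zbar P.
Hypothesis hhom : forall (r : R) (z : C), P (Cmult (RtoC r) z) = r ^ (2 * k) * P z.
Hypothesis hsub : forall z : C, z <> RtoC 0 -> 0 < dz_dzbar P z.

(* [h x y = A x * Bf y] is [1] at the origin and decays at infinity in the domain, so
   [g x y = sum_j h (2 ^ j * x) (2 ^ (rho * j) * y)] counts the dyadic scales between [(x, y)] and
   [1] up to a bounded error: [Re g] is bounded below, tends to [+oo] exactly at the origin, and
   [1 - 2 / (g + const)] is a peak function. *)
Lemma peak_axis (b : C) : Re b = 0 -> peak_at (Omega P) (RtoC 0, b).
Proof.
  intros Hb.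
  destruct (weight_exists k P hk hpoly hhom hsub) as [eps [Bp [Heps [HBp [HPb HW]]]]].
  destruct (HW 0) as [W [_ [_ [_ [HWe [HW0 [_ [_ [_ [HWup _]]]]]]]]]]. clear HW.
  set (rho := (2 * k)%nat) in *. assert (Hrho : (4 <= rho)%nat) by (unfold rho; lia).
  destruct (HWup (eps / 2) ltac:(lra)) as [K1 HK1].
  assert (HWb : forall z, Cmod (W z) <= exp (P z - eps / 2 * Cmod z ^ rho + K1)).
  { intros z. eapply Rle_trans; [apply HK1 | ]. apply exp_le.
    assert (0 <= dev rho 0 z).
    { unfold dev. apply Rmult_le_pos; [apply pow_le, Cmod_ge_0 | ].
      pose proof (Re_le_Cmod (z * cis (- 0))). rewrite Cmod_mult, Cmod_cis in H. lra. }
    nra. }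
  (* The gain [exp (- m * eps / 2 * |x|^rho)] must beat [exp (Bp * |x|^rho)], the possible size of
     [E1 y] where [Re y > 0], and leave one more [exp (- |x|^rho)] to compensate [1 + |x|^rho]. *)
  destruct (exists_nat_large ((Bp + 1) / (eps / 2))) as [m [Hm0 Hm]].
  assert (Hme : Bp + 1 <= INR m * (eps / 2)).
  { apply Rmult_lt_compat_r with (r := eps / 2) in Hm; [ | lra].
    replace ((Bp + 1) / (eps / 2) * (eps / 2)) with (Bp + 1) in Hm by (field; lra). lra. }
  set (A := fun x => (W x ^ m)%C). set (Bf := fun y => (Cexp (INR m * y) * E1 y)%C).
  assert (EA : ent A) by (apply ent_pow; auto).
  assert (EB : ent Bf) by (apply ent_mult; [apply ent_Cexp, ent_scal, ent_id | apply ent_E1]).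
  assert (HA0 : A 0%C = 1) by (unfold A; rewrite HW0; apply Cpow_1_l).
  assert (HB0 : Bf 0%C = 1) by (unfold Bf; replace (INR m * 0)%C with (RtoC 0) by ring; rewrite Cexp_0, E1_0; ring).
  (* A gauge adapted to the dilations of the domain: [(2 * x, 2^rho * y)] has [2^rho] times the
     gauge of [(x, y)]. *)
  set (Nz := fun x y : C => Cmod x ^ rho + Cmod y).
  set (Kh := 2 * exp (INR m * K1)).
  assert (HKh : 0 < Kh) by (unfold Kh; pose proof (exp_pos (INR m * K1)); lra).
  assert (Hdec : forall x y, Re y + P x < 0 -> Cmod (A x * Bf y)%C * Nz x y <= Kh).
  { intros x y Hxy. set (R0 := Cmod x ^ rho). assert (HR0 : 0 <= R0) by (apply pow_le, Cmod_ge_0).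
    assert (HPx := HPb x). fold R0 in HPx. apply Rabs_le_between in HPx.
    set (X := exp (Bp * R0)). assert (HX : 1 <= X).
    { unfold X. rewrite <- exp_0. apply exp_le. apply Rmult_le_pos; lra. }
    assert (HeY : exp (Re y) <= X) by (apply exp_le; lra).
    assert (HE : Cmod (E1 y) <= X) by (apply Cmod_E1_le; auto).
    assert (HEy : Cmod (E1 y) * Cmod y <= 1 + X) by (eapply Rle_trans; [apply Cmod_E1_mult | lra]).
    assert (HEN : Cmod (E1 y) * Nz x y <= 2 * X * (1 + R0)).
    { unfold Nz. fold R0. pose proof (Cmod_ge_0 (E1 y)). nra. }
    assert (HAB : Cmod (A x) * Cmod (Cexp (INR m * y)) <= exp (INR m * K1 - (Bp + 1) * R0)).
    { unfold A. rewrite Cmod_pow, Cmod_Cexp, Re_RtoC_mult.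
      apply Rle_trans with (exp (P x - eps / 2 * R0 + K1) ^ m * exp (INR m * Re y)).
      - apply Rmult_le_compat_r; [apply Rlt_le, exp_pos | ]. apply pow_incr. split; [apply Cmod_ge_0 | apply HWb].
      - rewrite exp_pow, <- exp_plus. apply exp_le.
        assert (0 < INR m) by (apply lt_0_INR; lia).
        assert (INR m * (Re y + P x) <= 0) by nra. nra. }
    unfold Bf. replace (A x * (Cexp (INR m * y) * E1 y))%C with ((A x * Cexp (INR m * y)) * E1 y)%C by ring.
    rewrite Cmod_mult, (Cmod_mult (A x)), Rmult_assoc.
    apply Rle_trans with (exp (INR m * K1 - (Bp + 1) * R0) * (2 * X * (1 + R0))).
    - apply Rmult_le_compat; auto.
      + apply Rmult_le_pos; apply Cmod_ge_0.
      + apply Rmult_le_pos; [apply Cmod_ge_0 | ]. unfold Nz. pose proof (Cmod_ge_0 y). fold R0. lra.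
    - unfold Kh. replace (INR m * K1 - (Bp + 1) * R0) with (INR m * K1 + (- (Bp * R0) + - R0)) by ring.
      rewrite !exp_plus, (exp_Ropp (Bp * R0)), (exp_Ropp R0). fold X.
      assert (H1R : 1 + R0 <= exp R0) by apply exp_ineq1_le.
      assert (Hp := exp_pos R0). assert (HpK := exp_pos (INR m * K1)).
      replace (exp (INR m * K1) * (/ X * / exp R0) * (2 * X * (1 + R0))) with (2 * exp (INR m * K1) * ((1 + R0) * / exp R0)) by (field; lra).
      rewrite <- (Rmult_1_r (2 * exp (INR m * K1))) at 2. apply Rmult_le_compat_l; [lra | ].
      apply Rmult_le_reg_r with (exp R0); auto. rewrite Rmult_assoc, Rinv_l by lra. lra. }
  assert (Hlip : exists Kl, 0 < Kl /\ forall x y, Cmod x <= 1 -> Cmod y <= 1 -> Cmod (A x * Bf y - 1)%C <= Kl * (Cmod x + Cmod y)).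
  { assert (HL : forall f, ent f -> exists L, 0 < L /\ forall h, Cmod h <= 1 -> Cmod (f h - f 0%C) <= L * Cmod h).
    { intros f Hf. destruct (ent_local f 0%C Hf) as [c [K [HK H]]]. exists (Cmod c + K). pose proof (Cmod_ge_0 c).
      split; [lra | ]. intros h Hh. specialize (H h Hh). replace (0 + h)%C with h in H by ring.
      pose proof (Cmod_reverse (f h - f 0%C) (c * h)). rewrite Cmod_mult in H1. pose proof (Cmod_ge_0 h).
      assert (K * Cmod h ^ 2 <= K * Cmod h) by (apply Rmult_le_compat_l; [lra | simpl; nra]). nra. }
    destruct (HL A EA) as [LA [HLA HA]]. destruct (HL Bf EB) as [LB [HLB HB]].
    exists (LA * (1 + LB) + LB). split; [nra | ]. intros x y Hx Hy. specialize (HA x Hx). specialize (HB y Hy).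
    rewrite HA0 in HA. rewrite HB0 in HB. pose proof (Cmod_ge_0 x). pose proof (Cmod_ge_0 y).
    replace (A x * Bf y - 1)%C with ((A x - 1) * Bf y + (Bf y - 1))%C by ring.
    eapply Rle_trans; [apply Cmod_triangle | ]. rewrite Cmod_mult.
    assert (HBy : Cmod (Bf y) <= 1 + LB).
    { pose proof (Cmod_reverse (Bf y) 1). rewrite Cmod_1 in H1. nra. }
    assert (Cmod (A x - 1) * Cmod (Bf y) <= LA * Cmod x * (1 + LB)) by (apply Rmult_le_compat; auto using Cmod_ge_0).
    assert (0 <= LB * Cmod x) by (apply Rmult_le_pos; lra). assert (0 <= LA * (1 + LB) * Cmod y) by (apply Rmult_le_pos; nra). lra. }
  destruct Hlip as [Kl [HKl Hlip]].
  set (La := 2 ^ rho). assert (HLa : 2 <= La).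
  { unfold La. apply Rle_trans with (2 ^ 1); [simpl; lra | apply Rle_pow; [lra | lia]]. }
  set (hj := fun j x y => (A (RtoC (2 ^ j) * x) * Bf (RtoC (La ^ j) * y))%C).
  assert (Hsc : forall j x y, Re y + P x < 0 -> Re (RtoC (La ^ j) * y)%C + P (RtoC (2 ^ j) * x)%C < 0).
  { intros j x y Hxy. rewrite Re_RtoC_mult, hhom. fold rho. replace ((2 ^ j) ^ rho) with (La ^ j).
    - assert (0 < La ^ j) by (apply pow_lt; lra). nra.
    - unfold La. rewrite <- !pow_mult. f_equal. lia. }
  assert (HNsc : forall j x y, Nz (RtoC (2 ^ j) * x)%C (RtoC (La ^ j) * y)%C = La ^ j * Nz x y).
  { intros j x y. unfold Nz. rewrite !Cmod_mult, !Cmod_RtoC_pos by (apply pow_le; lra). rewrite Rpow_mult_distr.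
    replace ((2 ^ j) ^ rho) with (La ^ j) by (unfold La; rewrite <- !pow_mult; f_equal; lia). ring. }
  assert (HNpos : forall x y c, Re y + P x <= - c -> c <= (1 + Bp) * Nz x y).
  { intros x y c Hxy. assert (HPx := HPb x). apply Rabs_le_between in HPx. fold rho in HPx. pose proof (Re_ge_Cmod y).
    unfold Nz. pose proof (Cmod_ge_0 y). assert (0 <= Cmod x ^ rho) by (apply pow_le, Cmod_ge_0). nra. }
  assert (HNp : forall x y, Re y + P x < 0 -> 0 < Nz x y).
  { intros x y Hxy. specialize (HNpos x y (- (Re y + P x)) ltac:(lra)). nra. }
  assert (Hhj : forall j x y, Re y + P x < 0 -> Cmod (hj j x y) <= Kh / Nz x y / 2 ^ j).
  { intros j x y Hxy. assert (H := Hdec _ _ (Hsc j x y Hxy)). rewrite HNsc in H. fold (hj j x y) in H.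
    assert (HN := HNp x y Hxy). assert (H2j : 0 < 2 ^ j) by (apply pow_lt; lra).
    assert (2 ^ j <= La ^ j) by (apply pow_incr; lra).
    apply Rmult_le_reg_r with (2 ^ j * Nz x y); [apply Rmult_lt_0_compat; lra | ].
    replace (Kh / Nz x y / 2 ^ j * (2 ^ j * Nz x y)) with Kh by (field; lra).
    eapply Rle_trans; [ | exact H]. apply Rmult_le_compat_l; [apply Cmod_ge_0 | ]. apply Rmult_le_compat_r; lra. }
  assert (Hg : forall p : C2, exists l, Re (snd p) + P (fst p) < 0 -> cvg (csum (fun j => hj j (fst p) (snd p))) l).
  { intros [x y]. simpl fst. simpl snd. destruct (Rlt_dec (Re y + P x) 0) as [Hxy | Hxy]; [ | exists 0%C; intros; lra].
    destruct (series_cvg (fun j => hj j x y) (Kh / Nz x y)) as [l Hl].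
    - apply Rdiv_le_0_compat; [lra | auto].
    - intros j. auto.
    - exists l. auto. }
  destruct (functional_choice _ Hg) as [g' Hg']. set (g := fun x y => g' (x, y)).
  assert (Hgc : forall x y, Re y + P x < 0 -> cvg (csum (fun j => hj j x y)) (g x y)) by (intros x y; apply (Hg' (x, y))).
  clear Hg Hg'.
  set (dec := fun x y j => Rle_dec (La ^ j * Nz x y) 1).
  set (cnt := fun x y n => rsum (fun j => if dec x y j then 1 else 0) n).
  (* Where the dilated gauge is at most 1 the term differs from 1 by at most [Kl * (|x| + |y|)] at
     that scale; elsewhere it is at most [Kh] over the gauge. Each of the three geometric sums is at
     most 2. *)
  set (Kc := 4 * Kl + 2 * Kh).
  assert (Hcnt : forall x y n, Re y + P x < 0 -> Cmod (csum (fun j => hj j x y) n - RtoC (cnt x y n))%C <= Kc).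
  { intros x y n Hxy. assert (HN := HNp x y Hxy).
    assert (E : RtoC (cnt x y n) = csum (fun j => RtoC (if dec x y j then 1 else 0)) n).
    { unfold cnt. clear. induction n; [reflexivity | ]. cbn [rsum csum]. now rewrite RtoC_plus, IHn. }
    rewrite E.
    replace (csum (fun j => hj j x y) n - csum (fun j => RtoC (if dec x y j then 1 else 0)) n)%C with
      (csum (fun j => (hj j x y + - (1) * RtoC (if dec x y j then 1 else 0))%C) n) by (rewrite csum_plus, csum_scal; ring).
    eapply Rle_trans; [apply Cmod_csum_le with (g := fun j => Kl * (if dec x y j then 2 ^ j * Cmod x else 0) +
        (Kl * (if dec x y j then La ^ j * Cmod y else 0) + Kh * (if dec x y j then 0 else / (La ^ j * Nz x y)))) | ].
    - intros j _. assert (HH := HNsc j x y). unfold Nz in HH at 1.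
      assert (Cx : Cmod (RtoC (2 ^ j) * x) = 2 ^ j * Cmod x) by (rewrite Cmod_mult, Cmod_RtoC_pos; [auto | apply pow_le; lra]).
      assert (Cy : Cmod (RtoC (La ^ j) * y) = La ^ j * Cmod y) by (rewrite Cmod_mult, Cmod_RtoC_pos; [auto | apply pow_le; lra]).
      destruct (dec x y j) as [d | d].
      + assert (Hx1 : Cmod (RtoC (2 ^ j) * x) <= 1).
        { apply Rnot_lt_le. intro Hgt. assert (1 < Cmod (RtoC (2 ^ j) * x) ^ rho) by (apply Rlt_pow_R1; [auto | lia]).
          pose proof (Cmod_ge_0 (RtoC (La ^ j) * y)). lra. }
        assert (Hy1 : Cmod (RtoC (La ^ j) * y) <= 1).
        { assert (0 <= Cmod (RtoC (2 ^ j) * x) ^ rho) by (apply pow_le, Cmod_ge_0). lra. }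
        assert (H := Hlip _ _ Hx1 Hy1). fold (hj j x y) in H. rewrite Cx, Cy in H.
        replace (hj j x y + - (1) * 1)%C with (hj j x y - 1)%C by ring. lra.
      + replace (hj j x y + - (1) * 0)%C with (hj j x y) by ring.
        assert (H := Hdec _ _ (Hsc j x y Hxy)). rewrite HNsc in H. fold (hj j x y) in H.
        assert (HL : 0 < La ^ j * Nz x y) by (apply Rmult_lt_0_compat; [apply pow_lt; lra | auto]).
        rewrite !Rmult_0_r, !Rplus_0_l. apply Rmult_le_reg_r with (La ^ j * Nz x y); auto.
        rewrite Rmult_assoc, Rinv_l by lra. lra.
    - rewrite !rsum_plus, !rsum_scal.
      assert (S1 : rsum (fun j => if dec x y j then 2 ^ j * Cmod x else 0) n <= 2).
      { apply (rsum_doubling (fun j => 2 ^ j * Cmod x) (fun j => La ^ j * Nz x y <= 1) (dec x y)).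
        - intros j. apply Rmult_le_pos; [apply pow_le; lra | apply Cmod_ge_0].
        - intros j. simpl. lra.
        - intros j d. apply Rnot_lt_le. intro Hgt.
          assert (Hgt' : 1 < (2 ^ j * Cmod x) ^ rho) by (apply Rlt_pow_R1; [auto | lia]). rewrite Rpow_mult_distr in Hgt'.
          replace ((2 ^ j) ^ rho) with (La ^ j) in Hgt' by (unfold La; rewrite <- !pow_mult; f_equal; lia).
          unfold Nz in d. assert (0 <= La ^ j * Cmod y) by (apply Rmult_le_pos; [apply pow_le; lra | apply Cmod_ge_0]). lra. }
      assert (S2 : rsum (fun j => if dec x y j then La ^ j * Cmod y else 0) n <= 2).
      { apply (rsum_doubling (fun j => La ^ j * Cmod y) (fun j => La ^ j * Nz x y <= 1) (dec x y)).
        - intros j. apply Rmult_le_pos; [apply pow_le; lra | apply Cmod_ge_0].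
        - intros j. simpl. assert (0 <= La ^ j * Cmod y) by (apply Rmult_le_pos; [apply pow_le; lra | apply Cmod_ge_0]). nra.
        - intros j d. unfold Nz in d.
          assert (0 <= La ^ j * Cmod x ^ rho) by (apply Rmult_le_pos; [apply pow_le; lra | apply pow_le, Cmod_ge_0]). lra. }
      assert (S3 : rsum (fun j => if dec x y j then 0 else / (La ^ j * Nz x y)) n <= 2).
      { apply (rsum_halving (fun j => La ^ j * Nz x y) (dec x y)).
        - intros j. apply Rmult_lt_0_compat; [apply pow_lt; lra | auto].
        - intros j. simpl. assert (0 < La ^ j * Nz x y) by (apply Rmult_lt_0_compat; [apply pow_lt; lra | auto]). nra. }
      unfold Kc. nra. }
  assert (Hcnt_lim : forall x y c0 c1, Re y + P x < 0 -> (exists n0, forall n, (n0 <= n)%nat -> c0 <= cnt x y n <= c1) ->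
     c0 - Kc <= Re (g x y) /\ Cmod (g x y) <= c1 + Kc).
  { intros x y c0 c1 Hxy [n0 Hn0]. assert (Hc := Hgc x y Hxy).
    assert (HH : forall e, 0 < e -> exists n, (n0 <= n)%nat /\ Cmod (csum (fun j => hj j x y) n - g x y) < e).
    { intros e He. destruct (Hc e He) as [n1 Hn1]. exists (max n0 n1). split; [lia | apply Hn1; lia]. }
    split; apply le_epsilon; intros e He; destruct (HH e He) as [n [Hn Hd]]; specialize (Hn0 n Hn); assert (Hk := Hcnt x y n Hxy).
    - pose proof (Re_le_Cmod (csum (fun j => hj j x y) n - g x y)) as G1. rewrite Re_minus in G1.
      pose proof (Re_ge_Cmod (csum (fun j => hj j x y) n - RtoC (cnt x y n))) as G2. rewrite Re_minus in G2.
      change (Re (RtoC (cnt x y n))) with (cnt x y n) in G2. lra.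
    - pose proof (Cmod_reverse (g x y) (csum (fun j => hj j x y) n)) as G1. rewrite Cmod_minus_sym in G1.
      pose proof (Cmod_reverse (csum (fun j => hj j x y) n) (RtoC (cnt x y n))) as G2.
      assert (0 <= cnt x y n) by (apply rsum_nonneg; intros; destruct (dec x y i); lra).
      rewrite (Cmod_RtoC_pos (cnt x y n)) in G2 by auto. lra. }
  assert (Hcnt0 : forall x y n, 0 <= cnt x y n) by (intros; apply rsum_nonneg; intros; destruct (dec x y i); lra).
  assert (Hnear : forall J, forall x y, Re y + P x < 0 -> La ^ J * Nz x y <= 1 -> INR J - Kc <= Re (g x y)).
  { intros J x y Hxy HJ.
    assert (HNxy := HNp x y Hxy).
    assert (Hle : forall j, (j <= J)%nat -> La ^ j * Nz x y <= 1).
    { intros j Hj. eapply Rle_trans; [ | exact HJ]. apply Rmult_le_compat_r; [lra | apply Rle_pow; [lra | auto]]. }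
    assert (HcJ : forall n, (J <= n)%nat -> INR J <= cnt x y n).
    { intros n Hn. unfold cnt. replace n with (J + (n - J))%nat by lia. rewrite rsum_split.
      assert (rsum (fun j => if dec x y j then 1 else 0) J = INR J).
      { rewrite (rsum_ext _ (fun _ => 1)); [rewrite rsum_const; ring | ]. intros i Hi.
        destruct (dec x y i) as [d | d]; [auto | exfalso; apply d, Hle; lia]. }
      assert (0 <= rsum (fun i => if dec x y (J + i)%nat then 1 else 0) (n - J)) by (apply rsum_nonneg; intros i _; destruct (dec x y (J + i)%nat); lra).
      lra. }
    assert (Hlow : forall c1, (exists n0, forall n, (n0 <= n)%nat -> INR J <= cnt x y n <= c1) -> INR J - Kc <= Re (g x y)).
    { intros c1 H. apply (Hcnt_lim x y (INR J) c1 Hxy H). }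
    destruct (exists_nat_large (/ Nz x y)) as [n1 [_ Hn1]].
    apply (Hlow (INR (max J n1))). exists (max J n1). intros n Hn. split; [apply HcJ; lia | ].
    unfold cnt. replace n with (max J n1 + (n - max J n1))%nat by lia. rewrite rsum_split.
    assert (rsum (fun j => if dec x y j then 1 else 0) (max J n1) <= INR (max J n1)).
    { eapply Rle_trans; [apply rsum_le with (g := fun _ => 1) | rewrite rsum_const; lra]. intros i _. destruct (dec x y i); lra. }
    assert (rsum (fun i => if dec x y (max J n1 + i)%nat then 1 else 0) (n - max J n1) = 0).
    { rewrite (rsum_ext _ (fun _ => 0)); [rewrite rsum_const; ring | ]. intros i _.
      destruct (dec x y (max J n1 + i)%nat) as [d | d]; [exfalso | auto].
      assert (Hpow : INR n1 <= La ^ (max J n1 + i)%nat).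
      { apply Rle_trans with (2 ^ (max J n1 + i)); [ | apply pow_incr; lra].
        apply Rle_trans with (INR (max J n1 + i)); [apply le_INR; lia | ]. generalize (max J n1 + i)%nat. clear.
        induction n; [simpl; lra | ]. rewrite S_INR. simpl. assert (1 <= 2 ^ n) by (apply pow_R1_Rle; lra). lra. }
      assert (/ Nz x y * Nz x y = 1) by (field; lra). nra. }
    lra. }
  assert (Hfar : forall nu0, 0 < nu0 -> exists Y, 0 < Y /\ forall x y, Re y + P x < 0 -> nu0 <= Nz x y -> Cmod (g x y) <= Y).
  { intros nu0 Hnu0. destruct (exists_nat_large (/ nu0)) as [n1 [_ Hn1]].
    exists (INR n1 + Kc). assert (HKc : 0 < Kc) by (unfold Kc; lra). split; [pose proof (pos_INR n1); lra | ].
    intros x y Hxy HN. apply (Hcnt_lim x y 0 (INR n1) Hxy). exists n1. intros n Hn. split; [auto | ].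
    unfold cnt. replace n with (n1 + (n - n1))%nat by lia. rewrite rsum_split.
    assert (rsum (fun j => if dec x y j then 1 else 0) n1 <= INR n1).
    { eapply Rle_trans; [apply rsum_le with (g := fun _ => 1) | rewrite rsum_const; lra]. intros i _. destruct (dec x y i); lra. }
    assert (rsum (fun i => if dec x y (n1 + i)%nat then 1 else 0) (n - n1) = 0).
    { rewrite (rsum_ext _ (fun _ => 0)); [rewrite rsum_const; ring | ]. intros i _.
      destruct (dec x y (n1 + i)%nat) as [d | d]; [exfalso | auto].
      assert (Hpow : INR n1 <= La ^ (n1 + i)).
      { apply Rle_trans with (2 ^ (n1 + i)); [ | apply pow_incr; lra].
        apply Rle_trans with (INR (n1 + i)); [apply le_INR; lia | ]. generalize (n1 + i)%nat. clear.
        induction n; [simpl; lra | ]. rewrite S_INR. simpl. assert (1 <= 2 ^ n) by (apply pow_R1_Rle; lra). lra. }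
      assert (/ nu0 * nu0 = 1) by (field; lra). assert (0 <= INR n1) by apply pos_INR. nra. }
    lra. }
  assert (Hreg : forall x y, Re y + P x < 0 -> - Kc <= Re (g x y)).
  { intros x y Hxy. assert (HNxy := HNp x y Hxy).
    destruct (Rle_dec (La ^ 0 * Nz x y) 1) as [d | d].
    - assert (H := Hnear O x y Hxy d). simpl INR in H. lra.
    - assert (HH : 0 - Kc <= Re (g x y)); [ | lra].
      apply (Hcnt_lim x y 0 0 Hxy). exists O. intros n _. split; auto. unfold cnt.
      rewrite (rsum_ext _ (fun _ => 0)); [rewrite rsum_const; lra | ]. intros i _.
      destruct (dec x y i) as [d' | d']; [exfalso; apply d | auto]. eapply Rle_trans; [ | exact d'].
      apply Rmult_le_compat_r; [lra | apply Rle_pow; [lra | lia]]. }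
  assert (Hloc : forall x y, Re y + P x < 0 -> loc2 g x y).
  { intros x y Hxy. destruct (Omega_perturb P x y hpoly) as [K [HK HPert]].
    set (c0 := - (Re y + P x)). assert (Hc0 : 0 < c0) by (unfold c0; lra).
    (* On the bidisc of radius [t] half of the defect [c0] survives, which keeps the gauge above
       [nu0] and the terms of the series uniformly summable. *)
    set (t := Rmin 1 (c0 / (4 * K))). assert (Ht : 0 < t) by (apply Rmin_glb_lt; [lra | apply Rdiv_lt_0_compat; lra]).
    assert (Ht1 : t <= 1) by apply Rmin_l. assert (Ht2 : t <= c0 / (4 * K)) by apply Rmin_r.
    assert (Hin : forall v1 v2, Cmod v1 <= t -> Cmod v2 <= t -> Re (y + v2)%C + P (x + v1)%C <= - (c0 / 2)).
    { intros v1 v2 H1 H2. assert (H := HPert (x + v1)%C (y + v2)%C).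
      replace (x + v1 - x)%C with v1 in H by ring. replace (y + v2 - y)%C with v2 in H by ring.
      specialize (H ltac:(lra)). apply Rabs_le_between in H.
      assert (K * (Cmod v1 + Cmod v2) <= K * (2 * (c0 / (4 * K)))) by (apply Rmult_le_compat_l; lra).
      replace (K * (2 * (c0 / (4 * K)))) with (c0 / 2) in * by (field; lra). unfold c0 in *. lra. }
    set (nu0 := c0 / 2 / (1 + Bp)). assert (Hnu0 : 0 < nu0) by (unfold nu0; apply Rdiv_lt_0_compat; lra).
    apply (series_loc2 A Bf 2 La g x y t (Kh / nu0)); auto.
    - apply Rdiv_le_0_compat; lra.
    - intros j v1 v2 H1 H2. assert (Hi := Hin v1 v2 H1 H2). assert (HNN := HNpos _ _ _ Hi).
      eapply Rle_trans; [apply (Hhj j (x + v1)%C (y + v2)%C); lra | ].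
      apply Rmult_le_compat_r; [apply Rlt_le, Rinv_0_lt_compat, pow_lt; lra | ].
      apply Rmult_le_compat_l; [lra | ]. apply Rinv_le_contravar; auto. unfold nu0.
      apply Rmult_le_reg_r with (1 + Bp); [lra | ]. replace (c0 / 2 / (1 + Bp) * (1 + Bp)) with (c0 / 2) by (field; lra). lra.
    - intros v1 v2 H1 H2. assert (Hi := Hin v1 v2 H1 H2). apply Hgc. lra. }
  (* The shift gives [Re G >= 2]; then [1 - 2 / G = (G - 2) / G] has modulus below 1, as
     [|G - 2| < |G|] means [Re G > 1]. *)
  set (G := fun x y => (g x y + RtoC (Kc + 2))%C).
  assert (HGre : forall x y, Re y + P x < 0 -> 2 <= Re (G x y)).
  { intros x y Hxy. unfold G. rewrite Re_plus. change (Re (RtoC (Kc + 2))) with (Kc + 2). specialize (Hreg x y Hxy). lra. }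
  assert (HGnz : forall x y, Re y + P x < 0 -> G x y <> 0).
  { intros x y Hxy E. specialize (HGre x y Hxy). rewrite E in HGre. unfold Re in HGre. simpl in HGre. lra. }
  assert (Hsh : forall w : C2, Omega P w -> Re (snd w - b)%C + P (fst w) < 0).
  { intros w Hw. unfold Omega in Hw. rewrite Re_minus, Hb. lra. }
  exists (fun w => (fun x y => (1 + - (2) * / G x (- b + 1 * y))%C) (fst w) (snd w)).
  assert (Earg : forall y, (- b + 1 * y)%C = (y - b)%C) by (intros; ring).
  split; [ | split; [ | split]].
  - apply (loc2_holomorphic (Omega P) (fun x y => (1 + - (2) * / G x (- b + 1 * y))%C)). intros w Hw.
    apply Hsh in Hw. apply loc2_plus; [apply loc2_const | ]. apply loc2_mult; [apply loc2_const | ].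
    apply loc2_inv; [rewrite Earg; auto | ]. unfold G. apply loc2_plus; [ | apply loc2_const].
    destruct (Hloc _ _ Hw) as [c1 [c2 [K [d [HK [Hd H]]]]]]. exists c1, c2, K, d. split; [auto | split; [auto | ]].
    intros h1 h2 H1 H2. specialize (H h1 h2 H1 H2). rewrite !Earg.
    replace (snd w + h2 - b)%C with (snd w - b + h2)%C by ring. exact H.
  - intros w Hw. apply Hsh in Hw. rewrite Earg. assert (H2 := HGre _ _ Hw). assert (Hz := HGnz _ _ Hw).
    set (u := G (fst w) (snd w - b)%C) in *.
    replace (1 + - (2) * / u)%C with ((u - 2) / u)%C by (field; auto). rewrite Cmod_div by auto.
    assert (Hp := Cmod_nz _ Hz). apply Rmult_lt_reg_r with (Cmod u); auto.
    replace (Cmod (u - 2) / Cmod u * Cmod u) with (Cmod (u - 2)) by (field; lra). rewrite Rmult_1_l.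
    apply Rsqr_incrst_0; [ | apply Cmod_ge_0 | lra]. unfold Rsqr. rewrite !Cmod_sqr.
    unfold Re, Im in *; simpl in *. nra.
  - intros e He. destruct (exists_nat_large (2 * (/ e) * 2)) as [J [_ HJ]].
    (* If both coordinates are within [d0], the gauge is at most [2 * d0 = / La^J], so scale [J] is
       still counted and [Re G >= J + 2 > 2 / e]. *)
    set (d0 := / (2 * La ^ J)). assert (HLJ : 1 <= La ^ J) by (apply pow_R1_Rle; lra).
    assert (Hd0 : 0 < d0 <= / 2).
    { unfold d0. split; [apply Rinv_0_lt_compat; lra | apply Rinv_le_contravar; lra]. }
    exists d0. split; [lra | ]. intros w Hw Hd. apply Hsh in Hw. rewrite Earg.
    assert (D1 := dist2_fst w (RtoC 0, b)). assert (D2 := dist2_snd w (RtoC 0, b)). simpl fst in D1. simpl snd in D2.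
    replace (fst w - 0)%C with (fst w) in D1 by ring.
    assert (HN : La ^ J * Nz (fst w) (snd w - b)%C <= 1).
    { unfold Nz. assert (Hx : Cmod (fst w) ^ rho <= d0).
      { replace rho with (S (rho - 1)) by lia. simpl. pose proof (Cmod_ge_0 (fst w)).
        assert (Cmod (fst w) ^ (rho - 1) <= 1) by (apply pow_le_1; lra).
        assert (0 <= Cmod (fst w) ^ (rho - 1)) by (apply pow_le; auto). nra. }
      apply Rle_trans with (La ^ J * (2 * d0)); [apply Rmult_le_compat_l; lra | ]. unfold d0. right. field. lra. }
    assert (HG := Hnear J _ _ Hw HN). assert (Hz := HGnz _ _ Hw).
    set (u := G (fst w) (snd w - b)%C) in *.
    assert (Hu : INR J + 2 <= Re u).
    { unfold u, G. rewrite Re_plus. change (Re (RtoC (Kc + 2))) with (Kc + 2). lra. }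
    replace (1 + - (2) * / u - 1)%C with (- (2 / u))%C by (field; auto). rewrite Cmod_opp, Cmod_div by auto.
    rewrite Cmod_RtoC_pos by lra. pose proof (Re_le_Cmod u). pose proof (pos_INR J).
    apply Rmult_lt_reg_r with (Cmod u); [lra | ]. replace (2 / Cmod u * Cmod u) with 2 by (field; lra).
    assert (/ e * e = 1) by (field; lra). assert (0 < / e) by (apply Rinv_0_lt_compat; auto). nra.
  - intros r Hr. set (nu0 := Rmin ((r / 2) ^ rho) (r / 2)).
    assert (Hnu0 : 0 < nu0) by (apply Rmin_glb_lt; [apply pow_lt; lra | lra]).
    destruct (Hfar nu0 Hnu0) as [Y [HY HYb]]. assert (HKc : 0 < Kc) by (unfold Kc; lra).
    set (Z := Y + Kc + 2). assert (HZ : 2 < Z) by (unfold Z; lra).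
    (* From [Re G >= 2] one gets [|G - 2|^2 <= |G|^2 - 4], whereas [(1 - c)^2 * |G|^2 >= |G|^2 - 2 *
       c * |G|^2] and [c * |G|^2 <= 1] for [c = / (Z * Z)]. *)
    exists (/ (Z * Z)). split; [apply Rinv_0_lt_compat; nra | ].
    intros w Hw Hd. apply Hsh in Hw. rewrite Earg.
    assert (D := dist2_le_sum w (RtoC 0, b)). simpl fst in D. simpl snd in D.
    replace (fst w - 0)%C with (fst w) in D by ring.
    assert (HN : nu0 <= Nz (fst w) (snd w - b)%C).
    { unfold Nz. pose proof (Cmod_ge_0 (fst w)). pose proof (Cmod_ge_0 (snd w - b)%C).
      assert (0 <= Cmod (fst w) ^ rho) by (apply pow_le; auto).
      destruct (Rle_lt_dec (r / 2) (Cmod (fst w))).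
      - assert ((r / 2) ^ rho <= Cmod (fst w) ^ rho) by (apply pow_incr; lra).
        pose proof (Rmin_l ((r / 2) ^ rho) (r / 2)). unfold nu0. lra.
      - pose proof (Rmin_r ((r / 2) ^ rho) (r / 2)). unfold nu0. lra. }
    assert (Hgb := HYb _ _ Hw HN). assert (H2 := HGre _ _ Hw). assert (Hz := HGnz _ _ Hw).
    set (u := G (fst w) (snd w - b)%C) in *.
    assert (Hu : Cmod u <= Z).
    { unfold u, G. eapply Rle_trans; [apply Cmod_triangle | ]. rewrite (Cmod_RtoC_pos (Kc + 2)) by lra. unfold Z. lra. }
    replace (1 + - (2) * / u)%C with ((u - 2) / u)%C by (field; auto). rewrite Cmod_div by auto.
    assert (Hp := Cmod_nz _ Hz). apply Rmult_lt_reg_r with (Cmod u); auto.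
    replace (Cmod (u - 2) / Cmod u * Cmod u) with (Cmod (u - 2)) by (field; lra).
    set (c := / (Z * Z)). assert (HcZ : c * (Z * Z) = 1) by (unfold c; field; lra).
    assert (Hc : 0 < c < 1 / 4).
    { split; [unfold c; apply Rinv_0_lt_compat; nra | nra]. }
    apply Rsqr_incrst_0; [ | apply Cmod_ge_0 | apply Rmult_le_pos; lra]. unfold Rsqr.
    assert (E1' := Cmod_sqr (u - 2)). assert (E2' := Cmod_sqr u).
    assert (E3' : Re (u - 2)%C = Re u - 2) by reflexivity. assert (E4' : Im (u - 2)%C = Im u) by (unfold Im; simpl; ring).
    rewrite E1', E3', E4'.
    assert (Cmod u * Cmod u <= Z * Z) by (apply Rmult_le_compat; lra).
    assert (c * (Cmod u * Cmod u) <= 1) by (rewrite <- HcZ; apply Rmult_le_compat_l; lra).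
    replace ((1 - c) * Cmod u * ((1 - c) * Cmod u)) with (Cmod u * Cmod u - 2 * (c * (Cmod u * Cmod u)) + c * c * (Cmod u * Cmod u)) by ring.
    assert (0 <= c * c * (Cmod u * Cmod u)) by (apply Rmult_le_pos; nra).
    rewrite E2' in *. nra.
Qed.

End Peaks.

(** * Peak functions under dilations *)

Lemma scale2_norm_le (s1 s2 : R) (u v : C) : 0 < s1 -> 0 < s2 ->
  norm2 ((RtoC s1 * u)%C, (RtoC s2 * v)%C) <= (s1 + s2) * norm2 (u, v).
Proof.
  intros H1 H2. eapply Rle_trans; [apply norm2_le_sum | ]. simpl fst. simpl snd.
  rewrite !Cmod_mult, !Cmod_RtoC_pos by lra.
  assert (A := norm2_fst (u, v)). assert (B := norm2_snd (u, v)). simpl fst in A. simpl snd in B. nra.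
Qed.

(** Pull the peak function back along the dilation, which distorts distances by at most [s1 + s2]
    one way and [/ s1 + / s2] the other way. *)
Lemma peak_at_scale (U : C2 -> Prop) (s1 s2 : R) (a b : C) : 0 < s1 -> 0 < s2 ->
  (forall x y, U (x, y) -> U ((RtoC s1 * x)%C, (RtoC s2 * y)%C)) ->
  peak_at U ((RtoC s1 * a)%C, (RtoC s2 * b)%C) -> peak_at U (a, b).
Proof.
  intros H1 H2 HU [f [Hh [Hb [Hl Hs]]]].
  set (S := fun w : C2 => ((RtoC s1 * fst w)%C, (RtoC s2 * snd w)%C)).
  assert (HS : forall w, U w -> U (S w)) by (intros [x y] Hw; apply HU; auto).
  set (M := s1 + s2). assert (HM : 0 < M) by (unfold M; lra).
  set (M' := / s1 + / s2).
  assert (HM' : 0 < M') by (unfold M'; assert (0 < / s1) by (apply Rinv_0_lt_compat; auto); assert (0 < / s2) by (apply Rinv_0_lt_compat; auto); lra).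
  assert (HD : forall w, dist2 (S w) (S (a, b)) <= M * dist2 w (a, b)).
  { intros w. unfold dist2, S. simpl fst. simpl snd.
    replace (RtoC s1 * fst w - RtoC s1 * a)%C with (RtoC s1 * (fst w - a))%C by ring.
    replace (RtoC s2 * snd w - RtoC s2 * b)%C with (RtoC s2 * (snd w - b))%C by ring. now apply scale2_norm_le. }
  assert (HD' : forall w, dist2 w (a, b) <= M' * dist2 (S w) (S (a, b))).
  { intros w. unfold dist2, S. simpl fst. simpl snd.
    assert (N1 : RtoC s1 <> 0) by (apply RtoC_nz; lra). assert (N2 : RtoC s2 <> 0) by (apply RtoC_nz; lra).
    replace (fst w - a)%C with (RtoC (/ s1) * (RtoC s1 * fst w - RtoC s1 * a))%C by (rewrite RtoC_inv by lra; field; auto).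
    replace (snd w - b)%C with (RtoC (/ s2) * (RtoC s2 * snd w - RtoC s2 * b))%C by (rewrite RtoC_inv by lra; field; auto).
    apply scale2_norm_le; apply Rinv_0_lt_compat; auto. }
  exists (fun w => f (S w)). split; [ | split; [ | split]].
  - intros w Hw. destruct (Hh (S w) (HS w Hw)) as [c1 [c2 Hc]]. exists (c1 * RtoC s1)%C, (c2 * RtoC s2)%C.
    intros e He. destruct (Hc (e / M) ltac:(apply Rdiv_lt_0_compat; auto)) as [d [Hd HH]].
    exists (d / M). split; [apply Rdiv_lt_0_compat; auto | ]. intros h Hh1 Hh2.
    assert (HN := scale2_norm_le s1 s2 (fst h) (snd h) H1 H2). rewrite <- surjective_pairing in HN. fold (S h) in HN. fold M in HN.
    assert (ES : S ((fst w + fst h)%C, (snd w + snd h)%C) = ((fst (S w) + fst (S h))%C, (snd (S w) + snd (S h))%C)).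
    { unfold S. simpl fst. simpl snd. f_equal; ring. }
    rewrite ES. replace (c1 * RtoC s1 * fst h + c2 * RtoC s2 * snd h)%C with (c1 * fst (S h) + c2 * snd (S h))%C by (unfold S; simpl fst; simpl snd; ring).
    eapply Rle_trans; [apply HH | ].
    + eapply Rle_lt_trans; [exact HN | ]. apply Rlt_le_trans with (M * (d / M)); [apply Rmult_lt_compat_l; auto | right; field; lra].
    + rewrite <- ES. apply HS, Hh2.
    + apply Rle_trans with (e / M * (M * norm2 h)); [apply Rmult_le_compat_l; [apply Rlt_le, Rdiv_lt_0_compat; auto | exact HN] | right; field; lra].
  - intros w Hw. apply Hb, HS, Hw.
  - intros e He. destruct (Hl e He) as [d [Hd HH]]. exists (d / M). split; [apply Rdiv_lt_0_compat; auto | ].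
    intros w Hw Hdw. apply HH; [apply HS, Hw | ]. eapply Rle_lt_trans; [apply HD | ].
    apply Rlt_le_trans with (M * (d / M)); [apply Rmult_lt_compat_l; auto | right; field; lra].
  - intros r Hr. destruct (Hs (r / M') ltac:(apply Rdiv_lt_0_compat; auto)) as [s [Hs0 HH]]. exists s. split; auto.
    intros w Hw Hdw. apply HH; [apply HS, Hw | ]. apply Rmult_le_reg_l with M'; auto.
    replace (M' * (r / M')) with r by (field; lra). eapply Rle_trans; [exact Hdw | apply HD'].
Qed.

(** * Quantitative separation from a point of a ray *)

Lemma pow_gap (r Rd : R) (k : nat) : (0 < k)%nat -> 0 <= r -> 0 <= Rd -> ((r - Rd) * Rd ^ (k - 1)) ^ 2 <= (r ^ k - Rd ^ k) ^ 2.
Proof.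
  intros Hk Hr HR.
  assert (Er : r ^ k = r * r ^ (k - 1)) by (replace k with (S (k - 1)) at 1 by lia; reflexivity).
  assert (ER : Rd ^ k = Rd * Rd ^ (k - 1)) by (replace k with (S (k - 1)) at 1 by lia; reflexivity).
  assert (P1 : 0 <= r ^ (k - 1)) by (apply pow_le; auto). assert (P2 : 0 <= Rd ^ (k - 1)) by (apply pow_le; auto).
  destruct (Rle_lt_dec Rd r) as [H | H].
  - assert (Rd ^ (k - 1) <= r ^ (k - 1)) by (apply pow_incr; lra). apply pow_incr. rewrite Er, ER. split; nra.
  - assert (r ^ (k - 1) <= Rd ^ (k - 1)) by (apply pow_incr; lra).
    replace ((r ^ k - Rd ^ k) ^ 2) with ((Rd ^ k - r ^ k) ^ 2) by ring.
    replace (((r - Rd) * Rd ^ (k - 1)) ^ 2) with (((Rd - r) * Rd ^ (k - 1)) ^ 2) by ring.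
    apply pow_incr. rewrite Er, ER. split; nra.
Qed.

Lemma Cmod_minus_sqr_ge (z w : C) : (Cmod z - Cmod w) ^ 2 <= Cmod (z - w) ^ 2.
Proof.
  pose proof (Cmod_reverse z w). pose proof (Cmod_reverse w z). rewrite Cmod_minus_sym in H0.
  apply pow_maj_Rabs. unfold Rabs. destruct (Rcase_abs (Cmod z - Cmod w)); lra.
Qed.

(** The first square vanishes at all points with the same power [k] as [a], that is at [k] rotated
    copies of [a]; [dev] vanishes on the ray only. The sum vanishes at [a] alone. *)
Definition sep (k : nat) (th0 Rd : R) (z : C) : R :=
  Cmod (z ^ k - (RtoC Rd * cis th0) ^ k)%C ^ 2 + dev (2 * k) th0 z.

(** Splits the squared distance into a radial part, controlled by the gap of the powers, and an
    angular part, controlled by [dev]. *)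
Lemma Cmod_ray_minus_sqr (th0 Rd : R) (z : C) :
  Cmod (z - RtoC Rd * cis th0)%C ^ 2 = (Cmod z - Rd) ^ 2 + 2 * Rd * (Cmod z - Re (z * cis (- th0))%C).
Proof.
  pose proof (Cmod_sqr (z - RtoC Rd * cis th0)). pose proof (Cmod_sqr z). pose proof (sin2_cos2 th0). unfold Rsqr in *.
  replace (Cmod (z - RtoC Rd * cis th0)%C ^ 2) with (Cmod (z - RtoC Rd * cis th0) * Cmod (z - RtoC Rd * cis th0)) by ring.
  rewrite H. replace ((Cmod z - Rd) ^ 2 + 2 * Rd * (Cmod z - Re (z * cis (- th0))%C)) with
    (Cmod z * Cmod z + Rd * Rd - 2 * Rd * Re (z * cis (- th0))%C) by ring. rewrite H0.
  unfold cis, Re, Im. simpl. rewrite cos_neg, sin_neg. destruct z as [x y]. simpl. nra.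
Qed.

Section Separation.

Variables (k : nat) (th0 Rd : R) (z : C).
Hypothesis (hk : (1 < k)%nat) (hR : 0 < Rd).
Notation rho := (2 * k)%nat.
Notation a := (RtoC Rd * cis th0)%C.

Lemma Cmod_ray : Cmod a = Rd.
Proof. rewrite Cmod_mult, Cmod_cis, Cmod_RtoC_pos by lra. ring. Qed.

Lemma sep_dev_nonneg : 0 <= Cmod z - Re (z * cis (- th0))%C.
Proof. pose proof (Re_le_Cmod (z * cis (- th0))). rewrite Cmod_mult, Cmod_cis in H. lra. Qed.

Lemma sep_ge_radial : (Cmod z ^ k - Rd ^ k) ^ 2 <= sep k th0 Rd z.
Proof.
  unfold sep. assert (H := Cmod_minus_sqr_ge (z ^ k) (a ^ k)). rewrite !Cmod_pow, Cmod_ray in H.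
  assert (0 <= dev rho th0 z); [ | lra]. unfold dev. apply Rmult_le_pos; [apply pow_le, Cmod_ge_0 | apply sep_dev_nonneg].
Qed.

(** For [|z| >= Rd / 2] the radial and angular parts of the distance are bounded separately. For
    smaller [|z|], where [dev] degenerates, the distance is at most [3 * Rd / 2] while [Rd - |z|]
    exceeds [Rd / 2], so the radial part alone suffices. *)
Lemma sep_ge_dist : / 2 ^ rho * Rd ^ (rho - 2) * Cmod (z - a) ^ 2 <= sep k th0 Rd z.
Proof.
  assert (HG := pow_gap (Cmod z) Rd k ltac:(lia) (Cmod_ge_0 z) ltac:(lra)).
  rewrite Rpow_mult_distr, <- pow_mult in HG. replace ((k - 1) * 2)%nat with (rho - 2)%nat in HG by lia.
  assert (Hr := Cmod_ge_0 z). set (r := Cmod z) in *. set (Q := Rd ^ (rho - 2)) in *.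
  assert (HQ : 0 < Q) by (apply pow_lt; auto).
  assert (H2 : 16 <= 2 ^ rho) by (replace 16 with (2 ^ 4) by ring; apply Rle_pow; [lra | lia]).
  assert (Hi : 0 < / 2 ^ rho <= / 16) by (split; [apply Rinv_0_lt_compat; lra | apply Rinv_le_contravar; lra]).
  destruct (Rle_lt_dec (Rd / 2) r) as [Hc | Hc].
  - rewrite Cmod_ray_minus_sqr. fold r. unfold sep, dev. fold r.
    assert (Hx := sep_dev_nonneg). fold r in Hx. set (x := r - Re (z * cis (- th0))%C) in *.
    assert (H := Cmod_minus_sqr_ge (z ^ k) (a ^ k)). rewrite !Cmod_pow, Cmod_ray in H. fold r in H.
    assert (Hp : (Rd / 2) ^ (rho - 1) <= r ^ (rho - 1)) by (apply pow_incr; lra).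
    assert (Ep : (Rd / 2) ^ (rho - 1) = 2 * Rd * Q * / 2 ^ rho).
    { unfold Q. replace (rho - 1)%nat with (S (rho - 2)) by lia. replace (2 ^ rho) with (4 * 2 ^ (rho - 2)).
      - unfold Rdiv. rewrite Rpow_mult_distr, pow_inv. simpl pow. field. apply pow_nonzero. lra.
      - replace rho with (2 + (rho - 2))%nat at 2 by lia. rewrite pow_add. ring. }
    rewrite Ep in Hp. assert (0 <= (r - Rd) ^ 2) by apply pow2_ge_0.
    assert (2 * Rd * Q * / 2 ^ rho * x <= r ^ (rho - 1) * x) by (apply Rmult_le_compat_r; auto).
    assert (/ 2 ^ rho * ((r - Rd) ^ 2 * Q) <= 1 * ((r - Rd) ^ 2 * Q)) by (apply Rmult_le_compat_r; [apply Rmult_le_pos; lra | lra]).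
    replace (/ 2 ^ rho * Q * ((r - Rd) ^ 2 + 2 * Rd * x)) with (/ 2 ^ rho * ((r - Rd) ^ 2 * Q) + 2 * Rd * Q * / 2 ^ rho * x) by ring. lra.
  - eapply Rle_trans; [ | apply sep_ge_radial]. fold r. eapply Rle_trans; [ | exact HG].
    assert (Hw : Cmod (z - a) <= 3 * (Rd / 2)).
    { eapply Rle_trans; [apply Cmod_triangle_minus | ]. rewrite Cmod_ray. fold r. lra. }
    assert (Cmod (z - a) ^ 2 <= (3 * (Rd / 2)) ^ 2) by (apply pow_incr; split; [apply Cmod_ge_0 | auto]).
    assert ((Rd / 2) ^ 2 <= (Rd - r) ^ 2) by (apply pow_incr; lra).
    replace ((r - Rd) ^ 2) with ((Rd - r) ^ 2) by ring.
    apply Rle_trans with (/ 16 * Q * (16 * (Rd - r) ^ 2)); [ | right; field].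
    apply Rmult_le_compat; [nra | apply pow2_ge_0 | nra | ]. rewrite Rpow_mult_distr in H. pose proof (pow2_ge_0 (Rd - r)). lra.
Qed.

(** For [|z| <= 2 * Rd] both powers are comparable to [Rd^rho] and [sep_ge_dist] applies. Beyond,
    [|z|^k >= 2 * Rd^k] makes the squared radial gap comparable to [|z|^rho]. *)
Lemma sep_ge_far (d : R) : 0 < d <= / 2 -> d * Rd <= Cmod (z - a) ->
  / 2 ^ rho * d ^ 2 / (2 ^ rho + 1) * (Cmod z ^ rho + Rd ^ rho) <= sep k th0 Rd z.
Proof.
  intros Hd Hz. assert (Hr := Cmod_ge_0 z).
  assert (H2 : 16 <= 2 ^ rho) by (replace 16 with (2 ^ 4) by ring; apply Rle_pow; [lra | lia]).
  assert (Hi : 0 < / 2 ^ rho <= / 16) by (split; [apply Rinv_0_lt_compat; lra | apply Rinv_le_contravar; lra]).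
  assert (HRr : 0 < Rd ^ rho) by (apply pow_lt; auto).
  assert (Hrr : 0 <= Cmod z ^ rho) by (apply pow_le; auto).
  assert (Hd2 : 0 < d ^ 2 <= / 4) by (simpl; nra).
  destruct (Rle_lt_dec (Cmod z) (2 * Rd)) as [Hc | Hc].
  - eapply Rle_trans; [ | apply sep_ge_dist].
    assert (Cmod z ^ rho <= 2 ^ rho * Rd ^ rho) by (rewrite <- Rpow_mult_distr; apply pow_incr; lra).
    apply Rle_trans with (/ 2 ^ rho * d ^ 2 / (2 ^ rho + 1) * ((2 ^ rho + 1) * Rd ^ rho)).
    + apply Rmult_le_compat_l; [ | lra]. apply Rdiv_le_0_compat; [nra | lra].
    + replace (/ 2 ^ rho * d ^ 2 / (2 ^ rho + 1) * ((2 ^ rho + 1) * Rd ^ rho)) with (/ 2 ^ rho * (d ^ 2 * Rd ^ rho)) by (field; lra).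
      rewrite Rmult_assoc. apply Rmult_le_compat_l; [lra | ].
      replace (Rd ^ rho) with (Rd ^ (rho - 2) * Rd ^ 2) by (rewrite <- pow_add; f_equal; lia).
      replace (d ^ 2 * (Rd ^ (rho - 2) * Rd ^ 2)) with (Rd ^ (rho - 2) * (d * Rd) ^ 2) by ring.
      apply Rmult_le_compat_l; [apply pow_le; lra | ]. apply pow_incr. split; [nra | auto].
  - eapply Rle_trans; [ | apply sep_ge_radial].
    assert (Hk2 : 2 * Rd ^ k <= Cmod z ^ k).
    { replace k with (S (k - 1)) by lia. simpl pow. assert (0 < Rd ^ (k - 1)) by (apply pow_lt; auto).
      assert (Rd ^ (k - 1) <= Cmod z ^ (k - 1)) by (apply pow_incr; lra). nra. }
    assert (HRk : 0 < Rd ^ k) by (apply pow_lt; auto).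
    assert (Ez : Cmod z ^ rho = (Cmod z ^ k) ^ 2) by (rewrite <- pow_mult; f_equal; lia).
    assert (ER : Rd ^ rho = (Rd ^ k) ^ 2) by (rewrite <- pow_mult; f_equal; lia).
    rewrite Ez, ER. set (u := Cmod z ^ k) in *. set (v := Rd ^ k) in *.
    assert (Hq : / 2 ^ rho * d ^ 2 / (2 ^ rho + 1) <= / 8).
    { apply Rmult_le_reg_r with (2 ^ rho + 1); [lra | ].
      replace (/ 2 ^ rho * d ^ 2 / (2 ^ rho + 1) * (2 ^ rho + 1)) with (/ 2 ^ rho * d ^ 2) by (field; lra). nra. }
    apply Rle_trans with (/ 8 * (u ^ 2 + v ^ 2)); [ | simpl; nra].
    apply Rmult_le_compat_r; [ | exact Hq]. simpl; nra.
Qed.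

End Separation.

(** The squared modulus is linearized at [w] by the real part of a function holomorphic in [u], with
    error exactly [|u - w|^2]. *)
Lemma Re_polarization (u w : C) : 2 * Re (Cconj w * (u - w))%C = Cmod u ^ 2 - Cmod w ^ 2 - Cmod (u - w) ^ 2.
Proof.
  assert (E : forall x : C, Cmod x ^ 2 = Re x * Re x + Im x * Im x) by (intros x; rewrite <- Cmod_sqr; ring).
  rewrite !E. destruct u, w. unfold Re, Im, Cconj. simpl. ring.
Qed.

Lemma exists_large (l : list R) : exists M, 1 <= M /\ forall x, In x l -> x <= M.
Proof.
  induction l as [ | y l [M [HM H]]]; [exists 1; split; [lra | intros x []] | ].
  exists (Rmax M y). split; [eapply Rle_trans; [exact HM | apply Rmax_l] | ].
  intros x [-> | Hx]; [apply Rmax_r | eapply Rle_trans; [apply H, Hx | apply Rmax_l]].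
Qed.

(** * Boundary points off the axis *)

Section OffAxis.

Variables (k : nat) (P : C -> R).
Hypothesis hk : (1 < k)%nat.
Hypothesis hpoly : is_poly_z_zbar P.
Hypothesis hhom : forall (r : R) (z : C), P (Cmult (RtoC r) z) = r ^ (2 * k) * P z.
Hypothesis hsub : forall z : C, z <> RtoC 0 -> 0 < dz_dzbar P z.

(* [exp L] is a local peak function with the sharp quadratic weight, where [C0] and the
   linearization of [|z ^ k|^2] at [a ^ k] compensate [P]; multiplying by [V] makes it decay at
   infinity, at the price of an error of lower order in the radius, absorbed by taking it large. *)
Lemma peak_large_radius (th0 : R) : exists Rd, 0 < Rd /\
  forall b, Re b = - P (RtoC Rd * cis th0)%C -> peak_at (Omega P) ((RtoC Rd * cis th0)%C, b).
Proof.
  destruct (weight_exists k P hk hpoly hhom hsub) as [eps [Bp [Heps [HBp [HPb HW]]]]].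
  destruct (HW th0) as [W [C0 [d [K [HWe [_ [Hd [HK [HC0 [HWup [HC0d HV]]]]]]]]]]]. clear HW.
  set (rho := (2 * k)%nat) in *. assert (Hrho : (4 <= rho)%nat) by (unfold rho; lia).
  assert (H2 : 16 <= 2 ^ rho) by (replace 16 with (2 ^ 4) by ring; apply Rle_pow; [lra | lia]).
  set (c2 := eps * / 2 ^ rho).
  assert (Hc2 : 0 < c2) by (apply Rmult_lt_0_compat; [auto | apply Rinv_0_lt_compat; lra]).
  set (c3 := eps * (/ 2 ^ rho * d ^ 2 / (2 ^ rho + 1))).
  assert (Hc3 : 0 < c3).
  { apply Rmult_lt_0_compat; auto. apply Rdiv_lt_0_compat; [ | lra]. apply Rmult_lt_0_compat; [apply Rinv_0_lt_compat; lra | apply pow_lt; lra]. }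
  destruct (HWup (c3 / 4) ltac:(lra)) as [K1 HK1].
  (* In this order the entries make the quadratic error of [V] at most half of the gain
     [c2 * Rd^(rho - 2)], each term of lower order at most [c3 / 24 * N], and the constant [K1] at
     most [c3 / 8 * N]. *)
  destruct (exists_large (2 * K / c2 :: 24 * K / c3 :: 8 * K1 / c3 :: nil)%list) as [Rd [HR1 HRb]].
  assert (HRa : 2 * K <= c2 * Rd).
  { replace (2 * K) with (c2 * (2 * K / c2)) by (field; lra). apply Rmult_le_compat_l; [lra | apply HRb; simpl; auto]. }
  assert (HRc : 24 * K <= c3 * Rd).
  { replace (24 * K) with (c3 * (24 * K / c3)) by (field; lra). apply Rmult_le_compat_l; [lra | apply HRb; simpl; auto]. }
  assert (HRd : 8 * K1 <= c3 * Rd).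
  { replace (8 * K1) with (c3 * (8 * K1 / c3)) by (field; lra). apply Rmult_le_compat_l; [lra | apply HRb; simpl; auto]. }
  clear HRb. exists Rd. split; [lra | ]. intros b Hb.
  destruct (HV Rd HR1) as [HVa [v [Hv HVw]]]. clear HV. cbv zeta in HVa, HVw.
  set (a := (RtoC Rd * cis th0)%C) in *.
  set (V := fun z => (W z * Cexp (- (C0 * z ^ rho)))%C) in *.
  assert (Ha : Cmod a = Rd) by (apply Cmod_ray; lra).
  assert (EV : ent V).
  { apply ent_mult; auto. apply ent_Cexp. apply ent_ext with (fun z => (- (1) * (C0 * z ^ rho))%C); [intros; ring | ].
    apply ent_scal, ent_scal, ent_pow, ent_id. }
  assert (HVp : 0 < Cmod (V a)) by (eapply Rlt_le_trans; [apply exp_pos | exact HVa]).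
  assert (HVnz : V a <> 0) by (apply Cmod_pos_nz; auto).
  (* Subtracting the values at [a] makes [L] vanish at the boundary point. Since [Re b = - P a] and
     [Re (C0 * a^rho) = P a - eps * Rd^rho], polarization yields the real part in [HReL]. *)
  set (Q := fun x => (- b + (C0 * (x ^ rho - a ^ rho) + RtoC (2 * eps) * (Cconj (a ^ k) * (x ^ k - a ^ k))))%C).
  set (L := fun x y => (y + Q x)%C).
  (* Dividing out the value and the linear part of the logarithm of [V] at [a] leaves an error that
     is quadratic in [x - a]. *)
  set (h := fun x => (V x * (/ V a * Cexp (- v * (x - a))))%C).
  set (f0 := fun x y => (Cexp (L x y) * h x)%C).
  assert (EQ : ent Q).
  { apply ent_plus; [apply ent_const | apply ent_plus].
    - apply ent_scal, ent_minus; [apply ent_pow, ent_id | apply ent_const].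
    - apply ent_scal, ent_scal, ent_minus; [apply ent_pow, ent_id | apply ent_const]. }
  assert (Eh : ent h).
  { apply ent_mult; auto. apply ent_scal, ent_Cexp, ent_scal, ent_minus; [apply ent_id | apply ent_const]. }
  assert (HReL : forall x y, Re (L x y) = Re y + Re (C0 * x ^ rho)%C + eps * Cmod x ^ rho - eps * Cmod (x ^ k - a ^ k)%C ^ 2).
  { intros x y. unfold L, Q. rewrite !Re_plus, Re_RtoC_mult.
    replace (Re (- b)%C) with (- Re b) by reflexivity. rewrite Hb.
    replace (C0 * (x ^ rho - a ^ rho))%C with (C0 * x ^ rho - C0 * a ^ rho)%C by ring. rewrite Re_minus.
    assert (E1 := HC0 Rd ltac:(lra)). fold a in E1. rewrite E1.
    assert (E2 := Re_polarization (x ^ k) (a ^ k)). rewrite !Cmod_pow, Ha, <- !pow_mult in E2.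
    replace (k * 2)%nat with rho in E2 by (unfold rho; lia). nra. }
  set (N := fun x : C => Cmod x ^ rho + Rd ^ rho).
  assert (HN1 : forall x, 1 <= N x).
  { intros x. unfold N. assert (1 <= Rd ^ rho) by (apply pow_R1_Rle; auto). assert (0 <= Cmod x ^ rho) by (apply pow_le, Cmod_ge_0). lra. }
  assert (Hsep : forall x, sep k th0 Rd x = Cmod (x ^ k - a ^ k)%C ^ 2 + dev rho th0 x) by reflexivity.
  assert (Hin : forall x y, Re y + P x < 0 -> Cmod (x - a) <= d * Rd ->
    Re (L x y) < 0 /\ Cmod (f0 x y) <= exp (- (c2 / 2 * Rd ^ (rho - 2) * Cmod (x - a) ^ 2))).
  { intros x y Hxy Hx. assert (HS := sep_ge_dist k th0 Rd x hk ltac:(lra)). fold rho a in HS. rewrite Hsep in HS.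
    assert (HS' : c2 * Rd ^ (rho - 2) * Cmod (x - a) ^ 2 <= eps * (Cmod (x ^ k - a ^ k)%C ^ 2 + dev rho th0 x)).
    { unfold c2. apply Rmult_le_compat_l with (r := eps) in HS; lra. }
    assert (HD := HC0d Rd x ltac:(lra) Hx).
    assert (HL : Re (L x y) <= (Re y + P x) - c2 * Rd ^ (rho - 2) * Cmod (x - a) ^ 2) by (rewrite HReL; lra).
    assert (Hsq : 0 <= Cmod (x - a) ^ 2) by apply pow2_ge_0.
    assert (HRp : 0 < Rd ^ (rho - 2)) by (apply pow_lt; lra).
    assert (0 <= c2 * Rd ^ (rho - 2) * Cmod (x - a) ^ 2) by (apply Rmult_le_pos; [apply Rlt_le, Rmult_lt_0_compat; auto | auto]).
    split; [lra | ]. unfold f0, h. rewrite !Cmod_mult, !Cmod_Cexp, Cmod_inv by auto.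
    assert (HVx := HVw (x - a)%C Hx). replace (a + (x - a))%C with x in HVx by ring.
    apply Rle_trans with (exp (Re (L x y)) * (Cmod (V a) * exp (Re (v * (x - a))%C + K * Rd ^ (rho - 3) * Cmod (x - a) ^ 2) * (/ Cmod (V a) * exp (Re (- v * (x - a))%C)))).
    { apply Rmult_le_compat_l; [apply Rlt_le, exp_pos | ]. apply Rmult_le_compat_r; [ | exact HVx].
      apply Rmult_le_pos; [apply Rlt_le, Rinv_0_lt_compat; auto | apply Rlt_le, exp_pos]. }
    replace (- v * (x - a))%C with (- (v * (x - a)))%C by ring.
    replace (Re (- (v * (x - a)))%C) with (- Re (v * (x - a))%C) by reflexivity.
    set (t := Re (v * (x - a))%C).
    apply Rle_trans with (exp (Re (L x y) + K * Rd ^ (rho - 3) * Cmod (x - a) ^ 2)).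
    { right. rewrite !exp_plus, exp_Ropp. field. split; [apply Rgt_not_eq, exp_pos | lra]. }
    apply exp_le.
    assert (HKR : K * Rd ^ (rho - 3) <= c2 / 2 * Rd ^ (rho - 2)).
    { replace (rho - 2)%nat with (S (rho - 3)) by lia. simpl pow. assert (0 < Rd ^ (rho - 3)) by (apply pow_lt; lra). nra. }
    apply Rmult_le_compat_r with (r := Cmod (x - a) ^ 2) in HKR; auto. lra. }
  assert (Hout : forall x y, Re y + P x < 0 -> d * Rd < Cmod (x - a) -> Cmod (f0 x y) <= exp (- (c3 / 2 * N x))).
  (* The expansion of [V] does not reach here. Instead [exp L * V] is rewritten as
     [exp (L - C0 * x^rho) * W] and the global bound on [W] is used. Of the gain [c3 * N], three
     terms take [c3 / 24] each, [K1] takes [c3 / 8] and the slack in the bound for [W] takes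
     [c3 / 4]; half is left. *)
  { intros x y Hxy Hx. assert (HS := sep_ge_far k th0 Rd x hk ltac:(lra) d Hd). fold rho a in HS. rewrite Hsep in HS.
    specialize (HS ltac:(lra)). fold (N x) in HS.
    assert (HS' : c3 * N x <= eps * (Cmod (x ^ k - a ^ k)%C ^ 2 + dev rho th0 x)).
    { unfold c3. rewrite Rmult_assoc. apply Rmult_le_compat_l; [lra | exact HS]. }
    assert (HWx := HK1 x). assert (HN := HN1 x).
    assert (Ef : f0 x y = (Cexp (L x y - C0 * x ^ rho) * W x * (/ V a * Cexp (- v * (x - a))))%C).
    { unfold f0, h. unfold V at 1. replace (L x y - C0 * x ^ rho)%C with (L x y + - (C0 * x ^ rho))%C by ring. rewrite Cexp_plus. ring. }
    rewrite Ef, !Cmod_mult, !Cmod_Cexp, Cmod_inv by auto. rewrite Re_minus, HReL.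
    assert (Hvw : Re (- v * (x - a))%C <= K * Rd ^ (rho - 2) * (Cmod x + Rd)).
    { eapply Rle_trans; [apply Re_le_Cmod | ]. rewrite Cmod_mult, Cmod_opp.
      apply Rmult_le_compat; auto using Cmod_ge_0. eapply Rle_trans; [apply Cmod_triangle_minus | ]. rewrite Ha. lra. }
    assert (HiV : / Cmod (V a) <= exp (K * Rd ^ (rho - 1))).
    { rewrite <- (Rinv_inv (exp _)), <- exp_Ropp. apply Rinv_le_contravar; [apply exp_pos | exact HVa]. }
    assert (HA1 : K * Rd ^ (rho - 1) <= c3 / 24 * N x).
    { assert (Rd ^ rho <= N x) by (unfold N; assert (0 <= Cmod x ^ rho) by (apply pow_le, Cmod_ge_0); lra).
      apply Rle_trans with (c3 / 24 * Rd ^ rho); [ | apply Rmult_le_compat_l; lra].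
      replace (Rd ^ rho) with (Rd * Rd ^ (rho - 1)) by (replace rho with (S (rho - 1)) at 2 by lia; reflexivity).
      rewrite <- Rmult_assoc. apply Rmult_le_compat_r; [apply pow_le; lra | lra]. }
    assert (HA2 : K * Rd ^ (rho - 2) * Cmod x <= c3 / 24 * N x).
    { assert (HrR : Rd ^ (rho - 1) * Cmod x <= N x).
      { unfold N. destruct (Rle_lt_dec (Cmod x) Rd) as [q | q].
        - assert (0 <= Cmod x ^ rho) by (apply pow_le, Cmod_ge_0).
          replace (Rd ^ rho) with (Rd ^ (rho - 1) * Rd) by (replace rho with (S (rho - 1)) at 2 by lia; simpl; ring).
          assert (Rd ^ (rho - 1) * Cmod x <= Rd ^ (rho - 1) * Rd) by (apply Rmult_le_compat_l; [apply pow_le; lra | auto]). lra.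
        - assert (0 <= Rd ^ rho) by (apply pow_le; lra).
          replace (Cmod x ^ rho) with (Cmod x ^ (rho - 1) * Cmod x) by (replace rho with (S (rho - 1)) at 2 by lia; simpl; ring).
          assert (Rd ^ (rho - 1) * Cmod x <= Cmod x ^ (rho - 1) * Cmod x) by (apply Rmult_le_compat_r; [apply Cmod_ge_0 | apply pow_incr; lra]). lra. }
      apply Rle_trans with (c3 / 24 * (Rd ^ (rho - 1) * Cmod x)); [ | apply Rmult_le_compat_l; lra].
      replace (Rd ^ (rho - 1)) with (Rd * Rd ^ (rho - 2)) by (replace (rho - 1)%nat with (S (rho - 2)) by lia; reflexivity).
      replace (c3 / 24 * (Rd * Rd ^ (rho - 2) * Cmod x)) with (c3 / 24 * Rd * (Rd ^ (rho - 2) * Cmod x)) by ring.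
      rewrite Rmult_assoc. apply Rmult_le_compat_r; [apply Rmult_le_pos; [apply pow_le; lra | apply Cmod_ge_0] | lra]. }
    assert (HA3 : K * Rd ^ (rho - 2) * Rd <= c3 / 24 * N x).
    { replace (K * Rd ^ (rho - 2) * Rd) with (K * Rd ^ (rho - 1)); auto.
      replace (rho - 1)%nat with (S (rho - 2)) by lia. simpl. ring. }
    assert (HA4 : K1 <= c3 / 8 * N x).
    { assert (Rd <= N x); [ | nra]. unfold N. assert (0 <= Cmod x ^ rho) by (apply pow_le, Cmod_ge_0).
      assert (Rd ^ 1 <= Rd ^ rho) by (apply Rle_pow; [auto | lia]). simpl (Rd ^ 1) in *. lra. }
    assert (HA5 : c3 / 4 * Cmod x ^ rho <= c3 / 4 * N x).
    { apply Rmult_le_compat_l; [lra | ]. unfold N. assert (0 <= Rd ^ rho) by (apply pow_le; lra). lra. }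
    set (A := Re y + Re (C0 * x ^ rho)%C + eps * Cmod x ^ rho - eps * Cmod (x ^ k - a ^ k)%C ^ 2 - Re (C0 * x ^ rho)%C).
    set (B := P x - eps * Cmod x ^ rho - eps * dev rho th0 x + c3 / 4 * Cmod x ^ rho + K1) in *.
    apply Rle_trans with (exp A * exp B * (exp (K * Rd ^ (rho - 1)) * exp (K * Rd ^ (rho - 2) * (Cmod x + Rd)))).
    { apply Rmult_le_compat.
      - apply Rmult_le_pos; [apply Rlt_le, exp_pos | apply Cmod_ge_0].
      - apply Rmult_le_pos; [apply Rlt_le, Rinv_0_lt_compat; auto | apply Rlt_le, exp_pos].
      - apply Rmult_le_compat_l; [apply Rlt_le, exp_pos | exact HWx].
      - apply Rmult_le_compat; [apply Rlt_le, Rinv_0_lt_compat; auto | apply Rlt_le, exp_pos | auto | now apply exp_le]. }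
    rewrite <- !exp_plus. apply exp_le. unfold A, B. lra. }
  set (K4 := Bp + Cmod C0 + eps).
  assert (HK4 : 0 < K4) by (unfold K4; pose proof (Cmod_ge_0 C0); lra).
  assert (HLup : forall x y, Re y + P x < 0 -> Re (L x y) <= K4 * N x).
  { intros x y Hxy. rewrite HReL. assert (HPx := HPb x). apply Rabs_le_between in HPx. fold rho in HPx.
    assert (HC := Re_le_Cmod (C0 * x ^ rho)). rewrite Cmod_mult, Cmod_pow in HC.
    assert (0 <= eps * Cmod (x ^ k - a ^ k)%C ^ 2) by (apply Rmult_le_pos; [lra | apply pow2_ge_0]).
    apply Rle_trans with (K4 * Cmod x ^ rho); [unfold K4; lra | ]. apply Rmult_le_compat_l; [lra | ].
    unfold N. assert (0 <= Rd ^ rho) by (apply pow_le; lra). lra. }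
  (* Outside the disc [Re L] may be positive, up to [K4 * N], so [E1] may grow; the power [m] of
     [f0] outweighs it and, since [N >= 1], leaves a factor [exp (- 1)]. *)
  destruct (exists_nat_large ((K4 + 1) / (c3 / 2))) as [m [Hm0 Hm]].
  assert (Hm1 : 1 <= INR m) by (apply (le_INR 1); lia).
  assert (Hme : K4 + 1 <= INR m * (c3 / 2)).
  { apply Rmult_lt_compat_r with (r := c3 / 2) in Hm; [ | lra].
    replace ((K4 + 1) / (c3 / 2) * (c3 / 2)) with (K4 + 1) in Hm by (field; lra). lra. }
  set (F := fun x y => (f0 x y ^ m * E1 (L x y))%C).
  assert (HF : forall x y, Cmod (F x y) = Cmod (f0 x y) ^ m * Cmod (E1 (L x y))) by (intros; unfold F; now rewrite Cmod_mult, Cmod_pow).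
  assert (HFin : forall x y, Re y + P x < 0 -> Cmod (x - a) <= d * Rd ->
    Cmod (F x y) <= Cmod (E1 (L x y)) /\ Cmod (E1 (L x y)) < 1 /\ Cmod (F x y) <= exp (- (c2 / 2 * Rd ^ (rho - 2) * Cmod (x - a) ^ 2))).
  { intros x y Hxy Hx. destruct (Hin x y Hxy Hx) as [HL Hf]. assert (HE := E1_lt_1 _ HL).
    assert (HE0 := Cmod_ge_0 (E1 (L x y))). assert (Hf0 := Cmod_ge_0 (f0 x y)).
    set (q := c2 / 2 * Rd ^ (rho - 2) * Cmod (x - a) ^ 2) in *.
    assert (Hq : 0 <= q).
    { unfold q. apply Rmult_le_pos; [apply Rmult_le_pos; [lra | apply pow_le; lra] | apply pow2_ge_0]. }
    assert (Hq1 : exp (- q) <= 1) by (rewrite <- exp_0; apply exp_le; lra).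
    assert (Hpm : Cmod (f0 x y) ^ (m - 1) <= 1) by (apply pow_le_1; lra).
    assert (Hpm0 : 0 <= Cmod (f0 x y) ^ (m - 1)) by (apply pow_le; auto).
    assert (Hpow : Cmod (f0 x y) ^ m <= exp (- q)).
    { replace m with (S (m - 1)) by lia. simpl pow. nra. }
    assert (Hpow0 : 0 <= Cmod (f0 x y) ^ m) by (apply pow_le; auto).
    rewrite HF. split; [nra | split; [auto | nra]]. }
  assert (HFout : forall x y, Re y + P x < 0 -> d * Rd < Cmod (x - a) -> Cmod (F x y) <= exp (- (1))).
  { intros x y Hxy Hx. assert (Hf := Hout x y Hxy Hx). assert (HL := HLup x y Hxy). assert (HN := HN1 x).
    rewrite HF. apply Rle_trans with (exp (- (c3 / 2 * N x)) ^ m * exp (K4 * N x)).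
    - apply Rmult_le_compat; [apply pow_le, Cmod_ge_0 | apply Cmod_ge_0 | apply pow_incr; split; [apply Cmod_ge_0 | auto] | ].
      apply Cmod_E1_le; [ | now apply exp_le]. rewrite <- exp_0. apply exp_le. nra.
    - rewrite exp_pow, <- exp_plus. apply exp_le. nra. }
  assert (He1 : exp (- (1)) < 1) by (apply Rlt_le_trans with (exp 0); [apply exp_increasing; lra | rewrite exp_0; lra]).
  assert (HQa : Q a = (- b)%C) by (unfold Q; ring).
  assert (HLa : L a b = 0) by (unfold L; rewrite HQa; ring).
  assert (HFa : F a b = 1).
  { unfold F, f0, h. rewrite HLa, E1_0, Cexp_0. replace (- v * (a - a))%C with (RtoC 0) by ring. rewrite Cexp_0.
    replace (1 * (V a * (/ V a * 1)))%C with (RtoC 1) by (field; auto). rewrite Cpow_1_l. ring. }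
  assert (Hloc : forall x y, loc2 F x y).
  { intros x y. assert (LL : loc2 L x y) by (apply loc2_plus; [apply (loc2_snd (fun z => z)), ent_id | apply loc2_fst, EQ]).
    apply loc2_mult; [apply loc2_pow, loc2_mult | ].
    - apply (loc2_comp Cexp); auto. apply (ent_Cexp (fun z => z)), ent_id.
    - apply loc2_fst, Eh.
    - apply (loc2_comp E1); auto. apply ent_E1. }
  exists (fun w => F (fst w) (snd w)). split; [ | split; [ | split]].
  - apply loc2_holomorphic. auto.
  - intros w Hw. unfold Omega in Hw. destruct (Rle_lt_dec (Cmod (fst w - a)) (d * Rd)) as [q | q].
    + destruct (HFin _ _ Hw q) as [A [B _]]. lra.
    + assert (A := HFout _ _ Hw q). lra.
  - intros e He. destruct (loc2_continuous F a b (Hloc a b) e He) as [t [Ht HH]]. exists t. split; auto.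
    intros w Hw Hdw. rewrite <- HFa. assert (D1 := dist2_fst w (a, b)). assert (D2 := dist2_snd w (a, b)). simpl in D1, D2.
    apply HH; simpl; lra.
  - intros r Hr. destruct (loc2_continuous (fun x _ => Q x) a b (loc2_fst Q a b EQ) (r / 4) ltac:(lra)) as [t [Ht HQt]].
    set (t' := Rmin t (r / 2)). assert (Ht' : 0 < t') by (apply Rmin_glb_lt; lra).
    assert (T1 : t' <= t) by apply Rmin_l. assert (T2 : t' <= r / 2) by apply Rmin_r.
    destruct (E1_strict (r / 4) ltac:(lra)) as [s1 [Hs1 HE1]].
    set (q0 := c2 / 2 * Rd ^ (rho - 2)). assert (Hq0 : 0 < q0) by (apply Rmult_lt_0_compat; [lra | apply pow_lt; lra]).
    set (s2 := 1 - exp (- (q0 * t' ^ 2))).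
    assert (Hs2 : 0 < s2).
    { unfold s2. assert (0 < q0 * t' ^ 2) by (apply Rmult_lt_0_compat; [auto | apply pow_lt; auto]).
      assert (exp (- (q0 * t' ^ 2)) < exp 0) by (apply exp_increasing; lra). rewrite exp_0 in *. lra. }
    set (s3 := 1 - exp (- (1))). assert (Hs3 : 0 < s3) by (unfold s3; lra).
    set (s := Rmin s1 (Rmin s2 s3)).
    assert (M1 : s <= s1) by apply Rmin_l.
    assert (M2 : s <= s2) by (eapply Rle_trans; [apply Rmin_r | apply Rmin_l]).
    assert (M3 : s <= s3) by (eapply Rle_trans; [apply Rmin_r | apply Rmin_r]).
    assert (Hs : 0 < s) by (repeat apply Rmin_glb_lt; auto).
    exists (s / 2). split; [lra | ]. intros w Hw Hdw. unfold Omega in Hw.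
    assert (D := dist2_le_sum w (a, b)). simpl fst in D. simpl snd in D.
    apply Rle_lt_trans with (1 - s); [ | lra].
    (* Three regions: in the disc but at distance [t'] from [a] the Gaussian factor decides; very
       close to [a] the second coordinate is far from [b], so [|L| >= r / 4] and [E1_strict]
       decides; outside the disc the bound [exp (- 1)] does. *)
    destruct (Rle_lt_dec (Cmod (fst w - a)) (d * Rd)) as [q | q].
    + destruct (HFin _ _ Hw q) as [A [B E]]. destruct (Rle_lt_dec t' (Cmod (fst w - a))) as [g | g].
      * eapply Rle_trans; [exact E | ]. fold q0. apply Rle_trans with (exp (- (q0 * t' ^ 2))); [ | unfold s2 in M2; lra].
        apply exp_le. apply Ropp_le_contravar. apply Rmult_le_compat_l; [lra | ]. apply pow_incr. lra.
      * eapply Rle_trans; [exact A | ]. apply Rle_trans with (1 - s1); [ | lra].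
        destruct (Hin _ _ Hw q) as [HL _]. apply HE1; [lra | ].
        assert (HQ := HQt (fst w) b ltac:(lra) ltac:(replace (b - b)%C with (RtoC 0) by ring; rewrite Cmod_0; auto)).
        cbv beta in HQ. rewrite HQa in HQ.
        replace (L (fst w) (snd w)) with ((snd w - b) + (Q (fst w) - - b))%C by (unfold L; ring).
        pose proof (Cmod_plus_reverse (snd w - b) (Q (fst w) - - b)). lra.
    + eapply Rle_trans; [apply (HFout _ _ Hw q) | ]. unfold s3 in M3. lra.
Qed.

(** The dilation by [s] and [s^(2k)] preserves the domain and moves [a] along its ray to the modulus
    [Rd], which depends on the direction of the ray only. *)
Lemma peak_off_axis (a b : C) : a <> 0 -> Re b + P a = 0 -> peak_at (Omega P) (a, b).
Proof.
  intros Ha Hb. destruct (polar a 0) as [th0 [_ Hp]]. destruct (peak_large_radius th0) as [Rd [HR H]].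
  assert (Hm := Cmod_nz a Ha). set (s := Rd / Cmod a). assert (Hs : 0 < s) by (apply Rdiv_lt_0_compat; auto).
  assert (Hsp : 0 < s ^ (2 * k)) by (apply pow_lt; auto).
  apply (peak_at_scale (Omega P) s (s ^ (2 * k)) a b); auto.
  - intros x y Hxy. unfold Omega in *. simpl fst in *. simpl snd in *. rewrite Re_RtoC_mult, hhom, <- Rmult_plus_distr_l.
    apply Rmult_lt_compat_l with (r := s ^ (2 * k)) in Hxy; lra.
  - assert (E : (RtoC s * a)%C = (RtoC Rd * cis th0)%C).
    { rewrite Hp at 1. rewrite Cmult_assoc, <- RtoC_mult. do 2 f_equal. unfold s. field. lra. }
    assert (EP := hhom s a). rewrite E in *. apply H. rewrite EP, Re_RtoC_mult. replace (Re b) with (- P a) by lra. ring.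
Qed.

End OffAxis.

Theorem theorem3p1 (k : nat) (P : C -> R)
  (hk : (1 < k)%nat)
  (hpoly : is_poly_z_zbar P)
  (hhom : forall (r : R) (z : C), P (Cmult (RtoC r) z) = r ^ (2 * k) * P z)
  (hsub : forall z : C, z <> RtoC 0 -> 0 < dz_dzbar P z) :
  forall p : C2, boundary (Omega P) p ->
    exists f : C2 -> C,
      holomorphic_on (Omega P) f /\
      (forall w, Omega P w -> Cmod (f w) < 1) /\
      (forall eps : R, 0 < eps -> exists delta : R, 0 < delta /\
         forall w, Omega P w -> dist2 w p < delta -> Cmod (Cminus (f w) (RtoC 1)) < eps) /\
      (forall r : R, 0 < r -> exists s : R, 0 < s /\
         forall w, Omega P w -> r <= dist2 w p -> Cmod (f w) < 1 - s).
Proof.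
  intros p Hp. change (peak_at (Omega P) p). apply boundary_Omega in Hp; auto. destruct p as [a b]. simpl in Hp.
  destruct (Req_dec (Cmod a) 0) as [Ea | Ea].
  - apply Cmod_eq_0 in Ea. subst a. apply peak_axis with k; auto.
    (* Homogeneity with factor 0 gives [P 0 = 0], so the boundary equation reads [Re b = 0]. *)
    assert (E := hhom 0 0%C). rewrite Cmult_0_l in E. rewrite pow_i, Rmult_0_l in E by lia. lra.
  - apply peak_off_axis with k; auto. intros ->. apply Ea, Cmod_0.
Qed.
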